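(* Let $s\in(0,1]$ and let $(x,v)\in\mathbb{T}\times\mathbb{R}$ or $(x,v)\in\mathbb{R}\times\mathbb{R}$. Let $r\in\mathbb{R}$. There exists a constant $C_r>0$ such that for every $f_0\in H^{r,0}$, the solution $f$ of the fractional Kolmogorov equation $$\partial_t f+v\,\partial_x f+(1-\Delta_v)^{s}f=0,\qquad f|_{t=0}=f_0,$$ satisfies for all $t\in(0,1]$ $$\|f(t)\|_{r,s}\le\frac{C_r}{t^{1/2}}\|f_0\|_{r,0}\qquad\text{and}\qquad \|f(t)\|_{r+s,0}\le\frac{C_r}{t^{1/2+s}}\|f_0\|_{r,0}.$$ (The constant $C_r$ is independent of $f_0$.)
   Context: $\mathbb{T}$ is the one-dimensional torus. For $\alpha,\beta\in\mathbb{R}$, $\Lambda_x^\alpha=(1-\Delta_x)^{\alpha/2}$ and $\Lambda_v^\beta=(1-\Delta_v)^{\beta/2}$ are the Fourier multipliers $$\widehat{\Lambda_x^\alpha f}(\xi,\eta)=(1+\xi^2)^{\alpha/2}\widehat f(\xi,\eta),\qquad \widehat{\Lambda_v^\beta f}(\xi,\eta)=(1+\eta^2)^{\beta/2}\widehat f(\xi,\eta),$$ where the hat is the Fourier transform in both variables, $\xi$ dual to $x$ and $\eta$ dual to $v$. The anisotropic Sobolev space is $H^{\alpha,\beta}=\{f\in\mathcal{S}' : \Lambda_x^\alpha\Lambda_v^\beta f\in L^2\}$ with norm $\|f\|_{\alpha,\beta}=\|\Lambda_x^\alpha\Lambda_v^\beta f\|_{L^2}$, where $L^2$ is with respect to Lebesgue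 measure $dx\,dv$. The first index refers to $x$, the second to $v$. The solution is the semigroup solution $f(t)=e^{-tP}f_0$ with $P=v\partial_x+\Lambda_v^{2s}$. *)

(* Defs.v *)
From mathcomp Require Import all_boot all_order all_algebra.
From mathcomp Require Import complex.
From mathcomp Require Import all_classical all_reals all_analysis.

Set Implicit Arguments.
Unset Strict Implicit.
Unset Printing Implicit Defensive.

Import Order.TTheory GRing.Theory Num.Theory.
Import numFieldNormedType.Exports.

Local Open Scope classical_set_scope.
Local Open Scope ring_scope.
Local Open Scope complex_scope.

(* The space of the x variable.  The torus is R / 2 pi Z, so that its dual
   group is Z and - Delta_x has symbol xi ^ 2.  A function on it is a
   function on R that is 2 pi-periodic in x. *)
Inductive xspace := Torus | Line.

Inductive coord := X | V.

Section Kolmogorov.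
Variable R : realType.

Local Notation C := R[i].
Local Notation normc := ComplexField.Normc.normc.
Local Notation leb := (@lebesgue_measure R).
Local Notation phase := (measurableTypeR R * measurableTypeR R)%type.

(* Functions on the torus are integrated over the period [0, 2 pi[; the dual
   measure d xi of the torus is the counting measure of Z, as a measure on R. *)

Definition xmeasure (D : xspace) : {measure set (measurableTypeR R) -> \bar R} :=
  match D with
  | Torus => mrestr leb (measurable_itv `[0%R, (2 * pi)%R[)
  | Line => leb
  end.

Definition ximeasure (D : xspace) : {measure set (measurableTypeR R) -> \bar R} :=
  match D with
  | Torus => measure_add
      (mseries (fun n : nat => \d_(n%:R : measurableTypeR R)) 0)
      (mseries (fun n : nat => \d_(- n.+1%:R : measurableTypeR R)) 0)
  | Line => leb
  end.

Definition xv_measure (D : xspace) : {measure set phase -> \bar R} :=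
  (xmeasure D \x leb)%E.

Definition freq_measure (D : xspace) : {measure set phase -> \bar R} :=
  (ximeasure D \x leb)%E.

Definition cintegral (mu : {measure set phase -> \bar R}) (g : R * R -> C) : C :=
  (\int[mu]_p complex.Re (g p)) +i* (\int[mu]_p complex.Im (g p)).

Definition dir (c : coord) : R * R :=
  match c with X => (1, 0) | V => (0, 1) end.

Definition pderiv (c : coord) (phi : R * R -> C) : R * R -> C := fun p =>
  ('D_(dir c) (fun q => complex.Re (phi q)) p)
    +i* ('D_(dir c) (fun q => complex.Im (phi q)) p).

Definition pderivable (phi : R * R -> C) : Prop := forall c p,
  derivable (fun q => complex.Re (phi q)) p (dir c) /\
  derivable (fun q => complex.Im (phi q)) p (dir c).

Definition iter_pderiv (w : seq coord) (phi : R * R -> C) : R * R -> C :=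
  foldr pderiv phi w.

Definition weight (D : xspace) (k l : nat) (p : R * R) : R :=
  match D with Torus => 1 | Line => `|p.1| ^+ k end * `|p.2| ^+ l.

(* Every iterated partial derivative is required to have (bounded) partial
   derivatives, so all of them are continuous. *)
Definition schwartz (D : xspace) (phi : R * R -> C) : Prop :=
  [/\ D = Torus -> forall x v, phi (x + 2 * pi, v) = phi (x, v),
      forall w, pderivable (iter_pderiv w phi) &
      forall w k l, exists M : R, forall p,
        weight D k l p * normc (iter_pderiv w phi p) <= M].

(* A distribution is a total functional of which only the values on
   [schwartz] functions are meaningful: equality is [dist_eq]. *)
Definition dist := (R * R -> C) -> C.

Definition dist_eq (D : xspace) (f g : dist) : Prop :=
  forall phi, schwartz D phi -> f phi = g phi.

Definition tempered (D : xspace) (f : dist) : Prop :=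
  (forall (a : C) phi psi, schwartz D phi -> schwartz D psi ->
     f (fun p => a * phi p + psi p) = a * f phi + f psi) /\
  (exists (N : nat) (K : R), forall phi (M : R), schwartz D phi ->
     (forall w k l p, (size w <= N)%N -> (k <= N)%N -> (l <= N)%N ->
        weight D k l p * normc (iter_pderiv w phi p) <= M) ->
     normc (f phi) <= K * M).

(* Unitary normalization in both variables; with the measures above,
   [osc (freq_measure D) (- 1)] inverts [osc (xv_measure D) 1] on Schwartz
   functions for both choices of D. *)
Definition osc (mu : {measure set phase -> \bar R}) (sgn : R)
    (phi : R * R -> C) : R * R -> C := fun q =>
  ((2 * pi)^-1)%:C * cintegral mu (fun p =>
     let a := sgn * (p.1 * q.1 + p.2 * q.2) in (cos a +i* sin a) * phi p).

(* By transposition: for psi a function of (xi, eta),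
   <F f, psi> = <f, F psi>; for phi a function of (x, v),
   <F^-1 u, phi> = <u, F^-1 phi>. *)
Definition fourier (D : xspace) (f : dist) : dist :=
  fun psi => f (osc (freq_measure D) (- 1) psi).

Definition inv_fourier (D : xspace) (u : dist) : dist :=
  fun phi => u (osc (xv_measure D) 1 phi).

Definition mulf (m : R * R -> R) (f : dist) : dist :=
  fun phi => f (fun p => (m p)%:C * phi p).

Definition multiplier (D : xspace) (m : R * R -> R) (f : dist) : dist :=
  inv_fourier D (mulf m (fourier D f)).

Definition Lambda_x (D : xspace) (alpha : R) : dist -> dist :=
  multiplier D (fun q => (1 + q.1 ^+ 2) `^ (alpha / 2)).

Definition Lambda_v (D : xspace) (beta : R) : dist -> dist :=
  multiplier D (fun q => (1 + q.2 ^+ 2) `^ (beta / 2)).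

Definition L2fun_norm (D : xspace) (g : R * R -> C) : \bar R :=
  Lnorm (xv_measure D) 2%:E (fun p => (normc (g p))%:E).

Definition L2fun (D : xspace) (g : R * R -> C) : Prop :=
  [/\ measurable_fun [set: phase] (fun p => complex.Re (g p)),
      measurable_fun [set: phase] (fun p => complex.Im (g p)) &
      (L2fun_norm D g < +oo)%E].

Definition represents (D : xspace) (g : R * R -> C) (f : dist) : Prop :=
  forall phi, schwartz D phi ->
    f phi = cintegral (xv_measure D) (fun p => g p * phi p).

Definition in_L2 (D : xspace) (f : dist) : Prop :=
  exists g, L2fun D g /\ represents D g f.

(* The L^2 representative is unique up to a null set, so this is the infimum
   of a single value, or +oo when f is not in L^2. *)
Definition L2norm (D : xspace) (f : dist) : \bar R :=
  ereal_inf [set L2fun_norm D g | g in [set g | L2fun D g /\ represents D g f]].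

Definition Hspace (D : xspace) (alpha beta : R) (f : dist) : Prop :=
  tempered D f /\ in_L2 D (Lambda_x D alpha (Lambda_v D beta f)).

Definition Hnorm (D : xspace) (alpha beta : R) (f : dist) : \bar R :=
  L2norm D (Lambda_x D alpha (Lambda_v D beta f)).

Definition dist_dx (f : dist) : dist := fun phi => - f (pderiv X phi).

(* P = v d_x + (1 - Delta_v)^s, where (1 - Delta_v)^s = Lambda_v^{2s}. *)
Definition opP (D : xspace) (s : R) (f : dist) : dist := fun phi =>
  mulf (fun p => p.2) (dist_dx f) phi + Lambda_v D (2 * s) f phi.

Definition C0_semigroup (D : xspace) (r : R) (T : R -> dist -> dist) : Prop :=
  let H := Hspace D r 0 in
  [/\ forall t f, 0 <= t -> H f -> H (T t f),
      forall t (a : C) f g, 0 <= t -> H f -> H g ->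
        dist_eq D (T t (fun phi => a * f phi + g phi))
                  (fun phi => a * T t f phi + T t g phi),
      forall t, 0 <= t -> exists M : R, forall f, H f ->
        (Hnorm D r 0 (T t f) <= M%:E * Hnorm D r 0 f)%E,
      (forall f, H f -> dist_eq D (T 0 f) f) /\
      (forall t u f, 0 <= t -> 0 <= u -> H f ->
         dist_eq D (T (t + u) f) (T t (T u f))) &
      forall f, H f ->
        Hnorm D r 0 (fun phi => T t f phi - f phi) @[t --> 0^'+] --> 0%E].

(* The infinitesimal generator of T on H^{r,0} is A with its maximal domain
   {f in H^{r,0} | A f in H^{r,0}}. *)
Definition generator (D : xspace) (r : R) (T : R -> dist -> dist)
    (A : dist -> dist) : Prop :=
  forall f g, Hspace D r 0 f -> Hspace D r 0 g ->
    (Hnorm D r 0 (fun phi => (h^-1)%:C * (T h f phi - f phi) - g phi)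
       @[h --> 0^'+] --> 0%E)
    <-> dist_eq D g (A f).

(* f(t) = e^{-tP} f0 *)
Definition semigroup_solution (D : xspace) (s r : R) (f0 : dist)
    (f : R -> dist) : Prop :=
  exists T : R -> dist -> dist,
    [/\ C0_semigroup D r T,
        generator D r T (fun g phi => - opP D s g phi) &
        forall t, 0 <= t -> dist_eq D (f t) (T t f0)].

End Kolmogorov.

(* Main.v *)
Require Import Defs.
From HB Require Import structures.
From mathcomp Require Import all_boot all_order all_algebra.
From mathcomp Require Import complex.
From mathcomp Require Import all_classical all_reals all_analysis.
From mathcomp Require Import measurable_realfun.
From mathcomp Require Import ring lra.

Set Implicit Arguments.
Unset Strict Implicit.
Unset Printing Implicit Defensive.

Import Order.TTheory GRing.Theory Num.Theory.
Import numFieldNormedType.Exports.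

Local Open Scope classical_set_scope.
Local Open Scope ring_scope.
Local Open Scope complex_scope.

(** In the Fourier variables the generator is the first-order operator A = xi d_eta - (1 + eta^2)^s, whose flow
    is W(xi, eta) |-> W(xi, eta + t xi) exp (- b_t(xi, eta)), where b_t is the integral of (1 + (eta + tau xi)^2)^s
    over 0 <= tau <= t.  By concavity b_t >= c t M^s with M = 1 + 2 (eta^2 + (t xi)^2), and M dominates both
    1 + eta^2 and t^2 (1 + xi^2); since x^(1/2) exp (- c x) is bounded, exp (- b_t) (1 + eta^2)^(s/2) is
    O(t^(-1/2)) and exp (- b_t) (1 + xi^2)^(s/2) is O(t^(-1/2 - s)).

    An abstract semigroup whose generator is - P agrees with this flow: for nice data W the curve
    u(tau) = flow_tau W lies in the domain of P, so T_(t - tau) u(tau) has zero derivative in tau (the local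
    boundedness of T comes from the uniform boundedness principle).  General data follow by density, which comes
    from the Riesz representation of functionals that are bounded on Schwartz functions. *)

(** * Measures *)

(** The semigroup is known only through its axioms on H^{r,0}, and the norm there is an infimum over
    L^2 representatives. Estimates are therefore made by duality: [dual_bounded f K] bounds f phi by
    K times the H^{-r,0} norm of phi, and the Riesz theorem turns such a bound back into a
    representative. Each passage loses a numerical factor, which the final constant absorbs.

    Two obstacles shape the comparison with the flow. The axioms bound each T_t separately, with no
    uniformity near t = 0, whereas the zero-derivative argument lets T_h act on a point that moves
    with h. And b_t is handled as a difference quotient (B(eta + t xi) - B(eta)) / xi of a primitive
    B of the symbol, so that regularity of the flow in xi is never established; the generator is
    identified in weak form, by integrating by parts in eta at each fixed xi. The weight in xi is
    harmless, since the flow preserves xi.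

    The line and the torus are treated together: a one-variable transform leads from each [kind] to
    its dual, and its inversion rests on Abel summation, whose kernels are the Poisson kernels of
    the half-plane and of the disc. *)

(* Lebesgue measure on R, Lebesgue measure on one period, and the counting measure of Z: Fourier duality
   exchanges the last two. *)
Inductive kind := Ln | Pr | Zc.

Definition dual (K : kind) : kind :=
  match K with Ln => Ln | Pr => Zc | Zc => Pr end.

Section Measures.
Variable R : realType.
Local Notation mR := (measurableTypeR R).

Definition mk (K : kind) : {measure set mR -> \bar R} :=
  match K with
  | Ln => lebesgue_measure
  | Pr => mrestr lebesgue_measure (measurable_itv `[0%R, (2 * pi)%R[)
  | Zc => measure_add
      (mseries (fun n : nat => \d_(n%:R : mR)) 0)
      (mseries (fun n : nat => \d_(- n.+1%:R : mR)) 0)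
  end.

(** A head constant of its own, to which the measure structure and, below, sigma-finiteness are
    attached. *)
Definition kmeasure (K : kind) : set mR -> \bar R := mk K.
HB.instance Definition _ K := Measure.on (kmeasure K).

Definition lorentz (x : R) : R := (1 + x ^+ 2)^-1.

Lemma oneDsq_gt0 (x : R) : 0 < 1 + x ^+ 2.
Proof. by rewrite ltr_wpDr ?sqr_ge0. Qed.

Lemma lorentz_gt0 x : 0 < lorentz x. Proof. by rewrite invr_gt0 oneDsq_gt0. Qed.

Lemma lorentz_le1 x : lorentz x <= 1.
Proof. by rewrite invf_le1 ?oneDsq_gt0// lerDl sqr_ge0. Qed.

Lemma continuous_lorentz : continuous lorentz.
Proof.
move=> x; apply: cvgV; first by rewrite gt_eqF ?oneDsq_gt0.
by apply: cvgD; [exact: cvg_cst|exact: exprn_continuous].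
Qed.

Lemma measurable_lorentz : measurable_fun setT lorentz.
Proof. by apply: continuous_measurable_fun; exact: continuous_lorentz. Qed.

(** A positive integrable function bounded by 1 for each of the three measures; nearly all
    dominations below are by a multiple of it. *)
Definition kdecay (K : kind) (x : R) : R := if K is Pr then 1 else lorentz x.

Lemma kdecay_gt0 K x : 0 < kdecay K x. Proof. by case: K => //=; exact: lorentz_gt0. Qed.

Lemma kdecay_le1 K x : kdecay K x <= 1. Proof. by case: K => //=; exact: lorentz_le1. Qed.

Lemma measurable_kdecay K : measurable_fun setT (kdecay K).
Proof. by case: K; [exact: measurable_lorentz|exact: measurable_cst|exact: measurable_lorentz]. Qed.

Lemma integral_lorentz : (\int[lebesgue_measure]_x (lorentz x)%:E = pi%:E)%E.
Proof.
rewrite ge0_symfun_integralT; last 1 first.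
- by move=> x /=; rewrite /lorentz sqrrN.
- rewrite (_ : [set x | _] = `[0, +oo[%classic); last first.
    by apply/seteqP; split => x/=; rewrite in_itv/= andbT.
  by rewrite integral0y_oneDsqr -EFinM mulrCA divff// mulr1.
- by move=> x; rewrite ltW// lorentz_gt0.
- exact: continuous_lorentz.
Qed.



(** Induction against a telescoping bound: 4/(n+1) - 4/(n+2) = 4/((n+1)(n+2)), and (n+1)(n+2) <= 4
    (1 + n^2). *)
Lemma sum_lorentz n : \sum_(0 <= k < n) lorentz k%:R <= 4 - 4 / n.+1%:R :> R.
Proof.
elim: n => [|n IH]; first by rewrite big_geq// divr1 subrr.
rewrite big_nat_recr//=.
suff H : lorentz n%:R <= 4 / n.+1%:R - 4 / n.+2%:R :> R.
  by apply: le_trans (lerD IH H) _; rewrite addrA subrK.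
rewrite /lorentz -!(natr1 n.+1) -!(natr1 n).
have : 0 <= n%:R :> R by [].
move: (n%:R) => x x0.
have -> : 4 / (x + 1) - 4 / (x + 1 + 1) = 4 / ((x + 1) * (x + 2)).
  by field; apply/andP; split; rewrite gt_eqF//; lra.
have a0 : 0 < 1 + x ^+ 2 := oneDsq_gt0 x.
have b0 : 0 < (x + 1) * (x + 2) by nra.
by rewrite ler_pdivlMr// mulrC ler_pdivrMr//; nra.
Qed.

Lemma integral_kdecay_lty K : (\int[kmeasure K]_x (kdecay K x)%:E < +oo)%E.
Proof.
have mW : measurable_fun setT (fun x => (lorentz x)%:E).
  by apply/measurable_EFinP; exact: measurable_lorentz.
have W0 x : (0 <= (lorentz x)%:E)%E by rewrite lee_fin ltW// lorentz_gt0.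
case: K.
- by rewrite integral_lorentz ltry.
- rewrite /= integral_cst//= /kmeasure/= /mrestr setTI mul1e.
  by rewrite lebesgue_measure_itv/=; case: ifP; rewrite -?EFinD ltry.
- rewrite [X in (integral X)]/kmeasure /mk ge0_integral_measure_add//.
  rewrite !ge0_integral_measure_series//.
  have H (e : nat -> R) : (forall k, lorentz (e k) <= lorentz k%:R) ->
      (\sum_(0 <= n <oo) \int[\d_(e n : mR)]_x (lorentz x)%:E <= 4%:E)%E.
    move=> he; apply: lime_le.
      by apply: is_cvg_nneseries => n _ _; exact: integral_ge0.
    apply: nearW => n.
    under eq_bigr do rewrite integral_dirac//= diracT mul1e.
    rewrite sumEFin lee_fin; apply: le_trans (_ : 4 - 4 / n.+1%:R <= _).
      by apply: le_trans (sum_lorentz n); apply: ler_sum => i _.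
    by rewrite lerBlDr lerDl divr_ge0.
  apply: (@le_lt_trans _ _ (4%:E + 4%:E)%E); last by rewrite -EFinD ltry.
  apply: leeD; first exact: H.
  apply: H => k; rewrite /lorentz sqrrN lef_pV2 ?posrE ?oneDsq_gt0// lerD2l.
  by rewrite ler_pXn2r ?nnegrE ?ler_nat// ltW.
Qed.

Lemma integrable_kdecay K : (kmeasure K).-integrable setT (EFin \o kdecay K).
Proof.
apply/integrableP; split; first by apply/measurable_EFinP; exact: measurable_kdecay.
under eq_integral do rewrite gee0_abs ?lee_fin ?(ltW (kdecay_gt0 _ _))//.
exact: integral_kdecay_lty.
Qed.

(** The superlevel sets of the positive integrable function [kdecay K] exhaust the line and have
    finite measure by Markov's inequality; this covers the three kinds at once. *)
Lemma mk_sigma_finite K : sigma_finite setT (kmeasure K).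
Proof.
exists (fun n => [set x | ((n.+1%:R)^-1%:E <= `|(kdecay K x)%:E|)%E]).
  apply/seteqP; split => // x _; have := kdecay_gt0 K x => W0.
  have [n _ /= Hn] := @cvgr0_norm_lt R R^o _ _ _ _ (@cvg_harmonic R) _ W0.
  exists n => //=; rewrite lee_fin (gtr0_norm W0); apply/ltW.
  by apply: le_lt_trans (Hn n (leqnn n)); exact: ler_norm.
move=> n; split.
  rewrite -[X in measurable X]setTI; apply: emeasurable_fun_c_infty => //.
  by apply: measurableT_comp => //; apply/measurable_EFinP; exact: measurable_kdecay.
have := @le_integral_abse _ _ R (kmeasure K) setT measurableT (EFin \o kdecay K) (n.+1%:R)^-1.
rewrite setTI => H.
have n0 : 0 < (n.+1%:R)^-1 :> R by rewrite invr_gt0.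
have {}H := H ((measurable_EFinP _ _).2 (measurable_kdecay K)) n0.
have I := le_lt_trans H (integrableP _ _ _ (integrable_kdecay K)).2.
rewrite ltey; apply/eqP => E; move: I; rewrite /= E gt0_muley ?lte_fin//.
Qed.

HB.instance Definition _ K :=
  Measure_isSigmaFinite.Build _ _ _ (kmeasure K) (mk_sigma_finite K).

Definition kmeasure_sf K : {sigma_finite_measure set mR -> \bar R} := kmeasure K.

Lemma integral_mk_Pr (f : mR -> \bar R) : measurable_fun setT f ->
  (\int[kmeasure Pr]_x f x = \int[lebesgue_measure]_(x in `[0%R, (2 * pi)%R[) f x)%E.
Proof.
move=> mf; pose D : set mR := `[0%R, (2 * pi)%R[%classic.
have mD : measurable D by exact: measurable_itv.
transitivity (\int[kmeasure Pr]_(x in D) f x)%E.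
  rewrite (@integral_mkcond _ _ _ _ D).
  apply: ae_eq_integral => //.
    by apply/(measurable_restrictT f mD); exact: measurable_funTS.
  exists (~` D); split.
  - exact: measurableC.
  - change (lebesgue_measure (~` D `&` D) = 0%E).
    by rewrite setICl measure0.
  - move=> x /= H Dx; apply: H => _; rewrite /patch.
    by rewrite mem_set.
apply: eq_measure_integral => A mA AD.
change (lebesgue_measure (A `&` D) = lebesgue_measure A).
by rewrite setIidl.
Qed.

Lemma mk_ZcE (A : set mR) : (kmeasure Zc A =
  \sum_(0 <= n <oo) \d_((n%:R)%R : R) A + \sum_(0 <= n <oo) \d_((- n.+1%:R)%R : R) A)%E.
Proof. exact: measure_addE. Qed.

(** Every Dirac mass sits at an integer, so the set where [f] and [g] differ is null. *)
Lemma integral_mk_Zc (f g : mR -> \bar R) :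
  measurable_fun setT f -> measurable_fun setT g ->
  (forall n : int, f n%:~R = g n%:~R) ->
  (\int[kmeasure Zc]_x f x = \int[kmeasure Zc]_x g x)%E.
Proof.
move=> mf mg fg; apply: ae_eq_integral => //.
have mN : measurable [set x : mR | f x != g x].
  by rewrite -[X in measurable X]setTI; exact: measurable_neqe.
exists [set x : mR | f x != g x]; split => //; last first.
  by move=> x /= H; apply/eqP => E; apply: H => _.
have d0 (e : mR) : (exists n : int, e = n%:~R) ->
    \d_e [set x : mR | f x != g x] = 0%E :> \bar R.
  by move=> [n ->]; rewrite diracE memNset//= fg eqxx.
change (kmeasure Zc [set x : mR | f x != g x] = 0%E).
rewrite mk_ZcE !eseries0 ?adde0// => n _ _; apply: d0.
  by exists (- n.+1%:Z); rewrite mulrNz.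
by exists n.
Qed.

Lemma mk_Zc_set1 (n : int) : kmeasure Zc [set (n%:~R : R)] = 1%E.
Proof.
rewrite mk_ZcE.
case: n => n.
  rewrite [X in (_ + X)%E]eseries0 => [|k _ _]; last first.
    by rewrite diracE memNset//= => /eqP; rewrite eq_sym gt_eqF// (@lt_le_trans _ _ 0)// oppr_lt0.
  rewrite adde0 (@nneseriesD1 _ _ n xpredT)//.
  rewrite eseries0 ?adde0 ?diracE ?mem_set// => k _ /= kn.
  by rewrite diracE memNset//= => /eqP; rewrite eqr_nat (negbTE kn).
rewrite [X in (X + _)%E]eseries0 => [|k _ _]; last first.
  by rewrite diracE memNset//= NegzE mulrNz => /eqP; rewrite gt_eqF// (@lt_le_trans _ _ 0)// oppr_lt0.
rewrite add0e (@nneseriesD1 _ _ n xpredT)//.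
rewrite eseries0 ?adde0 ?diracE ?mem_set// => k _ /= kn.
by rewrite diracE memNset//= NegzE mulrNz => /eqP; rewrite eqr_opp eqr_nat eqSS (negbTE kn).
Qed.
End Measures.

(** * Complex-valued functions *)

Section Complex.
Variable R : realType.
Local Notation C := R[i].
Local Notation re := (@complex.Re R).
Local Notation im := (@complex.Im R).
Local Notation normc := (@ComplexField.Normc.normc R).

Lemma cP (z w : C) : re z = re w -> im z = im w -> z = w.
Proof. by case: z w => [a b] [c d] /= -> ->. Qed.

Lemma cReM (z w : C) : re (z * w) = re z * re w - im z * im w.
Proof. by case: z w => [a b] [c d]. Qed.

Lemma cImM (z w : C) : im (z * w) = re z * im w + im z * re w.
Proof. by case: z w => [a b] [c d]. Qed.

Lemma cReD (z w : C) : re (z + w) = re z + re w.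
Proof. by case: z w => [a b] [c d]. Qed.

Lemma cImD (z w : C) : im (z + w) = im z + im w.
Proof. by case: z w => [a b] [c d]. Qed.

Lemma cReN (z : C) : re (- z) = - re z. Proof. by case: z. Qed.
Lemma cImN (z : C) : im (- z) = - im z. Proof. by case: z. Qed.
Lemma cReB (z w : C) : re (z - w) = re z - re w.
Proof. by rewrite cReD cReN. Qed.
Lemma cImB (z w : C) : im (z - w) = im z - im w.
Proof. by rewrite cImD cImN. Qed.
Lemma cReR (a : R) : re a%:C = a. Proof. by []. Qed.
Lemma cImR (a : R) : im a%:C = 0. Proof. by []. Qed.
Lemma cRe0 : re 0 = 0. Proof. by []. Qed.
Lemma cIm0 : im 0 = 0. Proof. by []. Qed.
Lemma cRe1 : re 1 = 1. Proof. by []. Qed.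
Lemma cIm1 : im 1 = 0. Proof. by []. Qed.
Lemma cReJ (z : C) : re (z^*)%C = re z. Proof. by case: z. Qed.
Lemma cImJ (z : C) : im (z^*)%C = - im z. Proof. by case: z. Qed.

Definition cE := (cReM, cImM, cReB, cImB, cReD, cImD, cReN, cImN, cReR, cImR,
  cRe0, cIm0, cRe1, cIm1, cReJ, cImJ).

(** The l^1 norm of the pair of real and imaginary parts. It suits componentwise integrals and
    derivatives, is submultiplicative and is equivalent to the modulus; the price is factors 2 and 4
    in later estimates. *)
Definition cnorm1 (z : C) : R := `|re z| + `|im z|.

Lemma cnorm1_ge0 z : 0 <= cnorm1 z. Proof. by rewrite addr_ge0. Qed.

Lemma cnorm10 : cnorm1 0 = 0. Proof. by rewrite /cnorm1 normr0 addr0. Qed.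

Lemma cnorm1D z w : cnorm1 (z + w) <= cnorm1 z + cnorm1 w.
Proof.
rewrite /cnorm1 !cE addrACA lerD// ler_normD//.
Qed.

Lemma cnorm1N z : cnorm1 (- z) = cnorm1 z. Proof. by rewrite /cnorm1 !cE !normrN. Qed.

Lemma cnorm1B z w : cnorm1 (z - w) <= cnorm1 z + cnorm1 w.
Proof. by rewrite -(cnorm1N w) cnorm1D. Qed.

Lemma cnorm1J z : cnorm1 (z^*)%C = cnorm1 z. Proof. by rewrite /cnorm1 !cE normrN. Qed.

Lemma cnorm1M z w : cnorm1 (z * w) <= cnorm1 z * cnorm1 w.
Proof.
rewrite /cnorm1 !cE; apply: le_trans (lerD (ler_normB _ _) (ler_normD _ _)) _.
rewrite !normrM; lra.
Qed.

Lemma cnorm1R (a : R) : cnorm1 a%:C = `|a|. Proof. by rewrite /cnorm1 !cE normr0 addr0. Qed.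

Lemma cnorm1RM (a : R) z : cnorm1 (a%:C * z) = `|a| * cnorm1 z.
Proof. by rewrite /cnorm1 !cE !mul0r subr0 addr0 !normrM mulrDr. Qed.

Lemma re_cnorm1 z : `|re z| <= cnorm1 z. Proof. by rewrite lerDl. Qed.
Lemma im_cnorm1 z : `|im z| <= cnorm1 z. Proof. by rewrite lerDr. Qed.

Lemma cnorm1_eq0 z : cnorm1 z <= 0 -> z = 0.
Proof.
move=> H; have a := normr_ge0 (re z); have b := normr_ge0 (im z).
move: H; rewrite /cnorm1 => H.
by apply: cP; apply/eqP; rewrite -normr_eq0 eq_le normr_ge0 andbT /=; lra.
Qed.

Definition normsq (z : C) : R := re z ^+ 2 + im z ^+ 2.

Lemma normsq_ge0 z : 0 <= normsq z. Proof. by rewrite addr_ge0// sqr_ge0. Qed.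

Lemma normcE z : normc z = Num.sqrt (normsq z).
Proof. by case: z. Qed.

Lemma normc_ge0 z : 0 <= normc z. Proof. by rewrite normcE sqrtr_ge0. Qed.

Lemma normc_normsq z : normc z ^+ 2 = normsq z.
Proof. by rewrite normcE sqr_sqrtr ?normsq_ge0. Qed.

Lemma normc_cnorm1 z : normc z <= cnorm1 z.
Proof.
rewrite -(@ler_pXn2r _ 2)// ?nnegrE ?normc_ge0 ?cnorm1_ge0// normc_normsq /normsq /cnorm1.
rewrite -(real_normK (num_real (re z))) -(real_normK (num_real (im z))).
have a := normr_ge0 (re z); have b := normr_ge0 (im z); nra.
Qed.

Lemma cnorm1_normc z : cnorm1 z <= 2 * normc z.
Proof.
rewrite -(@ler_pXn2r _ 2)// ?nnegrE ?mulr_ge0 ?normc_ge0 ?cnorm1_ge0//.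
rewrite exprMn normc_normsq /normsq /cnorm1.
rewrite -(real_normK (num_real (re z))) -(real_normK (num_real (im z))).
have a := normr_ge0 (re z); have b := normr_ge0 (im z); nra.
Qed.

Lemma normsqM z w : normsq (z * w) = normsq z * normsq w.
Proof. by rewrite /normsq !cE; ring. Qed.

Lemma normsqR (a : R) : normsq a%:C = a ^+ 2.
Proof. by rewrite /normsq !cE; ring. Qed.

Lemma normsqJ z : normsq (z^*)%C = normsq z.
Proof. by rewrite /normsq !cE sqrrN. Qed.

Lemma normsq_cnorm1 z : normsq z <= cnorm1 z ^+ 2.
Proof. by rewrite -normc_normsq ler_pXn2r ?nnegrE ?normc_ge0 ?cnorm1_ge0// normc_cnorm1. Qed.

Lemma normsqE z : (normsq z)%:C = z * (z^*)%C.
Proof. by apply: cP; rewrite !cE /normsq; ring. Qed.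

Definition cexp (a : R) : C := cos a +i* sin a.

Lemma cnorm1_cexp a : cnorm1 (cexp a) <= 2.
Proof.
have h (x : R) : -1 <= x -> x <= 1 -> `|x| <= 1 by move=> *; rewrite ler_norml; apply/andP.
rewrite /cnorm1/= -[2]/(1 + 1); apply: lerD; apply: h.
- exact: cos_geN1. - exact: cos_le1. - exact: sin_geN1. - exact: sin_le1.
Qed.

Lemma cexpD a b : cexp (a + b) = cexp a * cexp b.
Proof. by apply: cP; rewrite !cE/= ?cosD ?sinD; ring. Qed.

Lemma cexp0 : cexp 0 = 1.
Proof. by rewrite /cexp cos0 sin0. Qed.

Lemma cexpN a : cexp (- a) = ((cexp a)^*)%C.
Proof. by apply: cP; rewrite !cE/= ?cosN ?sinN. Qed.

Lemma cexp_pi2n (a : R) (n : int) : cexp (a + n%:~R * (2 * pi)) = cexp a.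
Proof.
have c2 : cexp (2 * pi) = 1 by rewrite /cexp mulr_natl cos2pi sin2pi.
have H (k : nat) b : cexp (b + k%:R * (2 * pi)) = cexp b.
  elim: k => [|k IH]; first by rewrite mul0r addr0.
  rewrite -natr1 mulrDl mul1r (addrC _ (2 * pi)).
  rewrite (addrC (2 * pi)) addrA cexpD c2 mulr1.
  exact: IH.
case: n => n; first exact: H.
rewrite NegzE mulrNz mulNr.
by rewrite -[in RHS](subrK (n.+1%:R * (2 * pi)) a) (H n.+1).
Qed.

Definition is_cderive (f : R -> C) (x : R) (l : C) :=
  is_derive x 1 (fun t => re (f t)) (re l) /\
  is_derive x 1 (fun t => im (f t)) (im l).

Lemma is_cderive_cst (c : C) x : is_cderive (fun _ => c) x 0.
Proof. by split; exact: is_derive_cst. Qed.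

Lemma is_cderiveD f g x a b : is_cderive f x a -> is_cderive g x b ->
  is_cderive (fun t => f t + g t) x (a + b).
Proof.
move=> [f1 f2] [g1 g2]; split; rewrite !cE.
  by under eq_fun do rewrite cReD; exact: is_deriveD.
by under eq_fun do rewrite cImD; exact: is_deriveD.
Qed.

Lemma is_cderiveM f g x a b : is_cderive f x a -> is_cderive g x b ->
  is_cderive (fun t => f t * g t) x (a * g x + f x * b).
Proof.
move=> [f1 f2] [g1 g2]; split.
  under eq_fun do rewrite cReM.
  apply: is_derive_eq (is_deriveB (is_deriveM f1 g1) (is_deriveM f2 g2)) _.
  by rewrite !cE /GRing.scale/=; ring.
under eq_fun do rewrite cImM.
apply: is_derive_eq (is_deriveD (is_deriveM f1 g2) (is_deriveM f2 g1)) _.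
by rewrite !cE /GRing.scale/=; ring.
Qed.

Lemma is_cderiveR (f : R -> R) (x a : R) : is_derive x 1 f a -> is_cderive (fun t => (f t)%:C) x a%:C.
Proof. by move=> h; split => //=; exact: is_derive_cst. Qed.

Lemma is_cderiveJ f x a : is_cderive f x a -> is_cderive (fun t => ((f t)^*)%C) x (a^*)%C.
Proof.
move=> [f1 f2]; split; rewrite !cE.
  by under eq_fun do rewrite cReJ.
by under eq_fun do rewrite cImJ; exact: is_deriveN.
Qed.

Lemma is_cderive_unique f x a b : is_cderive f x a -> is_cderive f x b -> a = b.
Proof.
move=> [[_ f1] [_ f2]] [[_ g1] [_ g2]]; apply: cP.
  by rewrite -f1 -g1. by rewrite -f2 -g2.
Qed.

Lemma is_cderive_eq f x a b : is_cderive f x a -> a = b -> is_cderive f x b.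
Proof. by move=> h <-. Qed.

Lemma is_cderive_cexp (a x : R) : is_cderive (fun t => cexp (a * t)) x (0 +i* a * cexp (a * x)).
Proof.
have h : is_derive x 1 (fun t : R => a * t) a.
  by apply: is_derive_eq; rewrite /GRing.scale/= mulr1.
split => /=.
  apply: is_derive_eq (@is_derive1_comp _ cos (fun t => a * t) x _ _ _ _) _.
  by rewrite /=; ring.
apply: is_derive_eq (@is_derive1_comp _ sin (fun t => a * t) x _ _ _ _) _.
by rewrite /=; ring.
Qed.


(** * Integration of complex-valued functions *)

Section Integral.
Context d (T : measurableType d) (mu : {measure set T -> \bar R}).

Definition cmeasurable (g : T -> C) : Prop :=
  measurable_fun setT (fun x => re (g x)) /\ measurable_fun setT (fun x => im (g x)).

Definition cintegrable (g : T -> C) : Prop :=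
  mu.-integrable setT (fun x => (re (g x))%:E) /\
  mu.-integrable setT (fun x => (im (g x))%:E).

Definition cint (g : T -> C) : C := (\int[mu]_x re (g x)) +i* (\int[mu]_x im (g x)).

Lemma cmeasurableD f g : cmeasurable f -> cmeasurable g -> cmeasurable (fun x => f x + g x).
Proof.
move=> [f1 f2] [g1 g2]; split.
  by under eq_fun do rewrite cReD; exact: measurable_funD.
by under eq_fun do rewrite cImD; exact: measurable_funD.
Qed.

Lemma cmeasurableM f g : cmeasurable f -> cmeasurable g -> cmeasurable (fun x => f x * g x).
Proof.
move=> [f1 f2] [g1 g2]; split.
  under eq_fun do rewrite cReM.
  by apply: measurable_funB; exact: measurable_funM.
under eq_fun do rewrite cImM.
by apply: measurable_funD; exact: measurable_funM.
Qed.

Lemma cmeasurable_cst c : cmeasurable (fun=> c).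
Proof. by split; exact: measurable_cst. Qed.

Lemma cmeasurableN f : cmeasurable f -> cmeasurable (fun x => - f x).
Proof.
move=> mf; have := cmeasurableM (cmeasurable_cst (-1)) mf.
by under eq_fun do rewrite mulN1r.
Qed.

Lemma cmeasurableB f g : cmeasurable f -> cmeasurable g -> cmeasurable (fun x => f x - g x).
Proof. by move=> mf mg; apply: cmeasurableD => //; exact: cmeasurableN. Qed.

Lemma cmeasurableJ f : cmeasurable f -> cmeasurable (fun x => ((f x)^*)%C).
Proof.
move=> [f1 f2]; split; first by under eq_fun do rewrite cReJ.
by under eq_fun do rewrite cImJ; exact: measurableT_comp.
Qed.

Lemma cmeasurableR (f : T -> R) : measurable_fun setT f -> cmeasurable (fun x => (f x)%:C).
Proof. by move=> mf; split => //=; exact: measurable_cst. Qed.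

Lemma cmeasurable_cexp (f : T -> R) : measurable_fun setT f -> cmeasurable (fun x => cexp (f x)).
Proof.
move=> mf; split => /=; apply: measurableT_comp => //.
  by apply: continuous_measurable_fun; exact: continuous_cos.
by apply: continuous_measurable_fun; exact: continuous_sin.
Qed.

Lemma cmeasurable_normsq f : cmeasurable f -> measurable_fun setT (fun x => normsq (f x)).
Proof. by move=> [f1 f2]; apply: measurable_funD; exact: measurable_funX. Qed.

Lemma dom_integrable (f G : T -> R) : measurable_fun setT f ->
  (forall x, `|f x| <= G x) -> mu.-integrable setT (EFin \o G) ->
  mu.-integrable setT (EFin \o f).
Proof.
move=> mf fG iG; apply: (le_integrable _ _ _ iG) => //.
  by apply/measurable_EFinP.
move=> x _ /=; rewrite lee_fin; apply: le_trans (fG x) _; exact: ler_norm.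
Qed.

Lemma cintegrable_dom (g : T -> C) (G : T -> R) : cmeasurable g -> (forall x, cnorm1 (g x) <= G x) ->
  mu.-integrable setT (EFin \o G) -> cintegrable g.
Proof.
move=> [g1 g2] gG iG; split.
  by apply: (dom_integrable g1 _ iG) => x; apply: le_trans (gG x); exact: re_cnorm1.
by apply: (dom_integrable g2 _ iG) => x; apply: le_trans (gG x); exact: im_cnorm1.
Qed.

Lemma cRe_int g : re (cint g) = \int[mu]_x re (g x). Proof. by []. Qed.
Lemma cIm_int g : im (cint g) = \int[mu]_x im (g x). Proof. by []. Qed.

Let ri (h : T -> R) := mu.-integrable setT (EFin \o h).

Lemma riD (f g : T -> R) : ri f -> ri g -> ri (fun x => f x + g x).
Proof.
move=> hf hg; rewrite /ri (_ : _ \o _ = (EFin \o f) \+ (EFin \o g))%E//.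
exact: integrableD.
Qed.

Lemma riZ (a : R) (f : T -> R) : ri f -> ri (fun x => a * f x).
Proof.
move=> hf; rewrite /ri (_ : _ \o _ = fun x => (a%:E * (EFin \o f) x)%E)//.
exact: integrableZl.
Qed.

Lemma riB (f g : T -> R) : ri f -> ri g -> ri (fun x => f x - g x).
Proof.
move=> hf hg; rewrite (_ : (fun x => _) = (fun x => f x + -1 * g x)).
  by apply: riD => //; exact: riZ.
by apply/funext => x; rewrite mulN1r.
Qed.

Lemma cintD f g : cintegrable f -> cintegrable g -> cint (fun x => f x + g x) = cint f + cint g.
Proof.
move=> [f1 f2] [g1 g2]; apply: cP; rewrite cE !(cRe_int, cIm_int) -RintegralD//;
  by apply: eq_Rintegral => x _; rewrite cE.
Qed.

Lemma cintegrableD f g : cintegrable f -> cintegrable g -> cintegrable (fun x => f x + g x).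
Proof.
move=> [f1 f2] [g1 g2]; split.
  by under eq_fun do rewrite cReD; exact: riD.
by under eq_fun do rewrite cImD; exact: riD.
Qed.

Lemma cintegrableZ c f : cintegrable f -> cintegrable (fun x => c * f x).
Proof.
move=> [f1 f2]; split.
  by under eq_fun do rewrite cReM; apply: riB; exact: riZ.
by under eq_fun do rewrite cImM; apply: riD; exact: riZ.
Qed.

Lemma cintZ c f : cintegrable f -> cint (fun x => c * f x) = c * cint f.
Proof.
move=> [f1 f2]; apply: cP; rewrite !cE !(cRe_int, cIm_int) -!RintegralZl//.
  rewrite -RintegralB//; [|exact: riZ..].
  by apply: eq_Rintegral => x _; rewrite cE.
rewrite -RintegralD//; [|exact: riZ..].
by apply: eq_Rintegral => x _; rewrite cE.
Qed.

Lemma cintegrableZr c f : cintegrable f -> cintegrable (fun x => f x * c).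
Proof. by move=> /(cintegrableZ c); under eq_fun do rewrite mulrC. Qed.

Lemma cint_ext f g : (forall x, f x = g x) -> cint f = cint g.
Proof. by move=> fg; congr cint; apply/funext. Qed.

Lemma cintZr c f : cintegrable f -> cint (fun x => f x * c) = cint f * c.
Proof.
by move=> hf; rewrite mulrC -cintZ//; apply: cint_ext => x; rewrite mulrC.
Qed.

Lemma cintN f : cintegrable f -> cint (fun x => - f x) = - cint f.
Proof.
by move=> hf; rewrite -mulN1r -cintZ//; apply: cint_ext => x; rewrite mulN1r.
Qed.

Lemma cintegrableN f : cintegrable f -> cintegrable (fun x => - f x).
Proof. by move=> /(cintegrableZ (-1)); under eq_fun do rewrite mulN1r. Qed.

Lemma cintB f g : cintegrable f -> cintegrable g -> cint (fun x => f x - g x) = cint f - cint g.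
Proof. by move=> hf hg; rewrite cintD// ?cintN//; exact: cintegrableN. Qed.

Lemma cint_conj f : cintegrable f -> cint (fun x => ((f x)^*)%C) = ((cint f)^*)%C.
Proof.
move=> [f1 f2]; apply: cP.
  by rewrite [RHS]cReJ; apply: eq_Rintegral => x _; rewrite cReJ.
rewrite [RHS]cImJ !cIm_int.
rewrite -mulN1r -RintegralZl//; apply: eq_Rintegral => x _.
by rewrite cImJ mulN1r.
Qed.

Lemma cint0 : cint (fun=> 0) = 0.
Proof. by apply: cP; rewrite /= Rintegral_cst// mul0r. Qed.

(** The factor 2 counts the real and the imaginary part, each bounded by the integral of [G]. *)
Lemma cnorm1_cint f (G : T -> R) : cintegrable f -> (forall x, cnorm1 (f x) <= G x) ->
  mu.-integrable setT (EFin \o G) -> cnorm1 (cint f) <= 2 * \int[mu]_x G x.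
Proof.
move=> [f1 f2] fG iG.
have h (k : T -> R) : mu.-integrable setT (EFin \o k) -> (forall x, `|k x| <= G x) ->
    `|\int[mu]_x k x| <= \int[mu]_x G x.
  move=> ik kG; apply: le_trans (le_normr_Rintegral _ _) _ => //.
  apply: le_Rintegral => //.
    exact: integrable_abse ik.
rewrite /cnorm1 /= mulr_natl mulr2n; apply: lerD; apply: h => // x;
  apply: le_trans (fG x); [exact: re_cnorm1|exact: im_cnorm1].
Qed.

Lemma is_cderive_cint (f f' : R -> T -> C) (G : T -> R) (t0 : R) :
  (forall t, cintegrable (f t)) -> (forall t x, is_cderive (f ^~ x) t (f' t x)) ->
  (forall t x, cnorm1 (f' t x) <= G x) -> mu.-integrable setT (EFin \o G) ->
  is_cderive (fun t => cint (f t)) t0 (cint (f' t0)).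
Proof.
move=> If df f'G iG.
have G0 x : 0 <= G x by apply: le_trans (f'G 0 x); exact: cnorm1_ge0.
have h (h h' : R -> T -> R) : (forall t, mu.-integrable setT (EFin \o h t)) ->
    (forall (t : R) x, is_derive t 1 (h ^~ x) (h' t x)) ->
    (forall t x, `|h' t x| <= G x) ->
    is_derive t0 1 (fun t => \int[mu]_x h t x) (\int[mu]_x h' t0 x).
  move=> ih dh h'G.
  have E t x : partial1of2 h t x = h' t x.
    by rewrite partial1of2E; have [_ ->] := dh t x.
  (* Any open interval around [t0] would do, since [G] dominates the derivative at all times. *)
  have H : (t0 \in `](t0 - 1), (t0 + 1)[) by rewrite in_itv/=; apply/andP; split; lra.
  have D := @derivable_under_integral R _ T mu h setT measurableT t0 (t0 - 1) (t0 + 1).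
  have V := @differentiation_under_integral R _ T mu h setT measurableT t0 (t0 - 1) (t0 + 1).
  have A1 : forall x, `](t0 - 1), (t0 + 1)[%classic x -> mu.-integrable setT (EFin \o h x) by [].
  have A2 : forall x y, `](t0 - 1), (t0 + 1)[%classic x -> setT y -> derivable (h ^~ y) x 1.
    by move=> x y _ _; have [] := dh x y.
  have A3 : forall x y, `](t0 - 1), (t0 + 1)[%classic x -> setT y -> `|partial1of2 h x y| <= G y.
    by move=> x y _ _; rewrite E.
  split; first exact: (D H A1 A2 G).
  rewrite -derive1E (V H A1 A2 G)//.
  by apply: eq_Rintegral => x _; rewrite E.
split => /=.
  apply: (h (fun t x => re (f t x)) (fun t x => re (f' t x))).
  - by move=> t; have [] := If t.
  - by move=> t x; have [] := df t x.
  - by move=> t x; apply: le_trans (f'G t x); exact: re_cnorm1.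
apply: (h (fun t x => im (f t x)) (fun t x => im (f' t x))).
- by move=> t; have [] := If t.
- by move=> t x; have [] := df t x.
- by move=> t x; apply: le_trans (f'G t x); exact: im_cnorm1.
Qed.

End Integral.

(** * Fubini's theorem for dominated complex integrands *)

Section Fubini.
Context d1 d2 (T1 : measurableType d1) (T2 : measurableType d2).
Variable m1 : {sigma_finite_measure set T1 -> \bar R}.
Variable m2 : {sigma_finite_measure set T2 -> \bar R}.

(** Tonelli gives measurability for nonnegative integrands, hence the split into positive and
    negative parts. *)
Lemma measurable_Rint (f : T1 * T2 -> R) : measurable_fun setT f ->
  measurable_fun setT (fun x => \int[m2]_y f (x, y)).
Proof.
move=> mf; apply: measurableT_comp => //.
have mE : measurable_fun setT (EFin \o f) by apply/measurable_EFinP.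
have a1 := measurable_fun_fubini_tonelli_F (m2 := m2) _ (measurable_funepos mE) (fun x => funepos_ge0 _ x).
have a2 := measurable_fun_fubini_tonelli_F (m2 := m2) _ (measurable_funeneg mE) (fun x => funeneg_ge0 _ x).
have -> : (fun x => \int[m2]_y (f (x, y))%:E)%E =
    (fubini_F m2 (EFin \o f)^\+ \- fubini_F m2 (EFin \o f)^\-)%E.
  apply/funext => x; rewrite [LHS]integralE /fubini_F.
  by congr (_ - _)%E; apply: eq_integral => y _; rewrite !(funeposE, funenegE).
exact: emeasurable_funB.
Qed.

Lemma cmeasurable_cint (f : T1 * T2 -> C) : cmeasurable f -> cmeasurable (fun x => cint m2 (fun y => f (x, y))).
Proof.
by move=> [f1 f2]; split; [exact: (measurable_Rint f1)|exact: (measurable_Rint f2)].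
Qed.

Lemma integrable_prod (G1 : T1 -> R) (G2 : T2 -> R) :
  (forall x, 0 <= G1 x) -> (forall y, 0 <= G2 y) ->
  m1.-integrable setT (EFin \o G1) -> m2.-integrable setT (EFin \o G2) ->
  (m1 \x m2)%E.-integrable setT (fun p => (G1 p.1 * G2 p.2)%:E).
Proof.
move=> p1 p2 i1 i2.
have mG1 : measurable_fun setT G1 by apply/measurable_EFinP; case/integrableP: i1.
have mG2 : measurable_fun setT G2 by apply/measurable_EFinP; case/integrableP: i2.
apply/integrable12ltyP.
  by apply/measurable_EFinP; apply: measurable_funM; exact: measurableT_comp.
have E x : (\int[m2]_y `|(G1 x * G2 y)%:E| = (G1 x)%:E * \int[m2]_y (G2 y)%:E)%E.
  rewrite -ge0_integralZl//.
  - by apply: eq_integral => y _; rewrite gee0_abs ?lee_fin ?mulr_ge0// EFinM.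
  - exact/measurable_EFinP.
  - by move=> y _; rewrite lee_fin.
  - by rewrite lee_fin.
under eq_integral do rewrite /= E.
rewrite ge0_integralZr//; [|exact/measurable_EFinP|by move=> y _; rewrite lee_fin|by apply: integral_ge0 => y _; rewrite lee_fin].
apply: lte_mul_pinfty.
- by apply: integral_ge0 => y _; rewrite lee_fin.
- exact: (integrable_fin_num measurableT i1).
- exact: (integrable_lty measurableT i2).
Qed.

(** A product majorant makes every section integrable, not just almost every one, so the iterated
    integrals of the real and imaginary parts are meaningful at each point. *)
Lemma cfubini (f : T1 * T2 -> C) (G1 : T1 -> R) (G2 : T2 -> R) : cmeasurable f ->
  (forall x y, cnorm1 (f (x, y)) <= G1 x * G2 y) ->
  (forall x, 0 <= G1 x) -> (forall y, 0 <= G2 y) ->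
  m1.-integrable setT (EFin \o G1) -> m2.-integrable setT (EFin \o G2) ->
  [/\ cint (m1 \x m2)%E f = cint m1 (fun x => cint m2 (fun y => f (x, y))),
      cint (m1 \x m2)%E f = cint m2 (fun y => cint m1 (fun x => f (x, y))) &
      cintegrable (m1 \x m2)%E f].
Proof.
move=> [mf1 mf2] fG p1 p2 i1 i2.
have h (g : T1 * T2 -> R) : measurable_fun setT g ->
    (forall x y, `|g (x, y)| <= G1 x * G2 y) ->
    [/\ \int[(m1 \x m2)%E]_p g p = \int[m1]_x \int[m2]_y g (x, y),
     \int[(m1 \x m2)%E]_p g p = \int[m2]_y \int[m1]_x g (x, y) &
     (m1 \x m2)%E.-integrable setT (EFin \o g)].
  move=> mg gG.
  have ig : (m1 \x m2)%E.-integrable setT (EFin \o g).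
    by apply: (dom_integrable mg _ (integrable_prod p1 p2 i1 i2)) => -[x y] /=.
  split => //.
    rewrite /Rintegral -(integral12_prod_meas1 ig); congr fine.
    apply: eq_integral => x _; rewrite fineK//.
    apply: integrable_fin_num => //.
    apply: (@dom_integrable _ _ m2 (fun y => g (x, y)) (fun y => G1 x * G2 y)).
    - exact: measurableT_comp.
    - by move=> y.
    - exact: riZ.
  rewrite /Rintegral -(integral21_prod_meas1 ig); congr fine.
  apply: eq_integral => y _; rewrite fineK//.
  apply: integrable_fin_num => //.
  apply: (@dom_integrable _ _ m1 (fun x => g (x, y)) (fun x => G2 y * G1 x)).
  - exact: measurableT_comp.
  - by move=> x; rewrite mulrC.
  - exact: riZ.
have [a1 b1 c1] := h _ mf1 (fun x y => le_trans (re_cnorm1 _) (fG x y)).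
have [a2 b2 c2] := h _ mf2 (fun x y => le_trans (im_cnorm1 _) (fG x y)).
split; last by [].
  by apply: cP; rewrite ?cRe_int ?cIm_int ?a1 ?a2.
by apply: cP; rewrite ?cRe_int ?cIm_int ?b1 ?b2.
Qed.

End Fubini.
End Complex.

(** * Changes of variable, dominated convergence and integrals of derivatives *)

Section RealIntegrals.
Variable R : realType.
Local Notation mR := (measurableTypeR R).
Local Notation leb := (@lebesgue_measure R).
Local Notation C := R[i].
Local Notation re := (@complex.Re R).
Local Notation im := (@complex.Im R).

(** Uniqueness of Lebesgue measure: the pushforward by the translation has the same values on
    half-open intervals. *)
Lemma leb_shift (a : R) (A : set mR) : measurable A ->
  leb ((fun x : mR => (x + a : mR)) @^-1` A) = leb A.
Proof.
move=> mA; pose phi := fun x : mR => (x + a : mR).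
have mphi : measurable_fun setT phi by exact: measurable_funD.
pose phiM := HB.pack_for {mfun mR >-> mR} phi (isMeasurableFun.Build _ _ _ _ phi mphi).
apply/esym; apply: (@lebesgue_measure_unique R (pushforward leb phiM)) => //.
move=> _ [[c e] _ <-]; rewrite /pushforward.
change (leb `]c, e]%classic = leb (phi @^-1` `]c, e]%classic)).
have -> : phi @^-1` `]c, e]%classic = `](c - a), (e - a)]%classic.
  by apply/seteqP; split => x; rewrite /= /phi !in_itv/= ltrBlDr lerBrDr.
rewrite !lebesgue_measure_itv/= !lte_fin ltrD2r; case: ifP => // _.
by rewrite -!EFinB; congr EFin; ring.
Qed.

Lemma leb_opp (A : set mR) : measurable A ->
  leb ((fun x : mR => (- x : mR)) @^-1` A) = leb A.
Proof.
move=> mA; pose phi := fun x : mR => (- x : mR).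
have mphi : measurable_fun setT phi by exact: measurableT_comp.
pose phiM := HB.pack_for {mfun mR >-> mR} phi (isMeasurableFun.Build _ _ _ _ phi mphi).
apply/esym; apply: (@lebesgue_measure_unique R (pushforward leb phiM)) => //.
move=> _ [[c e] _ <-]; rewrite /pushforward.
change (leb `]c, e]%classic = leb (phi @^-1` `]c, e]%classic)).
have -> : phi @^-1` `]c, e]%classic = `[(- e), (- c)[%classic.
  by apply/seteqP; split => x; rewrite /= /phi !in_itv/= andbC lerNl ltrNr.
rewrite !lebesgue_measure_itv/= !lte_fin ltrN2; case: ifP => // _.
by rewrite -!EFinB; congr EFin; ring.
Qed.

Section Change.
Variable phi : mR -> mR.
Hypothesis mphi : measurable_fun setT phi.
Hypothesis Hphi : forall A, measurable A -> leb (phi @^-1` A) = leb A.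

Lemma ge0_leb_change (f : mR -> \bar R) : measurable_fun setT f ->
  (forall x, 0 <= f x)%E -> (\int[leb]_x f (phi x) = \int[leb]_x f x)%E.
Proof.
move=> mf f0.
pose phiM := HB.pack_for {mfun mR >-> mR} phi (isMeasurableFun.Build _ _ _ _ phi mphi).
have := @ge0_integral_pushforward _ _ _ _ R phi mphi leb setT f measurableT mf (fun x _ => f0 x).
rewrite preimage_setT => <-.
have H A : measurable A -> A `<=` setT -> pushforward leb phiM A = leb A.
  by move=> mA _; exact: (Hphi mA).
exact: (@eq_measure_integral _ _ _ setT leb (pushforward leb phiM) f H).
Qed.

Lemma leb_change (f : mR -> \bar R) : measurable_fun setT f ->
  (\int[leb]_x f (phi x) = \int[leb]_x f x)%E.
Proof.
move=> mf; rewrite integralE [RHS]integralE; congr (_ - _)%E.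
  rewrite -[RHS](ge0_leb_change (measurable_funepos mf))//.
  by apply: eq_integral => x _; rewrite !funeposE.
rewrite -[RHS](ge0_leb_change (measurable_funeneg mf))//.
by apply: eq_integral => x _; rewrite !funenegE.
Qed.

End Change.

Lemma is_derive_cont (f : R -> R) (x a : R) : is_derive x 1 f a -> {for x, continuous f}.
Proof.
by move=> [df _]; apply: differentiable_continuous; apply/derivable1_diffP.
Qed.

Lemma cnorm1_cvgP (u : nat -> C) (a : C) :
  (fun n => cnorm1 (u n - a)) @ \oo --> (0 : R) <->
  ((fun n => re (u n)) @ \oo --> re a /\ (fun n => im (u n)) @ \oo --> im a).
Proof.
split=> [H|[H1 H2]].
  split; apply/cvgrPdist_le => e e0; move/cvgr0Pnorm_le : H => /(_ _ e0);
   apply: filterS => n; rewrite (ger0_norm (cnorm1_ge0 _)); apply: le_trans.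
    by rewrite distrC -cReB re_cnorm1.
  by rewrite distrC -cImB im_cnorm1.
rewrite -[X in _ --> X](addr0 0); under eq_fun do rewrite /cnorm1.
apply: cvgD; apply/cvgr0Pnorm_le => e e0.
  move/cvgrPdist_le : H1 => /(_ _ e0); apply: filterS => n.
  by rewrite normr_id distrC cReB.
move/cvgrPdist_le : H2 => /(_ _ e0); apply: filterS => n.
by rewrite normr_id distrC cImB.
Qed.

Lemma cnorm1_cvg_unique (u : nat -> C) (a b : C) :
  (fun n => cnorm1 (u n - a)) @ \oo --> (0 : R) ->
  (fun n => cnorm1 (u n - b)) @ \oo --> (0 : R) -> a = b.
Proof.
move=> /cnorm1_cvgP[a1 a2] /cnorm1_cvgP[b1 b2].
by apply: cP; [exact: (cvg_unique _ a1 b1)|exact: (cvg_unique _ a2 b2)].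
Qed.

Section DCT.
Context d (T : measurableType d) (mu : {measure set T -> \bar R}).

Lemma Rint_dct (f_ : nat -> T -> R) (f G : T -> R) :
  (forall n, measurable_fun setT (f_ n)) -> measurable_fun setT f ->
  (forall x, f_ ^~ x @ \oo --> f x) ->
  (forall n x, `|f_ n x| <= G x) -> mu.-integrable setT (EFin \o G) ->
  (fun n => \int[mu]_x f_ n x) @ \oo --> \int[mu]_x f x.
Proof.
move=> mf_ mf ff fG iG.
have ffE : {ae mu, forall x, setT x -> (fun n => (f_ n x)%:E) @ \oo --> (f x)%:E}.
  by apply: aeW => x _; apply/fine_cvgP; split; [exact: nearW|exact: ff].
have fGE : {ae mu, forall x n, setT x -> (`|(f_ n x)%:E| <= (G x)%:E)%E}.
  by apply: aeW => x n _; rewrite lee_fin.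
have mE n : measurable_fun setT (fun x => (f_ n x)%:E) by apply/measurable_EFinP.
have mfE : measurable_fun setT (fun x => (f x)%:E) by apply/measurable_EFinP.
have [i1 _ c] := dominated_convergence measurableT mE mfE ffE iG fGE.
by apply: fine_cvg; rewrite fineK; [exact: c|exact: integrable_fin_num].
Qed.

Lemma cint_dct (f_ : nat -> T -> C) (f : T -> C) (G : T -> R) :
  (forall n, cmeasurable (f_ n)) -> cmeasurable f ->
  (forall x, (fun n => cnorm1 (f_ n x - f x)) @ \oo --> (0 : R)) ->
  (forall n x, cnorm1 (f_ n x) <= G x) -> mu.-integrable setT (EFin \o G) ->
  (fun n => cnorm1 (cint mu (f_ n) - cint mu f)) @ \oo --> (0 : R).
Proof.
move=> mf_ [mf1 mf2] ff fG iG; apply/cnorm1_cvgP; split.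
  apply: (Rint_dct (G := G)) => //.
  - by move=> n; have [] := mf_ n.
  - by move=> x; have /cnorm1_cvgP[] := ff x.
  - by move=> n x; apply: le_trans (fG n x); exact: re_cnorm1.
apply: (Rint_dct (G := G)) => //.
- by move=> n; have [] := mf_ n.
- by move=> x; have /cnorm1_cvgP[] := ff x.
- by move=> n x; apply: le_trans (fG n x); exact: im_cnorm1.
Qed.
End DCT.

Lemma Rint_FTC (g g' : R -> R) (a b : R) : a < b ->
  (forall x : R, is_derive x 1 g (g' x)) -> continuous g' ->
  \int[leb]_(x in `[a, b]) g' x = g b - g a.
Proof.
move=> ab dg cg.
have cg0 : continuous g by move=> x; exact: is_derive_cont (dg x).
rewrite /Rintegral (@continuous_FTC2 _ g' g)//.
- exact: continuous_subspaceT.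
- split.
  + by move=> x _; have [] := dg x.
  + by apply: cvg_at_right_filter; exact: cg0.
  + by apply: cvg_at_left_filter; exact: cg0.
- by move=> x _; rewrite derive1E; have [] := dg x.
Qed.

(** The integral over [-n-1, n+1] is a boundary term that tends to 0 by the decay of [g], while
    dominated convergence takes it to the integral over the line. *)
Lemma Rint_deriv0_Ln (g g' : R -> R) (c : R) :
  (forall x : R, is_derive x 1 g (g' x)) -> continuous g' ->
  (forall x, `|g x| <= c * lorentz x) -> (forall x, `|g' x| <= c * lorentz x) ->
  \int[leb]_x g' x = 0.
Proof.
move=> dg cg gW g'W.
have iG : leb.-integrable setT (EFin \o (fun x => c * lorentz x)).
  by apply: riZ; exact: (integrable_kdecay R Ln).
have mg' : measurable_fun setT g' by exact: continuous_measurable_fun.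
pose f_ (n : nat) := g' \_ (`[- n.+1%:R, n.+1%:R]%classic).
have c1 : (fun n => \int[leb]_x f_ n x) @ \oo --> \int[leb]_x g' x.
  apply: (@Rint_dct _ mR leb f_ g' (fun x => c * lorentz x)) => //.
  - by move=> n; apply/(measurable_restrictT _ _).1 => //; exact: measurable_funTS.
  - move=> x; apply: cvg_near_cst; exists (Num.trunc `|x|) => // n /= nx.
    rewrite /f_ /patch mem_set//= in_itv/= -ler_norml.
    apply/ltW; apply: lt_le_trans (truncnS_gt _) _.
    by rewrite ler_nat ltnS.
  - move=> n x; rewrite /f_ /patch; case: ifP => // _.
    by rewrite normr0; apply: le_trans (g'W x).
have c2 : (fun n => \int[leb]_x f_ n x) @ \oo --> (0 : R).
  have E n : \int[leb]_x f_ n x = g n.+1%:R - g (- n.+1%:R).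
    rewrite -Rintegral_mkcond (Rint_FTC _ dg cg)//.
    by rewrite (@lt_trans _ _ 0)// oppr_lt0.
  under eq_fun do rewrite E.
  have c0 : 0 <= c.
    by have := le_trans (normr_ge0 _) (gW 0); rewrite pmulr_lge0// lorentz_gt0.
  apply/cvgr0Pnorm_le => e e0.
  have : (fun n => (2 * c) * (n.+1%:R)^-1) @ \oo --> (2 * c * 0 : R).
    by apply: cvgMl_tmp; exact: cvg_harmonic.
  rewrite mulr0 => /cvgr0Pnorm_le/(_ _ e0); apply: filterS => n.
  apply: le_trans; apply: le_trans (ler_normB _ _) _.
  apply: le_trans (lerD (gW _) (gW _)) _.
  have : 1 <= n.+1%:R :> R by rewrite ler1n.
  move: (n.+1%:R) => y y1.
  have -> : c * lorentz y + c * lorentz (- y) = 2 * c * lorentz y by rewrite /lorentz sqrrN; ring.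
  rewrite ger0_norm ?mulr_ge0// ?invr_ge0 ?(le_trans _ y1)//.
  rewrite ler_wpM2l// ?mulr_ge0// lef_pV2 ?posrE ?oneDsq_gt0//; first by nra.
  exact: lt_le_trans y1.
exact: (cvg_unique _ c1 c2).
Qed.

(** Boundary terms vanish by decay on the line and by periodicity on a period. The second derivative
    [h''] is there to make [h'] continuous, as the fundamental theorem of calculus asks. *)
Lemma cint_deriv0 (K : kind) (h h' h'' : R -> C) (c : R) : K <> Zc ->
  (forall x, is_cderive h x (h' x)) -> (forall x, is_cderive h' x (h'' x)) ->
  (forall x, cnorm1 (h x) <= c * kdecay K x) -> (forall x, cnorm1 (h' x) <= c * kdecay K x) ->
  (K = Pr -> forall x, h (x + 2 * pi) = h x) ->
  cint (kmeasure K) h' = 0.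
Proof.
move=> KZ dh dh' hW h'W per.
have cr : continuous (fun x => re (h' x)).
  by move=> x; have [H _] := dh' x; exact: is_derive_cont H.
have ci : continuous (fun x => im (h' x)).
  by move=> x; have [_ H] := dh' x; exact: is_derive_cont H.
case: K KZ hW h'W per => // _ hW h'W per.
  apply: cP; rewrite ?cRe_int ?cIm_int.
    apply: (@Rint_deriv0_Ln (fun x => re (h x)) _ c) => //.
    - by move=> x; have [] := dh x.
    - by move=> x; apply: le_trans (hW x); exact: re_cnorm1.
    - by move=> x; apply: le_trans (h'W x); exact: re_cnorm1.
  apply: (@Rint_deriv0_Ln (fun x => im (h x)) _ c) => //.
  - by move=> x; have [] := dh x.
  - by move=> x; apply: le_trans (hW x); exact: im_cnorm1.
  - by move=> x; apply: le_trans (h'W x); exact: im_cnorm1.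
have P (g g' : R -> R) : (forall x : R, is_derive x 1 g (g' x)) -> continuous g' ->
    g (2 * pi) = g 0 -> \int[kmeasure Pr]_x g' x = 0.
  move=> dg cg g0; have mg' := continuous_measurable_fun cg.
  have mE : measurable_fun setT (fun x : mR => (g' x)%:E) by apply/measurable_EFinP.
  rewrite /Rintegral integral_mk_Pr// integral_itv_bndo_bndc; last exact: measurable_funTS.
  have := Rint_FTC (mulr_gt0 (ltr0n _ 2) (pi_gt0 R)) dg cg.
  by rewrite /Rintegral g0 subrr.
have p0 : h (2 * pi) = h 0 by rewrite -[in RHS]per// add0r.
apply: cP; rewrite ?cRe_int ?cIm_int.
  apply: (P (fun x => re (h x))) => //; last by rewrite p0.
  by move=> x; have [] := dh x.
apply: (P (fun x => im (h x))) => //; last by rewrite p0.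
by move=> x; have [] := dh x.
Qed.

End RealIntegrals.

(** * Fourier inversion in one variable *)

Section Fourier1.
Variable R : realType.
Local Notation mR := (measurableTypeR R).
Local Notation leb := (@lebesgue_measure R).
Local Notation C := R[i].
Local Notation re := (@complex.Re R).
Local Notation im := (@complex.Im R).

Definition inZ (q : R) : bool := q \is a Num.int.

Lemma measurable_inZ : measurable [set q : mR | inZ q].
Proof.
have -> : [set q : mR | inZ q] = \bigcup_n ([set (n%:R : mR)] `|` [set (- n%:R : mR)]).
  apply/seteqP; split => q /=.
    move=> /intrP[[n|n] ->]; first by exists n => //; left.
    by exists n.+1 => //; right => /=; rewrite NegzE mulrNz.
  move=> [n _ [->|->]]; rewrite /inZ /=.
    by apply/intrP; exists n.
  by apply/intrP; exists (- n%:Z); rewrite mulrNz.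
by apply: bigcupT_measurable => n; apply: measurableU; exact: measurable_set1.
Qed.

(* A function on Z is encoded as a function on R that vanishes off Z. *)
Definition ind (K : kind) (q : R) : R := if K is Zc then (inZ q)%:R else 1.

Lemma ind_le1 K q : 0 <= ind K q <= 1.
Proof. by case: K; rewrite /ind ?ler01 ?lexx//; case: inZ; rewrite ?lexx ?ler01. Qed.

Lemma measurable_ind K : measurable_fun setT (ind K).
Proof.
case: K; rewrite /ind; [exact: measurable_cst|exact: measurable_cst|].
have -> : (fun q : R => (inZ q)%:R : R) = \1_[set q : mR | inZ q].
  by apply/funext => q; rewrite indicE; congr (nat_of_bool _)%:R; apply/idP/idP => [H|];
    [exact: mem_set|rewrite inE].
exact: measurable_indic measurable_inZ.
Qed.

Lemma cint_Zc_ext (f g : mR -> C) : cmeasurable f -> cmeasurable g ->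
  (forall n : int, f n%:~R = g n%:~R) -> cint (kmeasure Zc) f = cint (kmeasure Zc) g.
Proof.
move=> [f1 f2] [g1 g2] fg; apply: cP; rewrite ?cRe_int ?cIm_int /Rintegral; congr fine.
  by apply: integral_mk_Zc => [||n]; [exact/measurable_EFinP|exact/measurable_EFinP|rewrite fg].
by apply: integral_mk_Zc => [||n]; [exact/measurable_EFinP|exact/measurable_EFinP|rewrite fg].
Qed.

Definition spike (a : C) (x0 : R) (x : mR) : C := ((x == x0)%:R : R)%:C * a.

Lemma spike0 a x0 x : x != x0 -> spike a x0 x = 0.
Proof. by move=> /negbTE h; rewrite /spike h mul0r. Qed.

Lemma spike1 a x : spike a x x = a.
Proof. by rewrite /spike eqxx mul1r. Qed.

Lemma in_set1E (x0 x : R) : (x \in [set x0]) = (x == x0).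
Proof. by apply/idP/eqP; rewrite inE. Qed.

Lemma measurable_eqb (x0 : R) : measurable_fun setT (fun x : mR => ((x == x0)%:R : R)).
Proof.
have -> : (fun x : mR => ((x == x0)%:R : R)) = \1_[set x0].
  by apply/funext => q; rewrite indicE in_set1E.
by apply: measurable_indic; exact: measurable_set1.
Qed.

Lemma cmeasurable_spike a x0 : cmeasurable (spike a x0).
Proof. by apply: cmeasurableM; [apply: cmeasurableR; exact: measurable_eqb|exact: cmeasurable_cst]. Qed.

Lemma cnorm1_spike a x0 x : cnorm1 (spike a x0 x) <= (cnorm1 a * (1 + x0 ^+ 2)) * lorentz x.
Proof.
rewrite cnorm1RM; have [->|_] := eqVneq x x0.
  by rewrite normr1 mul1r -mulrA mulfV ?mulr1// gt_eqF// oneDsq_gt0.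
rewrite normr0 mul0r !mulr_ge0 ?cnorm1_ge0 ?(ltW (oneDsq_gt0 _))//.
exact: ltW (lorentz_gt0 _).
Qed.

Lemma iW (K : kind) (c : R) : (kmeasure K).-integrable setT (EFin \o (fun x => c * kdecay K x)).
Proof. by apply: riZ; exact: integrable_kdecay. Qed.

Lemma cint_spike a (n : int) : cint (kmeasure Zc) (spike a n%:~R) = a.
Proof.
have i1 : cintegrable (kmeasure Zc) (spike 1 n%:~R).
  apply: (@cintegrable_dom _ _ _ (kmeasure Zc) (spike 1 n%:~R) (fun x => (cnorm1 (1 : C) * (1 + n%:~R ^+ 2)) * kdecay Zc x)).
  - exact: cmeasurable_spike. - by move=> x; exact: cnorm1_spike. - exact: iW.
have -> : spike a n%:~R = fun x => spike 1 n%:~R x * a.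
  by apply/funext => x; rewrite /spike mulr1.
rewrite cintZr// -[RHS]mul1r; congr (_ * _).
under cint_ext do rewrite /spike mulr1.
apply: cP; rewrite ?cRe_int ?cIm_int /=; last by rewrite Rintegral_cst ?mul0r.
rewrite /Rintegral.
have -> : (fun x : mR => ((x == n%:~R :> R)%:R : R)%:E) = (fun x => (\1_[set (n%:~R : R)] x)%:E).
  by apply/funext => q; rewrite indicE in_set1E.
rewrite integral_indic// setIT; exact: (congr1 fine (mk_Zc_set1 R n)).
Qed.

(** Dominated convergence for the truncations of [f] to the integers from -N to N - 1. *)
Lemma Zc_sum (f : mR -> C) (c : R) : cmeasurable f -> (forall q, cnorm1 (f q) <= c * lorentz q) ->
  (fun N => cnorm1 (\sum_(0 <= k < N) (f k%:R + f (- k.+1%:R)) - cint (kmeasure Zc) f)) @ \oo --> (0 : R).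
Proof.
move=> mf fW.
(* The truncations vanish off Z while [f] need not, so [f] is first cut to Z; this does not change
   its integral. *)
pose g q : C := (ind Zc q)%:C * f q.
have mg : cmeasurable g by apply: cmeasurableM => //; apply: cmeasurableR; exact: measurable_ind.
have -> : cint (kmeasure Zc) f = cint (kmeasure Zc) g.
  apply: cint_Zc_ext => // n; rewrite /g /ind.
  by have -> : inZ n%:~R; [apply/intrP; exists n|rewrite mul1r].
pose g_ N q : C := \sum_(0 <= k < N) (spike (f k%:R) k%:R q + spike (f (- k.+1%:R)) (- k.+1%:R) q).
have mg_ N : cmeasurable (g_ N).
  elim: N => [|N IH].
    by rewrite (_ : g_ 0%N = fun=> 0); [exact: cmeasurable_cst|apply/funext => q; rewrite /g_ big_geq].
  rewrite (_ : g_ N.+1 = fun q => g_ N q + (spike (f N%:R) N%:R q + spike (f (- N.+1%:R)) (- N.+1%:R) q)).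
    by apply: cmeasurableD => //; apply: cmeasurableD; exact: cmeasurable_spike.
  by apply/funext => q; rewrite /g_ big_nat_recr.
(* [b N q] says that q is one of the 2N integers kept. These are distinct, so at most one spike is
   nonzero at q. *)
pose b N (q : R) := has (fun k => (q == k%:R) || (q == - k.+1%:R)) (iota 0 N).
have g_E N q : g_ N q = (if b N q then f q else 0).
  elim: N => [|N IH]; first by rewrite /g_ big_geq.
  rewrite /g_ big_nat_recr//= -/(g_ N q) IH.
  have -> : b N.+1 q = b N q || ((q == N%:R) || (q == - N.+1%:R)).
    by rewrite /b -[in iota 0 _](addn1 N) iotaD has_cat add0n /= orbF.
  rewrite /b.
  case: hasP => [[k]|nH].
    rewrite mem_iota /= => kN kq.
    suff [E1 E2] : q != N%:R /\ q != - N.+1%:R.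
      have e2 : spike (f (- N.+1%:R)) (- N.+1%:R) q = 0 := spike0 _ E2.
      by rewrite (spike0 _ E1) e2 !addr0.
    case/orP: kq => /eqP ->; split.
    - by rewrite eqr_nat neq_ltn kN.
    - by rewrite gt_eqF// (@lt_le_trans _ _ 0)// oppr_lt0.
    - by rewrite lt_eqF// (@lt_le_trans _ _ 0)// oppr_lt0.
    - by rewrite eqr_opp eqr_nat eqSS neq_ltn kN.
  rewrite add0r /=; have [->|H1] := eqVneq q N%:R.
    rewrite spike1 spike0 ?addr0//.
    by rewrite gt_eqF// (@lt_le_trans _ _ 0)// oppr_lt0.
  rewrite (spike0 _ H1) add0r.
  by have [->|H2] := eqVneq q (- N.+1%:R); [rewrite spike1|rewrite spike0].
have c0 : 0 <= c by have := le_trans (cnorm1_ge0 _) (fW 0); rewrite pmulr_lge0// lorentz_gt0.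
have S N : \sum_(0 <= k < N) (f k%:R + f (- k.+1%:R)) = cint (kmeasure Zc) (g_ N).
  have isp a (m : int) : cintegrable (kmeasure Zc) (spike a m%:~R).
    apply: (@cintegrable_dom _ _ _ (kmeasure Zc) (spike a m%:~R) (fun x => (cnorm1 a * (1 + m%:~R ^+ 2)) * kdecay Zc x)).
    - exact: cmeasurable_spike. - by move=> x; exact: cnorm1_spike. - exact: iW.
  have cn (k : nat) : - k.+1%:R = (- k.+1%:Z)%:~R :> R by rewrite mulrNz.
  have ig N' : cintegrable (kmeasure Zc) (g_ N').
    apply: (@cintegrable_dom _ _ _ (kmeasure Zc) (g_ N') (fun x => c * kdecay Zc x)) => //; last exact: iW.
    move=> x; rewrite g_E; case: ifP => // _; rewrite cnorm10 mulr_ge0//.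
    exact: ltW (lorentz_gt0 _).
  elim: N => [|N IH].
    rewrite big_geq//; apply/esym; rewrite (_ : g_ 0%N = fun=> 0) ?cint0//.
    by apply/funext => q; rewrite /g_ big_geq.
  rewrite big_nat_recr//= IH.
  have -> : g_ N.+1 = fun q => g_ N q + (spike (f N%:R) N%:~R q + spike (f (- N.+1%:R)) (- N.+1%:Z)%:~R q).
    by apply/funext => q; rewrite -cn /g_ big_nat_recr.
  rewrite cintD//; last by apply: cintegrableD; exact: isp.
  by rewrite cintD ?cint_spike//; exact: isp.
under eq_fun do rewrite S.
apply: (@cint_dct R _ mR (kmeasure Zc) g_ g (fun q => c * kdecay Zc q) mg_ mg); last exact: iW.
- move=> q; rewrite /g /ind; have [/intrP[m qm]|nq] := boolP (inZ q).
    apply: cvg_near_cst; exists (`|m|%N.+1) => // N /= mN.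
    rewrite g_E (_ : b N q = true) ?mul1r ?subrr ?cnorm10//.
    apply/hasP; case: m qm mN => m qm mN.
      by exists m; rewrite ?qm ?eqxx// mem_iota.
    exists m; last by rewrite qm NegzE mulrNz eqxx orbT.
    by rewrite mem_iota/=; apply: leq_trans mN; rewrite ltnS.
  rewrite mul0r (_ : (fun n => _) = fun=> 0); first exact: cvg_cst.
  apply/funext => N; rewrite g_E (_ : b N q = false) ?subrr ?cnorm10//.
  apply/hasP => -[k _ kq]; move/negP: nq; apply; rewrite /inZ; apply/intrP.
  case/orP: kq => /eqP ->; first by exists k.
  by exists (- k.+1%:Z); rewrite mulrNz.
- move=> N q; rewrite g_E; case: ifP => // _; rewrite cnorm10 mulr_ge0//.
  exact: ltW (lorentz_gt0 _).
Qed.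

End Fourier1.

(** * Abel factors, Poisson kernels and orthogonality of characters *)

Section Kernels.
Variable R : realType.
Local Notation mR := (measurableTypeR R).
Local Notation leb := (@lebesgue_measure R).
Local Notation C := R[i].
Local Notation re := (@complex.Re R).
Local Notation im := (@complex.Im R).

(** The Abel summation factor. It is chosen because its transform is explicit both for Lebesgue
    measure and for the counting measure of Z. *)
Definition kap (e q : R) : R := expR (- (e * `|q|)).

Lemma kap_ge0 e q : 0 <= kap e q. Proof. exact: expR_ge0. Qed.

Lemma kap_le1 e q : 0 < e -> kap e q <= 1.
Proof.
by move=> e0; rewrite -expR0 ler_expR oppr_le0 mulr_ge0// ltW.
Qed.

Lemma continuous_kap e : continuous (kap e).
Proof.
move=> q; apply: (@continuous_comp _ _ _ (fun q : R => - (e * `|q|)) expR).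
  by apply: cvgN; apply: cvgM; [exact: cvg_cst|exact: norm_continuous].
exact: continuous_expR.
Qed.

Lemma measurable_kap e : measurable_fun setT (kap e).
Proof. by apply: continuous_measurable_fun; exact: continuous_kap. Qed.

(** With u = e |q| / 2, exp(2u) >= (1 + u)^2 >= 1 + u^2. *)
Lemma kap_lorentz e q : 0 < e -> kap e q <= (1 + 4 / e ^+ 2) * lorentz q.
Proof.
move=> e0; rewrite /kap /lorentz; set u := e * `|q| / 2.
have u0 : 0 <= u by rewrite divr_ge0// mulr_ge0// ltW.
have -> : - (e * `|q|) = - (u + u) by rewrite /u -splitr.
have H1 : 1 + u <= expR u by exact: expR_ge1Dx.
have H2 : 1 + e ^+ 2 * q ^+ 2 / 4 <= expR (u + u).
  rewrite expRD; apply: (@le_trans _ _ ((1 + u) * (1 + u))).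
    have -> : e ^+ 2 * q ^+ 2 / 4 = u ^+ 2.
      by rewrite /u -(real_normK (num_real q)); field.
    by nra.
  by apply: ler_pM => //; rewrite addr_ge0.
rewrite expRN ler_pdivlMr ?oneDsq_gt0// mulrC ler_pdivrMr ?expR_gt0//.
have c0 : 0 <= 4 / e ^+ 2 by rewrite divr_ge0// sqr_ge0.
apply: (@le_trans _ _ ((1 + 4 / e ^+ 2) * (1 + e ^+ 2 * q ^+ 2 / 4))).
  have -> : (1 + 4 / e ^+ 2) * (1 + e ^+ 2 * q ^+ 2 / 4) =
     1 + q ^+ 2 + (e ^+ 2 * q ^+ 2 / 4 + 4 / e ^+ 2).
    by field; rewrite gt_eqF.
  by rewrite lerDl; apply: addr_ge0 => //; rewrite divr_ge0// mulr_ge0 ?sqr_ge0.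
by apply: ler_wpM2l => //; apply: addr_ge0.
Qed.

(** [kap] has a kink at 0, so [f] is compared with the derivative of [F] on q >= 0 only; evenness
    supplies the other half. *)
Lemma ray_FTC (f F F' : R -> R) (c e : R) : 0 < e ->
  (forall q : R, is_derive q 1 F (F' q)) -> continuous f -> (forall q, 0 <= f q) ->
  (forall q, 0 <= q -> f q = F' q) -> (forall q, 0 <= q -> `|F q| <= c * expR (- (e * q))) ->
  (forall q, f (- q) = f q) -> (\int[leb]_x (f x)%:E = (- (2 * F 0))%:E)%E.
Proof.
move=> e0 dF cf f0 fF Fc ev.
rewrite ge0_symfun_integralT//; last by move=> x /=; rewrite ev.
rewrite (_ : [set x | _] = `[0, +oo[%classic); last first.
  by apply/seteqP; split => x/=; rewrite in_itv/= andbT.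
rewrite (@ge0_continuous_FTC2y _ f F 0 0).
- by rewrite -EFinB -EFinM; congr EFin; ring.
- by move=> x _; exact: f0.
- exact: continuous_subspaceT.
- have H : c * expR (- (e * x)) @[x --> +oo%R] --> (c * 0 : R).
    apply: cvgM; first exact: cvg_cst.
    apply: (@cvg_comp _ _ _ (fun x : R => e * x) (fun x => expR (- x))); last exact: cvgr_expR.
    apply/cvgryPge => A; near=> x; rewrite mulrC -ler_pdivrMr//; near: x; exact: nbhs_pinfty_ge.
  rewrite mulr0 in H; apply: norm_cvg0; apply: (@squeeze_cvgr _ _ _ _ (fun=> 0) (fun x => c * expR (- (e * x)))) => //; last exact: cvg_cst.
  by near=> x; rewrite normr_ge0 Fc//; near: x; exact: nbhs_pinfty_ge.
- by move=> x _; have [] := dF x.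
- by apply: cvg_at_right_filter; exact: is_derive_cont (dF 0).
- by move=> x; rewrite in_itv/= andbT => x0; rewrite derive1E fF ?ltW//; have [] := dF x.
Unshelve. all: by end_near. Qed.

Lemma is_derive_expRM (a x : R) : is_derive x 1 (fun q : R => expR (a * q)) (a * expR (a * x)).
Proof.
have h : is_derive x 1 (fun t : R => a * t) a.
  by apply: is_derive_eq; rewrite /GRing.scale/= mulr1.
by apply: is_derive_eq (@is_derive1_comp _ expR (fun t => a * t) x _ _ _ _) _; rewrite mulrC.
Qed.

Lemma is_derive_cosM (a x : R) : is_derive x 1 (fun q : R => cos (q * a)) (- a * sin (x * a)).
Proof.
have h : is_derive x 1 (fun t : R => t * a) a.
  by apply: is_derive_eq; rewrite /GRing.scale/= mulr1 mulr0 add0r.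
by apply: is_derive_eq (@is_derive1_comp _ cos (fun t => t * a) x _ _ _ _) _; rewrite /=; ring.
Qed.

Lemma is_derive_sinM (a x : R) : is_derive x 1 (fun q : R => sin (q * a)) (a * cos (x * a)).
Proof.
have h : is_derive x 1 (fun t : R => t * a) a.
  by apply: is_derive_eq; rewrite /GRing.scale/= mulr1 mulr0 add0r.
by apply: is_derive_eq (@is_derive1_comp _ sin (fun t => t * a) x _ _ _ _) _; rewrite /=; ring.
Qed.

Lemma norm_cos_le1 (x : R) : `|cos x| <= 1.
Proof. by rewrite ler_norml cos_geN1 cos_le1. Qed.
Lemma norm_sin_le1 (x : R) : `|sin x| <= 1.
Proof. by rewrite ler_norml sin_geN1 sin_le1. Qed.

Lemma int_kap e : 0 < e -> (\int[leb]_q (kap e q)%:E = (2 / e)%:E)%E.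
Proof.
move=> e0.
apply: etrans (@ray_FTC (kap e) (fun q => - e^-1 * expR (- e * q)) (fun q => expR (- e * q)) e^-1 e e0 _ _ _ _ _ _) _.
- move=> q; apply: is_derive_eq (is_deriveM (is_derive_cst _ _ _) (is_derive_expRM _ _)) _.
  change (- e^-1 * (- e * expR (- e * q)) + expR (- e * q) * 0 = expR (- e * q)).
  by field; rewrite gt_eqF.
- exact: continuous_kap.
- by move=> q; exact: kap_ge0.
- by move=> q q0; rewrite /kap ger0_norm// mulNr.
- move=> q q0; rewrite normrM normrN mulNr (ger0_norm (expR_ge0 _)).
  by rewrite ger0_norm// invr_ge0 ltW.
- by move=> q; rewrite /kap normrN.
- by rewrite mulr0 expR0; congr EFin; ring.
Qed.

(** The factor 1 + cos in place of cos keeps the integrand nonnegative, as [ray_FTC] requires;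
    [kernel_Ln] subtracts the integral of [kap] again. *)
Lemma int_kap_cos1 e y : 0 < e ->
  (\int[leb]_q (kap e q * (1 + cos (q * y)))%:E = (2 * (e^-1 + e / (e ^+ 2 + y ^+ 2)))%:E)%E.
Proof.
move=> e0; have d0 : 0 < e ^+ 2 + y ^+ 2 by rewrite ltr_wpDr ?sqr_ge0// exprn_gt0.
pose d := e ^+ 2 + y ^+ 2.
pose F q := expR (- e * q) * (- e^-1 + d^-1 * (y * sin (q * y) - e * cos (q * y))).
apply: etrans (@ray_FTC (fun q => kap e q * (1 + cos (q * y))) F (fun q => expR (- e * q) * (1 + cos (q * y))) (e^-1 + d^-1 * (`|y| + e)) e e0 _ _ _ _ _ _) _.
- move=> q.
  have D1 := is_deriveB (is_deriveM (is_derive_cst y q 1) (is_derive_sinM y q))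
     (is_deriveM (is_derive_cst e q 1) (is_derive_cosM y q)).
  have D2 := is_deriveD (is_derive_cst (- e^-1) q 1) (is_deriveM (is_derive_cst d^-1 q 1) D1).
  apply: is_derive_eq (is_deriveM (is_derive_expRM (- e) q) D2) _.
  rewrite /GRing.scale/= /cst/= !fctE /=.
  rewrite /d; field; rewrite ?gt_eqF//.
- move=> q; apply: cvgM; first exact: continuous_kap.
  apply: cvgD; first exact: cvg_cst.
  by have := is_derive_cont (is_derive_cosM y q).
- by move=> q; rewrite mulr_ge0 ?kap_ge0//; have := cos_geN1 (q * y); lra.
- by move=> q q0; rewrite /kap ger0_norm// mulNr.
- move=> q q0; rewrite /F normrM mulrC mulNr (ger0_norm (expR_ge0 _)).
  rewrite ler_wpM2r ?expR_ge0//; apply: le_trans (ler_normD _ _) _.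
  rewrite normrN (ger0_norm (_ : 0 <= e^-1)) ?invr_ge0 ?(ltW e0)// lerD2l normrM (ger0_norm (_ : 0 <= d^-1)) ?invr_ge0 ?(ltW d0)//.
  apply: ler_wpM2l; first by rewrite invr_ge0 ltW.
  apply: le_trans (ler_normB _ _) _.
  rewrite !normrM (ger0_norm (ltW e0)); apply: lerD.
    by rewrite -[leRHS]mulr1; apply: ler_wpM2l => //; exact: norm_sin_le1.
  by rewrite -[leRHS]mulr1; apply: ler_wpM2l; [exact: ltW|exact: norm_cos_le1].
- by move=> q; rewrite /kap normrN mulNr cosN.
- by rewrite /F mulr0 expR0 mul0r sin0 cos0 /d; congr EFin; ring.
Qed.

Lemma integrable_kap e K : 0 < e -> K <> Pr -> (kmeasure K).-integrable setT (EFin \o kap e).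
Proof.
move=> e0 KP; apply: (@dom_integrable _ _ _ (kmeasure K) (kap e) (fun x => (1 + 4 / e ^+ 2) * kdecay K x) (measurable_kap e)); last exact: iW.
move=> q; rewrite ger0_norm ?kap_ge0//; apply: le_trans (kap_lorentz q e0) _.
by case: K KP.
Qed.

Lemma cintegrable_kap e K (y : R) : 0 < e -> K <> Pr ->
  cintegrable (kmeasure K) (fun q => (kap e q)%:C * cexp (q * y)).
Proof.
move=> e0 KP.
apply: (@cintegrable_dom _ _ _ (kmeasure K) _ (fun q => 2 * kap e q)).
- apply: cmeasurableM; first by apply: cmeasurableR; exact: measurable_kap.
  by apply: cmeasurable_cexp; exact: measurable_funM.
- move=> q; rewrite cnorm1RM (ger0_norm (kap_ge0 _ _)) mulrC ler_wpM2r ?kap_ge0//.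
  exact: cnorm1_cexp.
- by apply: riZ; exact: integrable_kap.
Qed.

(** The Poisson kernel of the half-plane. *)
Lemma kernel_Ln e y : 0 < e ->
  cint (kmeasure Ln) (fun q => (kap e q)%:C * cexp (q * y)) = (2 * e / (e ^+ 2 + y ^+ 2))%:C.
Proof.
move=> e0; have LP : Ln <> Pr by [].
have [i1 i2] := cintegrable_kap y e0 LP.
have d0 : 0 < e ^+ 2 + y ^+ 2 by rewrite ltr_wpDr ?sqr_ge0// exprn_gt0.
apply: cP; rewrite ?cRe_int ?cIm_int.
  under eq_Rintegral do rewrite cReM cReR cImR mul0r subr0 /=.
  have ik := integrable_kap e0 LP.
  have ikc : leb.-integrable setT (EFin \o (fun q => kap e q * (1 + cos (q * y)))).
    apply: (@dom_integrable _ _ _ leb _ (fun q => 2 * kap e q)).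
    - apply: measurable_funM; first exact: measurable_kap.
      apply: continuous_measurable_fun => q; apply: cvgD; first exact: cvg_cst.
      by have := is_derive_cont (is_derive_cosM y q).
    - move=> q; rewrite normrM (ger0_norm (kap_ge0 _ _)) mulrC ler_wpM2r ?kap_ge0//.
      by rewrite ger0_norm; [have := cos_le1 (q * y)|have := cos_geN1 (q * y)]; lra.
    - by apply: riZ; exact: ik.
  have -> : \int[kmeasure Ln]_q (kap e q * cos (q * y)) =
      \int[leb]_q (kap e q * (1 + cos (q * y))) - \int[leb]_q kap e q.
    rewrite -RintegralB//.
    by apply: eq_Rintegral => q _; ring.
  rewrite /Rintegral int_kap// int_kap_cos1//=.
  by field; rewrite ?gt_eqF.
(* The imaginary part of the integrand is odd: reflecting q shows that its integral equals its own
   opposite. *)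
have H (I : R) : I = - I -> I = 0 by move=> ?; lra.
apply: H; rewrite -[RHS]mulN1r -RintegralZl//.
rewrite /Rintegral; congr fine.
have mphi : measurable_fun setT (fun x : mR => (- x : mR)) by exact: measurableT_comp.
rewrite -(leb_change mphi (@leb_opp R)); last by have /integrableP[] := i2.
by apply: eq_integral => q _; rewrite !cImM !cReR !cImR /kap normrN /= mulNr sinN; congr EFin; ring.
Qed.

Lemma cexpMn (y : R) (k : nat) : cexp (k%:R * y) = cexp y ^+ k.
Proof.
elim: k => [|k IH]; first by rewrite mul0r cexp0 expr0.
by rewrite -natr1 mulrDl mul1r cexpD IH exprSr.
Qed.

Lemma cnorm1_cvg0_le (u v : nat -> R) (c : R) : (forall n, 0 <= u n <= c * v n) ->
  v @ \oo --> (0 : R) -> u @ \oo --> (0 : R).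
Proof.
move=> uv v0.
have H : (fun n => c * v n) @ \oo --> (c * 0 : R) by apply: cvgM => //; exact: cvg_cst.
rewrite mulr0 in H.
apply: (@squeeze_cvgr _ _ _ _ (fun=> 0) (fun n => c * v n)) => //; first exact: nearW.
exact: cvg_cst.
Qed.

(** The Poisson kernel of the disc at radius r = exp(-e): the sum splits into geometric series in z
    = r exp(i y) and in its conjugate w. *)
Lemma kernel_Zc e y : 0 < e -> let r := expR (- e) in
  cint (kmeasure Zc) (fun q => (kap e q)%:C * cexp (q * y)) =
  ((1 - r ^+ 2) / (1 - 2 * r * cos y + r ^+ 2))%:C.
Proof.
move=> e0 r; set f := fun q : mR => _.
have r0 : 0 <= r by exact: expR_ge0.
have r1 : r < 1 by rewrite -expR0 ltr_expR oppr_lt0.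
pose z : C := r%:C * cexp y; pose w : C := r%:C * cexp (- y).
have rk k : kap e k%:R = r ^+ k.
  by rewrite /kap normr_nat -expRM_natl; congr expR; ring.
have fk k : f k%:R = z ^+ k by rewrite /f rk cexpMn /z exprMn rmorphXn.
have fk' k : f (- k.+1%:R) = w ^+ k.+1.
  rewrite /f /kap normrN -/(kap e k.+1%:R) rk mulNr -mulrN cexpMn.
  by rewrite /w exprMn rmorphXn.
have mf : cmeasurable f.
  apply: cmeasurableM; first by apply: cmeasurableR; exact: measurable_kap.
  by apply: cmeasurable_cexp; exact: measurable_funM.
have fW q : cnorm1 (f q) <= (2 * (1 + 4 / e ^+ 2)) * lorentz q.
  rewrite cnorm1RM (ger0_norm (kap_ge0 _ _)) mulrC -mulrA; apply: ler_pM => //.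
  - exact: cnorm1_ge0. - exact: kap_ge0. - exact: cnorm1_cexp. - exact: kap_lorentz.
have S := Zc_sum mf fW.
pose D : C := (1 - z) * (1 - w).
pose P N : C := \sum_(0 <= k < N) (f k%:R + f (- k.+1%:R)).
(* Multiplication by (1 - z)(1 - w) clears both geometric series; what is left besides 1 - z w is of
   order r^N. *)
have DP N : D * P N = (1 - z * w) - (z ^+ N * (1 - w) + w ^+ N.+1 * (1 - z)).
  rewrite /P; elim: N => [|N IH].
    by rewrite big_geq// /D; ring.
  rewrite big_nat_recr//= mulrDr IH fk fk' /D !exprS; ring.
have zw : z * w = (r ^+ 2)%:C.
  by rewrite /z /w mulrACA -cexpD subrr cexp0 mulr1 expr2 rmorphM.
have DE : D = (1 - 2 * r * cos y + r ^+ 2)%:C.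
  have -> : D = 1 - z - w + z * w by rewrite /D; ring.
  by rewrite zw /z /w; apply: cP; rewrite !cE /= ?cosN ?sinN; ring.
have DN : D * cint (kmeasure Zc) f = 1 - z * w.
  apply: (@cnorm1_cvg_unique _ (fun N => D * P N)).
    apply: (@cnorm1_cvg0_le _ (fun N => cnorm1 (P N - cint (kmeasure Zc) f)) (cnorm1 D)) => //.
    by move=> N; rewrite cnorm1_ge0 -mulrBr cnorm1M.
  have l1e k a : cnorm1 ((r%:C * cexp a) ^+ k) <= 2 * r ^+ k.
    rewrite exprMn -rmorphXn cnorm1RM ger0_norm ?exprn_ge0// -cexpMn mulrC.
    by rewrite ler_wpM2r ?exprn_ge0// cnorm1_cexp.
  apply: (@cnorm1_cvg0_le _ (fun N => r ^+ N) (2 * cnorm1 (1 - w) + 2 * cnorm1 (1 - z))).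
    move=> N; rewrite cnorm1_ge0 DP addrAC subrr sub0r cnorm1N /=.
    apply: le_trans (cnorm1D _ _) _; rewrite mulrDl; apply: lerD; apply: le_trans (cnorm1M _ _) _.
      rewrite -[leRHS]mulrA (mulrC (cnorm1 (1 - w)) (r ^+ N)) mulrA; apply: ler_wpM2r; [exact: cnorm1_ge0|exact: l1e].
    rewrite -[leRHS]mulrA (mulrC (cnorm1 (1 - z)) (r ^+ N)) mulrA; apply: ler_wpM2r; first exact: cnorm1_ge0.
    apply: le_trans (l1e _ _) _.
    by apply: ler_wpM2l => //; rewrite exprS; apply: ler_piMl; [rewrite exprn_ge0|exact: ltW].
  by apply: cvg_expr; rewrite ger0_norm.
have d0 : 0 < 1 - 2 * r * cos y + r ^+ 2.
  by have := cos_le1 y; nra.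
have D0 : D != 0.
  by rewrite DE; apply/eqP => /(congr1 re) /= H; rewrite H ltxx in d0.
apply: (mulfI D0); rewrite DN zw DE; apply: cP; rewrite !cE ?mul0r ?subr0 ?addr0 ?mulr0//.
by field; rewrite gt_eqF.
Qed.

(** For n nonzero the integrand is the derivative of the periodic function exp(i n x) / (i n). *)
Lemma orth (n : int) : cint (kmeasure Pr) (fun x => cexp (n%:~R * x)) =
  if n == 0 then (2 * pi)%:C else 0 :> C.
Proof.
have [->|n0] := eqVneq n 0.
  transitivity (cint (kmeasure Pr) (fun=> 1) : C).
    by apply: cint_ext => x; rewrite mul0r cexp0.
  apply: cP; rewrite ?cRe_int ?cIm_int Rintegral_cst// ?mul0r// mul1r.
  have E : kmeasure Pr [set: mR] = (2 * pi)%:E.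
    change (leb (setT `&` `[0%R, (2 * pi)%R[%classic) = (2 * pi)%:E).
    by rewrite setTI lebesgue_measure_itv/= lte_fin mulr_gt0 ?pi_gt0// -EFinB subr0.
  exact: (congr1 fine E).
have nR : n%:~R != 0 :> R by rewrite intr_eq0.
pose b : R := - (n%:~R)^-1.
pose a : C := 0 +i* b.
have dh (x : R) : is_cderive (fun x => a * cexp (n%:~R * x)) x (cexp (n%:~R * x)).
  apply: is_cderive_eq (is_cderiveM (is_cderive_cst a x) (is_cderive_cexp _ x)) _.
  have aE : a * (0 +i* n%:~R) = 1.
    apply: cP; rewrite !cE; [change (0 * 0 - b * n%:~R = 1)|change (0 * n%:~R + b * 0 = 0)];
      by rewrite /b; field.
  by rewrite mul0r add0r mulrA aE mul1r.
apply: (@cint_deriv0 R Pr (fun x => a * cexp (n%:~R * x)) _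
   (fun x => 0 +i* n%:~R * cexp (n%:~R * x)) (2 * cnorm1 a + 2)) => //.
- by move=> x; exact: is_cderive_cexp.
- move=> x /=; rewrite mulr1; apply: le_trans (cnorm1M _ _) _.
  by rewrite mulrC; apply: le_trans (ler_wpM2r (cnorm1_ge0 a) (cnorm1_cexp _)) _; rewrite lerDl.
- move=> x /=; rewrite mulr1; apply: le_trans (cnorm1_cexp _) _.
  by rewrite lerDr mulr_ge0 ?cnorm1_ge0.
- by move=> _ x; rewrite mulrDr cexp_pi2n.
Qed.

End Kernels.

Ltac meas := repeat first
  [ done | exact: measurable_cst | exact: measurable_id | exact: measurable_fst
  | exact: measurable_snd | apply: measurable_funM | apply: measurable_funD
  | apply: measurable_funB ].

(** * Fourier inversion for an abstract summation kernel *)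

Section Inversion1.
Variable R : realType.
Local Notation mR := (measurableTypeR R).
Local Notation leb := (@lebesgue_measure R).
Local Notation C := R[i].
Local Notation re := (@complex.Re R).
Local Notation im := (@complex.Im R).

Definition FT (K : kind) (sg : R) (h : R -> C) (q : R) : C :=
  cint (kmeasure K) (fun x : mR => cexp (sg * q * x) * h x).

Definition eN (n : nat) : R := (n.+1%:R)^-1.

Lemma eN_gt0 n : 0 < eN n. Proof. by rewrite invr_gt0. Qed.
Lemma eN_le1 n : eN n <= 1. Proof. by rewrite invf_le1// ler1n. Qed.

Lemma kap_cvg (q : R) : (fun n => kap (eN n) q) @ \oo --> (1 : R).
Proof.
rewrite -expR0; apply: continuous_cvg; first exact: continuous_expR.
rewrite -[X in _ --> X]oppr0; apply: cvgN.
rewrite -[X in _ --> X](mul0r `|q|); apply: cvgMr_tmp.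
exact: cvg_harmonic.
Qed.

Lemma cnorm1_kexp (k b : R) : cnorm1 (k%:C * cexp b) <= 2 * `|k|.
Proof. by rewrite cnorm1RM mulrC ler_wpM2r// cnorm1_cexp. Qed.

Lemma cmeasurable_measurable (f : mR -> C) : cmeasurable f ->
  cmeasurable (fun p : mR * mR => f p.1) /\ cmeasurable (fun p : mR * mR => f p.2).
Proof.
move=> [f1 f2]; split; split.
- exact: (measurableT_comp f1 measurable_fst).
- exact: (measurableT_comp f2 measurable_fst).
- exact: (measurableT_comp f1 measurable_snd).
- exact: (measurableT_comp f2 measurable_snd).
Qed.

Lemma cmeasurable_phase (sg a : R) : cmeasurable (fun p : mR * mR => cexp (sg * p.1 * (p.2 - a))).
Proof.
apply: cmeasurable_cexp; apply: measurable_funM.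
  by apply: measurable_funM; [exact: measurable_cst|exact: measurable_fst].
by apply: measurable_funB; [exact: measurable_snd|exact: measurable_cst].
Qed.

Lemma inZ_int (n : int) : inZ (n%:~R : R).
Proof. by apply/intrP; exists n. Qed.

Lemma cint_ind K (f : mR -> C) : cmeasurable f ->
  cint (kmeasure K) (fun q => (ind K q)%:C * f q) = cint (kmeasure K) f.
Proof.
move=> mf; case: K; rewrite /ind.
- by apply: cint_ext => q; rewrite mul1r.
- by apply: cint_ext => q; rewrite mul1r.
- apply: cint_Zc_ext => //.
    by apply: cmeasurableM => //; apply: cmeasurableR; exact: (measurable_ind Zc).
  by move=> n; rewrite inZ_int mul1r.
Qed.

(** Abel summation. The factor [kap (eN n)] makes the double integral absolutely convergent, and
    Fubini turns it into the integral of [h] against an approximate identity [k n] of mass 2 pi. The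
    kernel is a parameter, so that the line and the period share the argument. *)
Lemma inv_gen (K : kind) (sg : R) (h : R -> C) (x0 c c' B : R) (k : nat -> R -> R) :
  K <> Zc -> cmeasurable (h : mR -> C) -> (forall x, cnorm1 (h x) <= c * kdecay K x) ->
  (forall q, cnorm1 ((ind (dual K) q)%:C * FT K sg h q) <= c' * kdecay (dual K) q) ->
  (forall n x, cint (kmeasure (dual K)) (fun q => (kap (eN n) q)%:C * cexp (sg * q * (x - x0))) = (k n x)%:C) ->
  (forall n, measurable_fun setT (k n : mR -> R)) ->
  (forall n, (kmeasure K).-integrable setT (EFin \o k n)) ->
  (forall n, \int[kmeasure K]_x k n x = 2 * pi) ->
  (forall x, (fun n => cnorm1 ((k n x)%:C * (h x - h x0))) @ \oo --> (0 : R)) ->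
  (forall n x, cnorm1 ((k n x)%:C * (h x - h x0)) <= B * kdecay K x) ->
  cint (kmeasure (dual K)) (fun q => cexp (- sg * q * x0) * ((ind (dual K) q)%:C * FT K sg h q))
  = (2 * pi)%:C * h x0.
Proof.
move=> KZ mh hW FW kE mk ik k1 kcvg kB.
have dP : dual K <> Pr by case: K KZ {hW FW kE mk ik k1 kcvg kB}.
have c0 : 0 <= c by have := le_trans (cnorm1_ge0 _) (hW 0); rewrite pmulr_lge0// kdecay_gt0.
have c'0 : 0 <= c' by have := le_trans (cnorm1_ge0 _) (FW 0); rewrite pmulr_lge0// kdecay_gt0.
have dW q : kdecay (dual K) q = lorentz q by case: (dual K) dP.
pose g q := (ind (dual K) q)%:C * FT K sg h q.
have mF : cmeasurable (FT K sg h : mR -> C).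
  apply: (@cmeasurable_cint _ _ _ _ _ (kmeasure_sf R K) (fun p : mR * mR => cexp (sg * p.1 * p.2) * h p.2)).
  apply: cmeasurableM; last by have [] := cmeasurable_measurable mh.
  by have := cmeasurable_phase sg 0; under eq_fun do rewrite subr0.
have mg : cmeasurable (g : mR -> C) by apply: cmeasurableM => //; apply: cmeasurableR; exact: measurable_ind.
have me : cmeasurable (fun q : mR => cexp (- sg * q * x0)).
  by apply: cmeasurable_cexp; meas.
(* The regularised integrals [A n] have two limits: dropping the factor [kap] gives the left-hand
   side, concentration of the kernel at [x0] gives the right-hand side. *)
pose A n := cint (kmeasure (dual K)) (fun q => (kap (eN n) q)%:C * (cexp (- sg * q * x0) * g q)).
have lg q : cnorm1 (cexp (- sg * q * x0) * g q) <= 2 * c' * kdecay (dual K) q.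
  apply: le_trans (cnorm1M _ _) _; rewrite -[leRHS]mulrA; apply: ler_pM; rewrite ?cnorm1_ge0//.
  exact: cnorm1_cexp.
  exact: FW.
apply: (@cnorm1_cvg_unique _ A).
  apply: (@cint_dct R _ mR (kmeasure (dual K)) (fun n q => (kap (eN n) q)%:C * (cexp (- sg * q * x0) * g q)) _ (fun q => 2 * c' * kdecay (dual K) q)).
  - move=> n; apply: cmeasurableM; first by apply: cmeasurableR; exact: measurable_kap.
    exact: cmeasurableM.
  - exact: cmeasurableM.
  - move=> q; set z := cexp _ * g q.
    have E n : (kap (eN n) q)%:C * z - z = (kap (eN n) q - 1)%:C * z.
      by rewrite rmorphB mulrBl mul1r.
    apply: (@cnorm1_cvg0_le _ _ (fun n => `|kap (eN n) q - 1|) (cnorm1 z)).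
      by move=> n; rewrite cnorm1_ge0 E cnorm1RM mulrC lexx.
    rewrite -[X in _ --> X](normr0 R); apply: cvg_norm.
    by rewrite -[X in _ --> X](subrr 1); apply: cvgB; [exact: kap_cvg|exact: cvg_cst].
  - move=> n q; rewrite cnorm1RM; apply: le_trans (lg q).
    by rewrite ger0_norm ?kap_ge0// ler_piMl ?cnorm1_ge0// kap_le1// eN_gt0.
  - by apply: riZ; exact: integrable_kdecay.
(* Fubini, then h = (h - h x0) + h x0; the mass of the kernel yields the second term. *)
have AE n : A n = cint (kmeasure K) (fun x => (k n x)%:C * (h x - h x0)) + (2 * pi)%:C * h x0.
  have ih : cintegrable (kmeasure K) (fun x => (k n x)%:C * (h x - h x0)).
    apply: (@cintegrable_dom _ _ _ (kmeasure K) _ (fun x => B * kdecay K x)).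
    - apply: cmeasurableM; first exact: cmeasurableR.
      by apply: cmeasurableB => //; exact: cmeasurable_cst.
    - by move=> x; exact: kB.
    - by apply: riZ; exact: integrable_kdecay.
  have ikC : cintegrable (kmeasure K) (fun x => (k n x)%:C).
    split; first exact: ik.
    rewrite (_ : (fun x => _) = EFin \o (fun x => 0 * kdecay K x)); first exact: iW.
    by apply/funext => x /=; rewrite mul0r.
  have -> : (2 * pi)%:C * h x0 = cint (kmeasure K) (fun x => (k n x)%:C * h x0).
    rewrite cintZr//; congr (_ * _); apply: cP; rewrite ?cRe_int ?cIm_int /=.
      by rewrite -(k1 n).
    by rewrite Rintegral_cst// mul0r.
  rewrite -cintD//; last exact: cintegrableZr.
  transitivity (cint (kmeasure (dual K)) (fun q => cint (kmeasure K) (fun x =>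
      (kap (eN n) q)%:C * (ind (dual K) q)%:C * cexp (sg * q * (x - x0)) * h x))).
    apply: cint_ext => q; rewrite /g /FT.
    have ih' : cintegrable (kmeasure K) (fun x => cexp (sg * q * x) * h x).
      apply: (@cintegrable_dom _ _ _ (kmeasure K) _ (fun x => 2 * c * kdecay K x)).
      - apply: cmeasurableM => //; apply: cmeasurable_cexp; exact: measurable_funM.
      - move=> x; apply: le_trans (cnorm1M _ _) _; rewrite -[leRHS]mulrA; apply: ler_pM; rewrite ?cnorm1_ge0//.
        exact: cnorm1_cexp.
      - by apply: riZ; exact: integrable_kdecay.
    rewrite !mulrA -cintZ//; apply: cint_ext => x.
    have -> : sg * q * (x - x0) = - sg * q * x0 + sg * q * x by ring.
    rewrite cexpD; ring.
  pose c2 := 1 + 4 / eN n ^+ 2.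
  have := @cfubini R _ _ mR mR (kmeasure_sf R (dual K)) (kmeasure_sf R K) (fun p : mR * mR =>
      (kap (eN n) p.1)%:C * (ind (dual K) p.1)%:C * cexp (sg * p.1 * (p.2 - x0)) * h p.2)
      (fun q => 2 * c2 * lorentz q) (fun x => c * kdecay K x).
  case.
  - apply: cmeasurableM; last by have [] := cmeasurable_measurable mh.
    apply: cmeasurableM; last exact: cmeasurable_phase.
    have mk1 : cmeasurable (fun q : mR => (kap (eN n) q)%:C * (ind (dual K) q)%:C).
      by apply: cmeasurableM; apply: cmeasurableR; [exact: measurable_kap|exact: measurable_ind].
    by have [] := cmeasurable_measurable mk1.
  - move=> q x; apply: le_trans (cnorm1M _ _) _; apply: ler_pM; rewrite ?cnorm1_ge0//.
    rewrite -rmorphM; apply: le_trans (cnorm1_kexp _ _) _.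
    rewrite -[leRHS]mulrA; apply: ler_wpM2l => //; have /andP[i0 i1] := ind_le1 (dual K) q.
    rewrite ger0_norm ?mulr_ge0 ?kap_ge0//; apply: le_trans (kap_lorentz q (eN_gt0 n)).
    by rewrite ler_piMr// kap_ge0.
  - by move=> q; rewrite !mulr_ge0 ?(ltW (lorentz_gt0 _))// addr_ge0// divr_ge0// sqr_ge0.
  - by move=> x; rewrite mulr_ge0 ?(ltW (kdecay_gt0 _ _)).
  - rewrite (_ : (fun q => 2 * c2 * lorentz q) = fun q => 2 * c2 * kdecay (dual K) q); first exact: iW.
    by apply/funext => q; rewrite dW.
  - exact: iW.
  move=> e1 e2 _; rewrite -[LHS]e1 [LHS]e2.
  apply: cint_ext => x; rewrite -mulrDr subrK -kE.
  have ig : cintegrable (kmeasure (dual K)) (fun q => (kap (eN n) q)%:C * cexp (sg * q * (x - x0))).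
    apply: (@cintegrable_dom _ _ _ (kmeasure (dual K)) _ (fun q => 2 * c2 * kdecay (dual K) q)).
    - apply: cmeasurableM; first by apply: cmeasurableR; exact: measurable_kap.
      by apply: cmeasurable_cexp; apply: measurable_funM => //; exact: measurable_funM.
    - move=> q; apply: le_trans (cnorm1_kexp _ _) _; rewrite -[leRHS]mulrA; apply: ler_wpM2l => //.
      by rewrite ger0_norm ?kap_ge0// dW; apply: kap_lorentz; exact: eN_gt0.
    - exact: iW.
  rewrite -cintZr//.
  rewrite -[RHS]cint_ind; first by apply: cint_ext => q; ring.
  apply: cmeasurableM; last exact: cmeasurable_cst.
  by apply: cmeasurableM; [apply: cmeasurableR; exact: measurable_kap|apply: cmeasurable_cexp; meas].
have H := @cint_dct R _ mR (kmeasure K) (fun n x => (k n x)%:C * (h x - h x0)) (fun=> 0) (fun x => B * kdecay K x).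
under eq_fun do rewrite AE addrK -(subr0 (cint _ _)) -(cint0 (kmeasure K)).
apply: H.
- by move=> n; apply: cmeasurableM; [exact: cmeasurableR|apply: cmeasurableB => //; exact: cmeasurable_cst].
- exact: cmeasurable_cst.
- move=> x; rewrite (_ : (fun n => _) = fun n => cnorm1 ((k n x)%:C * (h x - h x0)))//.
  by apply/funext => n; rewrite subr0.
- exact: kB.
- exact: iW.
Qed.


End Inversion1.

(** * Inversion on the line, on a period and on the integers *)

Section Inversion2.
Variable R : realType.
Local Notation mR := (measurableTypeR R).
Local Notation leb := (@lebesgue_measure R).
Local Notation C := R[i].
Local Notation re := (@complex.Re R).
Local Notation im := (@complex.Im R).

Definition k0 (e y : R) : R := 2 * e / (e ^+ 2 + y ^+ 2).

Lemma k0_d (e y : R) : 0 < e -> 0 < e ^+ 2 + y ^+ 2.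
Proof. by move=> e0; rewrite ltr_wpDr ?sqr_ge0// exprn_gt0. Qed.

Lemma k0_ge0 e y : 0 < e -> 0 <= k0 e y.
Proof. by move=> e0; rewrite divr_ge0 ?(ltW (k0_d _ _))// mulr_ge0// ltW. Qed.

Lemma continuous_k0 e : 0 < e -> continuous (k0 e).
Proof.
move=> e0 x; apply: cvgM; first exact: cvg_cst.
apply: cvgV; first by rewrite gt_eqF// k0_d.
by apply: cvgD; [exact: cvg_cst|exact: exprn_continuous].
Qed.

Lemma is_derive_atanM (a x : R) : is_derive x 1 (fun x => 2 * atan (a * x)) (2 * (a / (1 + (a * x) ^+ 2))).
Proof.
have h1 : is_derive x 1 (fun x : R => a * x) a.
  by apply: is_derive_eq; rewrite /GRing.scale/=; ring.
have h2 := @is_derive1_comp _ (@atan R) (fun x : R => a * x) x _ _ (is_derive1_atan _) h1.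
apply: is_derive_eq (is_deriveM (is_derive_cst (2 : R) x 1) h2) _.
change (2 * ((1 + (a * x) ^+ 2)^-1 * a) + atan (a * x) * 0 = 2 * (a / (1 + (a * x) ^+ 2))).
by ring.
Qed.

Lemma int_k0 e : 0 < e -> (\int[leb]_x (k0 e x)%:E = (2 * pi)%:E)%E.
Proof.
move=> e0.
rewrite ge0_symfun_integralT; last 1 first.
- by move=> x /=; rewrite /k0 sqrrN.
- rewrite (_ : [set x | _] = `[0, +oo[%classic); last first.
    by apply/seteqP; split => x/=; rewrite in_itv/= andbT.
  rewrite (@ge0_continuous_FTC2y _ (k0 e) (fun x => 2 * atan (e^-1 * x)) 0 pi).
  + by rewrite mulr0 atan0 mulr0 sube0 -EFinM.
  + by move=> x _; exact: k0_ge0.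
  + by apply: continuous_subspaceT; exact: continuous_k0.
  + have -> : pi = 2 * (pi / 2) :> R by field.
    apply: cvgM; first exact: cvg_cst.
    apply: (@cvg_comp _ _ _ (fun x : R => e^-1 * x) (@atan R)); last exact: cvgy_atan.
    apply/cvgryPge => A; near=> x; rewrite mulrC ler_pdivlMr//; near: x; exact: nbhs_pinfty_ge.
  + by move=> x _; have [] := is_derive_atanM e^-1 x.
  + by apply: cvg_at_right_filter; exact: is_derive_cont (is_derive_atanM e^-1 0).
  + move=> x _; rewrite derive1E; have [_ ->] := is_derive_atanM e^-1 x.
    have d := k0_d x e0; have en : e != 0 by rewrite gt_eqF.
    have dn : e ^+ 2 + x ^+ 2 != 0 by rewrite gt_eqF.
    have -> : 1 + (e^-1 * x) ^+ 2 = (e ^+ 2 + x ^+ 2) / e ^+ 2 by field.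
    by rewrite /k0 invf_div; field; rewrite en dn.
- by move=> x; exact: k0_ge0.
- exact: continuous_k0.
Unshelve. all: by end_near. Qed.

(** Peetre's inequality; the difference of the two sides is a sum of squares. *)
Lemma peetre1 (x y : R) : 1 + x ^+ 2 <= 2 * (1 + y ^+ 2) * (1 + (x - y) ^+ 2).
Proof.
suff : 0 <= 2 * (1 + y ^+ 2) * (1 + (x - y) ^+ 2) - (1 + x ^+ 2) by lra.
have -> : 2 * (1 + y ^+ 2) * (1 + (x - y) ^+ 2) - (1 + x ^+ 2) =
  1 + (x - 2 * y) ^+ 2 + 2 * (y * (x - y)) ^+ 2 by ring.
have h1 := sqr_ge0 (x - 2 * y); have h2 := sqr_ge0 (y * (x - y)); lra.
Qed.

Lemma sgn_int (sg : R) : sg ^+ 2 = 1 -> exists2 s : int, sg = s%:~R & s <> 0.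
Proof.
move=> /eqP; rewrite sqrf_eq1 => /orP[/eqP ->|/eqP ->]; first by exists 1.
by exists (-1); rewrite ?mulrNz.
Qed.

(** The Lipschitz bound tames the singularity that the Poisson kernel develops at [x0], and the
    decay of [h] controls the rest. *)
Lemma inv_Ln (sg : R) (h : R -> C) (x0 c c' L : R) : sg ^+ 2 = 1 ->
  cmeasurable (h : mR -> C) -> (forall x, cnorm1 (h x) <= c * lorentz x) ->
  (forall q, cnorm1 (FT Ln sg h q) <= c' * lorentz q) ->
  (forall x y, cnorm1 (h x - h y) <= L * `|x - y|) ->
  cint (kmeasure Ln) (fun q => cexp (- sg * q * x0) * FT Ln sg h q) = (2 * pi)%:C * h x0.
Proof.
move=> sg2 mh hW FW hL.
have c0 : 0 <= c by have := le_trans (cnorm1_ge0 _) (hW 0); rewrite pmulr_lge0// lorentz_gt0.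
have L0 : 0 <= L by have := le_trans (cnorm1_ge0 _) (hL 1 0); rewrite subr0 normr1 mulr1.
pose k n x : R := k0 (eN R n) (x - x0).
have mk n : measurable_fun setT (k n : mR -> R).
  apply: (@measurableT_comp _ _ _ _ _ _ (k0 (eN R n))); last by meas.
  by apply: continuous_measurable_fun; apply: continuous_k0; exact: eN_gt0.
have msh : measurable_fun setT (fun x : mR => (x + - x0 : mR)) by meas.
have mk0 n : measurable_fun setT (fun x : mR => (k0 (eN R n) x)%:E).
  apply/measurable_EFinP; apply: continuous_measurable_fun; apply: continuous_k0; exact: eN_gt0.
have I n : (\int[leb]_x (k n x)%:E = (2 * pi)%:E)%E.
  rewrite -(int_k0 (eN_gt0 R n)).
  exact: (leb_change msh (@leb_shift R (- x0)) (mk0 n)).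
transitivity (cint (kmeasure (dual Ln)) (fun q => cexp (- sg * q * x0) * ((ind (dual Ln) q)%:C * FT Ln sg h q))).
  by apply: cint_ext => q; rewrite /ind/= mul1r.
(* The majorant of kernel times increment: L comes from 2 e |y| <= e^2 + y^2, and 4 c from the bound
   2 c on the increment together with e <= 1. Peetre's inequality then recentres the profile from
   [x0] to 0 at the cost 2 (1 + x0^2). *)
apply: (@inv_gen R Ln sg h x0 c c' ((L + 4 * c) * (2 * (1 + x0 ^+ 2))) k) => //.
- by move=> q; rewrite /ind/= mul1r.
- move=> n x.
  transitivity (cint (kmeasure Ln) (fun q => (kap (eN R n) q)%:C * cexp (q * (sg * (x - x0))))).
    by apply: cint_ext => q; congr (_ * cexp _); ring.
  by rewrite kernel_Ln ?eN_gt0// exprMn sg2 mul1r.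
- move=> n; apply/integrableP; split; first by apply/measurable_EFinP.
  under eq_integral do rewrite gee0_abs ?lee_fin ?k0_ge0 ?eN_gt0//.
  by rewrite I ltry.
- by move=> n; rewrite /Rintegral I.
- move=> x; have [->|xx] := eqVneq x x0.
    by under eq_fun do rewrite subrr mulr0 cnorm10; exact: cvg_cst.
  have y0 : 0 < (x - x0) ^+ 2 by rewrite exprn_even_gt0//= subr_eq0.
  apply: (@cnorm1_cvg0_le _ _ (eN R) (2 * cnorm1 (h x - h x0) / (x - x0) ^+ 2)); last exact: cvg_harmonic.
  move=> n; rewrite cnorm1_ge0 cnorm1RM ger0_norm ?k0_ge0 ?eN_gt0//=.
  have -> : 2 * cnorm1 (h x - h x0) / (x - x0) ^+ 2 * eN R n = (2 * eN R n / (x - x0) ^+ 2) * cnorm1 (h x - h x0) by ring.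
  apply: ler_wpM2r; first exact: cnorm1_ge0.
  rewrite /k /k0; apply: ler_wpM2l; first by rewrite mulr_ge0// ltW// eN_gt0.
  by rewrite lef_pV2 ?posrE ?k0_d ?eN_gt0// lerDr sqr_ge0.
- move=> n x; rewrite cnorm1RM ger0_norm ?k0_ge0 ?eN_gt0//=.
  have e0 := eN_gt0 R n; have e1 := eN_le1 R n.
  have D1 : cnorm1 (h x - h x0) <= L * `|x - x0| := hL x x0.
  have D2 : cnorm1 (h x - h x0) <= 2 * c.
    apply: le_trans (cnorm1B _ _) _; rewrite mulr_natl mulr2n; apply: lerD;
    apply: le_trans (hW _) _; rewrite -[leRHS]mulr1; apply: ler_wpM2l => //; exact: lorentz_le1.
  have D0 := cnorm1_ge0 (h x - h x0).
  rewrite /k /k0; set y := x - x0 in D1 D2 D0 *; set D := cnorm1 _ in D1 D2 D0 *; set e := eN R n in e0 e1 *.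
  have d0 := k0_d y e0.
  have P : 2 * e / (e ^+ 2 + y ^+ 2) * D * (1 + y ^+ 2) <= L + 4 * c.
    have -> : 2 * e / (e ^+ 2 + y ^+ 2) * D * (1 + y ^+ 2) = (2 * e * D * (1 + y ^+ 2)) / (e ^+ 2 + y ^+ 2) by ring.
    rewrite ler_pdivrMr//.
    have N2 : `|y| ^+ 2 = y ^+ 2 by rewrite real_normK// num_real.
    have n0 := normr_ge0 y; rewrite -N2 in d0 *; move: (`|y|) n0 D1 d0 => z z0 D1 d0.
    have a1 : 2 * e * D <= L * (e ^+ 2 + z ^+ 2).
      apply: (@le_trans _ _ (2 * e * (L * z))); first by apply: ler_wpM2l => //; nra.
      have := sqr_ge0 (e - z); nra.
    have a2 : 2 * e * D * z ^+ 2 <= 4 * c * (e ^+ 2 + z ^+ 2).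
      apply: (@le_trans _ _ (4 * c * z ^+ 2)); last by apply: ler_wpM2l; nra.
      apply: ler_wpM2r; first exact: sqr_ge0. nra.
    nra.
  rewrite -ler_pdivrMr ?lorentz_gt0// /lorentz invrK.
  apply: (@le_trans _ _ (2 * e / (e ^+ 2 + y ^+ 2) * D * (2 * (1 + x0 ^+ 2) * (1 + y ^+ 2)))).
    apply: ler_wpM2l; last exact: peetre1.
    by rewrite mulr_ge0// divr_ge0 ?(ltW d0)// mulr_ge0// ltW.
  rewrite mulrCA mulrA [leLHS]mulrC mulrA -mulrA [leRHS]mulrC.
  have g : 0 <= 2 * (1 + x0 ^+ 2) by rewrite mulr_ge0// ltW// oneDsq_gt0.
  have := ler_wpM2l g P; lra.
Qed.

(** A weak form of Jordan's inequality. Since u cos u <= sin u, it holds when cos u >= 1/2;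
    otherwise sin^2 u >= 3/4, while u <= 2. *)
Lemma sin_lb (u : R) : 0 <= u -> u <= pi / 2 -> u / 3 <= sin u.
Proof.
move=> u0 up.
have s0 : 0 <= sin u by apply: sin_ge0_pi; rewrite u0/= (le_trans up)// ler_pdivrMr// ler_peMr ?pi_ge0// ler1n.
have g : u * cos u <= sin u.
  pose G (x : R) := sin x - x * cos x.
  have dG (x : R) : is_derive x 1 G (x * sin x).
    apply: is_derive_eq (is_deriveB (is_derive_sin x) (is_deriveM (is_derive_id x (1:R)) (is_derive_cos x))) _.
    by rewrite /GRing.scale/=; ring.
  have cG : {within `[0, u], continuous G}.
    by apply: continuous_subspaceT => x; exact: is_derive_cont (dG x).
  have [c cu] := @MVT_segment R G (fun x => x * sin x) 0 u u0 (fun x _ => dG x) cG.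
  rewrite /G sin0 mul0r !subr0 => E; rewrite -subr_ge0 E.
  move: cu; rewrite in_itv/= => /andP[c0 cu].
  have sc : 0 <= sin c.
    by apply: sin_ge0_pi; apply/andP; split => //; have := pi_ge0 R; lra.
  by apply: mulr_ge0 => //; exact: mulr_ge0.
have p4 : pi / 2 <= 2 :> R by exact: ltW (pihalf_lt2 R).
have [c|c] := leP (1/2) (cos u); first by nra.
have cu0 : 0 <= cos u by apply: cos_ge0_pihalf; rewrite up andbT (le_trans _ u0)// oppr_le0 divr_ge0// pi_ge0.
have := cos2Dsin2 u; nra.
Qed.

Lemma per_int (h : R -> C) : (forall x, h (x + 2 * pi) = h x) ->
  forall (m : int) x, h (x + m%:~R * (2 * pi)) = h x.
Proof.
move=> per; have N (k : nat) x : h (x + k%:R * (2 * pi)) = h x.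
  elim: k x => [|k IH] x; first by rewrite mul0r addr0.
  by rewrite -natr1 mulrDl mul1r addrA per.
case=> k x; first exact: N.
by rewrite NegzE mulrNz mulNr -[in RHS](subrK (k.+1%:R * (2 * pi)) x) (N k.+1).
Qed.

(** Modulo the period, x - x0 is some y in [-pi, pi], and 1 - cos y = 2 sin^2(y/2) >= y^2 / 18 by
    [sin_lb]. In this form the Lipschitz bound can be compared with the denominator of the Poisson
    kernel of the disc. *)
Lemma per_lip (h : R -> C) (L : R) : (forall x, h (x + 2 * pi) = h x) ->
  (forall x y, cnorm1 (h x - h y) <= L * `|x - y|) ->
  forall x x0, cnorm1 (h x - h x0) ^+ 2 <= 18 * L ^+ 2 * (1 - cos (x - x0)).
Proof.
move=> per hL x x0.
have p0 := pi_gt0 R.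
pose m := Num.floor ((x - x0 + pi) / (2 * pi)).
pose y := x - x0 - m%:~R * (2 * pi).
have hx : h x = h (x0 + y).
  by rewrite -(per_int per m (x0 + y)) /y; congr h; ring.
have cx : cos (x - x0) = cos y.
  have := cexp_pi2n y m; rewrite /y subrK => /(congr1 re) /= ->.
  by [].
have p20 : 0 < 2 * pi :> R by rewrite mulr_gt0.
have [y1 y2] : - pi <= y /\ y <= pi.
  have := floor_le_tmp ((x - x0 + pi) / (2 * pi)); rewrite ler_pdivlMr// => H1.
  have := floorD1_gt ((x - x0 + pi) / (2 * pi)); rewrite ltr_pdivrMr// intrD mulrDl mul1r => H2.
  by rewrite /y; rewrite -/m in H1 H2; split; lra.
have N : cnorm1 (h x - h x0) <= L * `|y| by rewrite hx; have := hL (x0 + y) x0; rewrite addrAC subrr add0r.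
have D0 := cnorm1_ge0 (h x - h x0).
have S : (`|y| / 2 / 3) ^+ 2 <= sin (y / 2) ^+ 2.
  have -> : sin (y / 2) ^+ 2 = sin (`|y| / 2) ^+ 2.
    by case: (ger0P y) => // _; rewrite mulNr sinN sqrrN.
  rewrite ler_pXn2r ?nnegrE ?divr_ge0//.
    apply: sin_lb; first by rewrite divr_ge0.
    by rewrite ler_pdivrMr// divfK// ler_norml y1.
  apply: sin_ge0_pi; rewrite divr_ge0//= ler_pdivrMr//.
  by apply: le_trans (_ : `|y| <= pi) _; [rewrite ler_norml y1|rewrite ler_peMr ?pi_ge0// ler1n].
rewrite cx.
have -> : cos y = 1 - 2 * sin (y / 2) ^+ 2.
  have := cosD (y / 2) (y / 2); rewrite -splitr => ->.
  have := cos2Dsin2 (y / 2); rewrite -!expr2; lra.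
have N2 : cnorm1 (h x - h x0) ^+ 2 <= (L * `|y|) ^+ 2.
  by rewrite ler_pXn2r ?nnegrE// (le_trans D0).
apply: le_trans N2 _; have L2 := sqr_ge0 L; move: S; rewrite !exprMn => S; nra.
Qed.


Definition kP (e y : R) : R :=
  let r := expR (- e) in (1 - r ^+ 2) / (1 - 2 * r * cos y + r ^+ 2).

Lemma cint_PrC (sg x0 : R) (m : int) : sg ^+ 2 = 1 ->
  cint (kmeasure Pr) (fun x => cexp (sg * m%:~R * (x - x0))) = (if m == 0 then (2 * pi)%:C else 0 : C).
Proof.
move=> /sgn_int[s -> s0].
transitivity (cint (kmeasure Pr) (fun x => cexp (- (s%:~R * m%:~R * x0)) * cexp ((s * m)%:~R * x)) : C).
  by apply: cint_ext => x; rewrite -cexpD intrM; congr cexp; ring.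
rewrite cintZ.
  rewrite orth mulf_eq0 (introF eqP s0) /=.
  case: eqP => [->|_]; last by rewrite mulr0.
  by rewrite mulr0 mul0r oppr0 cexp0 mul1r.
apply: (@cintegrable_dom _ _ _ (kmeasure Pr) _ (fun x => 2 * kdecay Pr x)); last exact: iW.
  by apply: cmeasurable_cexp; meas.
by move=> x; rewrite /= mulr1; exact: cnorm1_cexp.
Qed.

(** The denominator of the kernel is (1 - r)^2 + 2 r (1 - cos y), so [per_lip] plays the role that
    the Lipschitz bound has on the line. *)
Lemma inv_Pr (sg : R) (h : R -> C) (x0 c c' L : R) : sg ^+ 2 = 1 ->
  cmeasurable (h : mR -> C) -> (forall x, cnorm1 (h x) <= c) ->
  (forall q, cnorm1 ((ind Zc q)%:C * FT Pr sg h q) <= c' * lorentz q) ->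
  (forall x y, cnorm1 (h x - h y) <= L * `|x - y|) ->
  (forall x, h (x + 2 * pi) = h x) ->
  cint (kmeasure Zc) (fun q => cexp (- sg * q * x0) * ((ind Zc q)%:C * FT Pr sg h q)) = (2 * pi)%:C * h x0.
Proof.
move=> sg2 mh hW FW hL per.
have c0 : 0 <= c by apply: le_trans (cnorm1_ge0 _) (hW 0).
have L0 : 0 <= L by have := le_trans (cnorm1_ge0 _) (hL 1 0); rewrite subr0 normr1 mulr1.
pose k n x : R := kP (eN R n) (x - x0).
pose r n := expR (- eN R n).
(* Since eN n <= 1, every radius [r n] is at least exp(-1). *)
pose rr := expR (- (1 : R)).
have rr0 : 0 < rr by exact: expR_gt0.
have r_lb n : rr <= r n by rewrite ler_expR lerN2 eN_le1.
have r1 n : r n < 1 by rewrite -expR0 ltr_expR oppr_lt0 eN_gt0.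
have r0 n : 0 < r n by exact: expR_gt0.
have r2 n : 1 - r n <= eN R n by have := expR_ge1Dx (- eN R n); rewrite -/(r n); lra.
have cs (y : R) : 0 <= 1 - cos y by rewrite subr_ge0 cos_le1.
pose d n y := 1 - 2 * r n * cos y + r n ^+ 2.
have dE n y : d n y = (1 - r n) ^+ 2 + 2 * r n * (1 - cos y) by rewrite /d; ring.
have d0 n y : (1 - r n) ^+ 2 <= d n y.
  by rewrite dE lerDl mulr_ge0// mulr_ge0// ltW.
have r1' n : 0 < 1 - r n by rewrite subr_gt0.
have d00 n y : 0 < d n y by apply: lt_le_trans (d0 n y); rewrite exprn_gt0.
have num0 n : 0 <= 1 - r n ^+ 2 by have := r0 n; have := r1 n; nra.
have kE n x : k n x = (1 - r n ^+ 2) / d n (x - x0) by [].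
have k0 n x : 0 <= k n x by rewrite kE divr_ge0 ?(ltW (d00 _ _)).
have ck n : continuous (k n).
  move=> x; apply: cvgM; first exact: cvg_cst.
  apply: cvgV; first by rewrite gt_eqF// d00.
  apply: cvgD; last exact: cvg_cst.
  apply: cvgB; first exact: cvg_cst.
  apply: cvgM; first exact: cvg_cst.
  apply: (@continuous_comp _ _ _ (fun x => x - x0) cos); last exact: continuous_cos.
  by apply: cvgB; [exact: cvg_id|exact: cvg_cst].
have mk n : measurable_fun setT (k n : mR -> R) by exact: continuous_measurable_fun.
have ik n : (kmeasure Pr).-integrable setT (EFin \o k n).
  apply: (@dom_integrable _ _ _ (kmeasure Pr) (k n) (fun x => ((1 - r n ^+ 2) / (1 - r n) ^+ 2) * kdecay Pr x)) => //; last exact: iW.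
  move=> x; rewrite ger0_norm// mulr1 kE ler_wpM2l// lef_pV2 ?posrE ?d00//.
  by rewrite exprn_gt0.
have kZ n x : cint (kmeasure Zc) (fun q => (kap (eN R n) q)%:C * cexp (sg * q * (x - x0))) = (k n x)%:C.
  transitivity (cint (kmeasure Zc) (fun q => (kap (eN R n) q)%:C * cexp (q * (sg * (x - x0))))).
    by apply: cint_ext => q; congr (_ * cexp _); ring.
  rewrite kernel_Zc ?eN_gt0// /k /kP.
  suff -> : cos (sg * (x - x0)) = cos (x - x0) by [].
  move/eqP: sg2; rewrite sqrf_eq1 => /orP[/eqP ->|/eqP ->]; rewrite ?mul1r//.
  by rewrite mulN1r cosN.
(* The mass of the kernel: its Fourier series is integrated term by term, and orthogonality leaves
   only frequency 0. *)
have k1 n : cint (kmeasure Pr) (fun x => (k n x)%:C) = (2 * pi)%:C.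
  under cint_ext do rewrite -kZ.
  pose c2 := 1 + 4 / eN R n ^+ 2.
  have := @cfubini R _ _ mR mR (kmeasure_sf R Zc) (kmeasure_sf R Pr) (fun p : mR * mR =>
      (kap (eN R n) p.1)%:C * cexp (sg * p.1 * (p.2 - x0)))
      (fun q => 2 * c2 * kdecay Zc q) (fun x => 1 * kdecay Pr x).
  case.
  - apply: cmeasurableM; last exact: cmeasurable_phase.
    have mk1 : cmeasurable (fun q : mR => (kap (eN R n) q)%:C).
      by apply: cmeasurableR; exact: measurable_kap.
    by have [] := cmeasurable_measurable mk1.
  - move=> q x; rewrite !mulr1; apply: le_trans (cnorm1_kexp _ _) _.
    rewrite -[leRHS]mulrA; apply: ler_wpM2l => //.
    by rewrite ger0_norm ?kap_ge0//; apply: kap_lorentz; exact: eN_gt0.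
  - by move=> q; rewrite !mulr_ge0 ?(ltW (lorentz_gt0 _))// addr_ge0// divr_ge0// sqr_ge0.
  - by move=> x; rewrite mulr1.
  - exact: iW.
  - exact: iW.
  move=> e1 e2 _; rewrite -[LHS]e2 [LHS]e1.
  rewrite -[RHS](cint_spike ((2 * pi)%:C) 0).
  apply: cint_Zc_ext.
  - apply: (@cmeasurable_cint _ _ _ _ _ (kmeasure_sf R Pr) (fun p : mR * mR => (kap (eN R n) p.1)%:C * cexp (sg * p.1 * (p.2 - x0)))).
    apply: cmeasurableM; last exact: cmeasurable_phase.
    have mk1 : cmeasurable (fun q : mR => (kap (eN R n) q)%:C).
      by apply: cmeasurableR; exact: measurable_kap.
    by have [] := cmeasurable_measurable mk1.
  - exact: cmeasurable_spike.
  - move=> m /=; rewrite cintZ; last first.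
      apply: (@cintegrable_dom _ _ _ (kmeasure Pr) _ (fun x => 2 * kdecay Pr x)); last exact: iW.
        by apply: cmeasurable_cexp; meas.
      by move=> x; rewrite /= mulr1; exact: cnorm1_cexp.
    rewrite cint_PrC//; have [->|m0] := eqVneq m 0.
      by rewrite spike1 /kap normr0 mulr0 oppr0 expR0 mul1r.
    by rewrite mulr0 spike0// intr_eq0.
(* C1 is such that z = D / C1, for D the size of the increment, satisfies z^2 <= 2 r (1 - cos (x -
   x0)) at every radius. Then (1 - r^2) z <= (1 - r)^2 + z^2 bounds kernel times increment by C1. *)
have [C1 C10 HC1] : exists2 C1 : R, 0 < C1 & forall x, cnorm1 (h x - h x0) ^+ 2 <= C1 ^+ 2 * (2 * rr * (1 - cos (x - x0))).
  exists (1 + 18 * L ^+ 2 / (2 * rr)).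
    by rewrite ltr_wpDr// divr_ge0 ?mulr_ge0 ?sqr_ge0// ltW.
  move=> x; apply: le_trans (per_lip per hL x x0) _.
  have b0 : 0 < 2 * rr by rewrite mulr_gt0.
  have z0 : 0 <= 18 * L ^+ 2 / (2 * rr) by rewrite divr_ge0 ?mulr_ge0 ?sqr_ge0// ltW.
  have -> : 18 * L ^+ 2 * (1 - cos (x - x0)) = (18 * L ^+ 2 / (2 * rr)) * (2 * rr * (1 - cos (x - x0))).
    by rewrite mulrA divfK// gt_eqF.
  apply: ler_wpM2r; first by rewrite mulr_ge0// ltW.
  move: (18 * L ^+ 2 / (2 * rr)) z0 => z z0; nra.
apply: (@inv_gen R Pr sg h x0 c c' C1 k) => //.
- by move=> x; rewrite mulr1.
- by move=> n; have /(congr1 (fun z : C => re z)) := k1 n.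
- move=> x; have [yy|yy] := eqVneq (cos (x - x0)) 1.
    have -> : h x - h x0 = 0.
      apply: cnorm1_eq0; have := HC1 x; rewrite yy subrr !mulr0 => H.
      by have := cnorm1_ge0 (h x - h x0); nra.
    by under eq_fun do rewrite mulr0 cnorm10; exact: cvg_cst.
  have y0 : 0 < 1 - cos (x - x0) by rewrite lt_neqAle cs andbT eq_sym subr_eq0 eq_sym.
  apply: (@cnorm1_cvg0_le _ _ (eN R) (2 * cnorm1 (h x - h x0) / (2 * rr * (1 - cos (x - x0))))); last exact: cvg_harmonic.
  move=> n; rewrite cnorm1_ge0 cnorm1RM ger0_norm//=.
  have -> : 2 * cnorm1 (h x - h x0) / (2 * rr * (1 - cos (x - x0))) * eN R n = (2 * eN R n / (2 * rr * (1 - cos (x - x0)))) * cnorm1 (h x - h x0) by ring.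
  apply: ler_wpM2r; first exact: cnorm1_ge0.
  rewrite kE; apply: ler_pM => //.
  - by rewrite invr_ge0 ltW.
  - by have := r2 n; have := r1 n; have := r0 n; nra.
  - rewrite lef_pV2 ?posrE ?d00 ?mulr_gt0//; rewrite dE.
    have := r_lb n; have := sqr_ge0 (1 - r n); nra.
- move=> n x; rewrite cnorm1RM ger0_norm//= mulr1 kE mulrAC ler_pdivrMr// dE.
  have D0 := cnorm1_ge0 (h x - h x0); have H := HC1 x; move: D0 H.
  set D := cnorm1 _; set b := 1 - cos _ => D0 H.
  have b0 : 0 <= b by exact: cs.
  have rl := r_lb n; have q1 := r1 n; have q0 := r0 n.
  have H2 : (D / C1) ^+ 2 <= 2 * r n * b.
    rewrite exprMn exprVn ler_pdivrMr ?exprn_gt0//; apply: le_trans H _.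
    rewrite mulrC; apply: ler_wpM2r; first exact: sqr_ge0.
    by apply: ler_wpM2r => //; nra.
  have E : D = C1 * (D / C1) by rewrite mulrC divfK// gt_eqF.
  have zz : 0 <= D / C1 by rewrite divr_ge0// ltW.
  rewrite E; move: (D / C1) H2 zz => z H2 z0.
  rewrite mulrCA; apply: ler_wpM2l; first exact: ltW.
  have A := mulr_ge0 (sqr_ge0 (1 - r n)) z0; have B := sqr_ge0 (1 - r n - z).
  have -> : (1 - r n ^+ 2) * z = (1 - r n) ^+ 2 + z ^+ 2 - (1 - r n - z) ^+ 2 - (1 - r n) ^+ 2 * z by ring.
  apply: (@le_trans _ _ ((1 - r n) ^+ 2 + z ^+ 2)).
    by rewrite -addrA -opprD gerDl oppr_le0 addr_ge0.
  by rewrite lerD2l.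
Qed.

(** No summation factor is needed, because the period has finite measure: Fubini and orthogonality
    pick out the term at [x0]. *)
Lemma inv_Zc (sg : R) (h : R -> C) (x0 c : R) : sg ^+ 2 = 1 ->
  cmeasurable (h : mR -> C) -> (forall x, cnorm1 (h x) <= c * lorentz x) -> inZ x0 ->
  cint (kmeasure Pr) (fun q => cexp (- sg * q * x0) * FT Zc sg h q) = (2 * pi)%:C * h x0.
Proof.
move=> sg2 mh hW /intrP[m0 x0E].
have c0 : 0 <= c by have := le_trans (cnorm1_ge0 _) (hW 0); rewrite pmulr_lge0// lorentz_gt0.
have hW' q : cintegrable (kmeasure Zc) (fun x => cexp (sg * q * x) * h x).
  apply: (@cintegrable_dom _ _ _ (kmeasure Zc) _ (fun x => 2 * c * kdecay Zc x)).
  - by apply: cmeasurableM => //; apply: cmeasurable_cexp; meas.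
  - move=> x; apply: le_trans (cnorm1M _ _) _; rewrite -[leRHS]mulrA; apply: ler_pM; rewrite ?cnorm1_ge0//.
    exact: cnorm1_cexp.
  - exact: iW.
transitivity (cint (kmeasure Pr) (fun q => cint (kmeasure Zc) (fun x => cexp (sg * q * (x - x0)) * h x))).
  apply: cint_ext => q; rewrite /FT -cintZ//; apply: cint_ext => x.
  by rewrite mulrA -cexpD; congr (cexp _ * _); ring.
have := @cfubini R _ _ mR mR (kmeasure_sf R Pr) (kmeasure_sf R Zc) (fun p : mR * mR =>
      cexp (sg * p.1 * (p.2 - x0)) * h p.2)
      (fun x => 2 * kdecay Pr x) (fun q => c * kdecay Zc q).
case.
- by apply: cmeasurableM; [exact: cmeasurable_phase|have [] := cmeasurable_measurable mh].
- move=> q x; rewrite mulr1; apply: le_trans (cnorm1M _ _) _; apply: ler_pM; rewrite ?cnorm1_ge0//.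
  exact: cnorm1_cexp.
- by move=> x; rewrite mulr1.
- by move=> x; rewrite mulr_ge0// (ltW (lorentz_gt0 _)).
- exact: iW.
- exact: iW.
move=> e1 e2 _; rewrite -[LHS]e1 [LHS]e2 x0E.
rewrite -[RHS](cint_spike ((2 * pi)%:C * h m0%:~R) m0).
apply: cint_Zc_ext.
- apply: (@cmeasurable_cint _ _ _ _ _ (kmeasure_sf R Pr) (fun p : mR * mR => cexp (sg * p.2 * (p.1 - m0%:~R)) * h p.1)).
  apply: cmeasurableM; last by have [] := cmeasurable_measurable mh.
  by apply: cmeasurable_cexp; meas.
- exact: cmeasurable_spike.
- move=> m /=; rewrite cintZr; last first.
    apply: (@cintegrable_dom _ _ _ (kmeasure Pr) _ (fun x => 2 * kdecay Pr x)); last exact: iW.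
      by apply: cmeasurable_cexp; meas.
    by move=> x; rewrite /= mulr1; exact: cnorm1_cexp.
  transitivity (cint (kmeasure Pr) (fun x => cexp (sg * (m - m0)%:~R * (x - 0))) * h m%:~R : C).
    by congr (_ * _); apply: cint_ext => x; congr cexp; rewrite intrB; ring.
  rewrite cint_PrC// subr_eq0; have [->|mm] := eqVneq m m0; first by rewrite spike1.
  by rewrite mul0r spike0// eqr_int.
Qed.

End Inversion2.

(** * Rapidly decreasing functions *)

Section Classes.
Variable R : realType.
Local Notation mR := (measurableTypeR R).
Local Notation C := R[i].
Local Notation fn := (R * R -> C).

Definition cmeasurable2 (u : fn) := @cmeasurable R _ (mR * mR)%type u.

Definition kweight (K : kind) (a : nat) (x : R) : R := if K is Pr then 1 else `|x| ^+ a.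

Lemma kweight_ge0 K a x : 0 <= kweight K a x.
Proof. by case: K => //=; exact: exprn_ge0. Qed.

Lemma kweight0 K x : kweight K 0 x = 1.
Proof. by case: K. Qed.

Lemma kweightD K a b x : kweight K (a + b) x = kweight K a x * kweight K b x.
Proof. by case: K; rewrite /= ?exprD ?mulr1. Qed.

Definition respects_kind (K : kind) (h : R -> C) : Prop :=
  (K = Pr -> forall x, h (x + 2 * pi) = h x) /\
  (K = Zc -> forall x, ~~ inZ x -> h x = 0).

Definition swap_args (u : fn) : fn := fun p => u (p.2, p.1).

Record decaying (K1 K2 : kind) (u : fn) : Prop := Bd {
  decaying_meas : cmeasurable2 u;
  decaying_wt : forall a b, exists M, forall x y, kweight K1 a x * kweight K2 b y * cnorm1 (u (x, y)) <= M;
  decaying_spr1 : forall y, respects_kind K1 (fun x => u (x, y));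
  decaying_spr2 : forall x, respects_kind K2 (fun y => u (x, y)) }.

Definition has_pderiv1 (u u' : fn) := forall x y, is_cderive (fun t => u (t, y)) x (u' (x, y)).
Definition has_pderiv2 (u u' : fn) := forall x y, is_cderive (fun t => u (x, t)) y (u' (x, y)).

(** The Schwartz class of a product of two of the spaces, up to order n. A discrete variable ([Zc])
    is not differentiated. *)
Fixpoint sm (n : nat) (K1 K2 : kind) (u : fn) : Prop :=
  decaying K1 K2 u /\
  (if n is n'.+1 then
    (K1 <> Zc -> exists2 u', has_pderiv1 u u' & sm n' K1 K2 u') /\
    (K2 <> Zc -> exists2 u', has_pderiv2 u u' & sm n' K1 K2 u')
   else True).

Definition smooth K1 K2 u := forall n, sm n K1 K2 u.

Lemma sm_decaying n K1 K2 u : sm n K1 K2 u -> decaying K1 K2 u.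
Proof. by case: n => [|n] []. Qed.

Lemma smooth_decaying K1 K2 u : smooth K1 K2 u -> decaying K1 K2 u.
Proof. by move=> /(_ 0%N)/sm_decaying. Qed.

Lemma has_pderiv1_unique u v w : has_pderiv1 u v -> has_pderiv1 u w -> v = w.
Proof. by move=> h1 h2; apply/funext => -[x y]; exact: is_cderive_unique (h1 x y) (h2 x y). Qed.

Lemma has_pderiv2_unique u v w : has_pderiv2 u v -> has_pderiv2 u w -> v = w.
Proof. by move=> h1 h2; apply/funext => -[x y]; exact: is_cderive_unique (h1 x y) (h2 x y). Qed.

Lemma smooth_d1 K1 K2 u : K1 <> Zc -> smooth K1 K2 u -> exists2 u', has_pderiv1 u u' & smooth K1 K2 u'.
Proof.
move=> KZ Su; have [_ [/(_ KZ)[u' du' _] _]] := Su 1%N.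
exists u' => // n; have [_ [/(_ KZ)[v dv sv] _]] := Su n.+1.
by rewrite (has_pderiv1_unique du' dv).
Qed.

Lemma smooth_d2 K1 K2 u : K2 <> Zc -> smooth K1 K2 u -> exists2 u', has_pderiv2 u u' & smooth K1 K2 u'.
Proof.
move=> KZ Su; have [_ [_ /(_ KZ)[u' du' _]]] := Su 1%N.
exists u' => // n; have [_ [_ /(_ KZ)[v dv sv]]] := Su n.+1.
by rewrite (has_pderiv2_unique du' dv).
Qed.

(** A coinduction principle: membership follows from any class of decaying functions that is closed
    under differentiation, without formulas for higher derivatives. *)
Lemma smooth_coind K1 K2 (P : fn -> Prop) :
  (forall u, P u -> [/\ decaying K1 K2 u,
     K1 <> Zc -> exists2 u', has_pderiv1 u u' & P u' &
     K2 <> Zc -> exists2 u', has_pderiv2 u u' & P u']) ->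
  forall u, P u -> smooth K1 K2 u.
Proof.
move=> H u Pu n; elim: n u Pu => [|n IH] u /H[B d1 d2]; split => //; split => KZ.
  by have [u' du' Pu'] := d1 KZ; exists u' => //; exact: IH.
by have [u' du' Pu'] := d2 KZ; exists u' => //; exact: IH.
Qed.

Lemma decayingD K1 K2 a u v : decaying K1 K2 u -> decaying K1 K2 v -> decaying K1 K2 (fun p => a * u p + v p).
Proof.
move=> [mu wu p1 p2] [mv wv q1 q2]; split.
- by apply: cmeasurableD => //; apply: cmeasurableM => //; exact: cmeasurable_cst.
- move=> m n; have [M HM] := wu m n; have [N HN] := wv m n.
  exists (cnorm1 a * M + N) => x y.
  have w0 : 0 <= kweight K1 m x * kweight K2 n y by rewrite mulr_ge0 ?kweight_ge0.
  apply: le_trans (ler_wpM2l w0 (cnorm1D _ _)) _; rewrite mulrDr lerD//.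
  apply: le_trans (ler_wpM2l w0 (cnorm1M _ _)) _; rewrite mulrCA.
  by apply: ler_wpM2l => //; exact: cnorm1_ge0.
- move=> y; have [p _] := p1 y; have [q _] := q1 y; have [_ p'] := p1 y; have [_ q'] := q1 y.
  split => K x; first by rewrite p// q.
  by move=> nx; rewrite p'// q'// mulr0 addr0.
- move=> y; have [p _] := p2 y; have [q _] := q2 y; have [_ p'] := p2 y; have [_ q'] := q2 y.
  split => K x; first by rewrite p// q.
  by move=> nx; rewrite p'// q'// mulr0 addr0.
Qed.

Lemma is_cderive_lin (f g : R -> C) x a b c : is_cderive f x a -> is_cderive g x b ->
  is_cderive (fun t => c * f t + g t) x (c * a + b).
Proof.
move=> hf hg; apply: is_cderive_eq (is_cderiveD (is_cderiveM (is_cderive_cst c x) hf) hg) _.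
by rewrite mul0r add0r.
Qed.

Lemma smD n K1 K2 a u v : sm n K1 K2 u -> sm n K1 K2 v -> sm n K1 K2 (fun p => a * u p + v p).
Proof.
elim: n u v => [|n IH] u v [bu du] [bv dv]; split; try exact: decayingD => //.
  by [].
have [d1 d2] := du; have [e1 e2] := dv; split => KZ.
  have [u' hu su] := d1 KZ; have [v' hv sv] := e1 KZ.
  exists (fun p => a * u' p + v' p); last exact: IH.
  by move=> x y; exact: is_cderive_lin.
have [u' hu su] := d2 KZ; have [v' hv sv] := e2 KZ.
exists (fun p => a * u' p + v' p); last exact: IH.
by move=> x y; exact: is_cderive_lin.
Qed.

Lemma smoothD K1 K2 a u v : smooth K1 K2 u -> smooth K1 K2 v -> smooth K1 K2 (fun p => a * u p + v p).
Proof. by move=> su sv n; exact: smD. Qed.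

Lemma smooth0 K1 K2 : smooth K1 K2 (fun=> 0).
Proof.
apply: (@smooth_coind K1 K2 (fun u => u = fun=> 0)) => // u ->; split.
- split; [exact: cmeasurable_cst| |by move=> y; split|by move=> y; split].
  by move=> a b; exists 0 => x y; rewrite cnorm10 mulr0.
- by move=> _; exists (fun=> 0) => // x y; exact: is_cderive_cst.
- by move=> _; exists (fun=> 0) => // x y; exact: is_cderive_cst.
Qed.

Lemma smoothZ K1 K2 a u : smooth K1 K2 u -> smooth K1 K2 (fun p => a * u p).
Proof.
by move=> su; have := smoothD a su (smooth0 K1 K2); under eq_fun do rewrite addr0.
Qed.

Lemma decayingJ K1 K2 u : decaying K1 K2 u -> decaying K1 K2 (fun p => ((u p)^*)%C).
Proof.
move=> [mu wu p1 p2]; split.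
- exact: cmeasurableJ.
- by move=> a b; have [M HM] := wu a b; exists M => x y; rewrite cnorm1J.
- by move=> y; have [p q] := p1 y; split => K x; [rewrite p|move=> nx; rewrite q// conjc0].
- by move=> y; have [p q] := p2 y; split => K x; [rewrite p|move=> nx; rewrite q// conjc0].
Qed.

Lemma smoothJ K1 K2 u : smooth K1 K2 u -> smooth K1 K2 (fun p => ((u p)^*)%C).
Proof.
move=> su; apply: (@smooth_coind K1 K2 (fun w => exists2 u, smooth K1 K2 u & w = fun p => ((u p)^*)%C)); last by exists u.
move=> _ [{su}u su ->]; split.
- exact: decayingJ (smooth_decaying su).
- move=> KZ; have [u' du su'] := smooth_d1 KZ su.
  by exists (fun p => ((u' p)^*)%C); [move=> x y; exact: is_cderiveJ|exists u'].
- move=> KZ; have [u' du su'] := smooth_d2 KZ su.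
  by exists (fun p => ((u' p)^*)%C); [move=> x y; exact: is_cderiveJ|exists u'].
Qed.

Lemma cmeasurable2_swap_args u : cmeasurable2 u -> cmeasurable2 (swap_args u).
Proof.
have m : measurable_fun setT (fun p : mR * mR => (p.2, p.1)).
  by apply/measurable_fun_pairP; split; [exact: measurable_snd|exact: measurable_fst].
by move=> [u1 u2]; split; [exact: (measurableT_comp u1 m)|exact: (measurableT_comp u2 m)].
Qed.

Lemma decaying_swap_args K1 K2 u : decaying K1 K2 u -> decaying K2 K1 (swap_args u).
Proof.
move=> [mu wu p1 p2]; split => //; first exact: cmeasurable2_swap_args.
by move=> a b; have [M HM] := wu b a; exists M => x y; rewrite (mulrC (kweight K2 a x)).
Qed.

Lemma smooth_swap_args K1 K2 u : smooth K1 K2 u -> smooth K2 K1 (swap_args u).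
Proof.
move=> su; apply: (@smooth_coind K2 K1 (fun w => exists2 u, smooth K1 K2 u & w = swap_args u)); last by exists u.
move=> _ [{su}u su ->]; split.
- exact: decaying_swap_args (smooth_decaying su).
- move=> KZ; have [u' du su'] := smooth_d2 KZ su.
  by exists (swap_args u'); [move=> x y; exact: du|exists u'].
- move=> KZ; have [u' du su'] := smooth_d1 KZ su.
  by exists (swap_args u'); [move=> x y; exact: du|exists u'].
Qed.

(** Smooth functions of polynomial growth together with their derivatives up to order n: the
    multipliers of the Schwartz class. *)
Fixpoint symboln (n : nat) (g : R -> C) : Prop :=
  (cmeasurable (g : mR -> C) /\ exists a M, forall x, cnorm1 (g x) <= M * (1 + `|x| ^+ a)) /\
  (if n is n'.+1 then exists2 g', forall x, is_cderive g x (g' x) & symboln n' g' else True).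

Definition symbol g := forall n, symboln n g.

Lemma pw_gt0 (x : R) a : 0 < 1 + `|x| ^+ a.
Proof. by apply: ltr_pwDl => //; exact: exprn_ge0. Qed.

Lemma symboln_base n g : symboln n g -> cmeasurable (g : mR -> C) /\ exists a M, forall x, cnorm1 (g x) <= M * (1 + `|x| ^+ a).
Proof. by case: n => [|n] []. Qed.

Lemma symboln_gr n g : symboln n g -> cmeasurable (g : mR -> C) /\ exists a M, 0 <= M /\ forall x, cnorm1 (g x) <= M * (1 + `|x| ^+ a).
Proof.
have H : (cmeasurable (g : mR -> C) /\ exists a M, forall x, cnorm1 (g x) <= M * (1 + `|x| ^+ a)) ->
  cmeasurable (g : mR -> C) /\ exists a M, 0 <= M /\ forall x, cnorm1 (g x) <= M * (1 + `|x| ^+ a).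
  move=> [mg [a [M HM]]]; split => //; exists a, M; split => //.
  by have := le_trans (cnorm1_ge0 _) (HM 0); rewrite pmulr_lge0 ?pw_gt0.
by case: n => [|n] [h _]; exact: H.
Qed.

Lemma symboln_low n g : symboln n.+1 g -> symboln n g.
Proof.
elim: n g => [|n IH] g [h [g' dg og]]; split => //.
by exists g' => //; exact: IH.
Qed.

Lemma pow1D_le (x : R) (a b : nat) : (1 + `|x| ^+ a) * (1 + `|x| ^+ b) <= 4 * (1 + `|x| ^+ (a + b)).
Proof.
have h (c k : nat) : `|x| ^+ c <= 1 + `|x| ^+ (c + k).
  have [x1|x1] := leP 1 `|x|.
    by rewrite exprD; apply: ler_wpDl => //; rewrite ler_peMr ?exprn_ge0// exprn_ege1.
  by apply: ler_wpDr; [exact: exprn_ge0|rewrite exprn_ile1// ltW].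
have := h a b; have := h b a; rewrite (addnC b) mulrDl mul1r mulrDr mulr1 -exprD.
have := exprn_ge0 (a + b) (normr_ge0 x).
move: (`|x| ^+ a) (`|x| ^+ b) (`|x| ^+ (a + b)) => p q z; lra.
Qed.

Lemma pow1_le (x : R) (a b : nat) : 1 + `|x| ^+ a <= 4 * (1 + `|x| ^+ (a + b)).
Proof.
apply: le_trans (pow1D_le x a b); rewrite ler_peMr ?addr_ge0 ?exprn_ge0//.
by rewrite lerDl exprn_ge0.
Qed.

Lemma symbolnD n c g h : symboln n g -> symboln n h -> symboln n (fun x => c * g x + h x).
Proof.
elim: n g h => [|n IH] g h og oh.
  have [mg [a [M [M0 HM]]]] := symboln_gr og; have [mh [b [N [N0 HN]]]] := symboln_gr oh.
  split => //; split; first by apply: cmeasurableD => //; apply: cmeasurableM => //; exact: cmeasurable_cst.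
  exists (a + b)%N, (cnorm1 c * M * 4 + N * 4) => x.
  apply: le_trans (cnorm1D _ _) _; rewrite mulrDl; apply: lerD.
    apply: le_trans (cnorm1M _ _) _; rewrite -!mulrA; apply: ler_wpM2l; first exact: cnorm1_ge0.
    by apply: le_trans (HM x) _; apply: ler_wpM2l => //; exact: pow1_le.
  apply: le_trans (HN x) _; rewrite -!mulrA; apply: ler_wpM2l => //.
  by rewrite addnC; exact: pow1_le.
have h0 := symboln_base (IH _ _ (symboln_low og) (symboln_low oh)); split => //.
- have [_ [g' dg og']] := og; have [_ [h' dh oh']] := oh.
  exists (fun x => c * g' x + h' x); last exact: IH.
  by move=> x; exact: is_cderive_lin.
Qed.

Lemma symbolnM n g h : symboln n g -> symboln n h -> symboln n (fun x => g x * h x).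
Proof.
elim: n g h => [|n IH] g h og oh.
  have [mg [a [M [M0 HM]]]] := symboln_gr og; have [mh [b [N [N0 HN]]]] := symboln_gr oh.
  split => //; split; first exact: cmeasurableM.
  exists (a + b)%N, (M * N * 4) => x.
  apply: le_trans (cnorm1M _ _) _; apply: (@le_trans _ _ ((M * (1 + `|x| ^+ a)) * (N * (1 + `|x| ^+ b)))).
    by apply: ler_pM; rewrite ?cnorm1_ge0.
  rewrite mulrACA -[leRHS]mulrA; apply: ler_wpM2l; first exact: mulr_ge0.
  exact: pow1D_le.
have h0 := symboln_base (IH _ _ (symboln_low og) (symboln_low oh)); split => //.
- have [_ [g' dg og']] := og; have [_ [h' dh oh']] := oh.
  exists (fun x => 1 * (g' x * h x) + g x * h' x).
    by move=> x; rewrite mul1r; exact: is_cderiveM.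
  by apply: symbolnD; apply: IH => //; exact: symboln_low.
Qed.

Lemma symbol_cst c : symbol (fun=> c).
Proof.
move=> n; elim: n c => [|n IH] c; split => //.
- split; first exact: cmeasurable_cst.
  by exists 0%N, (cnorm1 c) => x; rewrite expr0 ler_peMr ?cnorm1_ge0// lerDl.
- split; first exact: cmeasurable_cst.
  by exists 0%N, (cnorm1 c) => x; rewrite expr0 ler_peMr ?cnorm1_ge0// lerDl.
- by exists (fun=> 0) => // x; exact: is_cderive_cst.
Qed.

Lemma symbol_id : symbol (fun x => x%:C).
Proof.
move=> n.
have h : cmeasurable (fun x : mR => x%:C : C) /\ exists a M, forall x : R, cnorm1 (x%:C : C) <= M * (1 + `|x| ^+ a).
  split; first by apply: cmeasurableR; exact: measurable_id.
  by exists 1%N, 1 => x; rewrite cnorm1R mul1r expr1 lerDr.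
case: n => [|n]; split => //; exists (fun=> 1); last exact: symbol_cst.
by move=> x; exact: (is_cderiveR (is_derive_id x (1 : R))).
Qed.

Lemma japR (x a : R) : is_derive x 1 (fun t : R => (1 + t ^+ 2) `^ a) (2 * a * x * (1 + x ^+ 2) `^ (a - 1)).
Proof.
have E : (fun t : R => (1 + t ^+ 2) `^ a) = fun t => expR (a * ln (1 + t ^+ 2)).
  by apply/funext => t; rewrite /powR gt_eqF ?oneDsq_gt0.
rewrite E.
have h1 : is_derive x 1 (fun t : R => 1 + t ^+ 2) (2 * x).
  by apply: is_derive_eq; rewrite /GRing.scale/=; ring.
have h2 := @is_derive1_comp _ (@ln R) (fun t : R => 1 + t ^+ 2) x _ _ (is_derive1_ln (oneDsq_gt0 x)) h1.
have h3 : is_derive x 1 (fun t : R => a * ln (1 + t ^+ 2)) (a * ((1 + x ^+ 2)^-1 * (2 * x))).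
  apply: is_derive_eq (is_deriveM (is_derive_cst a x 1) h2) _.
  change (a * ((1 + x ^+ 2)^-1 * (2 * x)) + ln (1 + x ^+ 2) * 0 = a * ((1 + x ^+ 2)^-1 * (2 * x))).
  by ring.
apply: is_derive_eq (@is_derive1_comp _ expR (fun t => a * ln (1 + t ^+ 2)) x _ _ (is_derive_expR _) h3) _.
have -> : expR (a * ln (1 + x ^+ 2)) = (1 + x ^+ 2) `^ a by rewrite /powR gt_eqF ?oneDsq_gt0.
rewrite powRD; last by apply/implyP => _; rewrite gt_eqF ?oneDsq_gt0.
by rewrite powRN powRr1 ?(ltW (oneDsq_gt0 x))//; ring.
Qed.

Lemma jap_le (x a : R) : exists k, forall x : R, (1 + x ^+ 2) `^ a <= (1 + `|x| ^+ 2) ^+ k.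
Proof.
exists (Num.trunc `|a|).+1 => y; rewrite real_normK ?num_real//.
rewrite -[leRHS]powR_mulrn ?(ltW (oneDsq_gt0 y))//.
apply: ler_powR; first by rewrite lerDl sqr_ge0.
apply: le_trans (ler_norm a) _; exact: ltW (truncnS_gt _).
Qed.

(** The derivative is 2 a x (1 + x^2)^(a - 1), a member of the same family times a symbol; hence the
    induction on the order with the exponent left free. *)
Lemma symbol_jap a : symbol (fun x => ((1 + x ^+ 2) `^ a)%:C).
Proof.
move=> n; elim: n a => [|n IH] a.
  split => //; split.
    apply: cmeasurableR; apply: continuous_measurable_fun => x.
    exact: is_derive_cont (japR x a).
  have [k Hk] := jap_le 0 a.
  have [N HN] : exists N, forall x : R, (1 + `|x| ^+ 2) ^+ k <= N * (1 + `|x| ^+ (2 * k)).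
    elim: k {Hk} => [|k [N IHk]]; first by exists 1 => x; rewrite muln0 !expr0 mul1r lerDl.
    exists (N * 4) => x; rewrite exprS.
    apply: le_trans (ler_wpM2l _ (IHk x)) _; first by rewrite addr_ge0// exprn_ge0.
    have N0 : 0 <= N.
      have : 0 <= (1 + `|x| ^+ 2) ^+ k by rewrite exprn_ge0// addr_ge0// exprn_ge0.
      by move=> /le_trans/(_ (IHk x)); rewrite pmulr_lge0 ?pw_gt0.
    rewrite mulrCA -mulrA; apply: ler_wpM2l => //.
    by rewrite mulnS; exact: pow1D_le.
  exists (2 * k)%N, N => x; rewrite cnorm1R ger0_norm ?powR_ge0//.
  exact: le_trans (Hk x) (HN x).
have h0 := symboln_base (IH a); split => //.
exists (fun x => ((2 * a)%:C * x%:C) * ((1 + x ^+ 2) `^ (a - 1))%:C).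
  by move=> x; rewrite -!rmorphM; exact: is_cderiveR (japR x a).
apply: symbolnM => //; apply: symbolnM; [exact: symbol_cst|exact: symbol_id].
Qed.

Lemma decayingM1 K1 K2 g u n : K1 <> Pr -> symboln n g -> decaying K1 K2 u -> decaying K1 K2 (fun p => g p.1 * u p).
Proof.
move=> KP og [mu wu p1 p2]; have [mg [a [M [M0 HM]]]] := symboln_gr og; split.
- by apply: cmeasurableM => //; have [] := cmeasurable_measurable mg.
- move=> i j; have [A HA] := wu i j; have [B HB] := wu (i + a)%N j.
  exists (M * (A + B)) => x y /=.
  have w0 : 0 <= kweight K1 i x * kweight K2 j y by rewrite mulr_ge0 ?kweight_ge0.
  apply: le_trans (ler_wpM2l w0 (cnorm1M _ _)) _.
  apply: (@le_trans _ _ (kweight K1 i x * kweight K2 j y * (M * (1 + `|x| ^+ a) * cnorm1 (u (x, y))))).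
    by apply: ler_wpM2l => //; apply: ler_wpM2r; [exact: cnorm1_ge0|exact: HM].
  have Ea : `|x| ^+ a = kweight K1 a x by case: K1 KP {p1 wu A HA B HB w0}.
  have := HA x y; have := HB x y; rewrite kweightD -Ea => h1 h2.
  have -> : kweight K1 i x * kweight K2 j y * (M * (1 + `|x| ^+ a) * cnorm1 (u (x, y))) =
     M * (kweight K1 i x * kweight K2 j y * cnorm1 (u (x, y)) + kweight K1 i x * `|x| ^+ a * kweight K2 j y * cnorm1 (u (x, y))) by ring.
  by apply: ler_wpM2l => //; apply: lerD.
- move=> y; have [_ q] := p1 y; split => K x; first by case: (KP K).
  by move=> nx; rewrite /= q// mulr0.
- by move=> x; have [p q] := p2 x; split => K y; [rewrite /= p|move=> ny; rewrite /= q// mulr0].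
Qed.

Lemma sm_low n K1 K2 u : sm n.+1 K1 K2 u -> sm n K1 K2 u.
Proof.
elim: n u => [|n IH] u [b [d1 d2]]; split => //; split => KZ.
  by have [u' h1 h2] := d1 KZ; exists u' => //; exact: IH.
by have [u' h1 h2] := d2 KZ; exists u' => //; exact: IH.
Qed.

Lemma smM1 n K1 K2 g u : K1 <> Pr -> symboln n g -> sm n K1 K2 u -> sm n K1 K2 (fun p => g p.1 * u p).
Proof.
move=> KP; elim: n g u => [|n IH] g u og su.
  by split => //; exact: (decayingM1 KP og (sm_decaying su)).
split; first exact: (decayingM1 KP og (sm_decaying su)).
have [_ [g' dg og']] := og; have [_ [d1 d2]] := su.
have sn : sm n K1 K2 u := sm_low su.
split => KZ.
  have [u' du su'] := d1 KZ.
  exists (fun p => 1 * (g' p.1 * u p) + g p.1 * u' p).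
    by move=> x y /=; rewrite mul1r; exact: is_cderiveM.
  by apply: smD; apply: IH => //; exact: symboln_low.
have [u' du su'] := d2 KZ.
exists (fun p => g p.1 * u' p); last by apply: IH => //; exact: symboln_low.
move=> x y /=; apply: is_cderive_eq (is_cderiveM (is_cderive_cst _ y) (du x y)) _.
by rewrite mul0r add0r.
Qed.

Lemma smoothM1 K1 K2 g u : K1 <> Pr -> symbol g -> smooth K1 K2 u -> smooth K1 K2 (fun p => g p.1 * u p).
Proof. by move=> KP og su n; exact: smM1. Qed.

Lemma smoothM2 K1 K2 g u : K2 <> Pr -> symbol g -> smooth K1 K2 u -> smooth K1 K2 (fun p => g p.2 * u p).
Proof.
move=> KP og su; have := smooth_swap_args (smoothM1 KP og (smooth_swap_args su)).
by rewrite (_ : swap_args _ = fun p => g p.2 * u p)//; apply/funext => -[x y].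
Qed.

End Classes.

(** * The partial Fourier transform on rapidly decreasing functions *)

Section Transform.
Variable R : realType.
Local Notation mR := (measurableTypeR R).
Local Notation C := R[i].
Local Notation fn := (R * R -> C).

Lemma WkV K (x : R) : (kdecay K x)^-1 <= kweight K 0 x + kweight K 2 x.
Proof.
have h : (lorentz x)^-1 <= 1 + `|x| ^+ 2 by rewrite /lorentz invrK real_normK// num_real.
by case: K; rewrite /= ?expr0// invr1 lerDl.
Qed.

(** Two further powers of each variable buy the integrable factor; the four constants belong to the
    four terms of (1 + |x|^2)(1 + |y|^2). *)
Lemma decay K1 K2 (u : fn) a b : decaying K1 K2 u -> exists2 c, 0 <= c &
  forall x y, kweight K1 a x * kweight K2 b y * cnorm1 (u (x, y)) <= c * (kdecay K1 x * kdecay K2 y).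
Proof.
move=> [_ wu _ _].
have [M1 H1] := wu a b; have [M2 H2] := wu (a + 2)%N b.
have [M3 H3] := wu a (b + 2)%N; have [M4 H4] := wu (a + 2)%N (b + 2)%N.
have H x y : kweight K1 a x * kweight K2 b y * cnorm1 (u (x, y)) <= (M1 + M2 + M3 + M4) * (kdecay K1 x * kdecay K2 y).
  have p1 := kdecay_gt0 K1 x; have p2 := kdecay_gt0 K2 y.
  rewrite -ler_pdivrMr ?mulr_gt0// invfM.
  set w := kweight K1 a x * kweight K2 b y * _.
  have w0 : 0 <= w by rewrite !mulr_ge0 ?kweight_ge0 ?cnorm1_ge0.
  apply: (@le_trans _ _ (w * ((kweight K1 0 x + kweight K1 2 x) * (kweight K2 0 y + kweight K2 2 y)))).
    by apply: ler_wpM2l => //; apply: ler_pM; [rewrite invr_ge0 ltW|rewrite invr_ge0 ltW|exact: WkV|exact: WkV].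
  have := H1 x y; have := H2 x y; have := H3 x y; have := H4 x y.
  rewrite !kweightD !kweight0 /w; move: (kweight K1 a x) (kweight K2 b y) (kweight K1 2 x) (kweight K2 2 y) (cnorm1 _) => p q r s t.
  move=> h1 h2 h3 h4.
  have -> : p * q * t * ((1 + r) * (1 + s)) = p * q * t + p * r * q * t + p * (q * s) * t + p * r * (q * s) * t by ring.
  lra.
exists (M1 + M2 + M3 + M4) => //.
have w0 : 0 <= kweight K1 a 0 * kweight K2 b 0 * cnorm1 (u (0, 0)) by rewrite !mulr_ge0 ?kweight_ge0 ?cnorm1_ge0.
by have := le_trans w0 (H 0 0); rewrite pmulr_lge0// mulr_gt0 ?kdecay_gt0.
Qed.

Lemma decay1 K1 K2 (u : fn) b : decaying K1 K2 u -> exists2 c, 0 <= c &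
  forall x y, kweight K2 b y * cnorm1 (u (x, y)) <= c * kdecay K1 x.
Proof.
move=> /(decay 0 b)[c c0 H]; exists c => // x y.
have := H x y; rewrite kweight0 mul1r => /le_trans; apply; apply: ler_wpM2l => //.
by rewrite ler_piMr ?kdecay_le1// ltW// kdecay_gt0.
Qed.

Lemma cmeasurable2_sec1 (u : fn) y : cmeasurable2 u -> cmeasurable ((fun x => u (x, y)) : mR -> C).
Proof.
have m : measurable_fun setT (fun x : mR => (x, y : mR)) by exact: measurable_pair2.
by move=> [u1 u2]; split; [exact: (measurableT_comp u1 m)|exact: (measurableT_comp u2 m)].
Qed.

Lemma cmeasurable2_sec2 (u : fn) x : cmeasurable2 u -> cmeasurable ((fun y => u (x, y)) : mR -> C).
Proof.
have m : measurable_fun setT (fun y : mR => (x : mR, y)) by exact: measurable_pair1.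
by move=> [u1 u2]; split; [exact: (measurableT_comp u1 m)|exact: (measurableT_comp u2 m)].
Qed.

(** The factor [ind] restores the encoding of functions on Z when the dual variable is discrete. *)
Definition FTx (K : kind) (sg : R) (u : fn) : fn := fun p =>
  (ind (dual K) p.1)%:C * FT K sg (fun x => u (x, p.2)) p.1.

Lemma FT_cintegrable K1 K2 sg (u : fn) xi y : decaying K1 K2 u ->
  cintegrable (kmeasure K1) (fun x => cexp (sg * xi * x) * u (x, y)).
Proof.
move=> bu; have [c c0 H] := decay1 0 bu.
apply: (@cintegrable_dom _ _ _ (kmeasure K1) _ (fun x => 2 * c * kdecay K1 x)); last exact: iW.
  by apply: cmeasurableM; [apply: cmeasurable_cexp; meas|apply: cmeasurable2_sec1; case: bu].
move=> x; apply: le_trans (cnorm1M _ _) _; rewrite -[leRHS]mulrA.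
apply: ler_pM; rewrite ?cnorm1_ge0 ?cnorm1_cexp//.
by have := H x y; rewrite kweight0 mul1r.
Qed.

Lemma cnorm1_ind K q (z : C) : cnorm1 ((ind K q)%:C * z) <= cnorm1 z.
Proof.
rewrite cnorm1RM; have /andP[i0 i1] := ind_le1 K q.
by rewrite ger0_norm// ler_piMl ?cnorm1_ge0.
Qed.

Lemma FTx_bound K1 K2 sg (u : fn) b : decaying K1 K2 u ->
  exists M, forall xi y, kweight K2 b y * cnorm1 (FTx K1 sg u (xi, y)) <= M.
Proof.
move=> bu; have [c c0 H] := decay1 b bu.
exists (2 * (2 * (c * \int[kmeasure K1]_x kdecay K1 x))) => xi y.
have w0 := kweight_ge0 K2 b y.
apply: le_trans (ler_wpM2l w0 (cnorm1_ind _ _ _)) _.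
have -> : kweight K2 b y * cnorm1 (FT K1 sg (fun x => u (x, y)) xi) =
    cnorm1 (cint (kmeasure K1) (fun x => (kweight K2 b y)%:C * (cexp (sg * xi * x) * u (x, y)))).
  by rewrite cintZ; [rewrite cnorm1RM ger0_norm|exact: FT_cintegrable bu].
have -> : 2 * (c * \int[kmeasure K1]_x kdecay K1 x) = \int[kmeasure K1]_x (2 * c * kdecay K1 x).
  by rewrite RintegralZl ?mulrA//; exact: integrable_kdecay.
apply: cnorm1_cint; [|move=> x|exact: iW].
  by apply: cintegrableZ; exact: FT_cintegrable bu.
rewrite cnorm1RM ger0_norm//; apply: le_trans (ler_wpM2l w0 (cnorm1M _ _)) _.
rewrite mulrCA -[leRHS]mulrA; apply: ler_pM; [exact: cnorm1_ge0|by rewrite mulr_ge0 ?cnorm1_ge0|exact: cnorm1_cexp|exact: H].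
Qed.

Lemma cmeasurable2_FT K sg (u : fn) : cmeasurable2 u -> cmeasurable2 (fun p => FT K sg (fun x => u (x, p.2)) p.1).
Proof.
move=> mu.
have m (f : (mR * mR) * mR -> mR * mR) : measurable_fun setT f -> cmeasurable (fun p => u (f p)).
  by move=> mf; case: mu => u1 u2; split; [exact: (measurableT_comp u1 mf)|exact: (measurableT_comp u2 mf)].
apply: (@cmeasurable_cint R _ _ (mR * mR)%type mR (kmeasure_sf R K)
  (fun q : (mR * mR) * mR => cexp (sg * q.1.1 * q.2) * u (q.2, q.1.2))).
have m1 : measurable_fun setT (fun q : (mR * mR) * mR => q.1.1).
  exact: (measurableT_comp measurable_fst measurable_fst).
have m2 : measurable_fun setT (fun q : (mR * mR) * mR => q.1.2).
  exact: (measurableT_comp measurable_snd measurable_fst).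
apply: cmeasurableM.
  apply: cmeasurable_cexp; apply: measurable_funM; last exact: measurable_snd.
  by apply: measurable_funM => //; exact: measurable_cst.
apply: (m (fun q => (q.2, q.1.2))).
by apply/measurable_fun_pairP; split => //; exact: measurable_snd.
Qed.

Lemma cmeasurable2_FTx K sg (u : fn) : cmeasurable2 u -> cmeasurable2 (FTx K sg u).
Proof.
move=> mu; apply: cmeasurableM; last exact: cmeasurable2_FT.
by have [h _] := cmeasurable_measurable (cmeasurableR (@measurable_ind R (dual K))); exact: h.
Qed.

Lemma cnorm1_i (a : R) (z : C) : cnorm1 ((0 +i* a) * z) = `|a| * cnorm1 z.
Proof.
have -> : cnorm1 ((0 +i* a) * z) = `|0 * complex.Re z - a * complex.Im z| + `|0 * complex.Im z + a * complex.Re z|.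
  by rewrite /cnorm1 !cE.
by rewrite !mul0r sub0r add0r normrN !normrM -mulrDr /cnorm1 addrC.
Qed.

(** Integration by parts. On a period the boundary terms cancel only at integer frequencies, but off
    Z both sides vanish by [ind]. *)
Lemma FTx_d1 K1 K2 sg (u u' : fn) : K1 <> Zc -> sg ^+ 2 = 1 -> smooth K1 K2 u -> has_pderiv1 u u' -> smooth K1 K2 u' ->
  forall p, FTx K1 sg u' p = (0 +i* - (sg * p.1)) * FTx K1 sg u p.
Proof.
move=> KZ sg2 su du su' [xi y] /=.
have [u'' du' su''] := smooth_d1 KZ su'.
have [c c0 Hc] := decay1 0 (smooth_decaying su); have [c' c'0 Hc'] := decay1 0 (smooth_decaying su').
rewrite /FTx /=.
have [iz|iz] := eqVneq (ind (dual K1) xi) 0; first by rewrite iz !mul0r mulr0.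
have E : cint (kmeasure K1) (fun x => (0 +i* (sg * xi)) * (cexp (sg * xi * x) * u (x, y)) + cexp (sg * xi * x) * u' (x, y)) = 0.
  pose a : C := 0 +i* (sg * xi).
  have dc (x : R) : is_cderive (fun x => cexp (sg * xi * x)) x (a * cexp (sg * xi * x)) := is_cderive_cexp _ x.
  apply: (@cint_deriv0 R K1 (fun x => cexp (sg * xi * x) * u (x, y)) _
     (fun x => a * (a * cexp (sg * xi * x) * u (x, y) + cexp (sg * xi * x) * u' (x, y)) +
       (a * cexp (sg * xi * x) * u' (x, y) + cexp (sg * xi * x) * u'' (x, y)))
     (2 * c + (`|sg * xi| * (2 * c) + 2 * c'))) => //.
  - by move=> x; apply: is_cderive_eq (is_cderiveM (dc x) (du x y)) _; rewrite mulrA.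
  - move=> x; apply: is_cderiveD; last exact: (is_cderiveM (dc x) (du' x y)).
    apply: is_cderive_eq (is_cderiveM (is_cderive_cst a x) (is_cderiveM (dc x) (du x y))) _.
    by rewrite mul0r add0r.
  - move=> x; apply: le_trans (cnorm1M _ _) _; apply: (@le_trans _ _ (2 * c * kdecay K1 x)); last first.
      by apply: ler_wpM2r; [rewrite ltW// kdecay_gt0|rewrite lerDl addr_ge0 ?mulr_ge0].
    rewrite -[leRHS]mulrA; apply: ler_pM; rewrite ?cnorm1_ge0 ?cnorm1_cexp//.
    by have := Hc x y; rewrite kweight0 mul1r.
  - move=> x; apply: (@le_trans _ _ ((`|sg * xi| * (2 * c) + 2 * c') * kdecay K1 x)); last first.
      by apply: ler_wpM2r; [rewrite ltW// kdecay_gt0|rewrite lerDr mulr_ge0].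
    apply: le_trans (cnorm1D _ _) _; rewrite mulrDl; apply: lerD.
      rewrite cnorm1_i -[leRHS]mulrA; apply: ler_wpM2l => //.
      apply: le_trans (cnorm1M _ _) _; rewrite -[leRHS]mulrA; apply: ler_pM; rewrite ?cnorm1_ge0 ?cnorm1_cexp//.
      by have := Hc x y; rewrite kweight0 mul1r.
    apply: le_trans (cnorm1M _ _) _; rewrite -[leRHS]mulrA; apply: ler_pM; rewrite ?cnorm1_ge0 ?cnorm1_cexp//.
    by have := Hc' x y; rewrite kweight0 mul1r.
  - move=> KP x; have [per _] := decaying_spr1 (smooth_decaying su) y; rewrite per//; congr (_ * _).
    have iZ : inZ xi by move: iz; rewrite KP /ind/=; case: inZ => //; rewrite eqxx.
    have [s -> _] := sgn_int sg2; have /intrP[m ->] := iZ.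
    by rewrite mulrDr -intrM cexp_pi2n.
have i1 := FT_cintegrable sg xi y (smooth_decaying su); have i2 := FT_cintegrable sg xi y (smooth_decaying su').
rewrite cintD// in E; last exact: cintegrableZ.
rewrite cintZ// in E.
rewrite mulrCA; congr (_ * _); rewrite /FT.
move/eqP: E; rewrite addrC addr_eq0 => /eqP ->.
have -> : (0 +i* - (sg * xi) : C) = - (0 +i* (sg * xi)) by apply: cP; rewrite ?cE /= ?oppr0.
by rewrite mulNr.
Qed.

(** Each power of the dual variable is traded for a derivative of [u]; when [u] lives on Z the dual
    is a period and carries no weight. *)
Lemma decaying_FTx K1 K2 sg (u : fn) : sg ^+ 2 = 1 -> smooth K1 K2 u -> decaying (dual K1) K2 (FTx K1 sg u).
Proof.
move=> sg2 su; have [mu wu p1 p2] := smooth_decaying su; split.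
- exact: cmeasurable2_FTx.
- have n1 : `|sg| = 1 by move/eqP: sg2; rewrite sqrf_eq1 => /orP[/eqP ->|/eqP ->]; rewrite ?normrN normr1.
  move=> a; elim: a u su {mu wu p1 p2} => [|a IH] u su b.
    have [M H] := FTx_bound sg b (smooth_decaying su); exists M => x y.
    by rewrite kweight0 mul1r.
  have [KZ|KZ] : K1 = Zc \/ K1 <> Zc by case: (K1); [right|right|left].
    have [M H] := FTx_bound sg b (smooth_decaying su); exists M => x y.
    by have -> : kweight (dual K1) a.+1 x = 1; [rewrite KZ|rewrite mul1r].
  have [u' du su'] := smooth_d1 KZ su; have [M HM] := IH u' su' b; exists M => x y.
  have := HM x y; rewrite (FTx_d1 KZ sg2 su du su') cnorm1_i normrN normrM n1 mul1r /=.
  have -> : kweight (dual K1) a.+1 x = kweight (dual K1) a x * `|x| by case: (K1) KZ => // _; rewrite /= exprSr.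
  by apply: le_trans; rewrite le_eqVlt; apply/orP; left; apply/eqP; ring.
- move=> y; split => K xi.
    (* Only integer x contribute, since [u] vanishes off Z, so the exponentials are 2 pi-periodic in
       xi. *)
    have KZ : K1 = Zc by case: (K1) K.
    rewrite /FTx KZ /ind/=; congr (_ * _); apply: cint_ext => x.
    have [iz|iz] := boolP (inZ x); last by have [_ ->] := p1 y; rewrite ?mulr0.
    have [s -> _] := sgn_int sg2; have /intrP[m ->] := iz.
    congr (_ * _); have -> : s%:~R * (xi + 2 * pi) * m%:~R = s%:~R * xi * m%:~R + (s * m)%:~R * (2 * pi) by rewrite intrM; ring.
    exact: cexp_pi2n.
  by move=> nz; rewrite /FTx K /ind/= (negbTE nz) mul0r.
- move=> xi; split => K y.
    by rewrite /FTx /=; congr (_ * _); apply: cint_ext => x; have [per _] := p2 x; rewrite per.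
  move=> nz; rewrite /FTx /=.
  have -> : FT K1 sg (fun x => u (x, y)) xi = 0; last by rewrite mulr0.
  rewrite /FT -(cint0 (kmeasure K1)); apply: cint_ext => x.
  by have [_ ->] := p2 x; rewrite ?mulr0.
Qed.

Lemma FTx_d2 K1 K2 sg (u u' : fn) : decaying K1 K2 u -> decaying K1 K2 u' -> has_pderiv2 u u' ->
  has_pderiv2 (FTx K1 sg u) (FTx K1 sg u').
Proof.
move=> bu bu' du xi y; rewrite /FTx /=.
have [c c0 H] := decay1 0 bu'.
have D : is_cderive (fun t => FT K1 sg (fun x => u (x, t)) xi) y (FT K1 sg (fun x => u' (x, y)) xi).
  apply: (@is_cderive_cint R _ mR (kmeasure K1) (fun t x => cexp (sg * xi * x) * u (x, t))
    (fun t x => cexp (sg * xi * x) * u' (x, t)) (fun x => 2 * c * kdecay K1 x) y).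
  - by move=> t; exact: FT_cintegrable bu.
  - move=> t x; apply: is_cderive_eq (is_cderiveM (is_cderive_cst _ t) (du x t)) _.
    by rewrite mul0r add0r.
  - move=> t x; apply: le_trans (cnorm1M _ _) _; rewrite -[leRHS]mulrA.
    apply: ler_pM; rewrite ?cnorm1_ge0 ?cnorm1_cexp//.
    by have := H x t; rewrite kweight0 mul1r.
  - exact: iW.
apply: is_cderive_eq (is_cderiveM (is_cderive_cst _ y) D) _.
by rewrite mul0r add0r.
Qed.

(** Differentiation under the integral. The dual variable is continuous exactly when K1 is not [Pr],
    and then multiplication by x preserves the class. *)
Lemma FTx_dxi K1 K2 sg (u : fn) : K1 <> Pr -> smooth K1 K2 u ->
  has_pderiv1 (FTx K1 sg u) (FTx K1 sg (fun p => (0 +i* sg) * (p.1%:C * u p))).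
Proof.
move=> KP su xi y; rewrite /FTx /=.
have i1 q : ind (dual K1) q = 1 by case: (K1) KP.
have su' : smooth K1 K2 (fun p => p.1%:C * u p).
  exact: (smoothM1 KP (@symbol_id R) su).
have [c c0 H] := decay1 0 (smooth_decaying su').
have D : is_cderive (fun t => FT K1 sg (fun x => u (x, y)) t) xi
    (FT K1 sg (fun x => (0 +i* sg) * (x%:C * u (x, y))) xi).
  apply: (@is_cderive_cint R _ mR (kmeasure K1) (fun t x => cexp (sg * t * x) * u (x, y))
    (fun t x => cexp (sg * t * x) * ((0 +i* sg) * (x%:C * u (x, y)))) (fun x => 2 * (`|sg| * c) * kdecay K1 x) xi).
  - by move=> t; exact: FT_cintegrable (smooth_decaying su).
  - move=> t x.
    have dc : is_cderive (fun t => cexp (sg * t * x)) t ((0 +i* (sg * x)) * cexp (sg * t * x)).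
      have := is_cderive_cexp (sg * x) t.
      by under eq_fun do rewrite -mulrA (mulrC x) mulrA; rewrite -[sg * x * t]mulrA (mulrC x) mulrA.
    apply: is_cderive_eq (is_cderiveM dc (is_cderive_cst _ t)) _.
    rewrite mulr0 addr0.
    have -> : (0 +i* (sg * x) : C) = (0 +i* sg) * x%:C.
      have sE : (0 +i* (sg * x) : C) = Complex 0 (sg * x) by [].
      by apply: cP; rewrite cE /= ?mul0r ?mulr0 ?addr0 ?subr0 ?add0r.
    by ring.
  - move=> t x; apply: le_trans (cnorm1M _ _) _; rewrite -[leRHS]mulrA.
    apply: ler_pM; rewrite ?cnorm1_ge0 ?cnorm1_cexp// cnorm1_i -mulrA; apply: ler_wpM2l => //.
    by have := H x y; rewrite kweight0 mul1r.
  - exact: iW.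
under eq_fun do rewrite i1.
rewrite i1; apply: is_cderive_eq (is_cderiveM (is_cderive_cst _ xi) D) _.
by rewrite mul0r add0r.
Qed.

(** The transforms of smooth functions form a class closed under differentiation: d_xi is the
    transform of i sg x u, and d_y commutes with the transform. *)
Lemma smooth_FTx K1 K2 sg (u : fn) : sg ^+ 2 = 1 -> smooth K1 K2 u -> smooth (dual K1) K2 (FTx K1 sg u).
Proof.
move=> sg2 su.
apply: (@smooth_coind R (dual K1) K2 (fun w => exists2 u, smooth K1 K2 u & w = FTx K1 sg u)); last by exists u.
move=> _ [{su}u su ->]; split.
- exact: decaying_FTx.
- move=> KZ; have KP : K1 <> Pr by move=> E; rewrite E in KZ.
  exists (FTx K1 sg (fun p => (0 +i* sg) * (p.1%:C * u p))); first exact: (FTx_dxi sg KP su).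
  exists (fun p => (0 +i* sg) * (p.1%:C * u p)) => //.
  by apply: smoothZ; exact: (smoothM1 KP (@symbol_id R) su).
- move=> KZ; have [u' du su'] := smooth_d2 KZ su.
  by exists (FTx K1 sg u'); [exact: (FTx_d2 sg (smooth_decaying su) (smooth_decaying su') du)|exists u'].
Qed.

Lemma is_cderive_lip (h h' : R -> C) (c : R) : (forall x, is_cderive h x (h' x)) -> (forall x, cnorm1 (h' x) <= c) ->
  forall x y, cnorm1 (h x - h y) <= (2 * c) * `|x - y|.
Proof.
move=> dh hc.
have L (g g' : R -> R) : (forall x : R, is_derive x 1 g (g' x)) -> (forall x, `|g' x| <= c) ->
    forall x y, y <= x -> `|g x - g y| <= c * `|x - y|.
  move=> dg gc x y yx.
  have cg : {within `[y, x], continuous g}.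
    by apply: continuous_subspaceT => z; exact: is_derive_cont (dg z).
  have [z _ ->] := @MVT_segment R g g' y x yx (fun z _ => dg z) cg.
  by rewrite normrM; apply: ler_wpM2r.
have L2 x y : y <= x -> cnorm1 (h x - h y) <= 2 * c * `|x - y|.
  move=> yx; rewrite /cnorm1 !cE -mulrA mulr_natl mulr2n; apply: lerD.
    apply: (L (fun x => complex.Re (h x)) (fun x => complex.Re (h' x))) => //.
      by move=> z; have [] := dh z.
    by move=> z; apply: le_trans (hc z); exact: re_cnorm1.
  apply: (L (fun x => complex.Im (h x)) (fun x => complex.Im (h' x))) => //.
    by move=> z; have [] := dh z.
  by move=> z; apply: le_trans (hc z); exact: im_cnorm1.
move=> x y; have [yx|xy] := leP y x; first exact: L2.
by rewrite -cnorm1N opprB distrC; apply: L2; exact: ltW.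
Qed.

Lemma FTx_inv K1 K2 sg (u : fn) : sg ^+ 2 = 1 -> smooth K1 K2 u ->
  FTx (dual K1) (- sg) (FTx K1 sg u) = fun p => (2 * pi)%:C * u p.
Proof.
move=> sg2 su; apply/funext => -[x0 y].
have [mu wu p1 p2] := smooth_decaying su.
have [c c0 H] := decay1 0 (smooth_decaying su).
have [c' c'0 H'] := decay1 0 (decaying_FTx sg2 su).
have mh := cmeasurable2_sec1 y mu.
have dd : dual (dual K1) = K1 by case: (K1).
have E : FTx (dual K1) (- sg) (FTx K1 sg u) (x0, y) = (ind K1 x0)%:C *
   cint (kmeasure (dual K1)) (fun q => cexp (- sg * q * x0) * ((ind (dual K1) q)%:C * FT K1 sg (fun x => u (x, y)) q)).
  rewrite /FTx dd /=; congr (_ * _); apply: cint_ext => q; congr (cexp _ * _); ring.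
rewrite E {E}.
have hW x : cnorm1 (u (x, y)) <= c * kdecay K1 x by have := H x y; rewrite kweight0 mul1r.
have FW q : cnorm1 ((ind (dual K1) q)%:C * FT K1 sg (fun x => u (x, y)) q) <= c' * kdecay (dual K1) q.
  by have := H' q y; rewrite kweight0 mul1r.
(* A bounded derivative gives the Lipschitz bound that the Poisson kernel arguments ask for. *)
have lip : K1 <> Zc -> exists L, forall x z, cnorm1 (u (x, y) - u (z, y)) <= L * `|x - z|.
  move=> KZ; have [u' du su'] := smooth_d1 KZ su; have [M HM] := decaying_wt (smooth_decaying su') 0 0.
  exists (2 * M); apply: (@is_cderive_lip (fun x => u (x, y)) (fun x => u' (x, y))) => [x|x]; first exact: du.
  by have := HM x y; rewrite !kweight0 !mul1r.
case: K1 su p1 p2 wu H c' H' c'0 dd hW FW lip {mu} => su p1 p2 wu H c' H' c'0 dd hW FW lip.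
- have [L HL] := lip (fun e => ltac:(discriminate e)).
  rewrite /ind mul1r; under cint_ext do rewrite mul1r.
  apply: (@inv_Ln R sg (fun x => u (x, y)) x0 c c' L) => //.
  by move=> q; have := FW q; rewrite /ind mul1r.
- have [L HL] := lip (fun e => ltac:(discriminate e)).
  rewrite [X in X%:C * _]/ind mul1r.
  apply: (@inv_Pr R sg (fun x => u (x, y)) x0 c c' L) => //.
    by move=> x; have := hW x; rewrite /= mulr1.
  by move=> x; have [->] := p1 y.
- have [iz|iz] := boolP (inZ x0); last first.
    rewrite [X in X%:C * _]/ind (negbTE iz) mul0r.
    by have [_ ->] := p1 y; rewrite ?mulr0.
  rewrite [X in X%:C * _]/ind iz mul1r.
  transitivity (cint (kmeasure Pr) (fun q => cexp (- sg * q * x0) * FT Zc sg (fun x => u (x, y)) q)).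
    by apply: cint_ext => q; rewrite /ind mul1r.
  exact: (@inv_Zc R sg (fun x => u (x, y)) x0 c).
Qed.

End Transform.

(** * Schwartz functions as a smooth class *)

Section Schwartz.
Variable R : realType.
Local Notation mR := (measurableTypeR R).
Local Notation C := R[i].
Local Notation fn := (R * R -> C).
Local Notation re := (@complex.Re R).
Local Notation im := (@complex.Im R).

Definition xkind (D : xspace) : kind := match D with Torus => Pr | Line => Ln end.
Definition xikind (D : xspace) : kind := dual (xkind D).

Lemma cintegral_xv (D : xspace) (f : fn) :
  cintegral (xv_measure R D) f = cint (kmeasure_sf R (xkind D) \x kmeasure_sf R Ln)%E f.
Proof. by case: D. Qed.

Lemma cintegral_freq (D : xspace) (f : fn) :
  cintegral (freq_measure R D) f = cint (kmeasure_sf R (xikind D) \x kmeasure_sf R Ln)%E f.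
Proof. by case: D. Qed.

Lemma is_derive_dirX (f : R * R -> R) (x y l : R) :
  is_derive (x, y) (dir R X) f l <-> is_derive x 1 (fun t => f (t, y)) l.
Proof.
have E : (fun h : R => h^-1 *: ((f \o shift (x, y)) (h *: (dir R X)) - f (x, y))) =
  (fun h : R => h^-1 *: (((fun t => f (t, y)) \o shift x) (h *: (1 : R)) - f (x, y))).
  apply/funext => h /=; congr (_ *: (f _ - _)).
  change ((h * 1 + x, h * 0 + y) = (h * 1 + x, y)).
  by rewrite mulr0 add0r.
split => -[D1 D2]; split.
- by rewrite /derivable -E.
- by rewrite -D2 /derive E.
- by rewrite /derivable E.
- by rewrite -D2 /derive -E.
Qed.

Lemma is_derive_dirV (f : R * R -> R) (x y l : R) :
  is_derive (x, y) (dir R V) f l <-> is_derive y 1 (fun t => f (x, t)) l.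
Proof.
have E : (fun h : R => h^-1 *: ((f \o shift (x, y)) (h *: (dir R V)) - f (x, y))) =
  (fun h : R => h^-1 *: (((fun t => f (x, t)) \o shift y) (h *: (1 : R)) - f (x, y))).
  apply/funext => h /=; congr (_ *: (f _ - _)).
  change ((h * 0 + x, h * 1 + y) = (x, h * 1 + y)).
  by rewrite mulr0 add0r.
split => -[D1 D2]; split.
- by rewrite /derivable -E.
- by rewrite -D2 /derive E.
- by rewrite /derivable E.
- by rewrite -D2 /derive -E.
Qed.

Lemma pderivX (u u' : fn) : has_pderiv1 u u' -> pderiv X u = u'.
Proof.
move=> du; apply/funext => -[x y]; have [d1 d2] := du x y.
have [_ e1] := (is_derive_dirX (fun q => re (u q)) x y _).2 d1.
have [_ e2] := (is_derive_dirX (fun q => im (u q)) x y _).2 d2.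
by rewrite /pderiv e1 e2; case: (u' (x, y)).
Qed.

Lemma pderivV (u u' : fn) : has_pderiv2 u u' -> pderiv V u = u'.
Proof.
move=> du; apply/funext => -[x y]; have [d1 d2] := du x y.
have [_ e1] := (is_derive_dirV (fun q => re (u q)) x y _).2 d1.
have [_ e2] := (is_derive_dirV (fun q => im (u q)) x y _).2 d2.
by rewrite /pderiv e1 e2; case: (u' (x, y)).
Qed.

Lemma pderivable_has_pderiv1 (u : fn) : pderivable u -> has_pderiv1 u (pderiv X u).
Proof.
move=> du x y; have [d1 d2] := du X (x, y); split.
  by apply/(is_derive_dirX (fun q => re (u q))); apply/derivableP.
by apply/(is_derive_dirX (fun q => im (u q))); apply/derivableP.
Qed.

Lemma pderivable_has_pderiv2 (u : fn) : pderivable u -> has_pderiv2 u (pderiv V u).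
Proof.
move=> du x y; have [d1 d2] := du V (x, y); split.
  by apply/(is_derive_dirV (fun q => re (u q))); apply/derivableP.
by apply/(is_derive_dirV (fun q => im (u q))); apply/derivableP.
Qed.

Lemma hasd_pderivable (u u1 u2 : fn) : has_pderiv1 u u1 -> has_pderiv2 u u2 -> pderivable u.
Proof.
move=> h1 h2 c [x y]; case: c.
  have [d1 d2] := h1 x y; split.
    by have [] := (is_derive_dirX (fun q => re (u q)) x y _).2 d1.
  by have [] := (is_derive_dirX (fun q => im (u q)) x y _).2 d2.
have [d1 d2] := h2 x y; split.
  by have [] := (is_derive_dirV (fun q => re (u q)) x y _).2 d1.
by have [] := (is_derive_dirV (fun q => im (u q)) x y _).2 d2.
Qed.

(* Approximate x from below on a grid. *)
Lemma measurable_caratheodory (f : mR * mR -> R) :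
  (forall y, continuous (fun x : R => f (x, y))) ->
  (forall x, measurable_fun setT (fun y => f (x, y))) -> measurable_fun setT f.
Proof.
move=> cf mf.
pose gr (n : nat) (x : R) : int := Num.floor (x * n.+1%:R).
pose f_ (n : nat) (p : mR * mR) := f ((gr n p.1)%:~R / n.+1%:R, p.2).
apply: (@measurable_fun_cvg _ _ R setT f_).
  move=> n _ A mA; rewrite setTI.
  have -> : f_ n @^-1` A = \bigcup_(k in [set: int])
     (([set x | gr n x = k] : set mR) `*` ((fun y => f (k%:~R / n.+1%:R, y)) @^-1` A)).
    apply/seteqP; split => [[x y] /= H|[x y] [k _ /= [<- H]]] //.
    by exists (gr n x).
  apply: countable_bigcupT_measurable; first exact: countableP.
  move=> k; apply: measurableX; last first.
    by rewrite -[X in measurable X]setTI; apply: mf.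
  have -> : [set x : mR | gr n x = k] = `[k%:~R / n.+1%:R, (k + 1)%:~R / n.+1%:R[%classic.
    apply/seteqP; split => x /=; rewrite in_itv/= ler_pdivrMr// ltr_pdivlMr//.
      by move=> <-; rewrite /gr floor_le_tmp floorD1_gt.
    by move=> /floor_def.
  exact: measurable_itv.
move=> [x y] _; apply: (@cvg_comp _ _ _ (fun n => (gr n x)%:~R / n.+1%:R : R) (fun z : R => f (z, y)) _ (nbhs x)); last exact: cf.
apply/cvgrPdist_le => e e0; near=> n.
have n0 : 0 < n.+1%:R :> R by [].
apply: (@le_trans _ _ (n.+1%:R^-1)).
  have h1 : (gr n x)%:~R / n.+1%:R <= x by rewrite ler_pdivrMr// floor_le_tmp.
  have h2 : x < ((gr n x) + 1)%:~R / n.+1%:R by rewrite ltr_pdivlMr// floorD1_gt.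
  rewrite ger0_norm ?subr_ge0// lerBlDl; apply: ltW; apply: lt_le_trans h2 _.
  by rewrite intrD mulrDl mul1r lexx.
near: n; have /cvgr0Pnorm_le/(_ _ e0) := @cvg_harmonic R.
by apply: filterS => n; rewrite ger0_norm// invr_ge0.
Unshelve. all: by end_near. Qed.

(** Partial derivatives give continuity in each variable separately, and this is already enough for
    joint measurability. *)
Lemma hasd_cmeasurable2 (u u1 u2 : fn) : has_pderiv1 u u1 -> has_pderiv2 u u2 -> cmeasurable2 u.
Proof.
move=> h1 h2; split; apply: measurable_caratheodory => [y x|x].
- by have [d1 _] := h1 x y; exact: is_derive_cont d1.
- by apply: continuous_measurable_fun => y; have [d1 _] := h2 x y; exact: is_derive_cont d1.
- by have [_ d1] := h1 x y; exact: is_derive_cont d1.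
- by apply: continuous_measurable_fun => y; have [_ d1] := h2 x y; exact: is_derive_cont d1.
Qed.

Lemma weightE D k l (x y : R) : weight D k l (x, y) = kweight (xkind D) k x * kweight Ln l y.
Proof. by case: D. Qed.

Lemma is_cderive_shift (h : R -> C) (a x : R) l : is_cderive h (x + a) l -> is_cderive (fun t => h (t + a)) x l.
Proof.
have E (g : R -> R) (m : R) : is_derive (x + a) 1 g m -> is_derive x 1 (fun t => g (t + a)) m.
  move=> dg.
  have ha : is_derive x 1 (fun t : R => t + a) 1 by apply: is_derive_eq; rewrite addr0.
  by apply: is_derive_eq (@is_derive1_comp _ g (fun t => t + a) x _ _ _ _) _; rewrite mulr1.
by move=> [d1 d2]; split; [exact: (E (fun t => re (h t)))|exact: (E (fun t => im (h t)))].
Qed.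

Lemma schwartz_pderiv D c (u : fn) : schwartz D u -> schwartz D (pderiv c u).
Proof.
move=> [per pd wt]; split.
- move=> DT x v; have p := per DT.
  have du : pderivable u := pd [::].
  case: c.
    have h := pderivable_has_pderiv1 du.
    apply: (is_cderive_unique _ (h x v)).
    have := is_cderive_shift (h (x + 2 * pi) v).
    by under eq_fun do rewrite p.
  have h := pderivable_has_pderiv2 du.
  apply: (is_cderive_unique _ (h x v)).
  by have := h (x + 2 * pi) v; under eq_fun do rewrite p.
- by move=> w; have := pd (rcons w c); rewrite /iter_pderiv foldr_rcons.
- by move=> w; have := wt (rcons w c); rewrite /iter_pderiv foldr_rcons.
Qed.

Lemma schwartz_smooth D (u : fn) : schwartz D u -> smooth (xkind D) Ln u.
Proof.
apply: smooth_coind => {}u su; have [per pd wt] := su.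
have h1 := pderivable_has_pderiv1 (pd [::]); have h2 := pderivable_has_pderiv2 (pd [::]).
split.
- split.
  + exact: hasd_cmeasurable2 h1 h2.
  + move=> a b; have [M HM] := wt [::] a b; exists (2 * M) => x y.
    have := HM (x, y); rewrite weightE /= => H.
    have w0 : 0 <= kweight (xkind D) a x * kweight Ln b y by rewrite mulr_ge0 ?kweight_ge0.
    apply: le_trans (ler_wpM2l w0 (cnorm1_normc _)) _.
    by rewrite mulrCA; apply: ler_wpM2l.
  + move=> y; split => K x; first by rewrite per//; case: (D) K.
    by case: (D) K.
  + by move=> x; split.
- by move=> _; exists (pderiv X u) => //; exact: schwartz_pderiv.
- by move=> _; exists (pderiv V u) => //; exact: schwartz_pderiv.
Qed.

Lemma smooth_pderiv D c (u : fn) : smooth (xkind D) Ln u -> smooth (xkind D) Ln (pderiv c u).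
Proof.
move=> su; have KZ : xkind D <> Zc by case: (D).
case: c.
  by have [u' du su'] := smooth_d1 KZ su; rewrite (pderivX du).
have LZ : Ln <> Zc by [].
by have [u' du su'] := smooth_d2 LZ su; rewrite (pderivV du).
Qed.

Lemma smooth_schwartz D (u : fn) : smooth (xkind D) Ln u -> schwartz D u.
Proof.
move=> su.
have si w : smooth (xkind D) Ln (iter_pderiv w u).
  by elim: w => //= c w IH; exact: smooth_pderiv.
have KZ : xkind D <> Zc by case: (D).
have LZ : Ln <> Zc by [].
split.
- move=> DT x v; have [p _] := decaying_spr1 (smooth_decaying su) v; apply: p; by rewrite DT.
- move=> w; have [u1 h1 _] := smooth_d1 KZ (si w); have [u2 h2 _] := smooth_d2 LZ (si w).
  exact: hasd_pderivable h1 h2.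
- move=> w k l; have [M HM] := decaying_wt (smooth_decaying (si w)) k l; exists M => -[x y].
  rewrite weightE; apply: le_trans (HM x y); apply: ler_wpM2l; last exact: normc_cnorm1.
  by rewrite mulr_ge0 ?kweight_ge0.
Qed.

Lemma schwartzP D (u : fn) : schwartz D u <-> smooth (xkind D) Ln u.
Proof. by split; [exact: schwartz_smooth|exact: smooth_schwartz]. Qed.

End Schwartz.

(** * The Fourier transform in two variables *)

Section Fourier2.
Variable R : realType.
Local Notation mR := (measurableTypeR R).
Local Notation C := R[i].
Local Notation fn := (R * R -> C).
Local Notation re := (@complex.Re R).
Local Notation im := (@complex.Im R).

Lemma FTxL K1 K2 sg a (u v : fn) : decaying K1 K2 u -> decaying K1 K2 v ->
  FTx K1 sg (fun p => a * u p + v p) = fun p => a * FTx K1 sg u p + FTx K1 sg v p.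
Proof.
move=> bu bv; apply/funext => -[xi y]; rewrite /FTx/= mulrCA -mulrDr; congr (_ * _).
rewrite /FT -cintZ; last exact: FT_cintegrable bu.
rewrite -cintD; [|by apply: cintegrableZ; exact: FT_cintegrable bu|exact: FT_cintegrable bv].
by apply: cint_ext => x; ring.
Qed.

Lemma decaying0 K1 K2 : decaying K1 K2 (fun=> 0 : C).
Proof. exact: smooth_decaying (smooth0 R K1 K2). Qed.

Lemma FTx0 K1 sg : FTx K1 sg (fun=> 0) = fun=> 0 :> C.
Proof.
apply/funext => p; rewrite /FTx /FT.
rewrite (_ : (fun x : mR => _) = fun=> 0) ?cint0 ?mulr0//.
by apply/funext => x /=; rewrite mulr0.
Qed.

Lemma FTxZ K1 K2 sg a (u : fn) : decaying K1 K2 u ->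
  FTx K1 sg (fun p => a * u p) = fun p => a * FTx K1 sg u p.
Proof.
move=> bu; have := FTxL sg a bu (decaying0 K1 K2).
under eq_fun do rewrite addr0.
by rewrite FTx0 => ->; apply/funext => p; rewrite addr0.
Qed.

Definition FTy sg (u : fn) : fn := swap_args (FTx Ln sg (swap_args u)).

Definition c2 : C := ((2 * pi)^-1)%:C.

Lemma c2K : c2 * (2 * pi)%:C = 1.
Proof. by rewrite /c2 -rmorphM mulVf// mulf_neq0// gt_eqF// pi_gt0. Qed.

(** This transform carries the sign +1: it acts on test functions in (x, v), where the definitions
    work by transposition. Using [c2] once in each direction cancels the two factors 2 pi of the
    one-variable inversions. *)
Definition FT2 (D : xspace) (u : fn) : fn := fun p => c2 * FTx (xkind D) 1 (FTy 1 u) p.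
Definition iFT2 (D : xspace) (u : fn) : fn := fun p => c2 * FTy (- 1) (FTx (xikind D) (- 1) u) p.

Lemma smooth_FTy K sg (u : fn) : sg ^+ 2 = 1 -> smooth K Ln u -> smooth K Ln (FTy sg u).
Proof. by move=> sg2 su; apply: smooth_swap_args; apply: (@smooth_FTx R Ln) => //; exact: smooth_swap_args. Qed.

Lemma FTy_inv K sg (u : fn) : sg ^+ 2 = 1 -> smooth K Ln u -> FTy (- sg) (FTy sg u) = fun p => (2 * pi)%:C * u p.
Proof.
move=> sg2 su; have := FTx_inv sg2 (smooth_swap_args su).
rewrite /FTy (_ : swap_args (swap_args (FTx Ln sg (swap_args u))) = FTx Ln sg (swap_args u)); last by apply/funext => -[].
by rewrite [dual Ln]/= => ->; apply/funext => -[].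
Qed.

Lemma swap_argsL a (u v : fn) : swap_args (fun p => a * u p + v p) = fun p => a * swap_args u p + swap_args v p.
Proof. by []. Qed.

Lemma swap_argsZ a (u : fn) : swap_args (fun p => a * u p) = fun p => a * swap_args u p.
Proof. by []. Qed.

Lemma FTyZ K sg a (u : fn) : decaying K Ln u -> FTy sg (fun p => a * u p) = fun p => a * FTy sg u p.
Proof. by move=> bu; rewrite /FTy swap_argsZ (FTxZ sg a (decaying_swap_args bu)). Qed.

Lemma sqr1 : (1 : R) ^+ 2 = 1. Proof. exact: expr1n. Qed.
Lemma sqrN1 : (- 1 : R) ^+ 2 = 1. Proof. by rewrite sqrrN expr1n. Qed.

Lemma smooth_FT2 D (u : fn) : smooth (xkind D) Ln u -> smooth (xikind D) Ln (FT2 D u).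
Proof. by move=> su; apply: smoothZ; apply: smooth_FTx; [exact: sqr1|apply: smooth_FTy; [exact: sqr1|]]. Qed.

Lemma xikindK D : dual (xikind D) = xkind D. Proof. by case: D. Qed.

Lemma smooth_iFT2 D (u : fn) : smooth (xikind D) Ln u -> smooth (xkind D) Ln (iFT2 D u).
Proof.
move=> su; apply: smoothZ; apply: smooth_FTy; first exact: sqrN1.
by rewrite -xikindK; apply: smooth_FTx => //; exact: sqrN1.
Qed.

Lemma iFT2_FT2 D (u : fn) : smooth (xkind D) Ln u -> iFT2 D (FT2 D u) = u.
Proof.
move=> su; have sT := smooth_FTy sqr1 su.
rewrite /iFT2 /FT2 (FTxZ _ _ (decaying_FTx sqr1 sT)) (FTx_inv sqr1 sT).
have -> : (fun p => c2 * ((2 * pi)%:C * FTy 1 u p)) = FTy 1 u.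
  by apply/funext => p; rewrite mulrA c2K mul1r.
rewrite (FTy_inv sqr1 su); apply/funext => p; by rewrite mulrA c2K mul1r.
Qed.

Lemma FT2_iFT2 D (u : fn) : smooth (xikind D) Ln u -> FT2 D (iFT2 D u) = u.
Proof.
move=> su; have sT : smooth (xkind D) Ln (FTx (xikind D) (-1) u).
  by rewrite -xikindK; apply: smooth_FTx => //; exact: sqrN1.
have bT := smooth_decaying (smooth_FTy sqrN1 sT).
rewrite /iFT2 /FT2 (FTyZ _ _ bT).
have := FTy_inv sqrN1 sT; rewrite opprK => ->.
have -> : (fun p => c2 * ((2 * pi)%:C * FTx (xikind D) (-1) u p)) = FTx (xikind D) (-1) u.
  by apply/funext => p; rewrite mulrA c2K mul1r.
have := FTx_inv sqrN1 su; rewrite opprK xikindK => ->.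
by apply/funext => p; rewrite mulrA c2K mul1r.
Qed.

Lemma FT2L D a (u v : fn) : smooth (xkind D) Ln u -> smooth (xkind D) Ln v ->
  FT2 D (fun p => a * u p + v p) = fun p => a * FT2 D u p + FT2 D v p.
Proof.
move=> su sv; rewrite /FT2.
have -> : FTy 1 (fun p => a * u p + v p) = fun p => a * FTy 1 u p + FTy 1 v p.
  by rewrite /FTy swap_argsL (FTxL 1 a (decaying_swap_args (smooth_decaying su)) (decaying_swap_args (smooth_decaying sv))).
rewrite (FTxL 1 a (smooth_decaying (smooth_FTy sqr1 su)) (smooth_decaying (smooth_FTy sqr1 sv))).
by apply/funext => p; rewrite mulrDr mulrCA.
Qed.

Lemma osc_gen K sg (u : fn) (q : R * R) : decaying K Ln u ->
  let F := fun p : mR * mR => cexp (sg * (p.1 * q.1 + p.2 * q.2)) * u p in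
  cint (kmeasure_sf R K \x kmeasure_sf R Ln)%E F = FT K sg (fun x => FT Ln sg (fun y => u (x, y)) q.2) q.1 /\
  cint (kmeasure_sf R K \x kmeasure_sf R Ln)%E F = FT Ln sg (fun y => FT K sg (fun x => u (x, y)) q.1) q.2.
Proof.
move=> bu F; have [c c0 H] := decay 0 0 bu.
have HF : forall x y, cnorm1 (F (x, y)) <= (2 * c * kdecay K x) * kdecay Ln y.
  move=> x y; apply: le_trans (cnorm1M _ _) _; rewrite -!mulrA; apply: ler_pM; rewrite ?cnorm1_ge0 ?cnorm1_cexp//.
  by have := H x y; rewrite !kweight0 !mul1r.
have mF : cmeasurable F.
  apply: cmeasurableM; last by case: bu.
  by apply: cmeasurable_cexp; meas.
have [] := @cfubini R _ _ mR mR (kmeasure_sf R K) (kmeasure_sf R Ln) F (fun x => 2 * c * kdecay K x) (kdecay Ln) mF HF.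
- by move=> x; rewrite !mulr_ge0// ltW// kdecay_gt0.
- by move=> y; rewrite ltW// kdecay_gt0.
- exact: iW.
- exact: integrable_kdecay.
move=> -> e2 _; split; last rewrite e2.
  apply: cint_ext => x; rewrite /F /= /FT -cintZ.
    by apply: cint_ext => y; rewrite mulrA -cexpD; congr (cexp _ * _); ring.
  have := FT_cintegrable sg q.2 x (decaying_swap_args bu); exact.
apply: cint_ext => y; rewrite /F /= /FT -cintZ.
  by apply: cint_ext => x; rewrite mulrA -cexpD; congr (cexp _ * _); ring.
exact: FT_cintegrable bu.
Qed.

Lemma osc_xvE D (u : fn) q : smooth (xkind D) Ln u ->
  osc (xv_measure R D) 1 u q = c2 * FT (xkind D) 1 (fun x => FTy 1 u (x, q.2)) q.1.
Proof.
move=> su; rewrite /osc cintegral_xv; congr (_ * _).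
have [e _] := osc_gen 1 q (smooth_decaying su).
apply: etrans (etrans e _); first by [].
by apply: cint_ext => x; congr (_ * _); rewrite /FTy /swap_args /FTx /= /ind mul1r.
Qed.

(** On the torus [osc] is defined at every real frequency, whereas [FT2] is cut to Z. *)
Lemma FT2_osc D (u : fn) q : smooth (xkind D) Ln u ->
  FT2 D u q = (ind (xikind D) q.1)%:C * osc (xv_measure R D) 1 u q.
Proof. by move=> su; rewrite osc_xvE// /FT2 /FTx mulrCA. Qed.

Lemma osc_freqE D (u : fn) : decaying (xikind D) Ln u -> osc (freq_measure R D) (- 1) u = iFT2 D u.
Proof.
move=> bu; apply/funext => q; rewrite /osc cintegral_freq; congr (_ * _).
have [_ e] := osc_gen (-1) q bu.
apply: etrans (etrans e _); first by [].
rewrite /FTy /swap_args /FTx /= /ind mul1r; apply: cint_ext => y; congr (_ * _).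
by rewrite xikindK; case: (D); rewrite mul1r.
Qed.

Lemma mk_Zc_nZ : kmeasure Zc [set x : mR | ~~ inZ x] = 0%E.
Proof.
have d0 (e : R) : inZ e -> \d_e [set x : mR | ~~ inZ x] = 0%E :> \bar R.
  by move=> ie; rewrite diracE memNset//= ie.
rewrite mk_ZcE !eseries0 ?adde0// => n _ _; apply: d0; apply/intrP.
  by exists (- n.+1%:Z); rewrite mulrNz.
by exists n.
Qed.

Lemma integral_prod_ind K (f g : mR * mR -> \bar R) : measurable_fun setT f -> measurable_fun setT g ->
  (forall p, ind K p.1 = 1 -> f p = g p) ->
  (\int[kmeasure_sf R K \x kmeasure_sf R Ln]_p f p = \int[kmeasure_sf R K \x kmeasure_sf R Ln]_p g p)%E.
Proof.
move=> mf mg fg; case: K fg => fg; try by apply: eq_integral => p _; exact: fg.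
apply: ae_eq_integral => //.
exists ([set x : mR | ~~ inZ x] `*` setT); split.
- apply: measurableX => //; rewrite (_ : [set x | _] = ~` [set x : mR | inZ x]).
    by apply: measurableC; exact: measurable_inZ.
  by apply/seteqP; split => x /=; move/negP.
- have mN : measurable [set x : mR | ~~ inZ x].
    rewrite (_ : [set x | _] = ~` [set x : mR | inZ x]).
      by apply: measurableC; exact: measurable_inZ.
    by apply/seteqP; split => x /=; move/negP.
  apply: etrans (@product_measure1E _ _ mR mR R (kmeasure_sf R Zc) (kmeasure_sf R Ln) _ _ mN measurableT) _.
  rewrite [X in (X * _)%E](_ : _ = 0%E); last exact: mk_Zc_nZ.
  by rewrite mul0e.
- move=> [x y] /= H; split => //; apply/negP => iZ; apply: H => _.
  by apply: fg; rewrite /ind /= iZ.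
Qed.

Lemma cint_prod_ind K (f g : fn) : cmeasurable2 f -> cmeasurable2 g -> (forall p, ind K p.1 = 1 -> f p = g p) ->
  cint (kmeasure_sf R K \x kmeasure_sf R Ln)%E f = cint (kmeasure_sf R K \x kmeasure_sf R Ln)%E g.
Proof.
move=> [f1 f2] [g1 g2] fg; apply: cP; rewrite ?cRe_int ?cIm_int /Rintegral; congr fine.
  by apply: integral_prod_ind; [exact/measurable_EFinP|exact/measurable_EFinP|move=> p /fg ->].
by apply: integral_prod_ind; [exact/measurable_EFinP|exact/measurable_EFinP|move=> p /fg ->].
Qed.

Lemma cmeasurable2_osc D (u : fn) : smooth (xkind D) Ln u -> cmeasurable2 (osc (xv_measure R D) 1 u).
Proof.
move=> su.
rewrite (_ : osc _ _ _ = fun q => c2 * FT (xkind D) 1 (fun x => FTy 1 u (x, q.2)) q.1).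
  apply: cmeasurableM; first exact: cmeasurable_cst.
  by apply: cmeasurable2_FT; exact: decaying_meas (smooth_decaying (smooth_FTy sqr1 su)).
by apply/funext => q; exact: osc_xvE.
Qed.

(** On the torus the uncut [osc] need not belong to the smooth class on frequencies; but
    [freq_measure] does not charge non-integer frequencies, so it may be replaced by [FT2] under the
    integral. *)
Lemma osc_mul D (m : R * R -> R) (u : fn) : smooth (xkind D) Ln u ->
  cmeasurable2 (fun p => (m p)%:C) -> smooth (xikind D) Ln (fun p => (m p)%:C * FT2 D u p) ->
  osc (freq_measure R D) (- 1) (fun p => (m p)%:C * osc (xv_measure R D) 1 u p) =
  iFT2 D (fun p => (m p)%:C * FT2 D u p).
Proof.
move=> su mm sm; have eB := osc_freqE (smooth_decaying sm); rewrite -{}eB.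
apply/funext => q.
have U g : osc (freq_measure R D) (- 1) g q = c2 *
    cint (kmeasure_sf R (xikind D) \x kmeasure_sf R Ln)%E (fun p => cexp (- 1 * (p.1 * q.1 + p.2 * q.2)) * g p).
  by rewrite -cintegral_freq.
rewrite [LHS]U [RHS]U; apply: (congr1 (fun z : C => c2 * z)).
have mc : cmeasurable2 (fun p => cexp (- 1 * (p.1 * q.1 + p.2 * q.2))) by apply: cmeasurable_cexp; meas.
apply: cint_prod_ind.
- apply: cmeasurableM; first exact: mc.
  by apply: cmeasurableM; [exact: mm|exact: cmeasurable2_osc].
- by apply: cmeasurableM; [exact: mc|exact: decaying_meas (smooth_decaying sm)].
- by move=> p ip; rewrite FT2_osc// ip mul1r.
Qed.


End Fourier2.

(** * Plancherel's theorem and the transform of derivatives *)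

Section Fourier3.
Variable R : realType.
Local Notation mR := (measurableTypeR R).
Local Notation C := R[i].
Local Notation fn := (R * R -> C).
Local Notation re := (@complex.Re R).
Local Notation im := (@complex.Im R).

(** The double integral of exp(i sg xi x) u(x) times the conjugate of w(xi) is computed in both
    orders: x first gives the integral of |w|^2, xi first gives u times the conjugate of the inverse
    transform of w, that is 2 pi |u|^2. *)
Lemma plancherel1 K1 K2 sg (u : fn) y : sg ^+ 2 = 1 -> smooth K1 K2 u ->
  (\int[kmeasure (dual K1)]_xi (normsq (FTx K1 sg u (xi, y)))%:E = (2 * pi)%:E * \int[kmeasure K1]_x (normsq (u (x, y)))%:E)%E.
Proof.
move=> sg2 su; set w := FTx K1 sg u; have sw : smooth (dual K1) K2 w by exact: smooth_FTx.
have [c c0 Hc] := decay1 0 (smooth_decaying su); have [d d0 Hd] := decay1 0 (smooth_decaying sw).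
have hu x : cnorm1 (u (x, y)) <= c * kdecay K1 x by have := Hc x y; rewrite kweight0 mul1r.
have hw x : cnorm1 (w (x, y)) <= d * kdecay (dual K1) x by have := Hd x y; rewrite kweight0 mul1r.
have mu := cmeasurable2_sec1 y (decaying_meas (smooth_decaying su)); have mw := cmeasurable2_sec1 y (decaying_meas (smooth_decaying sw)).
have isq K (h : mR -> C) e : cmeasurable h -> (forall x, cnorm1 (h x) <= e * kdecay K x) ->
    (kmeasure K).-integrable setT (fun x => (normsq (h x))%:E).
  move=> mh hh; apply: (@dom_integrable _ _ _ (kmeasure K) (fun x => normsq (h x)) (fun x => e ^+ 2 * kdecay K x)).
  - exact: cmeasurable_normsq.
  - move=> x; rewrite ger0_norm ?normsq_ge0//; apply: le_trans (normsq_cnorm1 _) _.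
    have e0 := le_trans (cnorm1_ge0 _) (hh x).
    apply: (@le_trans _ _ ((e * kdecay K x) ^+ 2)); first by rewrite ler_pXn2r ?nnegrE ?cnorm1_ge0.
    rewrite exprMn; apply: ler_wpM2l; first exact: sqr_ge0.
    by rewrite expr2 ler_piMr ?kdecay_le1// ltW// kdecay_gt0.
  - exact: iW.
have iu := isq K1 _ c mu hu; have iw := isq (dual K1) _ d mw hw.
have cJM (a b : C) : ((a * b)^*)%C = (a^*)%C * (b^*)%C by exact: rmorphM.
suff E : cint (kmeasure (dual K1)) (fun xi => (normsq (w (xi, y)))%:C) = (2 * pi)%:C * cint (kmeasure K1) (fun x => (normsq (u (x, y)))%:C).
  have := congr1 re E; rewrite cReM !cRe_int cReR cImR mul0r subr0 /Rintegral => E'.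
  rewrite -[LHS]fineK; last by apply: integrable_fin_num.
  rewrite -[X in (_ * X)%E]fineK; last by apply: integrable_fin_num.
  by rewrite -EFinM -E'.
have [] := @cfubini R _ _ mR mR (kmeasure_sf R (dual K1)) (kmeasure_sf R K1)
  (fun p => cexp (sg * p.1 * p.2) * u (p.2, y) * ((w (p.1, y))^*)%C)
  (fun xi => 2 * d * kdecay (dual K1) xi) (fun x => c * kdecay K1 x).
- apply: cmeasurableM; [apply: cmeasurableM|].
  + by apply: cmeasurable_cexp; meas.
  + by have [] := cmeasurable_measurable mu.
  + by have [] := cmeasurable_measurable (cmeasurableJ mw).
- move=> xi x; apply: le_trans (cnorm1M _ _) _.
  apply: le_trans (ler_wpM2r (cnorm1_ge0 _) (cnorm1M _ _)) _; rewrite cnorm1J.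
  rewrite mulrAC; apply: ler_pM; rewrite ?mulr_ge0 ?cnorm1_ge0//.
  by rewrite -[leRHS]mulrA; apply: ler_pM; rewrite ?cnorm1_ge0 ?cnorm1_cexp.
- by move=> x; rewrite !mulr_ge0// ltW// kdecay_gt0.
- by move=> x; rewrite !mulr_ge0// ltW// kdecay_gt0.
- exact: iW.
- exact: iW.
move=> -> e _; transitivity (cint (kmeasure_sf R (dual K1)) (fun xi => cint (kmeasure_sf R K1) (fun x => cexp (sg * xi * x) * u (x, y) * ((w (xi, y))^*)%C))).
  apply: cint_ext => xi; rewrite /= cintZr; last exact: FT_cintegrable (smooth_decaying su).
  rewrite normsqE; have [i0|i0] := eqVneq (ind (dual K1) xi) 0.
    have w0 : w (xi, y) = 0 by rewrite /w /FTx /= i0 mul0r.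
    have c0J : ((0 : C)^*)%C = 0 by apply: cP; rewrite !cE ?oppr0.
    transitivity (0 : C); first by rewrite w0 mul0r.
    by change (0 = cint (kmeasure_sf R K1) (fun x : mR => cexp (sg * xi * x) * u (x, y)) * ((w (xi, y))^*)%C); rewrite w0 c0J mulr0.
  have i1 : ind (dual K1) xi = 1.
    by move: i0; rewrite /ind; case: (dual K1) => //; case: inZ => //; rewrite eqxx.
  by congr (_ * _); rewrite /w /FTx /= i1 mul1r.
rewrite e -cintZ; last first.
  split; first exact: iu.
  rewrite (_ : (fun x => _) = EFin \o (fun x => 0 * kdecay K1 x)); first exact: iW.
  by apply/funext => x /=; rewrite mul0r.
apply: cint_ext => x; cbv beta iota delta [fst snd].
have [->|u0] := eqVneq (u (x, y)) 0.
  rewrite (_ : normsq 0 = 0) ?mulr0; last by rewrite /normsq /= expr0n addr0.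
  by apply: etrans (cint0 (kmeasure_sf R (dual K1))); apply: cint_ext => xi; rewrite mulr0 mul0r.
have ix : ind K1 x = 1.
  have [_ q] := decaying_spr1 (smooth_decaying su) y; move: q u0; rewrite /ind; case: (K1) => // q u0.
  have [//|nx] := boolP (inZ x); by rewrite q ?eqxx in u0.
transitivity (u (x, y) * ((cint (kmeasure (dual K1)) (fun xi => cexp (- sg * x * xi) * w (xi, y)))^*)%C).
  rewrite -cint_conj; last first.
    exact: (FT_cintegrable (- sg) x y (smooth_decaying sw)).
  rewrite -cintZ; last first.
    apply: (@cintegrable_dom _ _ _ (kmeasure (dual K1)) _ (fun xi => 2 * d * kdecay (dual K1) xi)); last exact: iW.
      by apply: cmeasurableJ; apply: cmeasurableM => //; apply: cmeasurable_cexp; meas.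
    move=> xi; rewrite cnorm1J; apply: le_trans (cnorm1M _ _) _; rewrite -[leRHS]mulrA.
    by apply: ler_pM; rewrite ?cnorm1_ge0 ?cnorm1_cexp.
  apply: cint_ext => xi; rewrite (cJM (cexp (- sg * x * xi)) (w (xi, y))) -cexpN.
  have -> : - (- sg * x * xi) = sg * xi * x by ring.
  by ring.
have -> : cint (kmeasure (dual K1)) (fun xi => cexp (- sg * x * xi) * w (xi, y)) = (2 * pi)%:C * u (x, y).
  have := FTx_inv sg2 su => /(congr1 (fun f => f (x, y))).
  by rewrite {1}/FTx /= (_ : dual (dual K1) = K1) ?ix ?mul1r; last by case: (K1).
rewrite cJM normsqE.
have -> : (((2 * pi)%:C)^*)%C = (2 * pi)%:C :> C by apply: cP; rewrite ?cE ?oppr0.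
by ring.
Qed.

Definition sqI (K : kind) (u : fn) : \bar R := (\int[kmeasure_sf R K \x kmeasure_sf R Ln]_p (normsq (u p))%:E)%E.

Lemma measurable_normsq (u : fn) : cmeasurable2 u -> measurable_fun setT (fun p : mR * mR => (normsq (u p))%:E).
Proof. by move=> mu; apply/measurable_EFinP; exact: cmeasurable_normsq. Qed.

Lemma sqI1 K (u : fn) : cmeasurable2 u -> sqI K u = (\int[kmeasure K]_x \int[kmeasure Ln]_y (normsq (u (x, y)))%:E)%E.
Proof.
move=> mu; apply: (@fubini_tonelli1 _ _ mR mR R (kmeasure_sf R K) (kmeasure_sf R Ln) (fun p => (normsq (u p))%:E)).
  exact: measurable_normsq.
by move=> p; rewrite lee_fin normsq_ge0.
Qed.

Lemma sqI2 K (u : fn) : cmeasurable2 u -> sqI K u = (\int[kmeasure Ln]_y \int[kmeasure K]_x (normsq (u (x, y)))%:E)%E.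
Proof.
move=> mu; apply: (@fubini_tonelli2 _ _ mR mR R (kmeasure_sf R K) (kmeasure_sf R Ln) (fun p => (normsq (u p))%:E)).
  exact: measurable_normsq.
by move=> p; rewrite lee_fin normsq_ge0.
Qed.

Lemma sqI_Z K (a : C) (u : fn) : cmeasurable2 u -> sqI K (fun p => a * u p) = ((normsq a)%:E * sqI K u)%E.
Proof.
move=> mu; rewrite /sqI -ge0_integralZl//.
- by apply: eq_integral => p _; rewrite normsqM EFinM.
- exact: measurable_normsq.
- by move=> p _; rewrite lee_fin normsq_ge0.
- by rewrite lee_fin normsq_ge0.
Qed.

Lemma sqI_FTx K sg (u : fn) : sg ^+ 2 = 1 -> smooth K Ln u ->
  sqI (dual K) (FTx K sg u) = ((2 * pi)%:E * sqI K u)%E.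
Proof.
move=> sg2 su; rewrite sqI2; last exact: decaying_meas (decaying_FTx sg2 su).
have mu := decaying_meas (smooth_decaying su).
rewrite (sqI2 K mu) -ge0_integralZl//.
- by apply: eq_integral => y _; rewrite (plancherel1 y sg2 su).
- apply: (@measurable_fun_fubini_tonelli_F _ _ _ _ _ (kmeasure_sf R K) (fun p => (normsq (u (p.2, p.1)))%:E)).
    exact: measurable_normsq (cmeasurable2_swap_args mu).
  by move=> p; rewrite lee_fin normsq_ge0.
- by move=> y _; apply: integral_ge0 => x _; rewrite lee_fin normsq_ge0.
- by rewrite lee_fin mulr_ge0// pi_ge0.
Qed.

Lemma sqI_FTy K sg (u : fn) : sg ^+ 2 = 1 -> smooth K Ln u ->
  sqI K (FTy sg u) = ((2 * pi)%:E * sqI K u)%E.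
Proof.
move=> sg2 su; have mu := decaying_meas (smooth_decaying su).
rewrite sqI1; last exact: decaying_meas (smooth_decaying (smooth_FTy sg2 su)).
rewrite (sqI1 K mu) -ge0_integralZl//.
- by apply: eq_integral => x _; have := plancherel1 x sg2 (smooth_swap_args su); exact.
- apply: (@measurable_fun_fubini_tonelli_F _ _ _ _ _ (kmeasure_sf R Ln) (fun p => (normsq (u p))%:E)).
    exact: measurable_normsq mu.
  by move=> p; rewrite lee_fin normsq_ge0.
- by move=> y _; apply: integral_ge0 => x _; rewrite lee_fin normsq_ge0.
- by rewrite lee_fin mulr_ge0// pi_ge0.
Qed.

Lemma plancherel D (u : fn) : smooth (xkind D) Ln u -> sqI (xikind D) (FT2 D u) = sqI (xkind D) u.
Proof.
move=> su; have sT := smooth_FTy (sqr1 R) su.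
rewrite /FT2 /sqI; rewrite -/(sqI _ _) (@sqI_Z _ (c2 R)); last exact: decaying_meas (decaying_FTx (sqr1 R) sT).
rewrite (sqI_FTx (sqr1 R) sT) (sqI_FTy (sqr1 R) su) !muleA -!EFinM.
have -> : normsq (c2 R) * (2 * pi) * (2 * pi) = 1; last by rewrite mul1e.
have p0 : pi != 0 :> R by rewrite gt_eqF// pi_gt0.
rewrite /c2 normsqR. by move: (@pi R) p0 => q q0; field.
Qed.

Lemma FT2_pderivX D (u : fn) : smooth (xkind D) Ln u -> forall p, FT2 D (pderiv X u) p = (0 +i* - p.1) * FT2 D u p.
Proof.
move=> su p; have KZ : xkind D <> Zc by case: (D).
have [u' du su'] := smooth_d1 KZ su; rewrite (pderivX du) /FT2.
have h1 : has_pderiv1 (FTy 1 u) (FTy 1 u').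
  have h2 : has_pderiv2 (swap_args u) (swap_args u') by move=> x y; exact: du.
  by have := FTx_d2 1 (decaying_swap_args (smooth_decaying su)) (decaying_swap_args (smooth_decaying su')) h2 => h x y; exact: (h y x).
by rewrite (FTx_d1 KZ (sqr1 R) (smooth_FTy (sqr1 R) su) h1 (smooth_FTy (sqr1 R) su')) mul1r mulrCA.
Qed.

(** The transpose of v d_x seen in frequency: [u2] is the eta-derivative of the transform, so d_x (v
    u) becomes - xi d_eta. *)
Lemma FT2_dxv D (u : fn) : smooth (xkind D) Ln u -> exists u2,
  [/\ has_pderiv2 (FT2 D u) u2, smooth (xikind D) Ln u2 &
   forall p, FT2 D (pderiv X (fun p => p.2%:C * u p)) p = - (p.1%:C * u2 p)].
Proof.
move=> su; pose v : fn := fun p => p.2%:C * u p.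
have sv : smooth (xkind D) Ln v by apply: (smoothM2 _ (@symbol_id R) su).
have LP : Ln <> Pr by [].
exists (fun p => (0 +i* 1) * FT2 D v p); split.
- have bT := smooth_decaying (smooth_FTy (sqr1 R) su).
  pose w : fn := fun p => (0 +i* 1) * v p.
  have sw : smooth (xkind D) Ln w by exact: smoothZ.
  have h2 : has_pderiv2 (FTy 1 u) (FTy 1 w).
    by have := FTx_dxi 1 LP (smooth_swap_args su) => h x y; exact: (h y x).
  have := FTx_d2 1 bT (smooth_decaying (smooth_FTy (sqr1 R) sw)) h2 => h x y.
  apply: is_cderive_eq (is_cderiveM (is_cderive_cst (c2 R) y) (h x y)) _.
  rewrite mul0r add0r /w (FTyZ _ _ (smooth_decaying sv)) (FTxZ _ _ (smooth_decaying (smooth_FTy (sqr1 R) sv))) /FT2.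
  by ring.
- by apply: smoothZ; exact: smooth_FT2.
- move=> p; rewrite (FT2_pderivX sv).
  have -> : (0 +i* - p.1 : C) = - p.1%:C * (0 +i* 1).
    by apply: cP; rewrite !cE /= ?mulr0 ?mul0r ?mulr1 ?oppr0 ?subr0 ?add0r ?addr0.
  by ring.
Qed.

End Fourier3.

(** * L2 spaces *)

Section L2.
Variable R : realType.
Local Notation C := R[i].
Local Notation re := (@complex.Re R).
Local Notation im := (@complex.Im R).
Context d (T : measurableType d) (mu : {measure set T -> \bar R}).

(** The rate 16^-n of squared distances absorbs the weight 2^n and still leaves a summable geometric
    series. *)
Lemma pw16 (n : nat) : (2 ^+ n * (4 * 16^-1 ^+ n) <= 8 / (2 ^ n.+1)%:R :> R).
Proof.
have -> : (2 ^ n.+1)%:R = 2 * 2 ^+ n :> R by rewrite natrX exprS.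
rewrite (_ : 8 / (2 * 2 ^+ n) = 4 / 2 ^+ n :> R); last first.
  have : 2 ^+ n != 0 :> R by rewrite expf_neq0.
  by move=> h; field.
rewrite mulrCA -exprVn; apply: ler_wpM2l; first lra.
rewrite -exprMn; apply: lerXn2r; rewrite ?nnegrE; lra.
Qed.

(* On {G < oo}, G = sum 2^n d_n^2, the AM-GM bound |d_n| <= 2^n d_n^2 + 2^-n makes the increments d_n summable. *)
Lemma L2_complete_real (f_ : nat -> T -> R) : (forall n, measurable_fun setT (f_ n)) ->
  (forall n m, (n <= m)%N -> (\int[mu]_x ((f_ m x - f_ n x) ^+ 2)%:E <= (4 * 16^-1 ^+ n)%:E)%E) ->
  exists2 f : T -> R, measurable_fun setT f & forall n, (\int[mu]_x ((f x - f_ n x) ^+ 2)%:E <= (4 * 16^-1 ^+ n)%:E)%E.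
Proof.
move=> mf H.
pose g (n : nat) x : \bar R := (2 ^+ n * (f_ n.+1 x - f_ n x) ^+ 2)%:E.
have g0 n x : (0 <= g n x)%E by rewrite lee_fin mulr_ge0 ?sqr_ge0// exprn_ge0.
have mg n : measurable_fun setT (g n).
  apply/measurable_EFinP; apply: measurable_funM => //.
  by apply: measurable_funX; apply: measurable_funB.
pose G x := (\sum_(n <oo) g n x)%E.
have mG : measurable_fun setT G by apply: ge0_emeasurable_sum => // n x _ _; exact: g0.
have G0 x : (0 <= G x)%E by apply: nneseries_ge0 => n _ _; exact: g0.
have IG : (\int[mu]_x G x < +oo)%E.
  rewrite integral_nneseries//.
  apply: (@le_lt_trans _ _ (8 : R)%:E); last exact: ltry.
  apply: le_trans (@epsilon_trick0 R 8 xpredT _); last lra.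
  apply: lee_nneseries => [n _ _|n _]; first by apply: integral_ge0 => x _; exact: g0.
  rewrite (_ : \int[mu]_x g n x = (2 ^+ n)%:E * \int[mu]_x ((f_ n.+1 x - f_ n x) ^+ 2)%:E)%E; last first.
    rewrite -ge0_integralZl//; last 2 first.
    - by apply/measurable_EFinP; apply: measurable_funX; apply: measurable_funB.
    - by move=> x _; rewrite lee_fin sqr_ge0.
  apply: (@le_trans _ _ ((2 ^+ n)%:E * (4 * 16^-1 ^+ n)%:E)%E).
    by apply: lee_wpmul2l; [rewrite lee_fin exprn_ge0|exact: H].
  by rewrite -EFinM lee_fin; exact: pw16.
pose E : set T := [set x | G x \is a fin_num].
have mE : measurable E by rewrite -[E]setTI; apply: emeasurable_fin_num.
have aeE : {ae mu, forall x, x \in E}.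
  have iG : mu.-integrable setT G.
    by apply/integrableP; split => //; under eq_integral do rewrite gee0_abs//.
  have := integrable_ae measurableT iG; apply: filterS => x /(_ I) h.
  by rewrite inE.
(* Where [G] is infinite the sequence may diverge; setting it to 0 there makes it converge
   everywhere and changes it only on a null set. *)
pose h n x := f_ n x * \1_E x.
have mh n : measurable_fun setT (h n).
  by apply: measurable_funM => //; exact: measurable_indic.
have ch x : cvgn (fun n => h n x).
  rewrite /h; have [xE|xE] := boolP (x \in E); last first.
    rewrite indicE (negbTE xE).
    have -> : (fun n => f_ n x * false%:R) = fun=> 0 by apply/funext => n; rewrite mulr0.
    exact: is_cvg_cst.
  rewrite indicE xE /=; have -> : (fun n => f_ n x * 1) = fun n => f_ n x.
    by apply/funext => n; rewrite mulr1.
  pose u n := f_ n x.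
  have E1 : u = (fun n => u 0%N + series (telescope u) n).
    by apply/funext => n; exact: eq_sum_telescope.
  rewrite -/u E1; apply: is_cvgD; first exact: is_cvg_cst.
  apply: normed_cvg; apply: nondecreasing_is_cvgn.
    by apply: nondecreasing_series => n _ _; exact: normr_ge0.
  exists (fine (G x) + 2) => _ [N _ <-].
  have GE : G x = (fine (G x))%:E by rewrite fineK//; move: xE; rewrite inE.
  rewrite /series /=.
  apply: (@le_trans _ _ (\sum_(0 <= k < N) (2 ^+ k * (f_ k.+1 x - f_ k x) ^+ 2 + geometric 1 2^-1 k))).
    apply: ler_sum => k _; rewrite /telescope /geometric /= mul1r -/(u _) -/(u _).
    set q := u _ - u _.
    have p0 : 0 < 2 ^+ k :> R by rewrite exprn_gt0.
    have -> : 2^-1 ^+ k = (2 ^+ k)^-1 :> R by rewrite exprVn.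
    rewrite -real_normK ?num_real//.
    move: (2 ^+ k) `|q| p0 (normr_ge0 q) => a b a0 b0.
    rewrite -(ler_pM2l a0) mulrDr divff ?gt_eqF//.
    have : 0 <= (a * b - 1) ^+ 2 by exact: sqr_ge0.
    have : 0 <= a * b by apply: mulr_ge0 => //; exact: ltW.
    nra.
  rewrite big_split /=; apply: lerD.
    rewrite -lee_fin -GE -sumEFin; apply: nneseries_lim_ge => k _ _; exact: g0.
  have := @geometric_le_lim R N 1 2^-1 ler01.
  have -> : 1 * (1 - 2^-1)^-1 = 2 :> R by rewrite (_ : 1 - 2^-1 = 2^-1 :> R); [rewrite mul1r invrK|lra].
  apply; first lra.
  by rewrite ger0_norm; lra.
pose f x := limn (fun n => h n x).
have hf x : h n x @[n --> \oo] --> f x by exact: ch.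
have mf' : measurable_fun setT f by apply: (measurable_fun_cvg mh) => x _; exact: hf.
exists f => // n.
have ae1 m : (\int[mu]_x ((h m x - h n x) ^+ 2)%:E <= \int[mu]_x ((f_ m x - f_ n x) ^+ 2)%:E)%E.
  apply: ge0_le_integral => //.
  - by move=> x _; rewrite lee_fin sqr_ge0.
  - by apply/measurable_EFinP; apply: measurable_funX; apply: measurable_funB.
  - by apply/measurable_EFinP; apply: measurable_funX; apply: measurable_funB.
  - move=> x _; rewrite lee_fin /h -mulrBl exprMn indicE.
    by case: (x \in E); rewrite ?expr1n ?mulr1// expr0n mulr0 sqr_ge0.
apply: (@le_trans _ _ (\int[mu]_x ((f x - h n x) ^+ 2)%:E)%E).
  apply: ae_ge0_le_integral => //.
  - by move=> x _; rewrite lee_fin sqr_ge0.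
  - by apply/measurable_EFinP; apply: measurable_funX; apply: measurable_funB.
  - by move=> x _; rewrite lee_fin sqr_ge0.
  - by apply/measurable_EFinP; apply: measurable_funX; apply: measurable_funB.
  - by move: aeE; apply: filterS => x xE _; rewrite /h indicE xE mulr1.
(* Fatou's lemma in m transfers the Cauchy estimate to the limit. *)
pose F m x : \bar R := ((h m x - h n x) ^+ 2)%:E.
have FE x : limn_einf (F^~ x) = ((f x - h n x) ^+ 2)%:E.
  have c : F m x @[m --> \oo] --> ((f x - h n x) ^+ 2)%:E.
    apply: cvg_EFin; first by near=> m.
    have c1 : h m x - h n x @[m --> \oo] --> f x - h n x.
      by apply: cvgB; [exact: hf|exact: cvg_cst].
    exact: (cvgM c1 c1).
  by have [-> _] := cvg_limn_einf_sup c.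
have := @fatou _ _ _ mu setT measurableT F.
rewrite (eq_integral (fun x => ((f x - h n x) ^+ 2)%:E)); last by move=> x _; exact: FE.
move=> /(_ _ _) L; apply: le_trans (L _ _) _.
- by move=> m; apply/measurable_EFinP; apply: measurable_funX; apply: measurable_funB.
- by move=> m x _; rewrite lee_fin sqr_ge0.
rewrite limn_einf_lim; apply: lime_le.
  apply: ereal_nondecreasing_is_cvgn; exact: nondecreasing_einfs.
near=> m; apply: (@le_trans _ _ (\int[mu]_x F (maxn m n) x)%E).
  by apply: ereal_inf_lbound => /=; exists (maxn m n) => //=; rewrite leq_maxl.
by apply: le_trans (ae1 _) _; apply: H; rewrite leq_maxr.
Unshelve. all: by end_near.
Qed.


Definition L2sq (u : T -> C) : R := \int[mu]_x normsq (u x).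
Definition L2 (u : T -> C) : Prop := cmeasurable u /\ mu.-integrable setT (EFin \o (fun x => normsq (u x))).
Definition L2ip (u v : T -> C) : C := cint mu (fun x => u x * ((v x)^*)%C).

Lemma L2sq_ge0 u : 0 <= L2sq u.
Proof. by apply: Rintegral_ge0 => x _; exact: normsq_ge0. Qed.

Lemma L2sq_EFin u : L2 u -> (L2sq u)%:E = (\int[mu]_x (normsq (u x))%:E)%E.
Proof. by move=> [mu' iu]; rewrite fineK//; apply: integrable_fin_num. Qed.

Lemma L2_le u : cmeasurable u -> forall B : R, (\int[mu]_x (normsq (u x))%:E <= B%:E)%E -> L2 u /\ L2sq u <= B.
Proof.
move=> mu' B H; have lu : L2 u.
  split => //; apply/integrableP; split; first by apply/measurable_EFinP; exact: cmeasurable_normsq.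
  under eq_integral => x _ do rewrite /= ger0_norm ?normsq_ge0//.
  exact: le_lt_trans H (ltry _).
by split => //; rewrite -lee_fin L2sq_EFin.
Qed.

Lemma normsqD_le (z w : C) : normsq (z + w) <= 2 * normsq z + 2 * normsq w.
Proof.
rewrite /normsq !cE; move: (re z) (im z) (re w) (im w) => a b c e.
have := sqr_ge0 (a - c); have := sqr_ge0 (b - e); nra.
Qed.

Lemma L2Z a u : L2 u -> L2 (fun x => a * u x).
Proof.
move=> [mu' iu]; split; first by apply: cmeasurableM => //; exact: cmeasurable_cst.
under [X in integrable _ _ X]eq_fun do rewrite /= normsqM.
exact: (@riZ _ _ _ mu (normsq a) (fun x => normsq (u x))).
Qed.

Lemma L2D u v : L2 u -> L2 v -> L2 (fun x => u x + v x).
Proof.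
move=> [mu' iu] [mv iv]; split; first exact: cmeasurableD.
apply: (dom_integrable (G := fun x => 2 * normsq (u x) + 2 * normsq (v x))).
- by apply: cmeasurable_normsq; exact: cmeasurableD.
- by move=> x; rewrite ger0_norm ?normsq_ge0// normsqD_le.
- by apply: riD; apply: riZ.
Qed.

Lemma L2B u v : L2 u -> L2 v -> L2 (fun x => u x - v x).
Proof.
move=> lu lv; have := L2D lu (L2Z (-1) lv).
by under eq_fun do rewrite mulN1r.
Qed.

Lemma L2J u : L2 u -> L2 (fun x => ((u x)^*)%C).
Proof.
by move=> [mu' iu]; split; [exact: cmeasurableJ|under [X in integrable _ _ X]eq_fun do rewrite /= normsqJ].
Qed.

Lemma L2sqJ u : L2sq (fun x => ((u x)^*)%C) = L2sq u.
Proof. by apply: eq_Rintegral => x _; rewrite normsqJ. Qed.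

Lemma L2sqZ a u : L2 u -> L2sq (fun x => a * u x) = normsq a * L2sq u.
Proof.
move=> [mu' iu]; rewrite /L2sq -RintegralZl//.
by apply: eq_Rintegral => x _; rewrite normsqM.
Qed.

Lemma L2sqD_le u v : L2 u -> L2 v -> L2sq (fun x => u x + v x) <= 2 * L2sq u + 2 * L2sq v.
Proof.
move=> lu lv; have [_ iuv] := L2D lu lv; have [mu' iu] := lu; have [mv iv] := lv.
rewrite /L2sq -!RintegralZl// -RintegralD//; [|exact: riZ..].
by apply: le_Rintegral => //; [apply: riD; exact: riZ|move=> x _; exact: normsqD_le].
Qed.

Lemma normsq_prod (z w : C) (a : R) : 0 < a -> cnorm1 (z * w) <= a * normsq z + a^-1 * normsq w.
Proof.
move=> a0; apply: le_trans (cnorm1M _ _) _.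
have hz := cnorm1_ge0 z; have hw := cnorm1_ge0 w.
have Z2 : cnorm1 z ^+ 2 <= 2 * normsq z.
  rewrite /cnorm1 /normsq -(real_normK (num_real (re z))) -(real_normK (num_real (im z))).
  by have := sqr_ge0 (`|re z| - `|im z|); nra.
have W2 : cnorm1 w ^+ 2 <= 2 * normsq w.
  rewrite /cnorm1 /normsq -(real_normK (num_real (re w))) -(real_normK (num_real (im w))).
  by have := sqr_ge0 (`|re w| - `|im w|); nra.
rewrite -(ler_pM2l a0) [leRHS]mulrDr !mulrA divff ?gt_eqF// mul1r.
have := sqr_ge0 (a * cnorm1 z - cnorm1 w).
have := ler_wpM2l (sqr_ge0 a) Z2; nra.
Qed.

Lemma L2_cintegrable u v : L2 u -> L2 v -> cintegrable mu (fun x => u x * v x).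
Proof.
move=> [mu' iu] [mv iv]; apply: (cintegrable_dom (G := fun x => 1 * normsq (u x) + 1^-1 * normsq (v x))).
- exact: cmeasurableM.
- by move=> x; apply: normsq_prod.
- by apply: riD; exact: riZ.
Qed.

(** Optimisation over the weight a in [normsq_prod]. The factor 4 reflects the use of [cnorm1] for
    both the product and the integral. *)
Lemma cauchy_schwarz u v : L2 u -> L2 v -> cnorm1 (cint mu (fun x => u x * v x)) <= 4 * Num.sqrt (L2sq u) * Num.sqrt (L2sq v).
Proof.
move=> lu lv; have iuv := L2_cintegrable lu lv; have [mu' iu] := lu; have [mv iv] := lv.
have H a : 0 < a -> cnorm1 (cint mu (fun x => u x * v x)) <= 2 * (a * L2sq u + a^-1 * L2sq v).
  move=> a0; rewrite /L2sq -!RintegralZl// -RintegralD//; [|exact: riZ..].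
  by apply: cnorm1_cint => //; [move=> x; exact: normsq_prod|apply: riD; exact: riZ].
have p0 := L2sq_ge0 u; have q0 := L2sq_ge0 v.
apply/ler_addgt0Pr => e e0.
pose p := Num.sqrt (L2sq u); pose q := Num.sqrt (L2sq v).
have pE : L2sq u = p ^+ 2 by rewrite sqr_sqrtr.
have qE : L2sq v = q ^+ 2 by rewrite sqr_sqrtr.
have p1 : 0 <= p := sqrtr_ge0 _; have q1 : 0 <= q := sqrtr_ge0 _.
rewrite -/p -/q; rewrite pE qE in H.
(* The optimal weight is q / p; adding [k] to both terms keeps it positive and finite when p or q is
   0, at a cost below e. *)
pose k := e / (4 * (p + q + 1)) ; have k0 : 0 < k by rewrite divr_gt0//; lra.
have a0 : 0 < (q + k) / (p + k) by rewrite divr_gt0//; lra.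
apply: le_trans (H _ a0) _.
have -> : ((q + k) / (p + k))^-1 = (p + k) / (q + k) by rewrite invf_div.
have h1 : (q + k) / (p + k) * p ^+ 2 <= (q + k) * p.
  rewrite mulrAC ler_pdivrMr; last lra.
  by rewrite expr2 mulrA; apply: ler_wpM2l; [apply: mulr_ge0|]; lra.
have h2 : (p + k) / (q + k) * q ^+ 2 <= (p + k) * q.
  rewrite mulrAC ler_pdivrMr; last lra.
  by rewrite expr2 mulrA; apply: ler_wpM2l; [apply: mulr_ge0|]; lra.
have h3 : k * (4 * (p + q + 1)) = e by rewrite divfK// gt_eqF//; lra.
nra.
Qed.

Lemma L2sq_expand u v (t : R) : L2 u -> L2 v ->
  L2sq (fun x => u x + t%:C * v x) = L2sq u + 2 * t * re (L2ip u v) + t ^+ 2 * L2sq v.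
Proof.
move=> lu lv; have [c1 _] := L2_cintegrable lu (L2J lv); have [mu' iu] := lu; have [mv iv] := lv.
rewrite /L2ip cRe_int /L2sq -!RintegralZl// -!RintegralD//; try exact: riZ; last by apply: riD => //; exact: riZ.
by apply: eq_Rintegral => x _; rewrite /normsq !cE; ring.
Qed.

Lemma pow2_lim (X c : R) : (forall n : nat, X <= c * 2^-1 ^+ n) -> X <= 0.
Proof.
move=> H; have c1 : (fun n : nat => c * 2^-1 ^+ n) @ \oo --> (0 : R).
  by have := @cvg_geometric R c 2^-1; apply; rewrite ger0_norm; lra.
by have := limr_ge (cvgP _ c1); rewrite (cvg_lim _ c1)//; apply; apply: nearW.
Qed.

(* A minimizing sequence in Sp of L2sq u - 2 Re (l u) is Cauchy; the conjugate of its limit represents l. *)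
Theorem riesz (Sp : (T -> C) -> Prop) (l : (T -> C) -> C) (K : R) :
  (forall a u v, Sp u -> Sp v -> Sp (fun x => a * u x + v x)) -> Sp (fun=> 0) ->
  (forall u, Sp u -> L2 u) ->
  (forall a u v, Sp u -> Sp v -> l (fun x => a * u x + v x) = a * l u + l v) ->
  0 <= K -> (forall u, Sp u -> cnorm1 (l u) <= K * Num.sqrt (L2sq u)) ->
  exists h, [/\ L2 h, L2sq h <= 8 * K ^+ 2, forall u, Sp u -> l u = cint mu (fun x => h x * u x) &
    forall e, 0 < e -> exists2 u, Sp u & L2sq (fun x => h x - ((u x)^*)%C) <= e].
Proof.
move=> SD S0 SL lD K0 lK.
have SZ a u : Sp u -> Sp (fun x => a * u x).
  by move=> su; have := SD a _ _ su S0; under eq_fun do rewrite addr0.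
have l0 : l (fun=> 0) = 0.
  have := lD 1 _ _ S0 S0; under [fun _ => _]eq_fun do rewrite mulr0 addr0.
  by rewrite mul1r => /eqP; rewrite -subr_eq subrr eq_sym => /eqP.
have lZ a u : Sp u -> l (fun x => a * u x) = a * l u.
  by move=> su; have := lD a _ _ su S0; rewrite l0 addr0 => <-; congr l; apply/funext => x; rewrite addr0.
pose J u := L2sq u - 2 * re (l u).
(* Completing the square: |u|^2 - 2 K |u| >= - K^2. *)
have Jlow u : Sp u -> - K ^+ 2 <= J u.
  move=> su; have := lK _ su; have := re_cnorm1 (l u).
  have := ler_norm (re (l u)); rewrite /J -{2}(sqr_sqrtr (L2sq_ge0 u)).
  by have := sqr_ge0 (Num.sqrt (L2sq u) - K); nra.
pose Q : set R := [set J u | u in Sp].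
have hQ : has_inf Q.
  split; first by exists (J (fun=> 0)); exists (fun=> 0).
  by exists (- K ^+ 2) => _ [u su <-]; exact: Jlow.
pose I0 := inf Q.
have JI u : Sp u -> I0 <= J u by move=> su; apply: ge_inf; [exact: hQ.2|exists u].
have [u_ Hu] : {u_ : nat -> (T -> C) & forall n, Sp (u_ n) /\ J (u_ n) <= I0 + 16^-1 ^+ n}.
  apply: (@choice _ _ (fun (n : nat) u => Sp u /\ J u <= I0 + 16^-1 ^+ n)) => n.
  have e0 : 0 < (16^-1 : R) ^+ n by rewrite exprn_gt0//; lra.
  by have [_ [u su <-] lt] := inf_adherent e0 hQ; exists u; split => //; exact: ltW.
have Su n : Sp (u_ n) by have [] := Hu n.
have Lu n := SL _ (Su n).
have N1 : (-1 : C) = (-1 : R)%:C by apply: cP; rewrite !cE ?oppr0.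
(* The parallelogram identity at the midpoint (u + v) / 2, where [J] is at least [I0]. *)
have par u v : Sp u -> Sp v -> L2sq (fun x => u x - v x) <= 2 * (J u - I0) + 2 * (J v - I0).
  move=> su sv; have lu := SL _ su; have lv := SL _ sv.
  have sm := SZ (2^-1%:C) _ (SD 1 _ _ su sv).
  have := JI _ sm; rewrite /J lZ ?lD//; last exact: SD.
  rewrite L2sqZ; last exact: SL (SD 1 _ _ su sv).
  have -> : (fun x => 1 * u x + v x) = (fun x => u x + 1%:C * v x).
    by apply/funext => x; rewrite !mul1r.
  have -> : (fun x => u x - v x) = (fun x => u x + (-1 : R)%:C * v x).
    by apply/funext => x; rewrite -N1 mulN1r.
  rewrite !L2sq_expand// normsqR !cE.
  move: (L2ip u v) (l u) (l v) (L2sq u) (L2sq v) => z a b c e.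
  by move: (re z) (re a) (re b) (im a) => *; lra.
have cau n m : (n <= m)%N -> L2sq (fun x => u_ m x - u_ n x) <= 4 * 16^-1 ^+ n.
  move=> nm; apply: le_trans (par _ _ (Su m) (Su n)) _.
  have [_ h1] := Hu m; have [_ h2] := Hu n.
  have : 16^-1 ^+ m <= 16^-1 ^+ n :> R by apply: ler_wiXn2l => //; lra.
  lra.
have comp (k : C -> R) : (forall z, k z ^+ 2 <= normsq z) -> (forall z w, k (z - w) = k z - k w) ->
   (forall u : T -> C, cmeasurable u -> measurable_fun setT (fun x => k (u x))) ->
   exists2 f : T -> R, measurable_fun setT f &
     forall n, (\int[mu]_x ((f x - k (u_ n x)) ^+ 2)%:E <= (4 * 16^-1 ^+ n)%:E)%E.
  move=> ks kB km; apply: (@L2_complete_real (fun n x => k (u_ n x))) => [n|n m nm].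
    by apply: km; have [] := Lu n.
  apply: (@le_trans _ _ (L2sq (fun x => u_ m x - u_ n x))%:E); last by rewrite lee_fin cau.
  have lB := L2B (Lu m) (Lu n); rewrite L2sq_EFin//.
  apply: ge0_le_integral => //.
  - by move=> x _; rewrite lee_fin sqr_ge0.
  - apply/measurable_EFinP; apply: measurable_funX; apply: measurable_funB; [exact: km (u_ m) (Lu m).1|exact: km (u_ n) (Lu n).1].
  - by apply/measurable_EFinP; apply: cmeasurable_normsq; exact: lB.1.
  - by move=> x _; rewrite lee_fin -kB.
have [f mf Hf] := comp re (fun z => ler_wpDr (sqr_ge0 (im z)) (lexx (re z ^+ 2))) (@cReB R) (fun u h => proj1 h).
have [g mg Hg] := comp im (fun z => ler_wpDl (sqr_ge0 (re z)) (lexx (im z ^+ 2))) (@cImB R) (fun u h => proj2 h).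
pose H : T -> C := fun x => f x +i* g x.
have mH : cmeasurable H by split.
have HL n : L2 (fun x => H x - u_ n x) /\ L2sq (fun x => H x - u_ n x) <= 8 * 16^-1 ^+ n.
  have mn : cmeasurable (fun x => H x - u_ n x) by apply: cmeasurableB => //; exact: (Lu n).1.
  apply: L2_le => //.
  under eq_integral => x _ do rewrite /normsq EFinD !cE /=.
  have m1 : measurable_fun setT (fun x => ((f x - re (u_ n x)) ^+ 2)%:E).
    by apply/measurable_EFinP; apply: measurable_funX; apply: measurable_funB => //; exact: (Lu n).1.1.
  have m2 : measurable_fun setT (fun x => ((g x - im (u_ n x)) ^+ 2)%:E).
    by apply/measurable_EFinP; apply: measurable_funX; apply: measurable_funB => //; exact: (Lu n).1.2.
  rewrite ge0_integralD//; try by move=> x _; rewrite lee_fin sqr_ge0.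
  apply: le_trans (leeD (Hf n) (Hg n)) _; rewrite -EFinD lee_fin; lra.
have LH : L2 H.
  have := L2D (HL 0%N).1 (Lu 0%N); congr L2; by apply/funext => x; rewrite subrK.
have pw n : 16^-1 ^+ n = (2^-1 ^+ n) ^+ 4 :> R.
  by rewrite -exprM mulnC exprM; congr (_ ^+ _); rewrite exprVn -natrX.
have pw0 n : 0 < 2^-1 ^+ n :> R by rewrite exprn_gt0//; lra.
have pw1 n : 2^-1 ^+ n <= 1 :> R by rewrite exprn_ile1//; lra.
(* First variation: [J] at u_n + t psi is at least I0. With |t| = 2^-n, t of sign opposite to X, and
   J (u_n) <= I0 + 16^-n, the term linear in t dominates the error and forces |X| = O(2^-n). *)
have reE psi : Sp psi -> re (L2ip H psi) = re (l psi).
  move=> sp; have Lp := SL _ sp; set X := re (L2ip H psi) - re (l psi).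
  suff : `|X| <= 0 by rewrite normr_le0 subr_eq0 => /eqP.
  apply: (@pow2_lim _ (L2sq psi + 1 + 24 * Num.sqrt (L2sq psi))) => n.
  pose t0 := 2^-1 ^+ n : R; pose t := if 0 <= X then - t0 else t0.
  have t00 : 0 < t0 := pw0 n; have t01 : t0 <= 1 := pw1 n.
  have tX : t * X = - (t0 * `|X|).
    rewrite /t; case: (lerP 0 X) => h; first by rewrite mulNr ger0_norm.
    by rewrite ltr0_norm// mulrN opprK.
  have t2 : t ^+ 2 = t0 ^+ 2 by rewrite /t; case: ifP; rewrite ?sqrrN.
  have := JI _ (SD t%:C _ _ sp (Su n)).
  rewrite /J lD// (_ : (fun x => t%:C * psi x + u_ n x) = fun x => u_ n x + t%:C * psi x); last first.
    by apply/funext => x; rewrite addrC.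
  rewrite L2sq_expand// t2 !cE; have [_] := Hu n; rewrite /J pw -/t0.
  have : `|re (L2ip H psi) - re (L2ip (u_ n) psi)| <= 12 * t0 ^+ 2 * Num.sqrt (L2sq psi).
    rewrite -cReB; apply: le_trans (re_cnorm1 _) _.
    rewrite /L2ip -cintB; [|exact: L2_cintegrable (L2J _)..].
    rewrite (_ : (fun x => _) = fun x => (H x - u_ n x) * ((psi x)^*)%C); last first.
      by apply/funext => x; rewrite mulrBl.
    apply: le_trans (cauchy_schwarz (HL n).1 (L2J Lp)) _; rewrite L2sqJ.
    apply: ler_wpM2r; first exact: sqrtr_ge0.
    have -> : 12 * t0 ^+ 2 = 4 * (3 * t0 ^+ 2) by ring.
    apply: ler_wpM2l => //.
    rewrite -[leRHS]ger0_norm; last by rewrite mulr_ge0 ?sqr_ge0.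
    rewrite -sqrtr_sqr; apply: ler_wsqrtr; apply: le_trans (HL n).2 _.
    have t4 : 0 <= t0 ^+ 4 by rewrite exprn_ge0// ltW.
    rewrite pw -/t0 (_ : (3 * t0 ^+ 2) ^+ 2 = 9 * t0 ^+ 4); last by ring.
    lra.
  have hs := sqrtr_ge0 (L2sq psi); have ha := L2sq_ge0 psi.
  have -> : 2 * t * re (L2ip (u_ n) psi) = 2 * (t * X) + 2 * t * re (l psi) - 2 * t * (re (L2ip H psi) - re (L2ip (u_ n) psi)).
    by rewrite /X; ring.
  rewrite tX; set dd := re (L2ip H psi) - _ => hd h1 h2.
  have h3 : - (t * dd) <= t0 * (12 * t0 ^+ 2 * Num.sqrt (L2sq psi)).
    have -> : - (t * dd) = (- t) * dd by ring.
    apply: le_trans (ler_norm _) _; rewrite normrM normrN.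
    have -> : `|t| = t0 by rewrite /t; case: ifP; rewrite ?normrN gtr0_norm.
    by apply: ler_wpM2l => //; exact: ltW.
  rewrite -(ler_pM2l t00).
  have h4 : 2 * (t0 * `|X|) <= t0 ^+ 4 + t0 ^+ 2 * L2sq psi + 24 * t0 ^+ 3 * Num.sqrt (L2sq psi).
    by move: h1 h2 h3; rewrite !exprS !expr0; nra.
  have h5 : t0 ^+ 4 <= t0 ^+ 2 by apply: ler_wiXn2l => //; exact: ltW.
  have h6 : t0 ^+ 3 <= t0 ^+ 2 by apply: ler_wiXn2l => //; exact: ltW.
  have h7 := ler_wpM2r hs h6; have h8 := sqr_ge0 t0; have h9 := mulr_ge0 h8 ha.
  have h10 := mulr_ge0 h8 hs.
  rewrite (_ : t0 * ((L2sq psi + 1 + 24 * Num.sqrt (L2sq psi)) * t0) = t0 ^+ 2 * L2sq psi + t0 ^+ 2 + 24 * (t0 ^+ 2 * Num.sqrt (L2sq psi))); last by ring.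
  nra.
exists (fun x => ((H x)^*)%C); split.
- exact: L2J.
- rewrite L2sqJ -subr_le0; apply: (@pow2_lim _ 20) => n.
  (* Since I0 <= J 0 = 0, |u_n|^2 is at most 2 re (l u_n) + 16^-n, and half of |u_n|^2 absorbs the
     linear term. *)
  have hu : L2sq (u_ n) <= 4 * K ^+ 2 + 2 * 16^-1 ^+ n.
    have [_] := Hu n; have := JI _ S0; rewrite /J l0 cRe0.
    have -> : L2sq (fun=> 0) = 0 by rewrite /L2sq /normsq /= expr0n addr0 Rintegral_cst// mul0r.
    have := lK _ (Su n); have := re_cnorm1 (l (u_ n)); have := ler_norm (re (l (u_ n))).
    rewrite -{2}(sqr_sqrtr (L2sq_ge0 (u_ n))) -{3}(sqr_sqrtr (L2sq_ge0 (u_ n))).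
    by have := sqr_ge0 (Num.sqrt (L2sq (u_ n)) - 2 * K); nra.
  have -> : L2sq H = L2sq (fun x => (H x - u_ n x) + u_ n x).
    by congr L2sq; apply/funext => x; rewrite subrK.
  rewrite lerBlDr; apply: le_trans (L2sqD_le (HL n).1 (Lu n)) _.
  have := (HL n).2; have : 16^-1 ^+ n <= 2^-1 ^+ n :> R.
    by apply: lerXn2r; rewrite ?nnegrE; lra.
  lra.
- move=> u su; rewrite -(_ : ((L2ip H u)^*)%C = cint mu (fun x => ((H x)^*)%C * u x)); last first.
    rewrite /L2ip -cint_conj; last exact: L2_cintegrable LH (L2J (SL _ su)).
    by apply: cint_ext => x; apply: cP; rewrite !cE; ring.
  have e1 := reE _ su; suff e2 : im (l u) = - im (L2ip H u).
    by apply: cP; rewrite ?cReJ ?cImJ.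
  (* Testing with i u recovers the imaginary part. *)
  have := reE _ (SZ (0 +i* 1) _ su).
  rewrite lZ// /L2ip (cint_ext _ (g := fun x => (0 -i* 1) * (H x * ((u x)^*)%C))); last first.
    by move=> x; apply: cP; rewrite !cE /=; ring.
  rewrite cintZ; last exact: L2_cintegrable LH (L2J (SL _ su)).
  rewrite -/(L2ip H u) !cE; clear; move: (L2ip H u) (l u) => -[a b] [c e] /=; rewrite !mul0r; lra.
- move=> e e0; have [n Hn] : exists n : nat, 8 * 16^-1 ^+ n <= e.
    apply: contrapT => /forallNP h; suff : e <= 0 by lra.
    apply: (@pow2_lim _ 8) => n; have /negP := h n; rewrite -ltNge => /ltW h1.
    apply: le_trans h1 _; apply: ler_wpM2l => //.
    by apply: lerXn2r; rewrite ?nnegrE; lra.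
  exists (u_ n) => //; apply: le_trans Hn; apply: le_trans (HL n).2.
  rewrite -L2sqJ le_eqVlt (_ : (_ == _) = true)//; apply/eqP; congr L2sq.
  by apply/funext => x; apply: cP; rewrite !cE; ring.
Qed.

End L2.

(** * The anisotropic Sobolev spaces *)

Section Hspaces.
Variable R : realType.
Local Notation mR := (measurableTypeR R).
Local Notation C := R[i].
Local Notation fn := (R * R -> C).
Local Notation re := (@complex.Re R).
Local Notation im := (@complex.Im R).

Definition mu_xv (D : xspace) : {measure set (mR * mR) -> \bar R} := (kmeasure_sf R (xkind D) \x kmeasure_sf R Ln)%E.
Definition mu_freq (D : xspace) : {measure set (mR * mR) -> \bar R} := (kmeasure_sf R (xikind D) \x kmeasure_sf R Ln)%E.

Definition japx (a : R) (p : R * R) : R := (1 + p.1 ^+ 2) `^ (a / 2).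
Definition japv (a : R) (p : R * R) : R := (1 + p.2 ^+ 2) `^ (a / 2).
Definition japxv (a b : R) (p : R * R) : R := japx a p * japv b p.

Lemma japxv_x a p : japxv a 0 p = japx a p.
Proof. by rewrite /japxv /japv mul0r powRr0 mulr1. Qed.

Lemma japxv_v b p : japxv 0 b p = japv b p.
Proof. by rewrite /japxv /japx mul0r powRr0 mul1r. Qed.

Lemma japx_gt0 a p : 0 < japx a p.
Proof. by apply: powR_gt0; exact: oneDsq_gt0. Qed.

Lemma japv_gt0 a p : 0 < japv a p.
Proof. by apply: powR_gt0; exact: oneDsq_gt0. Qed.

Lemma japv0 p : japv 0 p = 1. Proof. by rewrite /japv mul0r powRr0. Qed.

Lemma japxD a b p : japx (a + b) p = japx a p * japx b p.
Proof. by rewrite /japx mulrDl powRD// (gt_eqF (oneDsq_gt0 _)) implybT. Qed.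

Lemma japxK a p : japx a p * japx (- a) p = 1.
Proof. by rewrite -japxD subrr /japx mul0r powRr0. Qed.

Lemma smooth_japx K u a : K <> Pr -> smooth K Ln u -> smooth K Ln (fun p => (japx a p)%:C * u p).
Proof. by move=> KP su; exact: (smoothM1 KP (symbol_jap (a / 2)) su). Qed.

Lemma smooth_japv K u a : smooth K Ln u -> smooth K Ln (fun p => (japv a p)%:C * u p).
Proof. by move=> su; apply: (smoothM2 _ (symbol_jap (a / 2)) su). Qed.

Lemma kfP D : xikind D <> Pr. Proof. by case: D. Qed.

Lemma smooth_japxv D u a b : smooth (xikind D) Ln u -> smooth (xikind D) Ln (fun p => (japxv a b p)%:C * u p).
Proof.
move=> su; have := smooth_japx a (@kfP D) (smooth_japv b su).
by under eq_fun do rewrite mulrA -rmorphM.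
Qed.

Lemma measurable_j1 a : measurable_fun setT (fun x : mR => (1 + x ^+ 2) `^ a).
Proof. by have [[[h _] _] _] := symbol_jap a 0%N; exact: h. Qed.

Lemma measurable_japx a : measurable_fun setT (fun p : mR * mR => japx a p).
Proof. exact: (measurableT_comp (measurable_j1 (a / 2)) measurable_fst). Qed.

Lemma measurable_japv a : measurable_fun setT (fun p : mR * mR => japv a p).
Proof. exact: (measurableT_comp (measurable_j1 (a / 2)) measurable_snd). Qed.

(** The multiplier acting on test functions; by transposition, a multiplier applied to a
    distribution evaluates it here. *)
Definition mult D (m : R * R -> R) (phi : fn) : fn := iFT2 D (fun p => (m p)%:C * FT2 D phi p).

Lemma smooth_mult D a b phi : smooth (xkind D) Ln phi -> smooth (xkind D) Ln (mult D (japxv a b) phi).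
Proof. by move=> su; apply: smooth_iFT2; apply: smooth_japxv; exact: smooth_FT2. Qed.

Lemma FT2_mult D a b phi : smooth (xkind D) Ln phi -> FT2 D (mult D (japxv a b) phi) = fun p => (japxv a b p)%:C * FT2 D phi p.
Proof. by move=> su; apply: FT2_iFT2; apply: smooth_japxv; exact: smooth_FT2. Qed.

Lemma iFT2L D a (u v : fn) : smooth (xikind D) Ln u -> smooth (xikind D) Ln v ->
  iFT2 D (fun p => a * u p + v p) = fun p => a * iFT2 D u p + iFT2 D v p.
Proof.
move=> su sv; have e := FT2L a (smooth_iFT2 su) (smooth_iFT2 sv).
apply: etrans (iFT2_FT2 (smoothD a (smooth_iFT2 su) (smooth_iFT2 sv))); apply: (congr1 (iFT2 D)).
apply: etrans (esym e); apply/funext => p; congr (a * _ + _).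
  exact: (congr1 (fun f => f p) (esym (FT2_iFT2 su))).
exact: (congr1 (fun f => f p) (esym (FT2_iFT2 sv))).
Qed.

Lemma multL D a b c (u v : fn) : smooth (xkind D) Ln u -> smooth (xkind D) Ln v ->
  mult D (japxv a b) (fun p => c * u p + v p) = fun p => c * mult D (japxv a b) u p + mult D (japxv a b) v p.
Proof.
move=> su sv; rewrite /mult -iFT2L; [|exact: smooth_japxv (smooth_FT2 su)|exact: smooth_japxv (smooth_FT2 sv)].
by congr iFT2; apply/funext => p; rewrite (FT2L c su sv) mulrDr mulrCA.
Qed.

Lemma Lambda_xE D a (f : dist R) phi : smooth (xkind D) Ln phi -> Lambda_x D a f phi = f (mult D (japxv a 0) phi).
Proof.
move=> su; rewrite /Lambda_x /multiplier /inv_fourier /mulf /fourier.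
have mm : cmeasurable2 (fun p => (japx a p)%:C : C) by apply: cmeasurableR; exact: measurable_japx.
apply: etrans (congr1 f (@osc_mul _ D (japx a) phi su mm (@smooth_japx (xikind D) _ a (@kfP D) (smooth_FT2 su)))) _.
apply: (congr1 f); apply: (congr1 (iFT2 D)); apply/funext => p; apply: (congr1 (fun z : R => z%:C * _)).
by rewrite /japxv japv0 mulr1.
Qed.

Lemma Lambda_vE D b (f : dist R) phi : smooth (xkind D) Ln phi -> Lambda_v D b f phi = f (mult D (japxv 0 b) phi).
Proof.
move=> su; rewrite /Lambda_v /multiplier /inv_fourier /mulf /fourier.
have mm : cmeasurable2 (fun p => (japv b p)%:C : C) by apply: cmeasurableR; exact: measurable_japv.
apply: etrans (congr1 f (@osc_mul _ D (japv b) phi su mm (@smooth_japv (xikind D) _ b (smooth_FT2 su)))) _.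
apply: (congr1 f); apply: (congr1 (iFT2 D)); apply/funext => p; apply: (congr1 (fun z : R => z%:C * _)).
by rewrite /japxv /japx mul0r powRr0 mul1r.
Qed.

Lemma LambdaE D a b (f : dist R) phi : smooth (xkind D) Ln phi ->
  Lambda_x D a (Lambda_v D b f) phi = f (mult D (japxv a b) phi).
Proof.
move=> su; apply: etrans (Lambda_xE _ _ su) _; apply: etrans (Lambda_vE _ _ (smooth_mult a 0 su)) _.
apply: (congr1 f); apply: (congr1 (iFT2 D)); rewrite (FT2_mult a 0 su); apply/funext => p.
by rewrite mulrA -rmorphM japxv_v japxv_x (mulrC (japv b p)).
Qed.

Lemma mult_inv D a phi : smooth (xkind D) Ln phi -> mult D (japxv a 0) (mult D (japxv (- a) 0) phi) = phi.
Proof.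
move=> su; rewrite {1}/mult (FT2_mult (- a) 0 su) -[RHS](iFT2_FT2 su); apply: (congr1 (iFT2 D)); apply/funext => p.
by rewrite mulrA -rmorphM /japxv !japv0 !mulr1 japxK mul1r.
Qed.

Lemma L2_smooth K u : smooth K Ln u -> L2 (kmeasure_sf R K \x kmeasure_sf R Ln)%E u.
Proof.
move=> su; have [c c0 H] := decay 0 0 (smooth_decaying su); have mu := decaying_meas (smooth_decaying su); split => //.
have i := integrable_prod (m1 := kmeasure_sf R K) (m2 := kmeasure_sf R Ln) (G1 := fun x => c ^+ 2 * kdecay K x) (G2 := kdecay Ln).
apply: (@dom_integrable _ _ _ (kmeasure_sf R K \x kmeasure_sf R Ln)%E _ (fun p : mR * mR => c ^+ 2 * kdecay K p.1 * kdecay Ln p.2)).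
- exact: cmeasurable_normsq.
- move=> -[x y]; rewrite ger0_norm ?normsq_ge0//=; apply: le_trans (normsq_cnorm1 _) _.
  have := H x y; rewrite !kweight0 !mul1r => h.
  have w1 := kdecay_gt0 K x; have w2 := kdecay_gt0 Ln y; have w3 := kdecay_le1 K x; have w4 := kdecay_le1 Ln y.
  apply: (@le_trans _ _ ((c * (kdecay K x * kdecay Ln y)) ^+ 2)).
    by rewrite ler_pXn2r ?nnegrE ?cnorm1_ge0// !mulr_ge0// ltW.
  rewrite exprMn -mulrA; apply: ler_wpM2l; first exact: sqr_ge0.
  rewrite expr2 ler_piMr//; first by rewrite mulr_ge0// ltW.
  by rewrite mulr_ile1// ltW.
- apply: i.
  + by move=> x; rewrite mulr_ge0 ?sqr_ge0// ltW// kdecay_gt0.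
  + by move=> x; rewrite ltW// kdecay_gt0.
  + exact: iW.
  + exact: integrable_kdecay.
Qed.

Lemma L2sq_FT2 D u : smooth (xkind D) Ln u -> L2sq (mu_freq D) (FT2 D u) = L2sq (mu_xv D) u.
Proof. by move=> su; have := plancherel su => /(congr1 fine). Qed.

Lemma FT2Z D c (u : fn) : smooth (xkind D) Ln u -> FT2 D (fun p => c * u p) = fun p => c * FT2 D u p.
Proof.
move=> su; have := FT2L (c - 1) su su.
have e (f : fn) : (fun p => (c - 1) * f p + f p) = fun p => c * f p.
  by apply/funext => p; rewrite mulrBl mul1r subrK.
by rewrite !e.
Qed.

Lemma L2ip_i (mu : {measure set (mR * mR) -> \bar R}) (f g : fn) : L2 mu f -> L2 mu g ->
  re (L2ip mu f (fun p => (0 +i* 1) * g p)) = im (L2ip mu f g).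
Proof.
move=> lf lg.
have -> : L2ip mu f (fun p => (0 +i* 1) * g p) = (0 -i* 1) * L2ip mu f g.
  apply: etrans (cintZ _ (L2_cintegrable lf (L2J lg))); apply: cint_ext => x.
  by move: (f x) (g x) => [a b] [c e]; apply: cP; rewrite !cE /=; ring.
by move: (L2ip mu f g) => [a b] /=; ring.
Qed.

Lemma cancel_sqr (a b c e g h : R) : g = c -> h = e ->
  g + 2 * 1 * a + 1 ^+ 2 * h = c + 2 * 1 * b + 1 ^+ 2 * e -> a = b.
Proof. by move=> -> ->; rewrite expr1n => E; lra. Qed.

(** Polarisation: Plancherel for u, w and u + w. Replacing w by i w then gives the imaginary
    part. *)
Lemma re_L2ip_FT2 D (u w : fn) : smooth (xkind D) Ln w -> smooth (xkind D) Ln u ->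
  re (L2ip (mu_freq D) (FT2 D u) (FT2 D w)) = re (L2ip (mu_xv D) u w).
Proof.
move=> sw su; have := L2sq_FT2 (smoothD (1 : R)%:C sw su).
have -> : FT2 D (fun p => 1%:C * w p + u p) = fun p => FT2 D u p + 1%:C * FT2 D w p.
  by apply: etrans (FT2L _ sw su) _; apply/funext => p; rewrite addrC.
have -> : (fun p => 1%:C * w p + u p) = fun p => u p + 1%:C * w p.
  by apply/funext => p; rewrite addrC.
have lu : L2 (mu_xv D) u := L2_smooth su; have lw : L2 (mu_xv D) w := L2_smooth sw.
have lu' : L2 (mu_freq D) (FT2 D u) := L2_smooth (smooth_FT2 su); have lw' : L2 (mu_freq D) (FT2 D w) := L2_smooth (smooth_FT2 sw).
move=> E0; exact: (cancel_sqr (L2sq_FT2 su) (L2sq_FT2 sw) (etrans (etrans (esym (L2sq_expand 1 lu' lw')) E0) (L2sq_expand 1 lu lw))).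
Qed.

Lemma L2ip_FT2 D (u v : fn) : smooth (xkind D) Ln u -> smooth (xkind D) Ln v -> L2ip (mu_freq D) (FT2 D u) (FT2 D v) = L2ip (mu_xv D) u v.
Proof.
move=> su sv; apply: cP; first exact: re_L2ip_FT2.
have lu : L2 (mu_xv D) u := L2_smooth su; have lv : L2 (mu_xv D) v := L2_smooth sv.
have lu' : L2 (mu_freq D) (FT2 D u) := L2_smooth (smooth_FT2 su); have lv' : L2 (mu_freq D) (FT2 D v) := L2_smooth (smooth_FT2 sv).
rewrite -(L2ip_i lu lv) -(L2ip_i lu' lv') -(FT2Z _ sv); exact: re_L2ip_FT2 (smoothZ _ sv) su.
Qed.

End Hspaces.

(** * The norm of H^{r,0} by duality *)

Section Hnorms.
Variable R : realType.
Local Notation mR := (measurableTypeR R).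
Local Notation C := R[i].
Local Notation fn := (R * R -> C).
Local Notation re := (@complex.Re R).
Local Notation im := (@complex.Im R).
Local Notation normc := ComplexField.Normc.normc.

Lemma L2fun_normE D (g : fn) : L2fun_norm D g = sqrte (\int[mu_xv R D]_p (normsq (g p))%:E)%E.
Proof.
have H (mu : {measure set (mR * mR) -> \bar R}) :
    Lnorm mu 2%:E (fun p => (normc (g p))%:E) = sqrte (\int[mu]_p (normsq (g p))%:E)%E.
  rewrite unlock poweR12_sqrt; last by apply: integral_ge0 => x _; exact: poweR_ge0.
  congr sqrte; apply: eq_integral => p _.
  by rewrite /= ger0_norm ?normc_ge0// powR_mulrn ?normc_ge0// normc_normsq.
by rewrite /L2fun_norm /mu_xv; case: D; exact: H.
Qed.

Lemma L2funP D (g : fn) : L2fun D g <-> L2 (mu_xv R D) g.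
Proof.
have sl (x : \bar R) : (0 <= x)%E -> ((sqrte x < +oo) <-> (x < +oo))%E.
  by case: x => [x||] //= _; split => // _; exact: ltry.
have i0 : (0 <= \int[mu_xv R D]_p (normsq (g p))%:E)%E.
  by apply: integral_ge0 => p _; rewrite lee_fin normsq_ge0.
split=> [[m1 m2]|[[m1 m2] ig]].
  rewrite L2fun_normE => /(sl _ i0) h; split => //.
  apply/integrableP; split; first by apply/measurable_EFinP; exact: (@cmeasurable_normsq _ _ _ g).
  by under eq_integral => x _ do rewrite /= ger0_norm ?normsq_ge0//.
split => //; rewrite L2fun_normE; apply/(sl _ i0).
by apply: le_lt_trans (integrable_lty _ ig).
Qed.

Lemma L2fun_norm_L2sq D (g : fn) : L2 (mu_xv R D) g -> L2fun_norm D g = (Num.sqrt (L2sq (mu_xv R D) g))%:E.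
Proof. by move=> lg; rewrite L2fun_normE -L2sq_EFin. Qed.

Variables (D : xspace) (r : R).
Local Notation Sw := (smooth (xkind D) Ln).

Definition dist_linear (f : dist R) := forall a (phi psi : fn), Sw phi -> Sw psi ->
  f (fun p => a * phi p + psi p) = a * f phi + f psi.

(** The H^{-r,0} norm of a test function. *)
Definition dual_norm (phi : fn) : R := Num.sqrt (L2sq (mu_xv R D) (mult D (japxv (- r) 0) phi)).

(** The working form of the H^{r,0} norm: it is tested on one phi at a time and mentions no
    representative. It agrees with [Hnorm] up to the factors 3 and 4 of the lemmas below. *)
Definition dual_bounded (f : dist R) (K : R) := forall phi, Sw phi -> cnorm1 (f phi) <= K * dual_norm phi.

Lemma dual_norm_ge0 phi : 0 <= dual_norm phi. Proof. exact: sqrtr_ge0. Qed.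

Lemma tempered_dist_linear (f : dist R) : tempered D f -> dist_linear f.
Proof. by move=> [h _] a phi psi sp sq; apply: h; apply/schwartzP. Qed.

Lemma riesz_X (l : dist R) (K : R) : dist_linear l -> 0 <= K ->
  (forall u, Sw u -> cnorm1 (l u) <= K * Num.sqrt (L2sq (mu_xv R D) u)) ->
  exists h, [/\ L2 (mu_xv R D) h, L2sq (mu_xv R D) h <= 8 * K ^+ 2,
    forall u, Sw u -> l u = cint (mu_xv R D) (fun x => h x * u x) &
    forall e, 0 < e -> exists2 u, Sw u & L2sq (mu_xv R D) (fun x => h x - ((u x)^*)%C) <= e].
Proof.
move=> ll K0 H.
apply: (@riesz R _ (mR * mR)%type (mu_xv R D) (fun u => smooth (xkind D) Ln u) l K _ _ _ ll K0 H).
- by move=> a u v su sv; exact: smoothD.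
- exact: smooth0.
- by move=> u su; exact: L2_smooth.
Qed.

Lemma dist_linear_mult (f : dist R) a b : dist_linear f -> dist_linear (fun phi => f (mult D (japxv a b) phi)).
Proof.
move=> lf c phi psi sp sq.
by rewrite (multL a b c sp sq); apply: lf; exact: smooth_mult.
Qed.

Lemma Hnorm_le a b (f : dist R) (K : R) : dist_linear f -> 0 <= K ->
  (forall phi, Sw phi -> cnorm1 (f (mult D (japxv a b) phi)) <= K * Num.sqrt (L2sq (mu_xv R D) phi)) ->
  in_L2 D (Lambda_x D a (Lambda_v D b f)) /\ (Hnorm D a b f <= (3 * K)%:E)%E.
Proof.
move=> lf K0 H; have [h [Lh Ah hE _]] := riesz_X (dist_linear_mult a b lf) K0 H.
have rep : represents D h (Lambda_x D a (Lambda_v D b f)).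
  move=> phi /schwartzP sp; apply: etrans (LambdaE _ _ _ sp) _.
  by apply: etrans (hE _ sp) _; apply: esym; exact: cintegral_xv.
have Lf : L2fun D h by apply/L2funP.
split; first by exists h.
apply: (@le_trans _ _ (L2fun_norm D h)); first by apply: ereal_inf_lbound; exists h.
rewrite L2fun_norm_L2sq// lee_fin.
have -> : 3 * K = Num.sqrt ((3 * K) ^+ 2) by rewrite sqrtr_sqr ger0_norm// mulr_ge0.
by apply: ler_wsqrtr; apply: le_trans Ah _; have := sqr_ge0 K; nra.
Qed.

Lemma repr_dual_norm (f : dist R) g : L2 (mu_xv R D) g ->
  represents D g (Lambda_x D r (Lambda_v D 0 f)) ->
  forall phi, Sw phi -> f phi = cint (mu_xv R D) (fun p => g p * mult D (japxv (- r) 0) phi p).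
Proof.
move=> Lg rep phi sp; have sm := smooth_mult (- r) 0 sp.
have := rep _ ((schwartzP _ _).2 sm); rewrite (LambdaE r 0 f sm) (mult_inv r sp) => ->.
exact: cintegral_xv.
Qed.

Lemma Hnorm_repr (f : dist R) (K : R) : (Hnorm D r 0 f < K%:E)%E ->
  exists g, [/\ L2 (mu_xv R D) g, Num.sqrt (L2sq (mu_xv R D) g) < K &
    forall phi, Sw phi -> f phi = cint (mu_xv R D) (fun p => g p * mult D (japxv (- r) 0) phi p)].
Proof.
rewrite /Hnorm /L2norm => /ereal_inf_lt[_ [g [Lf rep] <-]].
have Lg : L2 (mu_xv R D) g by apply/L2funP.
by rewrite L2fun_norm_L2sq// lte_fin => lt; exists g; split => //; exact: repr_dual_norm.
Qed.

Lemma Hnorm_ge0 a b (f : dist R) : (0 <= Hnorm D a b f)%E.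
Proof.
apply: le_ereal_inf_tmp => _ [g _ <-]; rewrite L2fun_normE; exact: sqrte_ge0.
Qed.

Lemma dual_bounded_Hnorm_lt (f : dist R) (K : R) : (Hnorm D r 0 f < K%:E)%E -> dual_bounded f (4 * K).
Proof.
move=> /Hnorm_repr[g [Lg lt gE]] phi sp; rewrite (gE _ sp).
have Lp : L2 (mu_xv R D) (mult D (japxv (- r) 0) phi) := L2_smooth (smooth_mult (- r) 0 sp).
apply: le_trans (cauchy_schwarz Lg Lp) _; apply: ler_wpM2r; first exact: dual_norm_ge0.
by apply: ler_wpM2l => //; exact: ltW.
Qed.

(** The norm is an infimum, so a representative is taken with norm below K + e'; [e'] is chosen to
    make the excess at phi smaller than e. *)
Lemma dual_bounded_Hnorm (f : dist R) (K : R) : (Hnorm D r 0 f <= K%:E)%E -> dual_bounded f (4 * K).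
Proof.
move=> H phi sp; apply/ler_addgt0Pr => e e0.
pose e' := e / (4 * (dual_norm phi + 1)).
have n0 := dual_norm_ge0 phi; have e'0 : 0 < e' by rewrite divr_gt0//; lra.
have := @dual_bounded_Hnorm_lt f (K + e') (le_lt_trans H _) phi sp.
rewrite lte_fin ltrDl => /(_ e'0) /le_trans; apply.
have h3 : e' * (4 * (dual_norm phi + 1)) = e by rewrite divfK// gt_eqF//; lra.
nra.
Qed.

Lemma Hnorm_fin (f : dist R) : Hspace D r 0 f -> exists2 K, 0 <= K & Hnorm D r 0 f = K%:E.
Proof.
move=> [_ [g [Lf rep]]]; have h0 := Hnorm_ge0 r 0 f.
have : (Hnorm D r 0 f < +oo)%E.
  apply: (@le_lt_trans _ _ (L2fun_norm D g)); last by have [] := Lf.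
  by apply: ereal_inf_lbound; exists g.
by move: h0; case: (Hnorm D r 0 f) => // K; rewrite lee_fin => K0 _; exists K.
Qed.

Lemma Hspace_dual_bounded (f : dist R) : Hspace D r 0 f -> dist_linear f /\ exists2 K, 0 <= K & dual_bounded f K.
Proof.
move=> Hf; split; first by have [/tempered_dist_linear] := Hf.
have [K K0 E] := Hnorm_fin Hf; exists (4 * K); first by rewrite mulr_ge0.
by apply: dual_bounded_Hnorm; rewrite E.
Qed.

Lemma dual_bounded_Hnorm_le (f : dist R) (K : R) : dist_linear f -> 0 <= K -> dual_bounded f K ->
  in_L2 D (Lambda_x D r (Lambda_v D 0 f)) /\ (Hnorm D r 0 f <= (3 * K)%:E)%E.
Proof.
move=> lf K0 H; apply: Hnorm_le => // phi sp.
have := H _ (smooth_mult r 0 sp); rewrite /dual_norm.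
have E := mult_inv (- r) sp; rewrite opprK in E; by rewrite E.
Qed.

(* The distribution whose Fourier transform is W. *)
Definition freq_dist (W : fn) : dist R := fun phi => cint (mu_freq R D) (fun p => W p * FT2 D phi p).

Lemma dual_normE phi : Sw phi -> dual_norm phi = Num.sqrt (L2sq (mu_freq R D) (fun p => (japx (- r) p)%:C * FT2 D phi p)).
Proof.
move=> sp; rewrite /dual_norm -(L2sq_FT2 (smooth_mult (- r) 0 sp)) (FT2_mult (- r) 0 sp).
congr (Num.sqrt (L2sq _ _)); apply/funext => p; by rewrite japxv_x.
Qed.

Lemma L2_mul_le (mu : {measure set (mR * mR) -> \bar R}) (k : R * R -> R) (M : R) (W : fn) :
  measurable_fun setT (fun p : mR * mR => k p) -> (forall p, `|k p| <= M) -> L2 mu W ->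
  L2 mu (fun p => (k p)%:C * W p) /\ L2sq mu (fun p => (k p)%:C * W p) <= M ^+ 2 * L2sq mu W.
Proof.
move=> mk kM [mW iW']; apply: L2_le.
  by apply: cmeasurableM => //; apply: cmeasurableR.
rewrite EFinM L2sq_EFin// -ge0_integralZl//.
- apply: ge0_le_integral => //.
  + by move=> p _; rewrite lee_fin normsq_ge0.
  + by apply/measurable_EFinP; apply: cmeasurable_normsq; apply: cmeasurableM => //; apply: cmeasurableR.
  + apply: emeasurable_funM => //; by apply/measurable_EFinP; exact: cmeasurable_normsq.
  + move=> p _; rewrite -EFinM lee_fin normsqM normsqR; apply: ler_wpM2r; first exact: normsq_ge0.
    rewrite -(real_normK (num_real (k p))); have := kM p; have := normr_ge0 (k p); nra.
- by apply/measurable_EFinP; exact: cmeasurable_normsq.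
- by move=> p _; rewrite lee_fin normsq_ge0.
- by rewrite lee_fin sqr_ge0.
Qed.

Lemma freq_dist_cintegrable W phi : L2 (mu_freq R D) (fun p => (japx r p)%:C * W p) -> Sw phi ->
  cintegrable (mu_freq R D) (fun p => W p * FT2 D phi p) /\ cnorm1 (freq_dist W phi) <= 4 * Num.sqrt (L2sq (mu_freq R D) (fun p => (japx r p)%:C * W p)) * dual_norm phi.
Proof.
move=> LW sp.
have L' : L2 (mu_freq R D) (fun p => (japx (- r) p)%:C * FT2 D phi p).
  by have := L2_smooth (smooth_japx (- r) (@kfP D) (smooth_FT2 sp)).
have e : (fun p => ((japx r p)%:C * W p) * ((japx (- r) p)%:C * FT2 D phi p)) = fun p => W p * FT2 D phi p.
  apply/funext => p; rewrite mulrACA -rmorphM japxK.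
  exact: mul1r.
have c := L2_cintegrable LW L'; rewrite e in c.
by split => //; rewrite (dual_normE sp); have := cauchy_schwarz LW L'; rewrite e.
Qed.

Lemma dual_bounded_freq_dist W : L2 (mu_freq R D) (fun p => (japx r p)%:C * W p) ->
  dual_bounded (freq_dist W) (4 * Num.sqrt (L2sq (mu_freq R D) (fun p => (japx r p)%:C * W p))).
Proof. by move=> LW phi sp; have [] := freq_dist_cintegrable LW sp. Qed.

Lemma dist_linear_freq_dist W : L2 (mu_freq R D) (fun p => (japx r p)%:C * W p) -> dist_linear (freq_dist W).
Proof.
move=> LW a phi psi sp sq; have [cp _] := freq_dist_cintegrable LW sp; have [cq _] := freq_dist_cintegrable LW sq.
rewrite /freq_dist -(cintZ a cp) -(cintD (cintegrableZ a cp) cq); apply: cint_ext => p.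
by rewrite (FT2L a sp sq) mulrDr mulrCA.
Qed.

(** Density. The Riesz representative h of Lambda_x^r f is a limit of conjugates of test functions
    u; W is the conjugate of [FT2 D u] divided by the weight, and Plancherel transfers the
    approximation. *)
Lemma freq_dist_approx (f : dist R) (K e : R) : Hspace D r 0 f -> (Hnorm D r 0 f <= K%:E)%E -> 0 < e ->
  exists W, [/\ smooth (xikind D) Ln W, dual_bounded (fun phi => f phi - freq_dist W phi) e &
    L2sq (mu_freq R D) (fun p => (japx r p)%:C * W p) <= (24 * K + e) ^+ 2].
Proof.
move=> Hf HK e0; have [lf _] := Hspace_dual_bounded Hf.
have K0 : 0 <= K by rewrite -lee_fin (le_trans (Hnorm_ge0 _ _ _) HK).
pose l : dist R := fun u => f (mult D (japxv r 0) u).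
have [h [Lh Ah hE hap]] : exists h, [/\ L2 (mu_xv R D) h, L2sq (mu_xv R D) h <= 8 * (4 * K) ^+ 2,
    forall u, Sw u -> l u = cint (mu_xv R D) (fun x => h x * u x) &
    forall e, 0 < e -> exists2 u, Sw u & L2sq (mu_xv R D) (fun x => h x - ((u x)^*)%C) <= e].
  apply: riesz_X; first exact: dist_linear_mult; first by rewrite mulr_ge0.
  move=> u su; have := dual_bounded_Hnorm HK (smooth_mult r 0 su); rewrite /dual_norm.
  by have E := mult_inv (- r) su; rewrite opprK in E; rewrite E.
(* The distance e / 4 compensates the factor 4 of [cauchy_schwarz]. *)
have d0 : 0 < (e / 4) ^+ 2 by rewrite exprn_gt0// divr_gt0.
have [u su Hu] := hap _ d0.
have sE := smooth_FT2 su; have suJ := smoothJ su.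
have LuJ : L2 (mu_xv R D) (fun p => ((u p)^*)%C) := L2_smooth suJ.
have japxKC p : (japx r p)%:C * (japx (- r) p)%:C = 1 :> C by rewrite -rmorphM japxK.
have WE : (fun p => (japx r p)%:C * ((japx (- r) p)%:C * ((FT2 D u p)^*)%C)) = fun p => ((FT2 D u p)^*)%C.
  by apply/funext => p; rewrite mulrA japxKC mul1r.
exists (fun p => (japx (- r) p)%:C * ((FT2 D u p)^*)%C); split.
- by apply: smooth_japx (@kfP D) _; exact: smoothJ.
- move=> phi sp; have sm := smooth_mult (- r) 0 sp.
  have -> : f phi = cint (mu_xv R D) (fun p => h p * mult D (japxv (- r) 0) phi p).
    by apply: etrans (hE _ sm); rewrite /l (mult_inv r sp).
  have -> : freq_dist (fun p => (japx (- r) p)%:C * ((FT2 D u p)^*)%C) phi =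
      cint (mu_xv R D) (fun p => ((u p)^*)%C * mult D (japxv (- r) 0) phi p).
    have := L2ip_FT2 sm su; rewrite /L2ip (FT2_mult (- r) 0 sp) => E.
    rewrite /freq_dist; transitivity (cint (mu_freq R D) (fun x => (japxv (- r) 0 x)%:C * FT2 D phi x * ((FT2 D u x)^*)%C)).
      apply: cint_ext => p; rewrite japxv_x; move: (FT2 D u p) (FT2 D phi p) => a b; exact: mulrAC.
    by apply: etrans E _; apply: cint_ext => p; exact: mulrC.
  have Lm : L2 (mu_xv R D) (mult D (japxv (- r) 0) phi) := L2_smooth sm.
  rewrite -(cintB (L2_cintegrable Lh Lm) (L2_cintegrable LuJ Lm)).
  have -> : (fun p => h p * mult D (japxv (- r) 0) phi p - ((u p)^*)%C * mult D (japxv (- r) 0) phi p) =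
      fun p => (h p - ((u p)^*)%C) * mult D (japxv (- r) 0) phi p by apply/funext => p; rewrite mulrBl.
  apply: le_trans (cauchy_schwarz (L2B Lh LuJ) Lm) _; apply: ler_wpM2r; first exact: dual_norm_ge0.
  have -> : e = 4 * (e / 4) by rewrite mulrC divfK.
  apply: ler_wpM2l => //.
  rewrite -[leRHS]ger0_norm; last by rewrite divr_ge0// ltW.
  by rewrite -sqrtr_sqr; apply: ler_wsqrtr.
- rewrite WE L2sqJ (L2sq_FT2 su).
  have -> : L2sq (mu_xv R D) u = L2sq (mu_xv R D) (fun p => h p + -1 * (h p - ((u p)^*)%C)).
    rewrite -L2sqJ; congr L2sq; apply/funext => p.
    by rewrite mulN1r opprB addrCA subrr addr0.
  have LB := L2B Lh LuJ.
  apply: le_trans (L2sqD_le Lh (L2Z (-1) LB)) _; rewrite (L2sqZ (-1) LB).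
  have -> : normsq (-1 : C) = 1 by rewrite /normsq !cE; ring.
  (* The bound obtained is 2 * 8 (4 K)^2 + 2 (e / 4)^2, which (24 K + e)^2 covers with room to
     spare. *)
  have : 0 <= K * e by rewrite mulr_ge0// ltW.
  move: Hu Ah; rewrite !exprMn mul1r; nra.
Qed.

End Hnorms.

(** * Temperedness from a dual bound *)

Section Tempered.
Variable R : realType.
Local Notation mR := (measurableTypeR R).
Local Notation C := R[i].
Local Notation fn := (R * R -> C).
Local Notation normc := ComplexField.Normc.normc.
Variables (D : xspace) (r : R).
Local Notation Sw := (smooth (xkind D) Ln).

Lemma pderivL c a (u v : fn) : Sw u -> Sw v ->
  pderiv c (fun p => a * u p + v p) = fun p => a * pderiv c u p + pderiv c v p.
Proof.
move=> su sv; have KZ : xkind D <> Zc by case: (D).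
case: c.
  have [u' du _] := smooth_d1 KZ su; have [v' dv _] := smooth_d1 KZ sv.
  rewrite (pderivX du) (pderivX dv); apply: pderivX => x y.
  by apply: is_cderive_eq (is_cderiveD (is_cderiveM (is_cderive_cst a x) (du x y)) (dv x y)) _; rewrite mul0r add0r.
have LZ : Ln <> Zc by [].
have [u' du _] := smooth_d2 LZ su; have [v' dv _] := smooth_d2 LZ sv.
rewrite (pderivV du) (pderivV dv); apply: pderivV => x y.
by apply: is_cderive_eq (is_cderiveD (is_cderiveM (is_cderive_cst a y) (du x y)) (dv x y)) _; rewrite mul0r add0r.
Qed.

Lemma smooth_iter_pderiv w (u : fn) : Sw u -> Sw (iter_pderiv w u).
Proof. by move=> su; elim: w => [|c w IH] //=; exact: smooth_pderiv. Qed.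

Lemma iter_pderivL w a (u v : fn) : Sw u -> Sw v ->
  iter_pderiv w (fun p => a * u p + v p) = fun p => a * iter_pderiv w u p + iter_pderiv w v p.
Proof.
move=> su sv; elim: w => [|c w IH] //=.
by rewrite IH (pderivL c a (smooth_iter_pderiv w su) (smooth_iter_pderiv w sv)).
Qed.

(** The operator 1 - d_x^2, of symbol 1 + xi^2; unlike fractional powers, its iterates are visibly
    bounded by Schwartz seminorms. *)
Definition bessel (u : fn) : fn := fun p => -1 * pderiv X (pderiv X u) p + u p.

Lemma smooth_bessel (u : fn) : Sw u -> Sw (bessel u).
Proof. by move=> su; apply: smoothD => //; apply: smooth_pderiv; exact: smooth_pderiv. Qed.

Lemma FT2_bessel (u : fn) : Sw u -> FT2 D (bessel u) = fun p => (1 + p.1 ^+ 2)%:C * FT2 D u p.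
Proof.
move=> su; have s1 := smooth_pderiv X su; have s2 := smooth_pderiv X s1.
apply: etrans (FT2L (-1) s2 su) _; apply/funext => p.
rewrite (FT2_pderivX s1) (FT2_pderivX su) mulrA mulrA.
have -> : -1 * (0 +i* - p.1) * (0 +i* - p.1) = (p.1 ^+ 2)%:C :> C.
  by rewrite mulN1r; move: (p.1) => q; apply: cP; rewrite ?cE; cbv beta iota delta [complex.Re complex.Im]; rewrite ?(oppr0, mulr0, mul0r, add0r, addr0, sub0r)//; ring.
by rewrite rmorphD rmorph1 mulrDl mul1r addrC.
Qed.

Lemma FT2_besselX m (u : fn) : Sw u ->
  Sw (iter m bessel u) /\ FT2 D (iter m bessel u) = fun p => ((1 + p.1 ^+ 2) ^+ m)%:C * FT2 D u p.
Proof.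
move=> su; elim: m => [|m [s1 IH]] /=.
  by split => //; apply/funext => p; rewrite expr0 mul1r.
split; first exact: smooth_bessel.
apply: etrans (FT2_bessel s1) _; rewrite IH; apply/funext => p.
by rewrite [(_ ^+ m.+1)]exprS rmorphM mulrA.
Qed.

(** For m >= |r| / 2 the symbol (1 + xi^2)^m dominates (1 + xi^2)^(-r/2). *)
Lemma dual_norm_bessel m (u : fn) : `|r| / 2 <= m%:R -> Sw u ->
  dual_norm D r u <= Num.sqrt (L2sq (mu_xv R D) (iter m bessel u)).
Proof.
move=> rm su; have [sm Em] := FT2_besselX m su.
rewrite (dual_normE r su) -(L2sq_FT2 sm); apply: ler_wsqrtr; rewrite Em.
have LE : L2 (mu_freq R D) (FT2 D (iter m bessel u)) := L2_smooth (smooth_FT2 sm).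
rewrite Em in LE.
pose k (p : R * R) := japx (- r) p * (1 + p.1 ^+ 2) ^- m.
have q0 (p : R * R) : (1 + p.1 ^+ 2) ^+ m != 0 by rewrite expf_neq0// gt_eqF// oneDsq_gt0.
have mk : measurable_fun setT (fun p : mR * mR => k p).
  apply: measurable_funM; first exact: measurable_japx.
  have -> : (fun p : mR * mR => (1 + p.1 ^+ 2) ^- m) = fun p => japx (- (m%:R * 2)) p.
    apply/funext => p; rewrite /japx mulNr mulfK ?pnatr_eq0// powRN powR_mulrn//.
    exact: ltW (oneDsq_gt0 _).
  exact: measurable_japx.
have kM p : `|k p| <= 1.
  rewrite ger0_norm; last by rewrite mulr_ge0 ?invr_ge0 ?exprn_ge0// ltW// ?japx_gt0 ?oneDsq_gt0.
  rewrite /k ler_pdivrMr ?mul1r; last by rewrite exprn_gt0// oneDsq_gt0.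
  rewrite -powR_mulrn; last exact: ltW (oneDsq_gt0 _).
  apply: ler_powR; first by rewrite lerDl sqr_ge0.
  apply: le_trans rm; rewrite ler_pM2r ?invr_gt0//; rewrite -normrN; exact: ler_norm.
have [_] := L2_mul_le mk kM LE; rewrite expr1n mul1r; apply: le_trans.
rewrite le_eqVlt (_ : (_ == _) = true)//; apply/eqP; congr L2sq; apply/funext => p.
by rewrite mulrA -rmorphM /k mulrVK// unitfE.
Qed.

Definition sbd (N : nat) (u : fn) (M : R) := forall w k l p,
  (size w <= N)%N -> (k <= 2)%N -> (l <= 2)%N -> weight D k l p * normc (iter_pderiv w u p) <= M.

Lemma weight_ge0 k l (p : R * R) : 0 <= weight D k l p.
Proof. by case: p => x y; rewrite weightE mulr_ge0 ?kweight_ge0. Qed.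

Lemma normcD (z w : C) : normc (z + w) <= normc z + normc w.
Proof. exact: le_normcD. Qed.

Lemma normcN (z : C) : normc (- z) = normc z.
Proof. by rewrite !normcE /normsq !cE !sqrrN. Qed.

Lemma sbd_bessel N (u : fn) M : Sw u -> sbd (N + 2) u M -> sbd N (bessel u) (2 * M).
Proof.
move=> su H w k l p sw hk hl; have s2 := smooth_pderiv X (smooth_pderiv X su).
rewrite (iter_pderivL w (-1) s2 su).
apply: le_trans (ler_wpM2l (weight_ge0 k l p) (normcD _ _)) _.
rewrite mulN1r normcN mulrDr mulr_natl mulr2n; apply: lerD.
  have := H (rcons (rcons w X) X) k l p; rewrite /iter_pderiv !foldr_rcons; apply => //.
  by rewrite !size_rcons addn2 !ltnS.
by apply: H => //; rewrite (leq_trans sw)// leq_addr.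
Qed.

Lemma sbd_besselX m N (u : fn) M : Sw u -> sbd (N + 2 * m) u M -> sbd N (iter m bessel u) (2 ^+ m * M).
Proof.
elim: m N => [|m IH] N su H /=; first by rewrite expr0 mul1r -[N]addn0.
rewrite exprS -mulrA; apply: sbd_bessel; first by have [] := FT2_besselX m su.
by apply: IH => //; rewrite -addnA -mulnS.
Qed.

Lemma L2sq_sbd : exists2 c, 0 <= c & forall (u : fn) M, Sw u -> 0 <= M -> sbd 0 u M ->
  Num.sqrt (L2sq (mu_xv R D) u) <= c * M.
Proof.
pose G (p : mR * mR) : R := kdecay (xkind D) p.1 * kdecay Ln p.2.
have iG : (mu_xv R D).-integrable setT (EFin \o G).
  apply: (@integrable_prod _ _ _ mR mR (kmeasure_sf R (xkind D)) (kmeasure_sf R Ln)).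
  + by move=> x; rewrite ltW// kdecay_gt0.
  + by move=> x; rewrite ltW// kdecay_gt0.
  + exact: integrable_kdecay.
  + exact: integrable_kdecay.
have G0 p : 0 <= G p by rewrite mulr_ge0// ltW// kdecay_gt0.
have G1 p : G p <= 1 by rewrite mulr_ile1 ?kdecay_le1// ltW// kdecay_gt0.
pose I := \int[mu_xv R D]_p G p; have I0 : 0 <= I by apply: Rintegral_ge0.
exists (8 * Num.sqrt I); first by rewrite mulr_ge0// sqrtr_ge0.
move=> u M su M0 H.
have hu p : cnorm1 (u p) <= 8 * M * G p.
  case: p => x y; have h k l : (k <= 2)%N -> (l <= 2)%N -> kweight (xkind D) k x * kweight Ln l y * normc (u (x, y)) <= M.
    by move=> hk hl; have := H [::] k l (x, y) isT hk hl; rewrite weightE.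
  apply: le_trans (cnorm1_normc _) _; rewrite /G /=.
  have h00 := h 0%N 0%N isT isT; have h20 := h 2%N 0%N isT isT.
  have h02 := h 0%N 2%N isT isT; have h22 := h 2%N 2%N isT isT.
  have n0 := normc_ge0 (u (x, y)).
  have e (t : R) : `|t| ^+ 2 = t ^+ 2 by rewrite real_normK ?num_real.
  have p1 := oneDsq_gt0 x; have p2 := oneDsq_gt0 y.
  move: h00 h20 h02 h22; rewrite /kweight; case: (xkind D) => /=; rewrite /lorentz ?expr0 ?e ?mul1r ?mulr1 => h00 h20 h02 h22.
  - rewrite -invfM ler_pdivlMr ?mulr_gt0//; nra.
  - rewrite ler_pdivlMr//; nra.
  - rewrite -invfM ler_pdivlMr ?mulr_gt0//; nra.
have -> : 8 * Num.sqrt I * M = Num.sqrt ((8 * M) ^+ 2 * I).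
  by rewrite sqrtrM ?sqr_ge0// sqrtr_sqr ger0_norm ?mulr_ge0//; ring.
apply: ler_wsqrtr; rewrite /I -RintegralZl//; apply: le_Rintegral => //.
- by have [] := L2_smooth su.
- by apply: riZ.
- move=> p _; apply: le_trans (normsq_cnorm1 _) _.
  apply: (@le_trans _ _ ((8 * M * G p) ^+ 2)).
    rewrite ler_pXn2r ?nnegrE ?cnorm1_ge0//.
    by apply: mulr_ge0; [apply: mulr_ge0|exact: G0].
  rewrite exprMn; apply: ler_wpM2l; first exact: sqr_ge0.
  by rewrite expr2 ler_piMr.
Qed.

(** The H^{-r,0} norm of u is dominated by the L^2 norm of (1 - d_x^2)^m u, and this by finitely
    many Schwartz seminorms of u. *)
Lemma dual_bounded_tempered (f : dist R) (K : R) : dist_linear D f -> 0 <= K -> dual_bounded D r f K -> tempered D f.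
Proof.
move=> lf K0 Hf; split; first by move=> a u v /schwartzP su /schwartzP sv; exact: lf.
have [c c0 Hc] := L2sq_sbd; pose m := Num.bound (`|r| / 2).
have rm : `|r| / 2 <= m%:R.
  by apply/ltW; apply: le_lt_trans (archi_boundP _); rewrite ?divr_ge0//.
(* 2m derivatives for the m-th power of 1 - d_x^2; the 2 makes the weights of order 2 available,
   which give an integrable majorant. *)
exists (2 * m + 2)%N, (K * (c * 2 ^+ m)) => u M /schwartzP su H.
have M0 : 0 <= M.
  have := H [::] 0%N 0%N (0, 0) isT isT isT; apply: le_trans.
  by rewrite mulr_ge0 ?weight_ge0// normc_ge0.
have sb : sbd (0 + 2 * m) u M.
  move=> w k l p sw hk hl; apply: H.
  - by rewrite (leq_trans sw)// add0n leq_addr.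
  - by rewrite (leq_trans hk)// leq_addl.
  - by rewrite (leq_trans hl)// leq_addl.
have [sm _] := FT2_besselX m su.
have p0 : 0 <= 2 ^+ m :> R by rewrite exprn_ge0.
apply: le_trans (normc_cnorm1 _) _; apply: le_trans (Hf _ su) _.
rewrite -!mulrA; apply: ler_wpM2l => //.
apply: le_trans (dual_norm_bessel rm su) _.
by apply: Hc => //; [rewrite mulr_ge0|exact: sbd_besselX].
Qed.

Lemma dual_bounded_Hspace (f : dist R) (K : R) : dist_linear D f -> 0 <= K -> dual_bounded D r f K -> Hspace D r 0 f.
Proof.
move=> lf K0 H; split; first exact: dual_bounded_tempered H.
by have [] := dual_bounded_Hnorm_le lf K0 H.
Qed.

End Tempered.

(** * Strongly continuous semigroups *)

Section Semigroup.
Variable R : realType.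
Local Notation C := R[i].
Local Notation fn := (R * R -> C).
Local Notation re := (@complex.Re R).
Local Notation im := (@complex.Im R).

(** The limit is the supremum of the lower ends u n - e n, each of which lies below every upper end
    u m + e m. *)
Lemma cauchy_limit (u e : nat -> R) : (forall n m, (n <= m)%N -> `|u m - u n| <= e n) ->
  exists l, forall n, `|l - u n| <= e n.
Proof.
move=> H; pose E : set R := [set u n - e n | n in setT].
have key n m : u n - e n <= u m + e m.
  have [nm|/ltnW nm] := leqP n m; have := H _ _ nm.
    have e0 : 0 <= e m by have := H _ _ (leqnn m); rewrite subrr normr0.
    by rewrite ler_norml => /andP[]; lra.
  have e0 : 0 <= e n by have := H _ _ (leqnn n); rewrite subrr normr0.
  by rewrite ler_norml => /andP[]; lra.
have hE : has_sup E.
  split; first by exists (u 0%N - e 0%N); exists 0%N.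
  by exists (u 0%N + e 0%N) => _ [n _ <-]; exact: key.
exists (sup E) => n; rewrite ler_norml; apply/andP; split.
  have : u n - e n <= sup E by apply: ub_le_sup; [exact: hE.2|exists n].
  lra.
have : sup E <= u n + e n by apply: ge_sup; [exact: hE.1|move=> _ [m _ <-]; exact: key].
lra.
Qed.

Lemma cauchy_limitC (u : nat -> C) (e : nat -> R) : (forall n m, (n <= m)%N -> cnorm1 (u m - u n) <= e n) ->
  exists l, forall n, cnorm1 (l - u n) <= 2 * e n.
Proof.
move=> H.
have [a Ha] : exists l, forall n, `|l - re (u n)| <= e n.
  by apply: cauchy_limit => n m nm; rewrite -cReB; exact: le_trans (re_cnorm1 _) (H n m nm).
have [b Hb] : exists l, forall n, `|l - im (u n)| <= e n.
  by apply: cauchy_limit => n m nm; rewrite -cImB; exact: le_trans (im_cnorm1 _) (H n m nm).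
exists (a +i* b) => n; rewrite /cnorm1 !cE /= mulr_natl mulr2n; exact: lerD.
Qed.

(** Induction along the interval. At the supremum s of the good points the left condition carries
    the bound to s, and the right condition pushes it beyond s. One-sided conditions are imposed
    because a generator provides only right derivatives. *)
Lemma growth_le (g : R -> R) (t e : R) : 0 <= t -> g 0 <= 0 ->
  (forall x, 0 <= x < t -> exists2 d, 0 < d & forall h, 0 < h < d -> x + h <= t -> g (x + h) <= g x + e * h) ->
  (forall x, 0 < x <= t -> forall e', 0 < e' -> exists2 d, 0 < d & forall h, 0 < h < d -> h <= x -> g x <= g (x - h) + e') ->
  0 <= e -> g t <= e * t.
Proof.
move=> t0 g0 Hr Hl e0.
pose E : set R := [set x | 0 <= x <= t /\ forall y, 0 <= y <= x -> g y <= e * y].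
have E0 : E 0.
  split; first by rewrite lexx.
  move=> y yy; have -> : y = 0 by lra.
  by rewrite mulr0.
have hE : has_sup E.
  by split; [exists 0|exists t => x [/andP[_ ->]]].
pose s := sup E.
have sle x : E x -> x <= s by move=> Ex; apply: ub_le_sup => //; exact: hE.2.
have s0 : 0 <= s by exact: sle.
have st : s <= t by apply: ge_sup; [exact: hE.1|move=> x [/andP[_ ->]]].
have below y : 0 <= y < s -> g y <= e * y.
  move=> /andP[y0 ys]; have d0 : 0 < s - y by lra.
  have [x [xt Hx]] := sup_adherent d0 hE.
  rewrite -/s => xs; apply: Hx; rewrite y0 /=; lra.
have gs : g s <= e * s.
  have [<-|sn] := eqVneq 0 s; first by rewrite mulr0.
  have sp : 0 < s by rewrite lt_neqAle sn.
  apply/ler_addgt0Pr => e' e'0.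
  have /Hl /(_ _ e'0)[d d0 Hd] : 0 < s <= t by rewrite sp.
  pose h := Num.min (d / 2) (s / 2).
  have h0 : 0 < h by rewrite lt_min; apply/andP; split; lra.
  have hd : h < d by rewrite gt_min; apply/orP; left; lra.
  have hs : h <= s / 2 by rewrite ge_min lexx orbT.
  have b : 0 <= s - h < s by apply/andP; split; lra.
  have := Hd h; rewrite h0 hd => /(_ isT); have := below _ b.
  have : e * (s - h) <= e * s by apply: ler_wpM2l => //; lra.
  have : h <= s by lra.
  move=> h1 h2 h3 /(_ h1); lra.
have [->//|nst] := eqVneq t s.
have slt : s < t by rewrite lt_neqAle eq_sym nst.
have /Hr[d d0 Hd] : 0 <= s < t by rewrite s0.
pose h := Num.min (d / 2) (t - s).
have h0 : 0 < h by rewrite lt_min; apply/andP; split; lra.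
have hd : h <= d / 2 by rewrite ge_min lexx.
have ht : h <= t - s by rewrite ge_min lexx orbT.
have : E (s + h).
  split; first by apply/andP; split; lra.
  move=> y /andP[y0 ys]; have [ys'|sy] := ltP y s; first by apply: below; rewrite y0.
  have [<-//|ns] := eqVneq s y.
  have : g (s + (y - s)) <= g s + e * (y - s).
    apply: Hd; last lra.
    by rewrite subr_gt0 lt_neqAle ns sy /=; lra.
  by rewrite addrC subrK; lra.
by move/sle; lra.
Qed.

Variables (D : xspace) (r : R).
Local Notation Sw := (smooth (xkind D) Ln).
Local Notation HH := (Hspace D r 0).
Local Notation dual_bounded := (dual_bounded D r).
Local Notation dual_norm := (dual_norm D r).

Lemma dual_bounded_lin a (f g : dist R) K L : dual_bounded f K -> dual_bounded g L -> dual_bounded (fun phi => a * f phi + g phi) (cnorm1 a * K + L).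
Proof.
move=> hf hg phi sp; apply: le_trans (cnorm1D _ _) _; rewrite mulrDl; apply: lerD; last exact: hg.
by apply: le_trans (cnorm1M _ _) _; rewrite -mulrA; apply: ler_wpM2l; [exact: cnorm1_ge0|exact: hf].
Qed.

Lemma dual_bounded_le (f : dist R) K L : K <= L -> dual_bounded f K -> dual_bounded f L.
Proof. by move=> KL hf phi sp; apply: le_trans (hf _ sp) _; apply: ler_wpM2r => //; exact: dual_norm_ge0. Qed.

Lemma dual_bounded_ext (f g : dist R) K : (forall phi, Sw phi -> f phi = g phi) -> dual_bounded f K -> dual_bounded g K.
Proof. by move=> fg hf phi sp; rewrite -fg//; exact: hf. Qed.

Lemma HH_lin a (f g : dist R) : HH f -> HH g -> HH (fun phi => a * f phi + g phi).
Proof.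
move=> hf hg; have [lf [K K0 Kf]] := Hspace_dual_bounded hf; have [lg [L L0 Lg]] := Hspace_dual_bounded hg.
apply: (@dual_bounded_Hspace _ _ _ _ (cnorm1 a * K + L)); last exact: dual_bounded_lin.
- by move=> b u v su sv; rewrite lf// lg//; ring.
- by rewrite addr_ge0// mulr_ge0// cnorm1_ge0.
Qed.

Lemma cnorm1N1 : cnorm1 (-1 : C) = 1.
Proof. by rewrite cnorm1N /cnorm1 /= normr0 addr0 normr1. Qed.

Lemma HH_sub (f g : dist R) : HH f -> HH g -> HH (fun phi => f phi - g phi).
Proof.
move=> hf hg; have := HH_lin (-1) hg hf.
by congr HH; apply/funext => phi; rewrite mulN1r addrC.
Qed.

Lemma dual_bounded_sub (f g : dist R) K L : dual_bounded f K -> dual_bounded g L -> dual_bounded (fun phi => f phi - g phi) (K + L).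
Proof.
move=> hf hg; have := dual_bounded_lin (-1) hg hf; rewrite cnorm1N1 mul1r addrC.
by apply: dual_bounded_ext => phi _; rewrite mulN1r addrC.
Qed.

Variable T : R -> dist R -> dist R.
Hypothesis hT : C0_semigroup D r T.

Lemma T_H t f : 0 <= t -> HH f -> HH (T t f).
Proof. by case: hT => h _ _ _ _; exact: h. Qed.

Lemma T_lin t a f g phi : 0 <= t -> HH f -> HH g -> Sw phi ->
  T t (fun phi => a * f phi + g phi) phi = a * T t f phi + T t g phi.
Proof. by case: hT => _ h _ _ _ t0 hf hg /schwartzP sp; exact: (h t a f g t0 hf hg phi sp). Qed.

Lemma T_sub t f g phi : 0 <= t -> HH f -> HH g -> Sw phi ->
  T t (fun phi => f phi - g phi) phi = T t f phi - T t g phi.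
Proof.
move=> t0 hf hg sp; have := T_lin (-1) t0 hg hf sp.
rewrite (_ : (fun phi => -1 * g phi + f phi) = fun phi => f phi - g phi); last first.
  by apply/funext => q; rewrite mulN1r addrC.
by rewrite mulN1r addrC.
Qed.

Definition Tbd t M := forall f K, HH f -> 0 <= K -> dual_bounded f K -> dual_bounded (T t f) (M * K).

(** The operator bound of the semigroup axioms in dual form; 12 = 4 * 3 pays for passing to [Hnorm]
    and back. *)
Lemma T_decaying t : 0 <= t -> exists2 M, 0 <= M & Tbd t M.
Proof.
move=> t0; case: hT => _ _ /(_ t t0)[M HM] _ _; exists (12 * `|M|); first by rewrite mulr_ge0.
move=> f K hf K0 nf; have [lf _] := Hspace_dual_bounded hf.
have [_ le] := dual_bounded_Hnorm_le lf K0 nf.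
have -> : 12 * `|M| * K = 4 * (`|M| * (3 * K)) by ring.
apply: dual_bounded_Hnorm; apply: le_trans (HM _ hf) _; rewrite EFinM.
have [N N0 E] := Hnorm_fin hf; move: le; rewrite E -!EFinM !lee_fin => le.
apply: (@le_trans _ _ (`|M| * N)); first by apply: ler_wpM2r => //; exact: ler_norm.
exact: ler_wpM2l.
Qed.

Lemma T_0 f phi : HH f -> Sw phi -> T 0 f phi = f phi.
Proof. by case: hT => _ _ _ [h _] _ hf /schwartzP; exact: h. Qed.

Lemma T_D t u f phi : 0 <= t -> 0 <= u -> HH f -> Sw phi -> T (t + u) f phi = T t (T u f) phi.
Proof. by case: hT => _ _ _ [_ h] _ t0 u0 hf /schwartzP; exact: h. Qed.

Lemma Hnorm_cvg0 (F : R -> dist R) : Hnorm D r 0 (F h) @[h --> 0^'+] --> 0%E ->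
  forall e, 0 < e -> exists2 d, 0 < d & forall h, 0 < h < d -> dual_bounded (F h) e.
Proof.
move=> cv e e0; have e4 : (0 < (e / 4)%:E)%E by rewrite lte_fin divr_gt0.
have : \forall h \near 0^'+, (Hnorm D r 0 (F h) < (e / 4)%:E)%E.
  exact: (cv _ (open_ereal_lt' e4)).
rewrite near_withinE near_simpl => /nbhs_ballP[d /= d0 Hd]; exists d => // h /andP[h0 hd].
have -> : e = 4 * (e / 4) by rewrite mulrC divfK.
apply: dual_bounded_Hnorm_lt; apply: (Hd h) => //.
by rewrite /ball /= sub0r normrN gtr0_norm.
Qed.

Lemma T_cont f e : HH f -> 0 < e -> exists2 d, 0 < d & forall h, 0 < h < d -> dual_bounded (fun phi => T h f phi - f phi) e.
Proof. by case: hT => _ _ _ _ h hf; exact: (Hnorm_cvg0 (h f hf)). Qed.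

Lemma generator_cvg A f g e : generator D r T A -> HH f -> HH g -> dist_eq D g (A f) -> 0 < e ->
  exists2 d, 0 < d & forall h, 0 < h < d -> dual_bounded (fun phi => (h^-1)%:C * (T h f phi - f phi) - g phi) e.
Proof. by move=> hA hf hg E; have := (hA f g hf hg).2 E => /Hnorm_cvg0; apply. Qed.

(** A nearly sharp operator bound with a datum nearly attaining it: [b] is 9/10 of the least bound
    and [M] is below 11/10 of it, so that M <= 5/4 b. *)
Lemma Tbd_near t B : 0 <= t -> 0 < B -> ~ Tbd t B -> exists b M,
  [/\ B / 2 <= b, M <= 5 / 4 * b, Tbd t M & exists f phi,
  [/\ HH f, dual_bounded f 1, Sw phi & b * dual_norm phi < cnorm1 (T t f phi)]].
Proof.
move=> t0 B0 nB; pose Q : set R := [set M | 0 <= M /\ Tbd t M].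
have hQ : has_inf Q.
  have [M M0 HM] := T_decaying t0; split; first by exists M.
  by exists 0 => x [].
have le M : Q M -> B <= M.
  move=> [M0 HM]; rewrite leNgt; apply/negP => MB; apply: nB => f K hf K0 nf.
  by apply: dual_bounded_le (HM f K hf K0 nf); apply: ler_wpM2r => //; exact: ltW.
have BI : B <= inf Q by apply: lb_le_inf; [exact: hQ.1|move=> x; exact: le].
have d0 : 0 < inf Q / 10 by lra.
have [M [M0 HM] lt] := inf_adherent d0 hQ.
exists (9 / 10 * inf Q), M; split => //; [lra|lra|].
have nb : ~ Tbd t (9 / 10 * inf Q).
  move=> h; have : inf Q <= 9 / 10 * inf Q.
    by apply: ge_inf; [exact: hQ.2|split => //; lra].
  lra.
move/existsNP: nb => [f /existsNP[K /not_implyP[hf /not_implyP[K0 /not_implyP[nf nn]]]]].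
move/existsNP: nn => [phi /not_implyP[sp /negP]]; rewrite -ltNge => lt'.
have Kp : 0 < K.
  rewrite lt_neqAle K0 andbT; apply/eqP => K00; move: lt'.
  have := HM f K hf K0 nf phi sp; rewrite -K00 !mulr0 !mul0r; lra.
have hz : HH (fun phi => K^-1%:C * f phi).
  have := HH_lin (K^-1%:C - 1) hf hf; congr HH; apply/funext => q; ring.
exists (fun phi => K^-1%:C * f phi), phi; split => //.
  move=> q sq; rewrite mul1r cnorm1RM gtr0_norm ?invr_gt0// mulrC ler_pdivrMr// mulrC.
  exact: nf.
have -> : T t (fun phi => K^-1%:C * f phi) phi = K^-1%:C * T t f phi.
  have := T_lin (K^-1%:C - 1) t0 hf hf sp.
  rewrite (_ : (fun phi => _) = fun phi => K^-1%:C * f phi); last by apply/funext => q; ring.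
  by move=> ->; ring.
by rewrite cnorm1RM gtr0_norm ?invr_gt0// ltr_pdivlMl// mulrA (mulrC K).
Qed.

(** For a = c T g and b = T x, |a + b| + |a - b| >= 2 |a|, so one of the two signs works. *)
Lemma hump_sign t (g x : dist R) c phi : 0 <= t -> HH g -> HH x -> Sw phi -> 0 <= c ->
  exists2 s, `|s| = 1 & c * cnorm1 (T t g phi) <= cnorm1 (T t (fun psi => (s * c)%:C * g psi + x psi) phi).
Proof.
move=> t0 hg hx sp c0.
have E s : T t (fun psi => (s * c)%:C * g psi + x psi) phi = (s * c)%:C * T t g phi + T t x phi by exact: T_lin.
have : 2 * (c * cnorm1 (T t g phi)) <= cnorm1 ((1 * c)%:C * T t g phi + T t x phi) + cnorm1 ((-1 * c)%:C * T t g phi + T t x phi).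
  move: (T t g phi) (T t x phi) => a b; apply: le_trans (cnorm1B _ _).
  have -> : (1 * c)%:C * a + b - ((-1 * c)%:C * a + b) = (2 * c)%:C * a.
    have -> : (2 * c)%:C = (1 * c)%:C - (-1 * c)%:C :> C by rewrite -rmorphB; congr (_%:C); ring.
    by ring.
  by rewrite cnorm1RM ger0_norm ?mulr_ge0// mulrA.
have [h _|h] := lerP (c * cnorm1 (T t g phi)) (cnorm1 ((1 * c)%:C * T t g phi + T t x phi)).
  by exists 1; [exact: normr1|rewrite E].
by exists (-1); [rewrite normrN normr1|rewrite E; lra].
Qed.

(* Sokal's gliding hump: x = sum of (+-) 3^-n g_n, the signs chosen so that no term cancels at the n-th test function. *)
Lemma T_decaying_near0 : exists d M, [/\ 0 < d, 1 <= M & forall h, 0 <= h <= d -> Tbd h M].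
Proof.
apply: contrapT => Hno.
have Hn (n : nat) : exists q : R * R * R * dist R * fn, let: (h, b, M, g, phi) := q in
    [/\ 0 <= h <= n.+1%:R^-1, 10 ^+ n.+1 / 2 <= b, M <= 5 / 4 * b & Tbd h M] /\
    [/\ HH g, dual_bounded g 1, Sw phi & b * dual_norm phi < cnorm1 (T h g phi)].
  have B0 : 0 < 10 ^+ n.+1 :> R by rewrite exprn_gt0.
  have [h hh nB] : exists2 h, 0 <= h <= n.+1%:R^-1 & ~ Tbd h (10 ^+ n.+1).
    apply: contrapT => H; apply: Hno; exists n.+1%:R^-1, (10 ^+ n.+1); split.
    - by rewrite invr_gt0.
    - by rewrite exprn_ege1// ler1n.
    - by move=> h hh; apply: contrapT => nB; apply: H; exists h.
  have h0 : 0 <= h by case/andP: hh.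
  have [b [M [h1 h2 h3 [g [phi [h4 h5 h6 h7]]]]]] := Tbd_near h0 B0 nB.
  by exists (h, b, M, g, phi).
have [q Hq] := choice Hn; clear Hn.
pose h n := (q n).1.1.1.1; pose b n := (q n).1.1.1.2; pose M n := (q n).1.1.2.
pose g n := (q n).1.2; pose phi n := (q n).2.
have {}Hq n : [/\ 0 <= h n <= n.+1%:R^-1, 10 ^+ n.+1 / 2 <= b n, M n <= 5 / 4 * b n & Tbd (h n) (M n)] /\
    [/\ HH (g n), dual_bounded (g n) 1, Sw (phi n) & b n * dual_norm (phi n) < cnorm1 (T (h n) (g n) (phi n))].
  by have := Hq n; rewrite /h /b /M /g /phi; case: (q n) => [[[[? ?] ?] ?] ?].
(* Coefficients 5^-n. The terms after n sum to th n / 4, doubled to th n / 2 by the complex limit;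
   with M n <= 5/4 b n the tail takes at most 5/8 of th n * b n and leaves 3/8 for the hump. *)
pose th (n : nat) : R := 5^-1 ^+ n.
have th0 n : 0 < th n by rewrite exprn_gt0// invr_gt0.
have thS n : th n = 5 * th n.+1 by rewrite /th exprS mulrA divff ?mul1r// pnatr_eq0.
pose stp n s (x : dist R) : dist R := fun psi => (s * th n)%:C * g n psi + x psi.
(* The sign is chosen for all pairs (n, x) at once, so that the recursion can feed in its own
   partial sum. *)
have [sg Hsg] : {sg : nat * dist R -> R & forall q, HH q.2 -> `|sg q| = 1 /\
    th q.1 * cnorm1 (T (h q.1) (g q.1) (phi q.1)) <= cnorm1 (T (h q.1) (stp q.1 (sg q) q.2) (phi q.1))}.
  apply: (@choice _ _ (fun q s => HH q.2 -> `|s| = 1 /\ th q.1 * cnorm1 (T (h q.1) (g q.1) (phi q.1)) <=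
    cnorm1 (T (h q.1) (stp q.1 s q.2) (phi q.1)))) => -[n x] /=; have [hx|nx] := pselect (HH x); last by exists 0.
  have [[/andP[h0 _] _ _ _] [hg _ sp _]] := Hq n.
  by have [s s1 s2] := hump_sign h0 hg hx sp (ltW (th0 n)); exists s.
pose fix xs n : dist R := if n is k.+1 then stp k (sg (k, xs k)) (xs k) else fun=> 0.
have z0 : HH (fun=> 0).
  apply: (@dual_bounded_Hspace _ _ _ _ 0) => //; first by move=> a u v _ _; rewrite mulr0 addr0.
  by move=> psi _; rewrite cnorm10 mul0r.
have xsH n : HH (xs n).
  elim: n => [|n IH]; first exact: z0.
  by apply: HH_lin => //; have [_ []] := Hq n.
have xsS n : exists2 s, `|s| = 1 & xs n.+1 = stp n s (xs n).
  by exists (sg (n, xs n)) => //; have [] := Hsg (n, xs n) (xsH n).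
have xsG n : th n * cnorm1 (T (h n) (g n) (phi n)) <= cnorm1 (T (h n) (xs n.+1) (phi n)).
  by have [] := Hsg (n, xs n) (xsH n).
(* The sum of [th k] over k >= n. *)
pose e (n : nat) := 5 / 4 * th n.
have xsC n m psi : Sw psi -> (n <= m)%N -> cnorm1 (xs m psi - xs n psi) <= (e n - e m) * dual_norm psi.
  move=> sp; elim: m => [|m IH].
    by rewrite leqn0 => /eqP ->; rewrite subrr cnorm10 subrr mul0r.
  rewrite leq_eqVlt => /predU1P[->|]; first by rewrite !subrr cnorm10 mul0r.
  rewrite ltnS => nm; have [s s1 ->] := xsS m.
  rewrite /stp -addrA; apply: le_trans (cnorm1D _ _) _.
  have [_ [_ ng _ _]] := Hq m; have := ng _ sp; rewrite mul1r => lg.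
  rewrite cnorm1RM normrM s1 mul1r gtr0_norm//.
  apply: (@le_trans _ _ (th m * dual_norm psi + (e n - e m) * dual_norm psi)).
    by apply: lerD; [apply: ler_wpM2l => //; exact: ltW|exact: IH].
  rewrite -mulrDl; apply: ler_wpM2r; first exact: dual_norm_ge0.
  by rewrite /e (thS m); lra.
have e0 n : 0 <= e n by rewrite mulr_ge0// ltW.
have e_pos n : 0 <= e n by exact: e0.
(* The limit is taken separately at each test function, with an arbitrary value elsewhere; linearity
   and the dual bound are recovered afterwards. *)
have lim psi : exists l, Sw psi -> forall n, cnorm1 (l - xs n psi) <= 2 * (e n * dual_norm psi).
  have [sp|ns] := pselect (Sw psi); last by exists 0.
  have [l Hl] : exists l, forall n, cnorm1 (l - xs n psi) <= 2 * (e n * dual_norm psi).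
    apply: (@cauchy_limitC (fun n => xs n psi)) => n m nm; apply: le_trans (xsC n m psi sp nm) _.
    by apply: ler_wpM2r; [exact: dual_norm_ge0|rewrite lerBlDr lerDl].
  by exists l.
have [x Hx] := choice lim.
have xn n : dual_bounded (fun psi => x psi - xs n psi) (2 * e n).
  by move=> psi sp; rewrite -mulrA; exact: Hx.
have e0E : e 0%N = 5 / 4 by rewrite /e /th expr0 mulr1.
have xb : dual_bounded x (5 / 2).
  have -> : 5 / 2 = 2 * e 0%N :> R by rewrite e0E; lra.
  by apply: dual_bounded_ext (xn 0%N) => psi _; rewrite subr0.
have eE n : e n = 5 / 4 * th n by [].
have thpow n : th n <= 2^-1 ^+ n by apply: lerXn2r; rewrite ?nnegrE; lra.
have xl : dist_linear D x.
  move=> a u v su sv; have suv := smoothD a su sv.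
  apply/eqP; rewrite -subr_eq0; apply/eqP; apply: cnorm1_eq0.
  apply: (@pow2_lim _ _ (5 / 2 * (dual_norm (fun p => a * u p + v p) + cnorm1 a * dual_norm u + dual_norm v))) => n.
  have [ln _] := Hspace_dual_bounded (xsH n).
  have -> : x (fun p => a * u p + v p) - (a * x u + x v) =
      (x (fun p => a * u p + v p) - xs n (fun p => a * u p + v p)) - a * (x u - xs n u) - (x v - xs n v).
    by rewrite (ln a u v su sv); ring.
  apply: le_trans (cnorm1B _ _) _; apply: le_trans (lerD (cnorm1B _ _) (lexx _)) _.
  apply: le_trans (lerD (lerD (lexx _) (cnorm1M _ _)) (lexx _)) _.
  have h1 := xn n _ suv; have h2 := ler_wpM2l (cnorm1_ge0 a) (xn n _ su); have h3 := xn n _ sv.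
  apply: le_trans (lerD (lerD h1 h2) h3) _.
  move: (dual_norm_ge0 D r (fun p => a * u p + v p)) (dual_norm_ge0 D r u) (dual_norm_ge0 D r v) (cnorm1_ge0 a).
  move: (dual_norm (fun p => a * u p + v p)) (dual_norm u) (dual_norm v) (cnorm1 a) => n1 n2 n3 n4 p1 p2 p3 p4.
  have -> : 2 * e n * n1 + n4 * (2 * e n * n2) + 2 * e n * n3 = 2 * e n * (n1 + n4 * n2 + n3) by ring.
  rewrite [leRHS]mulrAC; apply: ler_wpM2r; first by rewrite !addr_ge0 ?mulr_ge0.
  by clear h1 h2 h3; rewrite eE; have := thpow n; lra.
have xH : HH x by apply: dual_bounded_Hspace xl _ xb; lra.
(* Strong continuity at this single [x] bounds T_k x for all small k; the humps will contradict
   it. *)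
have [d d0 Hd] := T_cont xH ltr01.
have Hd' k : 0 <= k < d -> dual_bounded (T k x) (1 + 5 / 2).
  move=> /andP[k0 kd]; have [k00|kp] := eqVneq 0 k.
    rewrite -k00; apply: (@dual_bounded_ext x); first by move=> psi sp; rewrite T_0.
    by apply: dual_bounded_le xb; lra.
  have kk : 0 < k < d by rewrite lt_neqAle kp k0.
  have := dual_bounded_lin 1 (Hd k kk) xb; rewrite (_ : cnorm1 1 = 1); last by rewrite /cnorm1 /= normr0 addr0 normr1.
  by rewrite mul1r; apply: dual_bounded_ext => psi _; rewrite mul1r subrK.
have [n0 Hn0] : exists n0 : nat, forall n, (n0 <= n)%N -> n.+1%:R^-1 < d.
  exists (Num.bound d^-1) => n nn; rewrite invf_plt ?posrE//.
  apply: lt_le_trans (archi_boundP _) _; first by rewrite invr_ge0 ltW.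
  by rewrite ler_nat (leq_trans nn).
have fin n : (n0 <= n)%N -> 2 ^+ n <= 4 :> R.
  move=> nn; have [[/andP[h0 hn] hb hM HB] [hg ng sp lt]] := Hq n.
  have hd : 0 <= h n < d by rewrite h0 (le_lt_trans hn)// Hn0.
  have N0 := dual_norm_ge0 D r (phi n); set N := dual_norm (phi n) in lt N0.
  have p10 : 0 < 10 ^+ n.+1 :> R by rewrite exprn_gt0.
  have bp : 0 < b n by lra.
  have Np : 0 < N.
    rewrite lt_neqAle N0 andbT; apply/eqP => N00.
    by have := HB _ _ hg ler01 ng _ sp; rewrite -/N -N00 mulr0; move: lt; rewrite -N00; lra.
  have up := Hd' _ hd _ sp; rewrite -/N in up.
  have go := xsG n.
  have xsub := HH_sub xH (xsH n.+1).
  have e2 : 0 <= 2 * e n.+1 by rewrite mulr_ge0.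
  have ta := HB _ _ xsub e2 (xn n.+1) _ sp; rewrite -/N (T_sub h0 xH (xsH n.+1) sp) in ta.
  have eS : 2 * e n.+1 = th n / 2 by rewrite eE (thS n); lra.
  rewrite eS in ta.
  have tri : cnorm1 (T (h n) (xs n.+1) (phi n)) <= cnorm1 (T (h n) x (phi n)) + cnorm1 (T (h n) x (phi n) - T (h n) (xs n.+1) (phi n)).
    by apply: le_trans (cnorm1B _ _); rewrite opprB addrCA subrr addr0.
  have k1 : th n * (b n * N) <= th n * cnorm1 (T (h n) (g n) (phi n)).
    by apply: ler_wpM2l; [exact: ltW|exact: ltW].
  have k2 : M n * (th n / 2) * N <= 5 / 4 * b n * (th n / 2) * N.
    by apply: ler_wpM2r => //; apply: ler_wpM2r => //; rewrite divr_ge0// ltW.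
  have k3 : th n * b n * (3 / 8) * N <= (1 + 5 / 2) * N by lra.
  move: k3; rewrite (ler_pM2r Np) => k3.
  (* The growth 10^n of the operator bounds beats the decay 5^-n of the coefficients. *)
  have k4 : 5 * 2 ^+ n <= th n * b n.
    have -> : 5 * 2 ^+ n = th n * (10 ^+ n.+1 / 2) :> R.
      have -> : 2 ^+ n = 5^-1 ^+ n * 10 ^+ n :> R by rewrite -exprMn; congr (_ ^+ _); lra.
      by rewrite /th exprS; lra.
    by apply: ler_wpM2l => //; exact: ltW.
  lra.
have : (1 : R) <= 0.
  apply: (@pow2_lim _ _ 4) => n.
  have := fin (n0 + n)%N (leq_addr _ _); rewrite exprD => f1.
  have p1 : 1 <= 2 ^+ n0 :> R by rewrite exprn_ege1// ler1n.
  have p2 : 0 < 2 ^+ n :> R by rewrite exprn_gt0.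
  rewrite exprVn ler_pdivlMr// mul1r; apply: le_trans f1; rewrite ler_peMl//; exact: ltW.
by rewrite lt_geF.
Qed.

(** The semigroup law cuts [0, h] into n steps of length at most d, with n depending on t only; each
    step costs a factor [M]. *)
Lemma T_decaying_upto t : 0 <= t -> exists2 M, 0 < M & forall h, 0 <= h <= t -> Tbd h M.
Proof.
move=> t0; have [d [M [d0 M1 HM]]] := T_decaying_near0.
pose n := (Num.bound (t / d)).+1; exists (M ^+ n); first by rewrite exprn_gt0//; lra.
move=> h /andP[h0 ht]; pose q := h / n%:R.
have q0 : 0 <= q by rewrite divr_ge0.
have qd : q <= d.
  rewrite ler_pdivrMr ?ltr0n// mulrC -ler_pdivrMr//.
  apply: le_trans (_ : t / d <= _); first by rewrite ler_pM2r// invr_gt0.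
  apply: ltW; apply: lt_le_trans (archi_boundP _) _; first by rewrite divr_ge0// ltW.
  by rewrite ler_nat.
have step k f K : HH f -> 0 <= K -> dual_bounded f K -> dual_bounded (T (k%:R * q) f) (M ^+ k * K).
  move=> hf K0 nf; elim: k => [|k IH].
    by rewrite mul0r expr0 mul1r; apply: dual_bounded_ext nf => psi sp; rewrite T_0.
  have kq : 0 <= k%:R * q by rewrite mulr_ge0.
  rewrite exprS -mulrA; apply: (@dual_bounded_ext (T q (T (k%:R * q) f))).
    by move=> psi sp; rewrite -T_D// -natr1 mulrDl mul1r addrC.
  apply: HM => //; [by rewrite q0|exact: T_H|].
  by rewrite mulr_ge0// exprn_ge0//; lra.
move=> f K hf K0 nf; have := step n f K hf K0 nf.
by rewrite /q mulrC divfK// pnatr_eq0.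
Qed.

(* The function x |-> T (t - x) (u x) phi has right derivative 0 and is left-continuous. *)
Lemma evolution (u v : R -> dist R) A t phi : generator D r T A -> 0 <= t -> Sw phi ->
  (forall x, 0 <= x -> HH (u x)) -> (forall x, 0 <= x -> HH (v x)) ->
  (forall x, 0 <= x -> dist_eq D (v x) (A (u x))) ->
  (forall x, 0 <= x -> forall e, 0 < e -> exists2 d, 0 < d & forall h, 0 < h < d ->
     dual_bounded (fun psi => (h^-1)%:C * (u (x + h) psi - u x psi) - v x psi) e) ->
  (forall x, 0 < x -> forall e, 0 < e -> exists2 d, 0 < d & forall h, 0 < h < d -> h <= x ->
     dual_bounded (fun psi => u x psi - u (x - h) psi) e) ->
  T t (u 0) phi = u t phi.
Proof.
move=> hA t0 sp Hu Hv Euv Hr Hl; have [M M0 HM] := T_decaying_upto t0.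
have N0 := dual_norm_ge0 D r phi; set N := dual_norm phi in N0.
pose F x := T (t - x) (u x) phi.
have minP (a b : R) : 0 < a -> 0 < b -> exists2 d, 0 < d & forall h, 0 < h < d -> 0 < h < a /\ 0 < h < b.
  move=> a0 b0; exists (Num.min a b); first by rewrite lt_min a0.
  by move=> h /andP[h0]; rewrite lt_min h0 => /andP[-> ->].
suff H e : 0 < e -> cnorm1 (F t - F 0) <= e * t.
  have : cnorm1 (F t - F 0) <= 0.
    apply/ler_addgt0Pr => e e0; rewrite add0r.
    have e1 : 0 < e / (t + 1) by rewrite divr_gt0//; lra.
    apply: le_trans (H _ e1) _; rewrite mulrAC ler_pdivrMr; last lra.
    by apply: ler_wpM2l; [exact: ltW|lra].
  move/cnorm1_eq0; rewrite /F subrr subr0 => /eqP; rewrite subr_eq0 => /eqP E.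
  by rewrite -E T_0//; exact: Hu.
move=> e0; apply: (@growth_le (fun x => cnorm1 (F x - F 0)) t e t0); last exact: ltW.
- by rewrite subrr cnorm10.
- move=> x /andP[x0 xt]; pose e1 := e / (2 * M * (N + 1)).
  have P0 : 0 < 2 * M * (N + 1) by rewrite !mulr_gt0//; lra.
  have e10 : 0 < e1 by rewrite divr_gt0.
  have [d1 d10 H1] := Hr x x0 _ e10.
  have [d2 d20 H2] := generator_cvg hA (Hu x x0) (Hv x x0) (Euv x x0) e10.
  have [d d0 Hd] := minP _ _ d10 d20; exists d => // h hd xh; have [h1 h2] := Hd h hd.
  have h0 : 0 < h by case/andP: hd.
  have hx : 0 <= x + h by lra.
  have htx : 0 <= t - (x + h) by lra.
  have Tu : HH (T h (u x)) by apply: T_H; [exact: ltW|exact: Hu].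
  (* Both u (x + h) and T_h (u x) are u x + h (v x) up to o(h), the first by assumption and the
     second because v x is the generator at u x; so their difference is o(h). *)
  have E : F (x + h) - F x = T (t - (x + h)) (fun psi => u (x + h) psi - T h (u x) psi) phi.
    rewrite (T_sub htx (Hu _ hx) Tu sp) /F; congr (_ - _).
    by rewrite -(T_D htx (ltW h0) (Hu x x0) sp); congr (T _ _ _); ring.
  have nb : dual_bounded (fun psi => u (x + h) psi - T h (u x) psi) (h * (e1 + e1)).
    have := dual_bounded_lin h%:C (dual_bounded_sub (H1 h h1) (H2 h h2)) (_ : dual_bounded (fun=> 0) 0).
    rewrite cnorm1R gtr0_norm// addr0; move=> Q; apply: (dual_bounded_ext _ (Q _)).
      move=> psi sq; rewrite addr0.
      have hh : h%:C * (h^-1)%:C = 1 :> C by rewrite -rmorphM divff ?gt_eqF.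
      move: (u _ psi) (u x psi) (T h _ psi) (v x psi) => a b c k.
      transitivity (h%:C * (h^-1)%:C * (a - c)); last by rewrite hh mul1r.
      by ring.
    by move=> psi _; rewrite cnorm10 mul0r.
  have hrange : 0 <= t - (x + h) <= t by rewrite htx; lra.
  have he : 0 <= h * (e1 + e1) by apply: mulr_ge0; lra.
  have := HM _ hrange _ _ (HH_sub (Hu _ hx) Tu) he nb _ sp; rewrite -E -/N => le.
  have -> : F (x + h) - F 0 = (F x - F 0) + (F (x + h) - F x) by ring.
  apply: le_trans (cnorm1D _ _) _; apply: lerD => //; apply: le_trans le _.
  have eE : e = e1 * (2 * M * (N + 1)) by rewrite /e1 divfK// gt_eqF.
  rewrite [in leRHS]eE; have := mulr_ge0 (mulr_ge0 (ltW M0) (ltW h0)) (ltW e10).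
  nra.
- move=> x /andP[x0 xt] e' e'0; pose e1 := e' / (3 * M * (N + 1)).
  have P0 : 0 < 3 * M * (N + 1) by rewrite !mulr_gt0//; lra.
  have e10 : 0 < e1 by rewrite divr_gt0.
  pose e2 := e1 / M; have e20 : 0 < e2 by rewrite divr_gt0.
  have [d1 d10 H1] := Hl x x0 _ e10.
  have [d3 d30 H3] := Hl x x0 _ e20.
  have [d2 d20 H2] := T_cont (Hu x (ltW x0)) e10.
  have [d4 d40 H4] := minP _ _ d10 d20; have [d d0 Hd] := minP _ _ d40 d30.
  exists d => // h hd hx; have [h4 h3] := Hd h hd; have [h1 h2] := H4 h h4.
  have h0 : 0 < h by case/andP: hd.
  have hxh : 0 <= x - h by lra.
  have htx : 0 <= t - x by lra.
  have Hxh := Hu _ hxh; have Hx := Hu x (ltW x0).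
  have TH g : HH g -> HH (T h g) by move=> hg; apply: T_H => //; exact: ltW.
  (* Here T_h acts on u (x - h), which moves with h: strong continuity at fixed points is not
     enough, and the bound [M], uniform in h, is what controls T_h (u x - u (x - h)). *)
  have E : F x - F (x - h) = T (t - x) (fun psi => u x psi - T h (u (x - h)) psi) phi.
    rewrite (T_sub htx Hx (TH _ Hxh) sp) /F; congr (_ - _).
    by rewrite -(T_D htx (ltW h0) Hxh sp); congr (T _ _ _); ring.
  have hr : 0 <= h <= t by apply/andP; split; lra.
  have nb : dual_bounded (fun psi => u x psi - T h (u (x - h)) psi) (M * e2 + e1).
    have q1 := HM h hr _ _ (HH_sub Hx Hxh) (ltW e20) (H3 h h3 hx).
    apply: (dual_bounded_ext _ (dual_bounded_sub q1 (H2 h h2))) => psi sq.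
    by rewrite (T_sub (ltW h0) Hx Hxh sq); ring.
  have hrange : 0 <= t - x <= t by rewrite htx; lra.
  have he : 0 <= M * e2 + e1 by apply: addr_ge0; [apply: mulr_ge0|]; exact: ltW.
  have := HM _ hrange _ _ (HH_sub Hx (TH _ Hxh)) he nb _ sp; rewrite -E -/N => le.
  have -> : F x - F 0 = (F (x - h) - F 0) + (F x - F (x - h)) by ring.
  apply: le_trans (cnorm1D _ _) _; apply: lerD => //; apply: le_trans le _.
  have eE : e' = e1 * (3 * M * (N + 1)) by rewrite /e1 divfK// gt_eqF.
  have e2E : M * e2 = e1 by rewrite /e2 mulrC divfK// gt_eqF.
  rewrite [in leRHS]eE e2E; have := mulr_ge0 (ltW M0) (ltW e10).
  nra.
Qed.

End Semigroup.

(** * The explicit solution on the Fourier side *)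

Section Flow1.
Variable R : realType.
Local Notation mR := (measurableTypeR R).
Local Notation C := R[i].
Local Notation leb := (@lebesgue_measure R).

Definition vsymbol (s y : R) : R := (1 + y ^+ 2) `^ s.

Lemma vsymbol_le s y : s <= 1 -> vsymbol s y <= 1 + y ^+ 2.
Proof.
move=> s1; rewrite /vsymbol -[leRHS]powRr1; last exact: ltW (oneDsq_gt0 y).
by apply: ler_powR => //; rewrite lerDl sqr_ge0.
Qed.

Lemma vsymbol_derive s : exists2 l' : R -> R, (forall y : R, is_derive y 1 (vsymbol s) (l' y)) & forall y : R, exists a : R, is_derive y 1 l' a.
Proof.
have [_ [g' dg og]] := symbol_jap s 2%N; have [_ [g'' dg' _]] := og.
exists (fun y => complex.Re (g' y)) => y; first by have [h _] := dg y; exact: h.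
by exists (complex.Re (g'' y)); have [h _] := dg' y; exact: h.
Qed.

Lemma vsymbol_cont s : continuous (vsymbol s).
Proof. by have [l' dl _] := vsymbol_derive s => y; exact: is_derive_cont (dl y). Qed.

(** Integrating from -oo gives a primitive on the whole line by a single formula. *)
Lemma antideriv_integrable (f : R -> R) : continuous f ->
  (forall u : R, leb.-integrable `]-oo, u] (EFin \o f)) ->
  forall y : R, is_derive y 1 (fun y => \int[leb]_(t in `]-oo, y]) f t) (f y).
Proof.
move=> cf If y; have yu : y < y + 1 by rewrite ltrDl.
have [d1 d2] := @continuous_FTC1 R f -oo%O y (y + 1) yu (If _) (ltNyr _) (cf y).
by apply: DeriveDef; [exact: d1|rewrite -derive1E d2].
Qed.

(* Q' is vsymbol on [0, oo[ and decays at -oo; vsymbol is the even part of 2 Q' minus an integrable function. *)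
Lemma antideriv_vsymbol s : s <= 1 -> exists B : R -> R, forall y : R, is_derive y 1 B (vsymbol s y).
Proof.
move=> s1; have cW : continuous (fun y : R => vsymbol (-1) y) by exact: vsymbol_cont.
have W1E y : vsymbol (-1) y = lorentz y by rewrite /vsymbol powR_inv1// ltW// oneDsq_gt0.
have IW : leb.-integrable setT (EFin \o (fun y => vsymbol (-1) y)).
  have -> : (fun y => vsymbol (-1) y) = @lorentz R by apply/funext => y; exact: W1E.
  exact: (@integrable_kdecay R Ln).
pose q y := vsymbol s (Num.max y 0) * vsymbol (-1) (Num.min y 0).
have cmax : continuous (fun y : R => Num.max y 0).
  by move=> y; apply: continuous_max; [exact: cvg_id|exact: cvg_cst].
have cmin : continuous (fun y : R => Num.min y 0).
  by move=> y; apply: continuous_min; [exact: cvg_id|exact: cvg_cst].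
have cq : continuous q.
  have c1 : continuous (vsymbol s \o (fun y : R => Num.max y 0)).
    by move=> z; apply: continuous_comp; [exact: cmax|exact: vsymbol_cont].
  have c2 : continuous (vsymbol (-1) \o (fun y : R => Num.min y 0)).
    by move=> z; apply: continuous_comp; [exact: cmin|exact: vsymbol_cont].
  by move=> y; exact: (cvgM (c1 y) (c2 y)).
have l0 a : vsymbol a 0 = 1 by rewrite /vsymbol expr0n addr0 powR1.
have qp y : 0 <= y -> q y = vsymbol s y by move=> y0; rewrite /q max_l// min_r// l0 mulr1.
have qn y : y <= 0 -> q y = vsymbol (-1) y by move=> y0; rewrite /q max_r// min_l// l0 mul1r.
(* On the negative side q is the Lorentz profile; on [0, u] it is at most 1 + u^2, hence at most (1
   + u^2)^2 times the profile. *)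
have Iq u : leb.-integrable `]-oo, u] (EFin \o q).
  have iG : leb.-integrable `]-oo, u] (fun y => ((1 + u ^+ 2) ^+ 2 * vsymbol (-1) y)%:E).
    apply: (@integrableS _ _ _ leb setT) => //.
    exact: (@integrableZl _ _ _ leb setT measurableT ((1 + u ^+ 2) ^+ 2) _ IW).
  apply: (le_integrable _ _ _ iG) => //.
    by apply/measurable_EFinP; apply: measurable_funTS; exact: continuous_measurable_fun.
  move=> y /=; rewrite in_itv /= => yu; rewrite lee_fin.
  have p0 : 0 <= vsymbol (-1) y by rewrite W1E ltW// (@kdecay_gt0 R Ln).
  have u2 := sqr_ge0 u; have y2 := sqr_ge0 y.
  rewrite [leRHS]ger0_norm; last by rewrite mulr_ge0// sqr_ge0.
  have [y0|/ltW y0] := lerP 0 y; last first.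
    by rewrite qn// ger0_norm//; rewrite ler_peMl//; nra.
  rewrite qp// ger0_norm; last exact: powR_ge0.
  apply: le_trans (vsymbol_le y s1) _.
  rewrite W1E /lorentz ler_pdivlMr ?oneDsq_gt0// -expr2.
  have yu2 : y ^+ 2 <= u ^+ 2 by rewrite ler_pXn2r ?nnegrE//; exact: le_trans yu.
  by rewrite ler_pXn2r ?nnegrE ?lerD2l// addr_ge0.
pose Q y := \int[leb]_(t in `]-oo, y]) q t; pose A y := \int[leb]_(t in `]-oo, y]) vsymbol (-1) t.
have dQ (y : R) : is_derive y 1 Q (q y) by exact: antideriv_integrable.
have dA (y : R) : is_derive y 1 A (vsymbol (-1) y).
  by apply: antideriv_integrable => // u; apply: (@integrableS _ _ _ leb setT).
have lN a y : vsymbol a (- y) = vsymbol a y by rewrite /vsymbol sqrrN.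
exists (fun y => Q y - Q (- y) - A y) => y.
have dN : is_derive y 1 (fun y : R => - y) (-1 : R) by exact: is_deriveNid.
have dQN : is_derive y 1 (fun y => Q (- y)) (q (- y) * -1).
  exact: (@is_derive1_comp _ Q (fun y => - y) y _ _ (dQ (- y)) dN).
apply: is_derive_eq (is_deriveB (is_deriveB (dQ y) dQN) (dA y)) _.
have [y0|/ltW y0] := lerP 0 y.
  by rewrite qp// qn ?oppr_le0// lN; ring.
by rewrite qn// qp ?oppr_ge0// lN; ring.
Qed.

End Flow1.

(** * The damping exponent and the flow *)

Section Flow2.
Variable R : realType.
Local Notation mR := (measurableTypeR R).
Local Notation C := R[i].
Local Notation fn := (R * R -> C).
Local Notation leb := (@lebesgue_measure R).

Lemma is_cderive_lip_itv (h h' : R -> C) (c a b : R) : (forall x, is_cderive h x (h' x)) -> a <= b ->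
  (forall x, a <= x <= b -> cnorm1 (h' x) <= c) -> cnorm1 (h b - h a) <= 2 * c * (b - a).
Proof.
move=> dh ab hc.
have L (g g' : R -> R) : (forall x : R, is_derive x 1 g (g' x)) ->
    (forall x, a <= x <= b -> `|g' x| <= c) -> `|g b - g a| <= c * (b - a).
  move=> dg gc; have cg : {within `[a, b], continuous g}.
    by apply: continuous_subspaceT => z; exact: is_derive_cont (dg z).
  have [z + ->] := @MVT_segment R g g' a b ab (fun z _ => dg z) cg.
  rewrite in_itv /= => zab; rewrite normrM (ger0_norm (_ : 0 <= b - a)) ?subr_ge0//.
  by apply: ler_wpM2r; [rewrite subr_ge0|exact: gc].
rewrite /cnorm1 !cE -mulrA mulr_natl mulr2n; apply: lerD.
  apply: (L (fun x => complex.Re (h x)) (fun x => complex.Re (h' x))).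
    by move=> z; have [] := dh z.
  by move=> z zab; apply: le_trans (hc z zab); exact: re_cnorm1.
apply: (L (fun x => complex.Im (h x)) (fun x => complex.Im (h' x))).
  by move=> z; have [] := dh z.
by move=> z zab; apply: le_trans (hc z zab); exact: im_cnorm1.
Qed.

Lemma is_cderive_comp (h : R -> C) (k : R -> R) (t k' : R) l : is_derive t 1 k k' -> is_cderive h (k t) l ->
  is_cderive (fun t => h (k t)) t (k'%:C * l).
Proof.
move=> dk [d1 d2]; split.
  apply: is_derive_eq (@is_derive1_comp _ (fun t => complex.Re (h t)) k t _ _ d1 dk) _.
  by rewrite !cE mul0r subr0 mulrC.
apply: is_derive_eq (@is_derive1_comp _ (fun t => complex.Im (h t)) k t _ _ d2 dk) _.
by rewrite !cE mul0r addr0 mulrC.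
Qed.

Lemma is_derive_expN (b : R -> R) (t b' : R) : is_derive t 1 b b' ->
  is_derive t 1 (fun t => expR (- b t)) (- b' * expR (- b t)).
Proof.
move=> db; have dN : is_derive t 1 (fun t => - b t) (- b') by exact: is_deriveN.
apply: is_derive_eq (@is_derive1_comp _ expR (fun t => - b t) t _ _ (is_derive_expR _) dN) _.
by rewrite mulrC.
Qed.

Lemma is_derive_aff (a c t : R) : is_derive t 1 (fun t : R => a + t * c) c.
Proof.
have -> : (fun t : R => a + t * c) = (fun t => c * t + a) by apply/funext => u; rewrite addrC mulrC.
by apply: is_derive_eq; rewrite addr0 /GRing.scale /= mulr1.
Qed.

Lemma is_derive_shift (c t : R) : is_derive t 1 (fun t : R => t + c) 1.
Proof. by apply: is_derive_eq; rewrite addr0. Qed.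

Variables (s : R) (B : R -> R).
Hypothesis (HB : forall y : R, is_derive y 1 B (vsymbol s y)).

(* The integral of vsymbol s (y + t * x) over 0 <= t <= e. *)
Definition damping (e x y : R) : R := if x == 0 then e * vsymbol s y else (B (y + e * x) - B y) / x.

Lemma damping0 x y : damping 0 x y = 0.
Proof. by rewrite /damping !mul0r addr0 subrr mul0r if_same. Qed.

(** Additivity of the integral along a characteristic, which has reached y + h x at time h; it makes
    the flow a semigroup. *)
Lemma damping_cocycle e h x y : damping (e + h) x y = damping e x (y + h * x) + damping h x y.
Proof.
rewrite /damping; case: eqVneq => [->|x0]; first by rewrite mulr0 addr0 mulrDl.
by rewrite -mulrDl (_ : y + (e + h) * x = y + h * x + e * x); [congr (_ / _)|]; ring.
Qed.

Lemma damping_derive (e x y : R) : is_derive e 1 (fun e => damping e x y) (vsymbol s (y + e * x)).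
Proof.
rewrite /damping; case: eqVneq => [->|x0].
  rewrite mulr0 addr0.
  have -> : (fun e => e * vsymbol s y) = (fun e => 0 + e * vsymbol s y) by apply/funext => t; rewrite add0r.
  exact: is_derive_aff.
have dk := is_derive_aff y x e.
have d1 := @is_derive1_comp _ B (fun e => y + e * x) e _ _ (HB _) dk.
have dc : is_derive e 1 (fun _ : R => B y) 0 by exact: is_derive_cst.
have d2 : is_derive e 1 (fun e => x^-1 * (B (y + e * x) - B y)) (x^-1 * (vsymbol s (y + e * x) * x - 0)).
  have q := is_deriveB d1 dc. exact: (is_deriveZ x^-1 q).
have -> : (fun e => (B (y + e * x) - B y) / x) = (fun e => x^-1 * (B (y + e * x) - B y)).
  by apply/funext => t; rewrite mulrC.
by apply: is_derive_eq d2 _; rewrite subr0 mulrCA mulVf ?mulr1.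
Qed.

Lemma damping_lower (e x y m : R) : 0 <= e -> (forall t, 0 <= t <= e -> m <= vsymbol s (y + t * x)) -> m * e <= damping e x y.
Proof.
move=> e0 H; have cg : {within `[0, e], continuous (fun e => damping e x y)}.
  by apply: continuous_subspaceT => z; exact: is_derive_cont (damping_derive z x y).
have [z + E] := @MVT_segment R _ _ 0 e e0 (fun z _ => damping_derive z x y) cg.
rewrite in_itv /= => /H; rewrite damping0 !subr0 in E; rewrite E => h.
exact: ler_wpM2r.
Qed.

Lemma damping_ge0 e x y : 0 <= e -> 0 <= damping e x y.
Proof.
move=> e0; have := @damping_lower e x y 0 e0; rewrite mul0r; apply => t _.
exact: powR_ge0.
Qed.

Lemma damping_derive2 (e x y : R) : x != 0 -> is_derive y 1 (damping e x) ((vsymbol s (y + e * x) - vsymbol s y) / x).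
Proof.
move=> x0; rewrite /damping (negbTE x0).
have d1 := @is_derive1_comp _ B (fun y => y + e * x) y _ _ (HB _) (is_derive_shift (e * x) y).
have d2 : is_derive y 1 (fun y => x^-1 * (B (y + e * x) - B y)) (x^-1 * (vsymbol s (y + e * x) * 1 - vsymbol s y)).
  exact: (@is_deriveZ _ _ _ (fun y => B (y + e * x) - B y) x^-1 y 1 _ (is_deriveB d1 (HB y))).
have -> : (fun y => (B (y + e * x) - B y) / x) = (fun y => x^-1 * (B (y + e * x) - B y)).
  by apply/funext => t; rewrite mulrC.
by apply: is_derive_eq d2 _; rewrite mulr1 mulrC.
Qed.

Lemma measurable_damping e : measurable_fun setT (fun p : mR * mR => damping e p.1 p.2).
Proof.
have mB : measurable_fun setT (B : mR -> mR).
  by apply: continuous_measurable_fun => y; exact: is_derive_cont (HB y).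
have ml : measurable_fun setT (vsymbol s : mR -> mR).
  by apply: continuous_measurable_fun; exact: vsymbol_cont.
have m1 : measurable_fun setT (fun p : mR * mR => p.1) by exact: measurable_fst.
have m2 : measurable_fun setT (fun p : mR * mR => p.2) by exact: measurable_snd.
apply: measurable_fun_ifT.
- by apply: measurable_fun_eqr => //; exact: measurable_cst.
- by apply: measurable_funM; [exact: measurable_cst|exact: measurableT_comp].
- apply: measurable_funM.
    apply: measurable_funB; last exact: measurableT_comp.
    apply: (measurableT_comp mB); apply: measurable_funD => //.
    by apply: measurable_funM => //; exact: measurable_cst.
  (* The inverse is written with a real power of p.1^2, which is known to be measurable; at p.1 = 0
     both sides are 0 by convention. *)
  have -> : (fun p : mR * mR => p.1^-1) = fun p => p.1 * (p.1 ^+ 2) `^ (-1).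
    apply/funext => p; rewrite powR_inv1 ?sqr_ge0//.
    by have [->|x0] := eqVneq p.1 0; [rewrite mul0r invr0|field].
  have mp : measurable_fun setT (fun z : mR => z `^ (-1) : mR) by exact: measurable_powR.
  apply: measurable_funM => //; apply: (measurableT_comp mp).
  exact: measurable_funX.
Qed.

Definition flow (e : R) (W : fn) : fn := fun p => (expR (- damping e p.1 p.2))%:C * W (p.1, p.2 + e * p.1).

Lemma flow0 W : flow 0 W = W.
Proof. by apply/funext => -[x y]; rewrite /flow /= damping0 oppr0 expR0 mul0r addr0 mul1r. Qed.

Lemma flow_comp e h W : flow e (flow h W) = flow (e + h) W.
Proof.
apply/funext => -[x y]; rewrite /flow /= mulrA -rmorphM -expRD [e + h]addrC damping_cocycle.
by congr ((expR _)%:C * W (x, _)); ring.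
Qed.

Lemma flowB e (U W : fn) : flow e (fun p => U p - W p) = fun p => flow e U p - flow e W p.
Proof. by apply/funext => p; rewrite /flow mulrBr. Qed.

Lemma flowZ e a (U : fn) : flow e (fun p => a * U p) = fun p => a * flow e U p.
Proof. by apply/funext => p; rewrite /flow mulrCA. Qed.

Lemma flow_mulx e (m : R -> C) (W : fn) : flow e (fun p => m p.1 * W p) = fun p => m p.1 * flow e W p.
Proof. by apply/funext => p; rewrite /flow /= mulrCA. Qed.

Lemma cnorm1_flow e W p : 0 <= e -> cnorm1 (flow e W p) <= cnorm1 (W (p.1, p.2 + e * p.1)).
Proof.
move=> e0; rewrite cnorm1RM ger0_norm ?expR_ge0// ler_piMl ?cnorm1_ge0//.
by rewrite -expR0 ler_expR oppr_le0 damping_ge0.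
Qed.

Variable K : kind.

Definition shear (e : R) (W : fn) : fn := fun p => W (p.1, p.2 + e * p.1).

Lemma cmeasurable2_shear e W : cmeasurable2 W -> cmeasurable2 (shear e W).
Proof.
move=> [w1 w2]; have m : measurable_fun setT (fun p : mR * mR => (p.1, p.2 + e * p.1) : mR * mR).
  apply/measurable_fun_pairP; split; first exact: measurable_fst.
  apply: measurable_funD; first exact: measurable_snd.
  by apply: measurable_funM; [exact: measurable_cst|exact: measurable_fst].
by split; [exact: (measurableT_comp w1 m)|exact: (measurableT_comp w2 m)].
Qed.

(** At fixed xi the shear is a translation in eta, which preserves Lebesgue measure. *)
Lemma shear_contract e W : L2 (kmeasure_sf R K \x kmeasure_sf R Ln)%E W ->
  L2 (kmeasure_sf R K \x kmeasure_sf R Ln)%E (shear e W) /\ L2sq (kmeasure_sf R K \x kmeasure_sf R Ln)%E (shear e W) <= L2sq (kmeasure_sf R K \x kmeasure_sf R Ln)%E W.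
Proof.
move=> LW; have [mW iW'] := LW; have mF := cmeasurable2_shear e mW; apply: L2_le => //.
rewrite L2sq_EFin//; change (sqI K (shear e W) <= sqI K W)%E.
rewrite (sqI1 K mF) (sqI1 K mW); apply: ge0_le_integral => //.
- by move=> x _; apply: integral_ge0 => y _; rewrite lee_fin normsq_ge0.
- apply: (@measurable_fun_fubini_tonelli_F _ _ _ _ _ (kmeasure_sf R Ln) (fun p => (normsq (shear e W p))%:E)).
    exact: measurable_normsq mF.
  by move=> p; rewrite lee_fin normsq_ge0.
- apply: (@measurable_fun_fubini_tonelli_F _ _ _ _ _ (kmeasure_sf R Ln) (fun p => (normsq (W p))%:E)).
    exact: measurable_normsq mW.
  by move=> p; rewrite lee_fin normsq_ge0.
- move=> x _; pose phi := fun y : mR => (y + e * x : mR).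
  have mphi : measurable_fun setT phi by exact: measurable_funD.
  have ms : measurable_fun setT (fun y : mR => (normsq (W (x, y)))%:E).
    by apply/measurable_EFinP; apply: cmeasurable_normsq; exact: cmeasurable2_sec2.
  have E := @ge0_leb_change R phi mphi (@leb_shift R (e * x)) (fun y => (normsq (W (x, y)))%:E) ms.
  by rewrite -[leRHS]E// => y; rewrite lee_fin normsq_ge0.
Qed.

Lemma measurable_expbb e : measurable_fun setT (fun p : mR * mR => expR (- damping e p.1 p.2)).
Proof. by apply: (measurableT_comp (@measurable_expR R)); apply: measurable_funN; exact: measurable_damping. Qed.

Lemma cmeasurable2_flow e W : cmeasurable2 W -> cmeasurable2 (flow e W).
Proof. by move=> mW; apply: cmeasurableM; [apply: cmeasurableR; exact: measurable_expbb|exact: cmeasurable2_shear]. Qed.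

Lemma flow_contract e W : 0 <= e -> L2 (kmeasure_sf R K \x kmeasure_sf R Ln)%E W ->
  L2 (kmeasure_sf R K \x kmeasure_sf R Ln)%E (flow e W) /\ L2sq (kmeasure_sf R K \x kmeasure_sf R Ln)%E (flow e W) <= L2sq (kmeasure_sf R K \x kmeasure_sf R Ln)%E W.
Proof.
move=> e0 LW; have [Ls As] := shear_contract e LW.
have kM (p : R * R) : `|expR (- damping e p.1 p.2)| <= 1.
  by rewrite ger0_norm ?expR_ge0// -expR0 ler_expR oppr_le0 damping_ge0.
have [LF AF] := L2_mul_le (measurable_expbb e) kM Ls; split => //.
by apply: le_trans AF _; rewrite expr1n mul1r.
Qed.

(* U = A V, where A = xi d_eta - (1 + eta^2)^s is the generator on the Fourier side. *)
Definition freq_generator (V U : fn) := exists2 V2, has_pderiv2 V V2 & U = fun p => p.1%:C * V2 p - (vsymbol s p.2)%:C * V p.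

Hypothesis KP : K <> Pr.

Lemma smooth_freq_generator V : smooth K Ln V -> exists2 U, smooth K Ln U & freq_generator V U.
Proof.
move=> sV; have [V2 dV sV2] := smooth_d2 (K2 := Ln) (fun e => ltac:(discriminate e)) sV.
exists (fun p => p.1%:C * V2 p - (vsymbol s p.2)%:C * V p); last by exists V2.
have a1 : smooth K Ln (fun p => p.1%:C * V2 p) by exact: (smoothM1 KP (@symbol_id R) sV2).
have a2 : smooth K Ln (fun p => (vsymbol s p.2)%:C * V p) by apply: (smoothM2 _ (symbol_jap s) sV).
by have := smoothD (-1) a2 a1; under eq_fun do rewrite mulN1r addrC.
Qed.

(** The derivative falls on the data: d/de flow_e V = flow_e (A V), so a second derivative is just
    flow_e (A (A V)). *)
Lemma flow_derive V U x y e : freq_generator V U -> is_cderive (fun e => flow e V (x, y)) e (flow e U (x, y)).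
Proof.
move=> [V2 dV ->]; rewrite /flow /=.
have d1 := is_cderiveR (is_derive_expN (damping_derive e x y)).
have d2 := is_cderive_comp (is_derive_aff y x e) (dV x (y + e * x)).
by apply: is_cderive_eq (is_cderiveM d1 d2) _; rewrite rmorphM rmorphN; ring.
Qed.

(** Peetre's inequality moves the decay in eta from y + e x back to y at the cost of a factor of
    order 1 + x^2, for which two more powers of decay in x pay. *)
Lemma smooth_shift_bound (U : fn) : smooth K Ln U -> exists2 M, 0 <= M & forall x y e, 0 <= e <= 1 ->
  cnorm1 (U (x, y + e * x)) <= M * (kdecay K x * lorentz y).
Proof.
move=> sU; have [c c0 Hc] := decay 0 0 (smooth_decaying sU); have [d d0 Hd] := decay 2 0 (smooth_decaying sU).
exists (2 * (c + d)); first by rewrite mulr_ge0 ?addr_ge0.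
move=> x y e /andP[e0 e1]; set z := y + e * x.
have h1 := Hc x z; have h2 := Hd x z.
have wE a : kweight K a x = `|x| ^+ a by case: (K) KP.
rewrite !kweight0 !mul1r in h1; rewrite kweight0 mulr1 wE real_normK ?num_real// in h2.
have px := oneDsq_gt0 x; have pz := oneDsq_gt0 z; have py := oneDsq_gt0 y.
have h3 : (1 + x ^+ 2) * cnorm1 (U (x, z)) <= (c + d) * (kdecay K x * lorentz z) by rewrite !mulrDl mul1r; exact: lerD.
have pe : lorentz z <= 2 * (1 + x ^+ 2) * lorentz y.
  rewrite /lorentz ler_pdivlMr// mulrC ler_pdivrMr//.
  have := peetre1 y z; have -> : y - z = - (e * x) by rewrite /z; ring.
  have e2 : e ^+ 2 <= 1 by rewrite expr_le1.
  have : (e * x) ^+ 2 <= x ^+ 2 by rewrite exprMn ler_piMl// sqr_ge0.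
  rewrite sqrrN; nra.
rewrite -(ler_pM2l px); apply: le_trans h3 _.
have k0 : 0 <= (c + d) * kdecay K x by rewrite mulr_ge0 ?addr_ge0// ltW// kdecay_gt0.
have := ler_wpM2l k0 pe.
have -> : (1 + x ^+ 2) * (2 * (c + d) * (kdecay K x * lorentz y)) = (c + d) * kdecay K x * (2 * (1 + x ^+ 2) * lorentz y) by ring.
by move=> h5; apply: le_trans h5; rewrite mulrA.
Qed.

(** Two mean value estimates in the time variable, each with the factor 2 of complex values, against
    a bound on flow_e (A (A V)) uniform for e in [0, 1]. *)
Lemma flow_taylor V U : smooth K Ln V -> smooth K Ln U -> freq_generator V U -> exists2 M, 0 <= M & forall h x y, 0 <= h <= 1 ->
  cnorm1 (flow h V (x, y) - V (x, y) - h%:C * U (x, y)) <= M * h ^+ 2 * (kdecay K x * lorentz y).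
Proof.
move=> sV sU gV; have [U2 sU2 gU] := smooth_freq_generator sU.
have [M M0 HM] := smooth_shift_bound sU2; exists (4 * M); first by rewrite mulr_ge0.
move=> h x y /andP[h0 h1]; set c := M * (kdecay K x * lorentz y).
have c0 : 0 <= c by rewrite mulr_ge0// mulr_ge0// ltW// ?kdecay_gt0 ?lorentz_gt0.
have d1 e : 0 <= e <= h -> cnorm1 (flow e U (x, y) - U (x, y)) <= 2 * c * h.
  move=> /andP[e0 eh]; have := @is_cderive_lip_itv (fun e => flow e U (x, y)) (fun e => flow e U2 (x, y)) c 0 e.
  rewrite flow0 subr0 => L; apply: le_trans (L _ e0 _) _.
  - by move=> t; exact: flow_derive.
  - move=> t /andP[t0 te]; apply: le_trans (cnorm1_flow _ _ t0) _; apply: HM.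
    by rewrite t0 (le_trans te)// (le_trans eh).
  - by apply: ler_wpM2l => //; rewrite mulr_ge0.
have := @is_cderive_lip_itv (fun e => flow e V (x, y) - e%:C * U (x, y)) (fun e => flow e U (x, y) - U (x, y)) (2 * c * h) 0 h.
rewrite flow0 mul0r !subr0 => L.
have -> : flow h V (x, y) - V (x, y) - h%:C * U (x, y) = flow h V (x, y) - h%:C * U (x, y) - V (x, y) by ring.
apply: le_trans (L _ h0 d1) _; last first.
  by rewrite le_eqVlt; apply/orP; left; apply/eqP; rewrite /c; ring.
move=> t; have dt : is_cderive (fun e => e%:C * U (x, y)) t (U (x, y)).
  have := is_cderiveM (is_cderiveR (is_derive_aff 0 1 t)) (is_cderive_cst (U (x, y)) t).
  under eq_fun do rewrite add0r mulr1.
  by move/is_cderive_eq; apply; rewrite mulr0 addr0 mul1r.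
have := is_cderive_lin (-1) dt (flow_derive x y t gV).
under eq_fun do rewrite mulN1r addrC.
by move/is_cderive_eq; apply; rewrite mulN1r addrC.
Qed.

Lemma L2sq_decay (W : fn) c : cmeasurable2 W -> 0 <= c -> (forall x y, cnorm1 (W (x, y)) <= c * (kdecay K x * lorentz y)) ->
  L2 (kmeasure_sf R K \x kmeasure_sf R Ln)%E W /\
  L2sq (kmeasure_sf R K \x kmeasure_sf R Ln)%E W <= c ^+ 2 * \int[(kmeasure_sf R K \x kmeasure_sf R Ln)%E]_p (kdecay K p.1 * lorentz p.2).
Proof.
move=> mW c0 H; pose G (p : mR * mR) : R := kdecay K p.1 * kdecay Ln p.2.
have iG : (kmeasure_sf R K \x kmeasure_sf R Ln)%E.-integrable setT (EFin \o G).
  apply: (@integrable_prod R _ _ mR mR (kmeasure_sf R K) (kmeasure_sf R Ln) (kdecay K) (kdecay Ln)).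
  + by move=> x; rewrite ltW// kdecay_gt0.
  + by move=> x; rewrite ltW// kdecay_gt0.
  + exact: integrable_kdecay.
  + exact: integrable_kdecay.
have G0 p : 0 <= G p by rewrite mulr_ge0// ltW// ?kdecay_gt0 ?lorentz_gt0.
have G1 p : G p <= 1 by rewrite mulr_ile1 ?kdecay_le1 ?lorentz_le1// ltW// ?kdecay_gt0 ?lorentz_gt0.
have ic : (kmeasure_sf R K \x kmeasure_sf R Ln)%E.-integrable setT (EFin \o (fun p => c ^+ 2 * G p)) by exact: riZ.
have le p : normsq (W p) <= c ^+ 2 * G p.
  case: p => x y; apply: le_trans (normsq_cnorm1 _) _.
  apply: (@le_trans _ _ ((c * G (x, y)) ^+ 2)).
    by rewrite ler_pXn2r ?nnegrE ?cnorm1_ge0//; exact: mulr_ge0.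
  rewrite exprMn; apply: ler_wpM2l; first exact: sqr_ge0.
  by rewrite expr2 ler_piMr.
have LW : L2 (kmeasure_sf R K \x kmeasure_sf R Ln)%E W.
  split => //; apply: (@dom_integrable _ _ _ (kmeasure_sf R K \x kmeasure_sf R Ln)%E _ (fun p => c ^+ 2 * G p)) => //.
  - exact: cmeasurable_normsq.
  - by move=> p; rewrite ger0_norm ?normsq_ge0.
split => //; rewrite -RintegralZl//; apply: le_Rintegral => //.
by have [] := LW.
Qed.

Lemma flow_taylor_L2sq V U : smooth K Ln V -> smooth K Ln U -> freq_generator V U -> exists2 M, 0 <= M & forall h, 0 <= h <= 1 ->
  L2 (kmeasure_sf R K \x kmeasure_sf R Ln)%E (fun p => flow h V p - V p - h%:C * U p) /\
  L2sq (kmeasure_sf R K \x kmeasure_sf R Ln)%E (fun p => flow h V p - V p - h%:C * U p) <= M * h ^+ 4.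
Proof.
move=> sV sU gV; have [M M0 HM] := flow_taylor sV sU gV.
set I := \int[(kmeasure_sf R K \x kmeasure_sf R Ln)%E]_p (kdecay K p.1 * lorentz p.2).
have I0 : 0 <= I by apply: Rintegral_ge0 => p _; rewrite mulr_ge0// ltW// ?kdecay_gt0 ?lorentz_gt0.
exists (M ^+ 2 * I) => [|h h01]; first by rewrite mulr_ge0 ?sqr_ge0.
have mW : cmeasurable2 (fun p => flow h V p - V p - h%:C * U p).
  have mV := decaying_meas (smooth_decaying sV); have mU := decaying_meas (smooth_decaying sU).
  apply: cmeasurableB; first by apply: cmeasurableB => //; exact: cmeasurable2_flow.
  by apply: cmeasurableM => //; exact: cmeasurable_cst.
have c0 : 0 <= M * h ^+ 2 by rewrite mulr_ge0 ?sqr_ge0.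
have [LW AW] := L2sq_decay mW c0 (fun x y => HM h x y h01); split => //.
apply: le_trans AW _; rewrite -/I le_eqVlt; apply/orP; left; apply/eqP; ring.
Qed.

End Flow2.

(** * The generator in weak form *)

Section Weak.
Variable R : realType.
Local Notation mR := (measurableTypeR R).
Local Notation C := R[i].
Local Notation fn := (R * R -> C).
Variables (s : R) (B : R -> R).
Hypotheses (s1 : s <= 1) (HB : forall y : R, is_derive y 1 B (vsymbol s y)).
Local Notation flow := (flow s B).
Local Notation damping := (damping s B).

Lemma flow_d2 t (V V2 : fn) x y : x != 0 -> has_pderiv2 V V2 ->
  is_cderive (fun y => flow t V (x, y)) y ((expR (- damping t x y))%:C *
    (V2 (x, y + t * x) - ((vsymbol s (y + t * x) - vsymbol s y) / x)%:C * V (x, y + t * x))).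
Proof.
move=> x0 dV; rewrite /flow /=.
have d1 := is_cderiveR (is_derive_expN (damping_derive2 HB t y x0)).
have d2 := is_cderive_comp (is_derive_shift (t * x) y) (dV x (y + t * x)).
by apply: is_cderive_eq (is_cderiveM d1 d2) _; rewrite rmorphM rmorphN rmorph1 mul1r; ring.
Qed.

Lemma is_cderive_vsymbol (y : R) : exists l : C, is_cderive (fun y => (vsymbol s y)%:C) y l.
Proof. by have [l' dl _] := vsymbol_derive s; exists (l' y)%:C; apply: is_cderiveR; exact: dl. Qed.

Lemma smooth_bounded K (u : fn) : smooth K Ln u -> exists2 M, 0 <= M & forall p, cnorm1 (u p) <= M.
Proof.
move=> su; have [c c0 H] := decay 0 0 (smooth_decaying su); exists c => // -[x y].
have := H x y; rewrite !kweight0 !mul1r => /le_trans; apply; rewrite ler_piMr//.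
by rewrite mulr_ile1 ?kdecay_le1// ltW// kdecay_gt0.
Qed.

Section Pairing.
Variable K : kind.
Hypothesis KP : K <> Pr.

(** Since s <= 1 the symbol in eta is at most 1 + eta^2, so Schwartz decay absorbs it. *)
Lemma decay_sum (u : fn) : smooth K Ln u -> exists2 c, 0 <= c & forall x y,
  [/\ cnorm1 (u (x, y)) <= c * (kdecay K x * lorentz y), `|x| * cnorm1 (u (x, y)) <= c * (kdecay K x * lorentz y) &
      vsymbol s y * cnorm1 (u (x, y)) <= c * (kdecay K x * lorentz y)].
Proof.
move=> su; have bu := smooth_decaying su.
have [c c0 Hc] := decay 0 0 bu; have [d d0 Hd] := decay 1 0 bu; have [e e0 He] := decay 0 2 bu.
exists (c + d + e); first by rewrite !addr_ge0.
move=> x y; have h1 := Hc x y; have h2 := Hd x y; have h3 := He x y.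
have wE a : kweight K a x = `|x| ^+ a by case: (K) KP.
rewrite !kweight0 !mul1r in h1; rewrite kweight0 mulr1 wE expr1 in h2; rewrite kweight0 mul1r /kweight real_normK ?num_real// in h3.
rewrite -[kdecay Ln y]/(lorentz y) in h1 h2 h3.
have w0 : 0 <= kdecay K x * lorentz y by rewrite mulr_ge0// ltW// ?kdecay_gt0 ?lorentz_gt0.
have hl := ler_wpM2r (cnorm1_ge0 (u (x, y))) (vsymbol_le y s1).
move: (kdecay K x * lorentz y) w0 h1 h2 h3 hl => w w0 h1 h2 h3 hl.
have cw := mulr_ge0 c0 w0; have dw := mulr_ge0 d0 w0; have ew := mulr_ge0 e0 w0.
by split; nra.
Qed.

(* The integrand is the eta-derivative of xi (flow t V) E. *)
Lemma weak_flow t (V U E E2 : fn) : 0 <= t -> smooth K Ln V -> smooth K Ln U -> freq_generator s V U ->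
  smooth K Ln E -> smooth K Ln E2 -> has_pderiv2 E E2 ->
  cint (kmeasure_sf R K \x kmeasure_sf R Ln)%E (fun p => flow t U p * E p + (vsymbol s p.2)%:C * (flow t V p * E p) + flow t V p * (p.1%:C * E2 p)) = 0.
Proof.
move=> t0 sV sU gV sE sE2 dE.
have [MV MV0 HV] := smooth_bounded sV; have [MU MU0 HU] := smooth_bounded sU.
have [c c0 Hc] := decay_sum sE; have [d d0 Hd] := decay_sum sE2.
pose F (p : mR * mR) : C := flow t U p * E p + (vsymbol s p.2)%:C * (flow t V p * E p) + flow t V p * (p.1%:C * E2 p).
have fV x y : cnorm1 (flow t V (x, y)) <= MV by apply: le_trans (cnorm1_flow HB _ _ t0) (HV _).
have fU x y : cnorm1 (flow t U (x, y)) <= MU by apply: le_trans (cnorm1_flow HB _ _ t0) (HU _).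
have w0 (x y : R) : 0 <= kdecay K x * lorentz y by rewrite mulr_ge0// ltW// ?kdecay_gt0 ?lorentz_gt0.
pose M := MU * c + MV * c + MV * d.
have M0 : 0 <= M by rewrite !addr_ge0// mulr_ge0.
have FM x y : cnorm1 (F (x, y)) <= M * (kdecay K x * lorentz y).
  have [h1 h2 h3] := Hc x y; have [k1 k2 k3] := Hd x y.
  rewrite /F /M !mulrDl; apply: le_trans (cnorm1D _ _) (lerD (le_trans (cnorm1D _ _) (lerD _ _)) _).
  - apply: le_trans (cnorm1M _ _) _; rewrite -mulrA; apply: ler_pM => //; exact: cnorm1_ge0.
  - rewrite mulrCA; apply: le_trans (cnorm1M _ _) _; rewrite -mulrA; apply: ler_pM; rewrite ?cnorm1_ge0//.
    by rewrite cnorm1RM ger0_norm// powR_ge0.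
  - apply: le_trans (cnorm1M _ _) _; rewrite -mulrA; apply: ler_pM; rewrite ?cnorm1_ge0//.
    by rewrite cnorm1RM.
have mV := cmeasurable2_flow HB t (decaying_meas (smooth_decaying sV)); have mU := cmeasurable2_flow HB t (decaying_meas (smooth_decaying sU)).
have mE := decaying_meas (smooth_decaying sE); have mE2 := decaying_meas (smooth_decaying sE2).
have mF : @cmeasurable R _ (mR * mR)%type F.
  apply: cmeasurableD; first (apply: cmeasurableD; first exact: cmeasurableM).
    apply: cmeasurableM; last exact: cmeasurableM.
    by apply: cmeasurableR; apply: measurableT_comp; [apply: continuous_measurable_fun; exact: vsymbol_cont|exact: measurable_snd].
  by apply: cmeasurableM => //; apply: cmeasurableM => //; apply: cmeasurableR; exact: measurable_fst.
have [] := @cfubini R _ _ mR mR (kmeasure_sf R K) (kmeasure_sf R Ln) F (fun x => M * kdecay K x) (kdecay Ln).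
- exact: mF.
- by move=> x y; rewrite -mulrA; exact: FM.
- by move=> x; rewrite mulr_ge0// ltW// kdecay_gt0.
- by move=> y; rewrite ltW// kdecay_gt0.
- exact: iW.
- exact: (@integrable_kdecay R Ln).
move=> -> _ _.
rewrite -[RHS](cint0 (kmeasure_sf R K)); apply: cint_ext => x.
have [V2 dV UE] := gV.
(* At xi = 0 there is no transport: flow_t (A V) is - (1 + eta^2)^s flow_t V, and the integrand
   vanishes identically. *)
have [x0|x0] := eqVneq x 0.
  rewrite -[RHS](cint0 (kmeasure_sf R Ln)); apply: cint_ext => y; rewrite /F /flow UE x0; cbv beta iota delta [fst snd].
  rewrite !mulr0 addr0 (_ : (0 : R)%:C = 0 :> C)//.
  by move: (V2 _) (V _) (E _) (E2 _) (_%:C) (_%:C) => *; ring.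
pose h y := x%:C * (flow t V (x, y) * E (x, y)).
have dh y : is_cderive h y (F (x, y)).
  have d1 := is_cderiveM (flow_d2 t y x0 dV) (dE x y).
  apply: is_cderive_eq (is_cderiveM (is_cderive_cst x%:C y) d1) _.
  rewrite /F /flow UE /= mul0r add0r rmorphM rmorphB.
  have xx : x%:C * (x^-1)%:C = 1 :> C by rewrite -rmorphM divff.
  set e := (expR _)%:C; set a := (vsymbol s (y + t * x))%:C; set b := (vsymbol s y)%:C.
  move: (V2 _) (V (x, y + t * x)) (E (x, y)) (E2 (x, y)) => v2 v w w2.
  transitivity (e * (x%:C * v2 - (x%:C * (x^-1)%:C) * ((a - b) * v)) * w + e * v * (x%:C * w2)); first by ring.
  by rewrite xx; ring.
have [U2 dU _] := smooth_d2 (K2 := Ln) (fun e => ltac:(discriminate e)) sU.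
have [E3 dE2 _] := smooth_d2 (K2 := Ln) (fun e => ltac:(discriminate e)) sE2.
(* [cint_deriv0] asks for a second derivative of the primitive, which exists because A V and the
   eta-derivative of E are again differentiable in eta. *)
have ex y : exists l, is_cderive (fun y => F (x, y)) y l.
  have [ll dl] := is_cderive_vsymbol y.
  have a1 := is_cderiveM (flow_d2 t y x0 dU) (dE x y).
  have a2 := is_cderiveM dl (is_cderiveM (flow_d2 t y x0 dV) (dE x y)).
  have a3 := is_cderiveM (flow_d2 t y x0 dV) (is_cderiveM (is_cderive_cst x%:C y) (dE2 x y)).
  by eexists; exact: is_cderiveD (is_cderiveD a1 a2) a3.
have [h'' dh'] := choice ex.
have P1 : Ln <> Zc by [].
apply: (@cint_deriv0 R Ln h (fun y => F (x, y)) h'' (M + MV * c) P1 dh dh') => //.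
- move=> y; have [_ h2 _] := Hc x y.
  have wy := ltW (lorentz_gt0 y).
  rewrite /h cnorm1RM; apply: (@le_trans _ _ (MV * (`|x| * cnorm1 (E (x, y))))).
    rewrite mulrCA; apply: ler_wpM2l => //.
    by apply: le_trans (cnorm1M _ _) _; apply: ler_wpM2r; [exact: cnorm1_ge0|exact: fV].
  have : MV * (c * (kdecay K x * lorentz y)) <= MV * (c * (1 * lorentz y)).
    by apply: ler_wpM2l => //; apply: ler_wpM2l => //; apply: ler_wpM2r => //; exact: kdecay_le1.
  have : MV * (`|x| * cnorm1 (E (x, y))) <= MV * (c * (kdecay K x * lorentz y)) by apply: ler_wpM2l.
  have : 0 <= M * lorentz y by exact: mulr_ge0.
  have -> : MV * (c * (1 * lorentz y)) = MV * c * lorentz y by ring.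
  rewrite [in (M + _) * _]mulrDl -[kdecay Ln y]/(lorentz y) => g1 g2 g3.
  by apply: le_trans g2 _; apply: le_trans g3 _; rewrite lerDr.
- move=> y; apply: le_trans (FM x y) _; have wy := ltW (lorentz_gt0 y).
  have : M * (kdecay K x * lorentz y) <= M * (1 * lorentz y).
    by apply: ler_wpM2l => //; apply: ler_wpM2r => //; exact: kdecay_le1.
  have : 0 <= MV * c * lorentz y by rewrite !mulr_ge0.
  by rewrite mul1r mulrDl -[kdecay Ln y]/(lorentz y); lra.
Qed.

End Pairing.

(** [weak_flow] tested with the transform of phi: A becomes - P, since the transpose of v d_x is, in
    frequency, xi d_eta acting on the transform of phi. *)
Lemma freq_dist_gen D t (V U : fn) phi : 0 <= t -> smooth (xikind D) Ln V -> smooth (xikind D) Ln U -> freq_generator s V U -> smooth (xkind D) Ln phi ->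
  freq_dist D (flow t U) phi = - opP D s (freq_dist D (flow t V)) phi.
Proof.
move=> t0 sV sU gV sp; have [u2 [dE su2 Edx]] := FT2_dxv sp.
have sE := smooth_FT2 sp; have KP := @kfP D.
have Lu : L2 (mu_freq R D) (flow t U) by have [] := flow_contract HB t0 (L2_smooth sU).
have Lv : L2 (mu_freq R D) (flow t V) by have [] := flow_contract HB t0 (L2_smooth sV).
have sxu : smooth (xikind D) Ln (fun p => p.1%:C * u2 p) by exact: (smoothM1 KP (@symbol_id R) su2).
have slE : smooth (xikind D) Ln (fun p => (vsymbol s p.2)%:C * FT2 D phi p) by apply: (smoothM2 _ (symbol_jap s) sE).
have c1 := L2_cintegrable Lu (L2_smooth sE); have c2' := L2_cintegrable Lv (L2_smooth sxu); have c3 := L2_cintegrable Lv (L2_smooth slE).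
have W := weak_flow KP t0 sV sU gV sE su2 dE.
have e1 : freq_dist D (flow t V) (pderiv X (fun p => p.2%:C * phi p)) = - cint (mu_freq R D) (fun p => flow t V p * (p.1%:C * u2 p)).
  rewrite -(cintN c2'); apply: cint_ext => p; rewrite Edx; exact: mulrN.
have e2 : Lambda_v D (2 * s) (freq_dist D (flow t V)) phi = cint (mu_freq R D) (fun p => flow t V p * ((vsymbol s p.2)%:C * FT2 D phi p)).
  apply: etrans (Lambda_vE _ _ sp) _; rewrite /freq_dist (FT2_mult 0 (2 * s) sp); apply: cint_ext => p.
  have -> // : japxv 0 (2 * s) p = vsymbol s p.2.
  by rewrite japxv_v /japv /vsymbol mulrAC divff ?mul1r// pnatr_eq0.
have e3 : cint (mu_freq R D) (fun p => flow t U p * FT2 D phi p) +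
    cint (mu_freq R D) (fun p => flow t V p * ((vsymbol s p.2)%:C * FT2 D phi p)) +
    cint (mu_freq R D) (fun p => flow t V p * (p.1%:C * u2 p)) = 0.
  rewrite -W -(cintD c1 c3) -(cintD (cintegrableD c1 c3) c2'); apply: cint_ext => p.
  by rewrite (mulrCA (flow t V p) (vsymbol s p.2)%:C).
rewrite /opP e2; change (freq_dist D (flow t U) phi = - (- freq_dist D (flow t V) (pderiv X (fun p => p.2%:C * phi p)) + cint (mu_freq R D) (fun p => flow t V p * ((vsymbol s p.2)%:C * FT2 D phi p)))).
rewrite e1 opprK; apply/eqP; rewrite -subr_eq0 opprK; apply/eqP; apply: etrans e3.
rewrite -addrA; apply: (congr1 (fun z => _ + z)); exact: addrC.
Qed.

End Weak.

(** * Identification of the semigroup and the smoothing estimates *)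

Section Final.
Variable R : realType.
Local Notation mR := (measurableTypeR R).
Local Notation C := R[i].
Local Notation fn := (R * R -> C).
Variables (s : R) (B : R -> R).
Hypotheses (s0 : 0 < s) (s1 : s <= 1) (HB : forall y : R, is_derive y 1 B (vsymbol s y)).
Local Notation flow := (flow s B).
Local Notation damping := (damping s B).

Section Evolve.
Variables (D : xspace) (r : R).
Local Notation dual_bounded := (dual_bounded D r).
Local Notation jW W := (fun p => (japx r p)%:C * W p).

(** xi is constant along characteristics, so any weight in xi commutes with the flow; weighted
    estimates thus reduce to r = 0. *)
Lemma japx_flow t (W : fn) : (fun p => (japx r p)%:C * flow t W p) = flow t (jW W).
Proof. by have := flow_mulx s B t (fun x => ((1 + x ^+ 2) `^ (r / 2))%:C) W => <-. Qed.

Lemma smooth_jW (W : fn) : smooth (xikind D) Ln W -> smooth (xikind D) Ln (jW W).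
Proof. by move=> sW; exact: smooth_japx (@kfP D) sW. Qed.

Lemma freq_generator_jW (V U : fn) : freq_generator s V U -> freq_generator s (jW V) (jW U).
Proof.
move=> [V2 dV ->]; exists (jW V2).
  move=> x y; apply: is_cderive_eq (is_cderiveM (is_cderive_cst ((japx r (x, y))%:C) y) (dV x y)) _.
  by rewrite mul0r add0r.
by apply/funext => p; rewrite mulrBr mulrCA; congr (_ - _); rewrite mulrCA.
Qed.

Lemma L2_jFl t (W : fn) : 0 <= t -> L2 (mu_freq R D) (jW W) ->
  L2 (mu_freq R D) (jW (flow t W)) /\ L2sq (mu_freq R D) (jW (flow t W)) <= L2sq (mu_freq R D) (jW W).
Proof. by move=> t0 LW; rewrite japx_flow; exact: flow_contract. Qed.

Lemma HH_freq_dist (W : fn) : L2 (mu_freq R D) (jW W) -> Hspace D r 0 (freq_dist D W).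
Proof.
move=> LW; apply: (dual_bounded_Hspace (dist_linear_freq_dist LW) _ (dual_bounded_freq_dist LW)).
by rewrite mulr_ge0// sqrtr_ge0.
Qed.

Lemma freq_dist_sub (U W : fn) phi : L2 (mu_freq R D) (jW U) -> L2 (mu_freq R D) (jW W) -> smooth (xkind D) Ln phi ->
  freq_dist D (fun p => U p - W p) phi = freq_dist D U phi - freq_dist D W phi.
Proof.
move=> LU LW sp; have [cU _] := freq_dist_cintegrable LU sp; have [cW _] := freq_dist_cintegrable LW sp.
by rewrite /freq_dist -(cintB cU cW); apply: cint_ext => p; rewrite mulrBl.
Qed.

Lemma freq_dist_scale a (W : fn) phi : L2 (mu_freq R D) (jW W) -> smooth (xkind D) Ln phi ->
  freq_dist D (fun p => a * W p) phi = a * freq_dist D W phi.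
Proof.
move=> LW sp; have [cW _] := freq_dist_cintegrable LW sp.
by rewrite /freq_dist -(cintZ a cW); apply: cint_ext => p; rewrite mulrA.
Qed.

Lemma L2_jB (U W : fn) : L2 (mu_freq R D) (jW U) -> L2 (mu_freq R D) (jW W) -> L2 (mu_freq R D) (jW (fun p => U p - W p)).
Proof. by move=> LU LW; have := L2B LU LW; under eq_fun do rewrite -mulrBr. Qed.

Lemma L2_jZ a (W : fn) : L2 (mu_freq R D) (jW W) -> L2 (mu_freq R D) (jW (fun p => a * W p)).
Proof. by move=> LW; have := L2Z a LW; under eq_fun do rewrite mulrCA. Qed.

Lemma dual_bounded_freq_dist_le (W : fn) A : L2 (mu_freq R D) (jW W) -> 0 <= A -> L2sq (mu_freq R D) (jW W) <= A ^+ 2 -> dual_bounded (freq_dist D W) (4 * A).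
Proof.
move=> LW A0 AW; apply: dual_bounded_le (dual_bounded_freq_dist LW); apply: ler_wpM2l => //.
by rewrite -[leRHS](ger0_norm A0) -sqrtr_sqr; exact: ler_wsqrtr.
Qed.

Lemma flow_remainder (V U : fn) : smooth (xikind D) Ln V -> smooth (xikind D) Ln U -> freq_generator s V U -> exists2 M, 0 <= M &
  forall h, 0 <= h <= 1 -> L2 (mu_freq R D) (jW (fun p => flow h V p - V p - h%:C * U p)) /\
    L2sq (mu_freq R D) (jW (fun p => flow h V p - V p - h%:C * U p)) <= (M * h ^+ 2) ^+ 2.
Proof.
move=> sV sU gV.
have [M M0 HM] := flow_taylor_L2sq HB (@kfP D) (smooth_jW sV) (smooth_jW sU) (freq_generator_jW gV).
exists (Num.sqrt M) => [|h h01]; first exact: sqrtr_ge0.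
have e : (fun p => flow h (jW V) p - jW V p - h%:C * jW U p) = jW (fun p => flow h V p - V p - h%:C * U p).
  by rewrite -japx_flow; apply/funext => p; rewrite -[X in X - _]mulrBr mulrCA -mulrBr.
have := HM h h01; rewrite e exprMn sqr_sqrtr// -exprM; exact.
Qed.

(** The flow property reduces the expansion at time x to the one at time 0, whose remainder is then
    contracted by flow_x. *)
Lemma freq_dist_flow_sub x h (V U : fn) phi : 0 <= x -> 0 <= h <= 1 ->
  smooth (xikind D) Ln V -> smooth (xikind D) Ln U -> freq_generator s V U -> smooth (xkind D) Ln phi ->
  freq_dist D (flow (x + h) V) phi - freq_dist D (flow x V) phi - h%:C * freq_dist D (flow x U) phi =
  freq_dist D (flow x (fun p => flow h V p - V p - h%:C * U p)) phi.
Proof.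
move=> x0 /andP[h0 h1] sV sU gV sp.
have LV := L2_smooth (smooth_jW sV); have LU := L2_smooth (smooth_jW sU).
have xh : 0 <= x + h by rewrite addr_ge0.
have [L1 _] := L2_jFl xh LV; have [L2' _] := L2_jFl x0 LV; have [L3 _] := L2_jFl x0 LU.
rewrite -(freq_dist_scale h%:C L3 sp) -(freq_dist_sub L1 L2' sp) -(freq_dist_sub (L2_jB L1 L2') (L2_jZ h%:C L3) sp).
congr (freq_dist D _ phi).
by rewrite !flowB flowZ flow_comp.
Qed.

Lemma T_freq_dist (T : R -> dist R -> dist R) t (W : fn) phi : C0_semigroup D r T ->
  generator D r T (fun g phi => - opP D s g phi) -> 0 <= t -> smooth (xikind D) Ln W -> smooth (xkind D) Ln phi ->
  T t (freq_dist D W) phi = freq_dist D (flow t W) phi.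
Proof.
move=> hT hA t0 sW sp; have [U sU gW] := smooth_freq_generator s (@kfP D) sW.
have LW := L2_smooth (smooth_jW sW); have LU := L2_smooth (smooth_jW sU).
have LF x V : 0 <= x -> L2 (mu_freq R D) (jW V) -> L2 (mu_freq R D) (jW (flow x V)).
  by move=> x0 LV; have [] := L2_jFl x0 LV.
have [M M0 HM] := flow_remainder sW sU gW.
have E := @evolution R D r T hT (fun x => freq_dist D (flow x W)) (fun x => freq_dist D (flow x U)) _ t phi hA t0 sp.
rewrite flow0 in E; apply: E.
- by move=> x x0; apply: HH_freq_dist; exact: LF.
- by move=> x x0; apply: HH_freq_dist; exact: LF.
- move=> x x0 psi /schwartzP sq; exact: (freq_dist_gen s1 HB x0 sW sU gW sq).
(* Right derivative. After division by h the remainder has dual bound 4 M h; this d keeps h below 1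
   and 4 M h below e. *)
- move=> x x0 e e0; pose d := e / (4 * M + 1 + e).
  have P0 : 0 < 4 * M + 1 + e by lra.
  have d0 : 0 < d by rewrite divr_gt0.
  have dE : d * (4 * M + 1 + e) = e by rewrite divfK// gt_eqF.
  exists d => // h /andP[h0 hd].
  have h1 : h <= 1 by apply: ltW; apply: lt_le_trans hd _; rewrite ler_pdivrMr// mul1r; lra.
  have h01 : 0 <= h <= 1 by rewrite ltW.
  have [LQ AQ] := HM h h01.
  have [LFQ AFQ] := L2_jFl x0 LQ.
  have nQ := dual_bounded_freq_dist_le LFQ (_ : 0 <= M * h ^+ 2) (le_trans AFQ AQ).
  have := dual_bounded_lin (h^-1)%:C (nQ ltac:(by rewrite mulr_ge0 ?sqr_ge0)) (_ : dual_bounded (fun=> 0) 0).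
  move=> /(_ (fun psi _ => ltac:(by rewrite cnorm10 mul0r))) Q.
  apply: (@dual_bounded_ext _ _ _ _ _ e _ (dual_bounded_le _ Q)).
    move=> psi sq; rewrite addr0 -(freq_dist_flow_sub x0 h01 sW sU gW sq).
    have hh : (h^-1)%:C * h%:C = 1 :> C by rewrite -rmorphM mulVf ?gt_eqF.
    by rewrite mulrBr mulrA hh mul1r.
  rewrite cnorm1R ger0_norm ?invr_ge0 ?(ltW h0)// addr0.
  have -> : h^-1 * (4 * (M * h ^+ 2)) = 4 * M * h.
    have hn : h != 0 by rewrite gt_eqF.
    by field.
  nra.
- move=> x x0 e e0.
  have KU := sqrtr_ge0 (L2sq (mu_freq R D) (jW U)); set k := Num.sqrt _ in KU.
  (* Left continuity. The increment is h flow (A W) plus a remainder of order h^2, with dual bound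
     at most 4 (k + M) h for h <= 1. *)
  pose d := e / (8 * (M + k) + 1 + e).
  have P0 : 0 < 8 * (M + k) + 1 + e by lra.
  have d0 : 0 < d by rewrite divr_gt0.
  have dE : d * (8 * (M + k) + 1 + e) = e by rewrite divfK// gt_eqF.
  exists d => // h /andP[h0 hd] hx.
  have h1 : h <= 1 by apply: ltW; apply: lt_le_trans hd _; rewrite ler_pdivrMr// mul1r; lra.
  have h01 : 0 <= h <= 1 by rewrite ltW.
  have [LQ AQ] := HM h h01.
  have xh : 0 <= x - h by lra.
  have [LFQ AFQ] := L2_jFl xh LQ.
  have [LFU AFU] := L2_jFl xh LU.
  have nQ := dual_bounded_freq_dist_le LFQ (_ : 0 <= M * h ^+ 2) (le_trans AFQ AQ).
  have kE : L2sq (mu_freq R D) (jW U) = k ^+ 2 by rewrite sqr_sqrtr// L2sq_ge0.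
  have nU := dual_bounded_freq_dist_le LFU KU (le_trans AFU (_ : L2sq (mu_freq R D) (jW U) <= k ^+ 2)).
  have := dual_bounded_lin h%:C (nU ltac:(by rewrite kE)) (nQ ltac:(by rewrite mulr_ge0 ?sqr_ge0)) => Q.
  apply: (@dual_bounded_ext _ _ _ _ _ e _ (dual_bounded_le _ Q)).
    move=> psi sq; rewrite -(freq_dist_flow_sub xh h01 sW sU gW sq) subrK.
    by rewrite addrC subrK.
  rewrite cnorm1R ger0_norm ?(ltW h0)//.
  have : h ^+ 2 <= h by rewrite expr2 ler_piMl// ltW.
  have := mulr_ge0 (ltW h0) M0; have := mulr_ge0 (ltW h0) KU.
  have : M * h ^+ 2 <= M * h by apply: ler_wpM2l => //; rewrite expr2 ler_piMl// ltW.
  nra.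
Qed.

End Evolve.

(* Here M := 1 + 2 (y^2 + (t x)^2) bounds 1 + (y + e x)^2 for e <= t, so that (1 + (y + e x)^2)^s is at least
   M^(s - 1) (1 + (y + e x)^2), whose integral over e is an explicit cubic. *)
Lemma damping_coercive t x y : 0 < t ->
  t * (1 + 2 * (y ^+ 2 + (t * x) ^+ 2)) `^ s / 32 <= damping t x y.
Proof.
move=> t0; set M := 1 + 2 * (y ^+ 2 + (t * x) ^+ 2).
have y2 := sqr_ge0 y; have a2 := sqr_ge0 (t * x).
have M0 : 0 < M by rewrite /M; lra.
pose m := M `^ (s - 1); have m0 : 0 < m by exact: powR_gt0.
have mM : m * M = M `^ s.
  by rewrite /m -{2}(powRr1 (ltW M0)) -powRD ?subrK// (gt_eqF M0) implybT.
pose P e := e * (1 + y ^+ 2) + e ^+ 2 * (y * x) + e ^+ 3 * (x ^+ 2 / 3).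
have dP (e : R) : is_derive e 1 P (1 + (y + e * x) ^+ 2).
  rewrite /P; apply: is_derive_eq; rewrite /GRing.scale /=.
  by field.
have dG (e : R) : is_derive e 1 (fun e => damping e x y - m * P e) (vsymbol s (y + e * x) - m * (1 + (y + e * x) ^+ 2)).
  exact: (is_deriveB (damping_derive HB e x y) (is_deriveZ m (dP e))).
have cg : {within `[0, t], continuous (fun e => damping e x y - m * P e)}.
  by apply: continuous_subspaceT => z; exact: is_derive_cont (dG z).
have [z + E] := @MVT_segment R _ _ 0 t (ltW t0) (fun z _ => dG z) cg.
rewrite in_itv /= => /andP[z0 zt].
have P00 : P 0 = 0 by rewrite /P !expr0n /= !mul0r !addr0.
rewrite damping0 P00 mulr0 !subr0 in E.
have zM : 1 + (y + z * x) ^+ 2 <= M.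
  have : (z * x) ^+ 2 <= (t * x) ^+ 2.
    rewrite !exprMn; apply: ler_wpM2r; first exact: sqr_ge0.
    by rewrite ler_pXn2r ?nnegrE// ltW.
  have := sqr_ge0 (y - z * x); rewrite /M; nra.
have pz := oneDsq_gt0 (y + z * x).
have dpos : 0 <= vsymbol s (y + z * x) - m * (1 + (y + z * x) ^+ 2).
  rewrite subr_ge0 /vsymbol.
  set w := 1 + (y + z * x) ^+ 2 in zM pz *.
  have -> : w `^ s = w `^ (s - 1) * w.
    by rewrite -{3}(powRr1 (ltW pz)) -powRD ?subrK// (gt_eqF pz) implybT.
  apply: ler_wpM2r; first exact: ltW.
  rewrite /m -(opprB 1 s) !powRN lef_pV2 ?posrE ?powR_gt0//.
  by apply: ge0_ler_powR => //; rewrite ?nnegrE ?subr_ge0 ?(ltW pz) ?(ltW M0).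
have : 0 <= damping t x y - m * P t by rewrite E mulr_ge0// ltW.
rewrite subr_ge0; apply: le_trans; rewrite -mM.
have -> : t * (m * M) / 32 = m * (t * M / 32) by ring.
apply: ler_wpM2l; first exact: ltW.
rewrite /P /M; have -> : t * (1 + y ^+ 2) + t ^+ 2 * (y * x) + t ^+ 3 * (x ^+ 2 / 3) =
   t * (1 + y ^+ 2 + y * (t * x) + (t * x) ^+ 2 / 3) by ring.
rewrite -mulrA; apply: ler_wpM2l; first exact: ltW.
(* With a = t x, y^2 + y a + a^2 / 3 >= (y^2 + a^2) / 16, since 4/15 of the square of 15/8 y + a can
   be split off. Doubling 16 because of the 2 in [M] gives the constant 32. *)
move: (t * x) a2 => a a2; have := sqr_ge0 (15 / 8 * y + a); nra.
Qed.

(** From exp z >= 1 + z at z = x / 32: 32 exp z >= 32 + x, which exceeds the square root of x. *)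
Lemma exp_sqrt_bound (x : R) : 0 <= x -> expR (- (x / 32)) * Num.sqrt x <= 32.
Proof.
move=> x0; have e1 := expR_ge1Dx (x / 32); rewrite expRN.
have q0 := sqrtr_ge0 x; have qE := sqr_sqrtr x0; set q := Num.sqrt x in q0 qE *.
have p0 : 0 < expR (x / 32) := expR_gt0 _.
rewrite mulrC ler_pdivrMr//.
have := sqr_ge0 (q - 1); nra.
Qed.

(** q = t^(1/2) M^(s/2) is the square root of the quantity t M^s in [damping_coercive]. M^(s/2)
    bounds the weight in eta directly, and t^s times the weight in xi because t^2 (1 + x^2) = t^2 +
    (t x)^2 <= M, where t <= 1 enters. *)
Lemma symbol_bound t x y : 0 < t -> t <= 1 ->
  japv s (x, y) * expR (- damping t x y) <= 32 / t `^ (1 / 2) /\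
  japx s (x, y) * expR (- damping t x y) <= 32 / t `^ (1 / 2 + s).
Proof.
move=> t0 t1; have := damping_coercive x y t0; set M := 1 + 2 * _ => Hb.
have y2 := sqr_ge0 y; have a2 := sqr_ge0 (t * x).
have M0 : 0 < M by rewrite /M; lra.
pose q := t `^ (1 / 2) * M `^ (s / 2).
have tp : 0 < t `^ (1 / 2) by exact: powR_gt0.
have ts : 0 < t `^ s by exact: powR_gt0.
have q0 : 0 <= q by rewrite mulr_ge0 ?powR_ge0.
have q2 : q ^+ 2 = t * M `^ s.
  have e1 : t `^ (1 / 2) ^+ 2 = t.
    by rewrite -powR_mulrn ?powR_ge0// -powRrM (_ : 1 / 2 * 2%:R = 1) ?powRr1 ?(ltW t0)//; field.
  have e2 : M `^ (s / 2) ^+ 2 = M `^ s.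
    by rewrite -powR_mulrn ?powR_ge0// -powRrM (_ : s / 2 * 2%:R = s)//; field.
  by rewrite exprMn e1 e2.
have qexp : expR (- damping t x y) * q <= 32.
  have x0 : 0 <= t * M `^ s by rewrite -q2 sqr_ge0.
  apply: le_trans (exp_sqrt_bound x0).
  rewrite -q2 sqrtr_sqr (ger0_norm q0); apply: ler_wpM2r => //.
  by rewrite ler_expR lerN2 q2.
have jM : japv s (x, y) <= M `^ (s / 2).
  rewrite /japv /=; apply: ge0_ler_powR; rewrite ?nnegrE ?(ltW M0) ?(ltW (oneDsq_gt0 _))//; first by rewrite divr_ge0// ltW.
  by rewrite /M; lra.
have xM : japx s (x, y) * t `^ s <= M `^ (s / 2).
  have -> : t `^ s = (t ^+ 2) `^ (s / 2).
    by rewrite -powR_mulrn ?(ltW t0)// -powRrM; congr (_ `^ _); field.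
  rewrite /japx /= -powRM ?sqr_ge0// ?(ltW (oneDsq_gt0 _))//.
  have t2 : t ^+ 2 <= 1 by rewrite expr_le1// ltW.
  apply: ge0_ler_powR; rewrite ?nnegrE ?(ltW M0)//; first by rewrite divr_ge0// ltW.
    by rewrite mulr_ge0 ?sqr_ge0// ltW// oneDsq_gt0.
  rewrite /M; have -> : (1 + x ^+ 2) * t ^+ 2 = t ^+ 2 + (t * x) ^+ 2 by ring.
  lra.
have e0 : 0 <= expR (- damping t x y) by exact: expR_ge0.
split.
  rewrite ler_pdivlMr//; apply: le_trans qexp; rewrite /q.
  have := ler_wpM2r (mulr_ge0 e0 (ltW tp)) jM.
  move: (japv s _) (expR _) (t `^ _) (M `^ _) => a b c e; nra.
have -> : t `^ (1 / 2 + s) = t `^ (1 / 2) * t `^ s by rewrite powRD// (gt_eqF t0) implybT.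
rewrite ler_pdivlMr ?mulr_gt0//; apply: le_trans qexp; rewrite /q.
have := ler_wpM2r (mulr_ge0 e0 (ltW tp)) xM.
move: (japx s _) (expR _) (t `^ (1/2)) (t `^ s) (M `^ _) => a b c e f; nra.
Qed.

(** The datum is split into a Schwartz part and a small rest. The rest is controlled by the bound on
    T_t alone; on the Schwartz part T_t is the flow, and the factor m exp(-b_t) is bounded by [L].
    The constant 96 is 4 from Cauchy-Schwarz times 24 from [freq_dist_approx]. *)
Lemma smoothing (D : xspace) (r a b t K L : R) (m : R * R -> R) (T : R -> dist R -> dist R) (f0 : dist R) psi :
  C0_semigroup D r T -> generator D r T (fun g phi => - opP D s g phi) -> 0 <= t ->
  Hspace D r 0 f0 -> (Hnorm D r 0 f0 <= K%:E)%E -> (forall p, japxv a b p = japx r p * m p) ->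
  measurable_fun setT (fun p : mR * mR => m p) ->
  (forall p, `|m p * expR (- damping t p.1 p.2)| <= L) -> smooth (xkind D) Ln psi ->
  cnorm1 (T t f0 (mult D (japxv a b) psi)) <= 96 * L * K * Num.sqrt (L2sq (mu_xv R D) psi).
Proof.
move=> hT hA t0 Hf HK wE mm mL sp; set n := Num.sqrt _.
have n0 : 0 <= n by exact: sqrtr_ge0.
have L0 : 0 <= L by apply: le_trans (mL (0, 0)); exact: normr_ge0.
have sc := smooth_mult a b sp; set chi := mult D (japxv a b) psi in sc *.
have [M M0 HM] := T_decaying hT t0; have N0 := dual_norm_ge0 D r chi.
apply/ler_addgt0Pr => e e0.
(* [P] collects the coefficients of the approximation error d: the bound on T_t at chi for the rest,
   and 4 L n for the excess in the norm of W. *)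
pose P := M * dual_norm D r chi + 4 * L * n + 1.
have P0 : 0 < P by have := mulr_ge0 M0 N0; have := mulr_ge0 L0 n0; rewrite /P; lra.
pose d := e / P; have d0 : 0 < d by rewrite divr_gt0.
have dE : d * P = e by rewrite divfK// gt_eqF.
have [W [sW nW AW]] := freq_dist_approx Hf HK d0.
have LW : L2 (mu_freq R D) (fun p => (japx r p)%:C * W p) := L2_smooth (smooth_japx r (@kfP D) sW).
have K0 : 0 <= K by rewrite -lee_fin (le_trans (Hnorm_ge0 _ _ _ _) HK).
have HJ := HH_freq_dist LW.
have e1 : T t f0 chi = T t (fun phi => f0 phi - freq_dist D W phi) chi + freq_dist D (flow t W) chi.
  by rewrite (T_sub hT t0 Hf HJ sc) (T_freq_dist hT hA t0 sW sc) subrK.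
have h1 := HM _ _ (HH_sub Hf HJ) (ltW d0) nW _ sc.
have [Ls As] := shear_contract t LW.
have mk : measurable_fun setT (fun p : mR * mR => m p * expR (- damping t p.1 p.2)).
  by apply: measurable_funM => //; exact: measurable_expbb.
have [LG AG] := L2_mul_le mk mL Ls.
have LE : L2 (mu_freq R D) (FT2 D psi) := L2_smooth (smooth_FT2 sp).
have e2 : freq_dist D (flow t W) chi = cint (mu_freq R D) (fun p => (m p * expR (- damping t p.1 p.2))%:C *
    shear t (fun p => (japx r p)%:C * W p) p * FT2 D psi p).
  rewrite /freq_dist /chi (FT2_mult a b sp); apply: cint_ext => p.
  rewrite wE /flow /shear !rmorphM -[japx r (p.1, p.2 + t * p.1)]/(japx r p).
  move: (FT2 D psi p) (W _) (expR _) => z w q; ring.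
have h2 : cnorm1 (freq_dist D (flow t W) chi) <= 4 * (L * (24 * K + d)) * n.
  rewrite e2; apply: le_trans (cauchy_schwarz LG LE) _; rewrite (L2sq_FT2 sp) -/n.
  apply: (ler_wpM2r n0); apply: ler_wpM2l; first exact: ler0n.
  have Ld : 0 <= L * (24 * K + d) by exact: (mulr_ge0 L0 (addr_ge0 (mulr_ge0 (ler0n R 24) K0) (ltW d0))).
  rewrite -[leRHS](ger0_norm Ld) -sqrtr_sqr; apply: ler_wsqrtr.
  apply: le_trans AG _; rewrite exprMn; apply: ler_wpM2l; first exact: sqr_ge0.
  exact: le_trans As AW.
rewrite e1; apply: le_trans (cnorm1D _ _) _; apply: le_trans (lerD h1 h2) _.
rewrite -dE /P; lra.
Qed.

End Final.
Theorem theorem1p3 (R : realType) (s : R) (hs0 : 0 < s) (hs1 : s <= 1)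
    (D : xspace) (r : R) :
  exists C : R, 0 < C /\
    forall f0 : dist R, Hspace D r 0 f0 ->
    forall f : R -> dist R, semigroup_solution D s r f0 f ->
    forall t : R, 0 < t -> t <= 1 ->
      (Hnorm D r s (f t) <= (C / t `^ (1 / 2))%:E * Hnorm D r 0 f0)%E /\
      (Hnorm D (r + s) 0 (f t) <= (C / t `^ (1 / 2 + s))%:E * Hnorm D r 0 f0)%E.
Proof.
(* 3 from [Hnorm_le], 96 from [smoothing] and 32 from [symbol_bound]; the constant depends neither
   on s nor on r. *)
exists (3 * 96 * 32); split; first by rewrite !mulr_gt0.
move=> f0 Hf f [T [hT hA fT]] t t0 t1.
have [B HB] := antideriv_vsymbol hs1.
have [K K0 KE] := Hnorm_fin Hf; rewrite KE -!EFinM.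
have HK : (Hnorm D r 0 f0 <= K%:E)%E by rewrite KE.
have t0' := ltW t0.
have fE phi : smooth (xkind D) Ln phi -> f t phi = T t f0 phi.
  by move=> sp; apply: fT => //; exact/schwartzP.
have lf : dist_linear D (f t).
  have [lT _] := Hspace_dual_bounded (T_H hT t0' Hf).
  by move=> a phi psi sp sq; rewrite !fE//; [exact: lT|exact: smoothD].
(* Both estimates have one form: the target weight is (1 + xi^2)^(r/2) times [m], where m is the
   weight of order s in eta for the first and in xi for the second. *)
have bound a b (m : R * R -> R) q : 0 < q -> (forall p, japxv a b p = japx r p * m p) ->
    measurable_fun setT (fun p : measurableTypeR R * measurableTypeR R => m p) ->
    (forall x y, 0 <= m (x, y)) ->
    (forall x y, m (x, y) * expR (- damping s B t x y) <= 32 / q) ->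
    (Hnorm D a b (f t) <= (3 * 96 * 32 / q * K)%:E)%E.
  move=> q0 wE mm m0 mL.
  have -> : 3 * 96 * 32 / q * K = 3 * (96 * (32 / q) * K) by ring.
  have q1 : 0 <= 32 / q by rewrite divr_ge0// ltW.
  have k0 : 0 <= 96 * (32 / q) * K := mulr_ge0 (mulr_ge0 (ler0n R 96) q1) K0.
  have [] // := Hnorm_le (a := a) (b := b) lf k0 _.
  move=> phi sp; rewrite fE; last exact: smooth_mult.
  apply: (smoothing hs1 HB hT hA t0' Hf HK wE mm _ sp) => -[x y].
  by rewrite ger0_norm ?mulr_ge0 ?expR_ge0 ?m0//; exact: mL.
split.
  apply: (bound r s (japv s)) => //; first exact: powR_gt0.
  - exact: measurable_japv.
  - by move=> x y; rewrite ltW ?japv_gt0.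
  - by move=> x y; have [] := symbol_bound hs0 hs1 HB x y t0 t1.
apply: (bound (r + s) 0 (japx s)) => //; first exact: powR_gt0.
- by move=> p; rewrite japxv_x japxD.
- exact: measurable_japx.
- by move=> x y; rewrite ltW ?japx_gt0.
- by move=> x y; have [] := symbol_bound hs0 hs1 HB x y t0 t1.
Qed.
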